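(* Let $h\in\mathbb N$ be fixed and suppose $\mathbb E\|X_k\|_{L^2}^2\le C$ for a universal constant $C$. Assume that for some $\mathfrak a>0$, $\mathfrak h,p\ge1$, with $q=p\,2^{\mathfrak p+4}$, $\mathfrak p=\lceil\mathfrak h/\mathfrak a\rceil$, and $J_n^+\in\mathbb N$: (1) $\Omega_{4q}(k)\lesssim k^{-\mathfrak b}$ for some $\mathfrak b>3/2$; (2) $\max_{1\le j\le J_n^+}\Big\{n^{-\frac12+\mathfrak a}\sum_{i\ne j}\frac{\lambda_i}{|\lambda_j-\lambda_i|},\ n^{-1+2\mathfrak a}\sum_{i\ne j}\frac{\lambda_i\lambda_j}{(\lambda_j-\lambda_i)^2}\Big\}\le C$ and $\lambda_{J_n^+}\ge n^{-\mathfrak h}/C$; (3) $0<\inf_{j\in\mathbb N}\sum_{r=1}^\infty\widetilde\lambda_r\,\mathbb E[\eta_{h,r}\eta_{0,j}]^2$. Then, with $s_n=n^{-1/2}$ and $C$ the universal constant appearing in the bound $\mathbb E\|X_k\|_{L^2}^2\le C$ and in condition (2) (up to enlarging universal constants not depending on $n$): (a) $\mathcal D=\sum_j\lambda_j\langle e_j,\cdot\rangle e_j$ with $\lambda_j\geq 0$, $\sum_j\lambda_j\le C$; $\widehat{\mathcal D}=\sum_{i,j}\sqrt{\widetilde\lambda_i\widetilde\lambda_j}(\eta^{\mathcal D}_{i,j}-\eta^{\mathcal R}_{i,j})\langle e_i,\cdot\rangle e_j$ and $\mathcal D=\sum_{i,j}\sqrt{\widetilde\lambda_i\widetilde\lambda_j}\,\mathbb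 E[\eta^{\mathcal D}_{i,j}]\langle e_i,\cdot\rangle e_j$; (b) $n^{1/2}\max_{i,j}\|\overline\eta^{\mathcal D}_{i,j}\|_q\le C$ and $n^{1/2}\max_{i,j}\|\eta^{\mathcal R}_{i,j}\|_q\le s_n$; (c) $1/C\le\mathbb E[\eta^{\mathcal D}_{j,j}]\le C$ for all $j\in\mathbb N$. In particular, for $1\le J<J_n^+$, with $I_{i,j}=\langle(\widehat{\mathcal D}-\mathcal D)(e_i),e_j\rangle$ and $\Lambda_j=\sum_{k\ne j}\frac{\lambda_j\lambda_k}{(\lambda_j-\lambda_k)^2}$, $$\Big\|\max_{1\le j\le J}\Big|\frac1{\lambda_j}(\widehat\lambda_j-\lambda_j-I_{j,j})\Big|\Big\|_p\lesssim\frac{J^{1/p}n^{-\mathfrak a}}{\sqrt n},$$ $$\bigg\|\max_{1\le j\le J}\bigg\|\frac1{\sqrt{\Lambda_j}}\Big(\widehat e_j-e_j+\frac{e_j}2\|\widehat e_j-e_j\|_{L^2}^2-\sum_{k\ne j}e_k\frac{I_{k,j}}{\lambda_j-\lambda_k}\Big)\bigg\|_{L^2}\bigg\|_p\lesssim\frac{J^{1/p}n^{-\mathfrak a}}{\sqrt n},$$ $$\bigg\|\max_{1\le j\le J}\bigg|\frac1{\Lambda_j}\Big(\|\widehat e_j-e_j\|_{L^2}^2-\sum_{k\ne j}\frac{I_{k,j}^2}{(\lambda_j-\lambda_k)^2}\Big)\bigg|\bigg\|_p\lesssim\frac{J^{1/p}n^{-\mathfrak a}}{n}.$$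
   Context: $\mathcal T\subset\mathbb R^d$ compact, $L^2=L^2(\mathcal T)$; $\{X_k\}_{k\in\mathbb Z}$ stationary in $L^2$ with mean $\mu$, $\overline X_k=X_k-\mu$, $\bar X_n=\frac1n\sum_{k=1}^nX_k$. For real random $Y$: $\|Y\|_q=(\mathbb E|Y|^q)^{1/q}$, $\overline Y=Y-\mathbb EY$. $\lesssim$: up to a constant not depending on $n,j,J$ (or on $k$ in conditions on $\Omega$). Lag operator: $\mathcal C_h(\cdot)=\mathbb E[\langle\overline X_k,\cdot\rangle\overline X_{k+h}]=\sum_j\sqrt{\lambda_j}\langle e_j,\cdot\rangle f_j$ is the singular value decomposition ($(e_j),(f_j)$ orthonormal bases), and $\mathcal D=\mathcal C_h^*\mathcal C_h$, with eigenvalues $\lambda_1\ge\lambda_2\ge\dots$ and eigenfunctions $e_j$. Put $\widetilde\lambda_j=\mathbb E[\langle\overline X_k,e_j\rangle^2]$, $\eta_{k,j}=\langle\overline X_k,e_j\rangle\widetilde\lambda_j^{-1/2}$, so $\overline X_k=\sum_j\widetilde\lambda_j^{1/2}\eta_{k,j}e_j$. The estimator is $$\widehat{\mathcal D}(\cdot)=\frac1{(n-h)^2}\sum_{1\le k,l\le n-h}\langle X_{l+h}-\bar X_n,X_{k+h}-\bar X_n\rangle\langle X_k-\bar X_n,\cdot\rangle(X_l-\bar X_n),$$ with eigenvalues $\widehat\lambda_1\ge\widehat\lambda_2\ge\dots$, orthonormal eigenfunctions $\widehat e_j$, $\langle\widehat e_j,e_j\rangle\ge0$. With $A_{l,h,r,i,j}=(\eta_{l+h,r}\eta_{l,i}-\mathbb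 E[\eta_{l+h,r}\eta_{l,i}])\,\mathbb E[\eta_{l+h,r}\eta_{l,j}]$, $$\eta^{\mathcal D}_{i,j}=\frac1{n-h}\sum_{l=1}^{n-h}\sum_{r\ge1}\widetilde\lambda_r(A_{l,h,r,i,j}+A_{l,h,r,j,i})+\sum_{r\ge1}\widetilde\lambda_r\mathbb E[\eta_{h,r}\eta_{0,i}]\mathbb E[\eta_{h,r}\eta_{0,j}],$$ and $\eta^{\mathcal R}_{i,j}=\eta^{\mathcal D}_{i,j}-(\widetilde\lambda_i\widetilde\lambda_j)^{-1/2}\langle\widehat{\mathcal D}(e_i),e_j\rangle$. Dependence: $\eta_{k,j}=g_j(\dots,\epsilon_{k-1,j},\epsilon_{k,j})$ for measurable $g_j$ and an IID sequence $\{(\epsilon_{k,j})_{j\in\mathbb N}\}_{k\in\mathbb Z}$ (arbitrary dependence across $j$). With $\{\epsilon'_{k,j}\}$ an independent copy, $\eta_{k,j}'=g_j(\dots,\epsilon_{-1,j},\epsilon_{0,j}',\epsilon_{1,j},\dots,\epsilon_{k,j})$ and $\Omega_p(k)=\max_{j\in\mathbb N}\|\eta_{k,j}-\eta_{k,j}'\|_p$.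
   Formalization: Condition (3) and conclusion (c) range over those j with positive score variance (over all j in N, (3) contradicts the finite second moment), and condition (1) also requires the dependence coefficient at k=0 to be finite (bounded by the same constant), without which (b) can fail. *)

(* Defs.v *)
From HB Require Import structures.
From mathcomp Require Import all_boot all_order all_algebra.
From mathcomp Require Import all_classical all_reals all_analysis.
Set Implicit Arguments. Unset Strict Implicit. Unset Printing Implicit Defensive.
Import Order.TTheory GRing.Theory Num.Theory.
Import numFieldNormedType.Exports.
Local Open Scope classical_set_scope.
Local Open Scope ring_scope.

(* R^d, with its Borel sigma-algebra (the product sigma-algebra on tuples) *)
Notation Rspace R d := (d.-tuple (measurableTypeR R)).

Section lebesgue_Rd.
Context {R : realType}.
Local Open Scope ereal_scope.

Definition tuple_of_pair d (z : measurableTypeR R * Rspace R d) : Rspace R d.+1 :=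
  [tuple of z.1 :: z.2].

Lemma measurable_tuple_of_pair d : measurable_fun setT (@tuple_of_pair d).
Proof. exact: measurable_cons. Qed.

Section step.
Context d (nu : {sigma_finite_measure set (Rspace R d) -> \bar R}).
Local Notation prd := (@lebesgue_measure R \x nu).

Definition lebesgue_step (A : set (Rspace R d.+1)) : \bar R :=
  prd (@tuple_of_pair d @^-1` A).

Let mpre A : measurable A -> measurable (@tuple_of_pair d @^-1` A).
Proof.
by move=> mA; rewrite -[X in measurable X]setTI; exact: measurable_tuple_of_pair.
Qed.

Let step0 : lebesgue_step set0 = 0.
Proof. by rewrite /lebesgue_step preimage_set0 measure0. Qed.

Let step_ge0 A : 0 <= lebesgue_step A.
Proof. exact: measure_ge0. Qed.

Let step_sigma_additive : semi_sigma_additive lebesgue_step.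
Proof.
move=> F mF tF mUF; rewrite /lebesgue_step preimage_bigcup.
apply: measure_semi_sigma_additive.
- by move=> n; exact: mpre.
- apply/trivIsetP => /= i j _ _ ij; rewrite -preimage_setI.
  by move/trivIsetP : tF => /(_ _ _ _ _ ij) ->//; rewrite preimage_set0.
- by rewrite -preimage_bigcup; exact: mpre.
Qed.

HB.instance Definition _ := isMeasure.Build _ _ _ lebesgue_step
  step0 step_ge0 step_sigma_additive.

Let step_sigma_finite : sigma_finite setT lebesgue_step.
Proof.
have /sigma_finiteP[F [FT ndF Foo]] := sigma_finiteT (@lebesgue_measure R).
have /sigma_finiteP[G [GT ndG Goo]] := sigma_finiteT nu.
pose split_tuple (t : Rspace R d.+1) : measurableTypeR R * Rspace R d :=
  (thead t, [tuple of behead t]).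
have msplit : measurable_fun setT split_tuple.
  apply/measurable_fun_pairP; split; first exact: measurable_tnth.
  exact: measurable_behead.
have pairK : cancel (@tuple_of_pair d) split_tuple.
  by move=> [x t]; congr pair; rewrite ?theadE//; apply/val_inj.
exists (fun n => split_tuple @^-1` (F n `*` G n)).
  rewrite -preimage_bigcup -[LHS](preimage_setT split_tuple); congr preimage.
  rewrite -setXTT FT GT predeqE => -[x y]; split.
    move=> [/= [n _ Fnx] [k _ Gky]]; exists (maxn n k) => //; split.
    - by move: x Fnx; exact/subsetPset/ndF/leq_maxl.
    - by move: y Gky; exact/subsetPset/ndG/leq_maxr.
  by move=> [n _ []/= ? ?]; split; exists n.
move=> n; have [mF Fn] := Foo n; have [mG Gn] := Goo n; split.
  by rewrite -[X in measurable X]setTI; apply: msplit => //; exact: measurableX.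
rewrite /lebesgue_step (_ : _ @^-1` _ = F n `*` G n).
  by rewrite product_measure1E// lte_mul_pinfty// ge0_fin_numE.
by rewrite predeqE => z; rewrite /preimage/mkset pairK.
Qed.

HB.instance Definition _ := Measure_isSigmaFinite.Build _ _ _ lebesgue_step
  step_sigma_finite.
End step.

(* Lebesgue measure on R^d, as the d-fold product of [lebesgue_measure] *)
Fixpoint lebesgue_Rd d : {sigma_finite_measure set (Rspace R d) -> \bar R} :=
  match d with
  | 0 => \d_([tuple])
  | d'.+1 => lebesgue_step (lebesgue_Rd d')
  end.
End lebesgue_Rd.

(* The library has no topology on tuples: compactness is read in 'rV[R]_d.
   A compact set is Borel, but [mrestr], which restricts Lebesgue measure to it,
   wants a proof of measurability as an argument. *)
Definition compact_Rd (R : realType) d (A : set (Rspace R d)) : Prop :=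
  compact [set (\row_(i < d) (tnth x i : R)) | x in A].

(* L^2(S, mu): [LfunType] is the library's type of square-integrable functions.
   It is not quotiented by a.e. equality, so that two elements are equal in L^2
   when the l2norm of their difference vanishes. *)
Notation L2 mu := (LfunType mu (lee1n 2)).

Section hilbert.
Context dS (S : measurableType dS) (R : realType).
Variable mu : {measure set S -> \bar R}.
Implicit Types (f g v : L2 mu) (e : nat -> L2 mu) (lam : nat -> R).

Definition l2dot f g : R := \int[mu]_x (f x * g x).

Definition l2norm f : R := Num.sqrt (l2dot f f).

Definition l2cvg (u : nat -> L2 mu) f : Prop :=
  (fun N => l2norm (u N - f)) @ \oo --> (0 : R).

(* convergence of a double sequence, both indices tending to infinity *)
Definition l2cvg2 (u : nat -> nat -> L2 mu) f : Prop :=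
  (fun MN : nat * nat => l2norm (u MN.1 MN.2 - f))
    @ filter_prod \oo \oo --> (0 : R).

(* the sum of an L^2-valued series, defined up to a.e. equality *)
Definition l2sum (u : nat -> L2 mu) : L2 mu :=
  xget 0 [set f | l2cvg (fun N => \sum_(k < N) u k) f].

Definition orthonormal e : Prop := forall i j, l2dot (e i) (e j) = (i == j)%:R.

Definition orthonormal_basis e : Prop :=
  orthonormal e /\
  forall v, l2cvg (fun N => \sum_(j < N) l2dot (e j) v *: e j) v.

Definition l2adjoint (A : L2 mu -> L2 mu) v : L2 mu :=
  xget 0 [set w : L2 mu | forall u, l2dot (A u) v = l2dot u w].

(* A = sum_j sqrt(lam_j) <e_j, .> f_j *)
Definition is_svd (A : L2 mu -> L2 mu) lam e (f : nat -> L2 mu) : Prop :=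
  [/\ orthonormal_basis e, orthonormal_basis f,
      (forall i j, (i <= j)%N -> lam j <= lam i) &
      forall v, l2cvg
        (fun N => \sum_(j < N) (Num.sqrt (lam j) * l2dot (e j) v) *: f j) (A v)].

(* A = sum_j lam_j <e_j, .> e_j with lam nonincreasing and e orthonormal.
   The expansion makes lam exhaust the nonzero spectrum of A, with
   multiplicities; e need not span the kernel of A. *)
Definition is_eigensystem (A : L2 mu -> L2 mu) lam e : Prop :=
  [/\ orthonormal e, (forall i j, (i <= j)%N -> lam j <= lam i) &
      forall v, l2cvg
        (fun N => \sum_(j < N) (lam j * l2dot (e j) v) *: e j) (A v)].

(* sum_{i <> j} lam_i / |lam_j - lam_i| and
   sum_{i <> j} lam_i lam_j / (lam_j - lam_i)^2, as extended reals *)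
Definition relgap1 lam j : \bar R :=
  (\sum_(0 <= i <oo | i != j) (lam i / `|lam j - lam i|)%:E)%E.

Definition relgap2 lam j : \bar R :=
  (\sum_(0 <= i <oo | i != j) (lam i * lam j / (lam j - lam i) ^+ 2)%:E)%E.

(* The gap condition at sample size n for the first Jn eigenvalues, lam 0 being
   the largest.  On paper, finiteness of the sums forces these eigenvalues to be
   simple; here x / 0 = 0, so simplicity is a separate clause. *)
Definition gap_condition (C a hh : R) (n Jn : nat) lam : Prop :=
  (forall j, (j < Jn)%N ->
    [/\ forall i, i != j -> lam i != lam j,
        ((n%:R `^ (- 2^-1 + a))%:E * relgap1 lam j <= C%:E)%E &
        ((n%:R `^ (- 1 + 2 * a))%:E * relgap2 lam j <= C%:E)%E]) /\
  n%:R `^ (- hh) / C <= lam Jn.-1.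

End hilbert.

Section process.
Context dS (S : measurableType dS) (R : realType).
Variable mu : {measure set S -> \bar R}.
Context dO (Om : measurableType dO) (P : probability Om R).

Definition Ex (Y : Om -> R) : R := fine 'E_P[Y].

(* ||Y||_p = (E |Y|^p)^(1/p) *)
Definition pnorm (p : R) (Y : Om -> R) : \bar R := 'N[P]_(p%:E)[EFin \o Y].

Definition random_element (Y : Om -> L2 mu) : Prop :=
  forall v, measurable_fun setT (fun w => l2dot (Y w) v).

(* the expectation of an L^2-valued random element (weak integral) *)
Definition l2mean (Y : Om -> L2 mu) : L2 mu :=
  xget 0 [set m : L2 mu | forall v, l2dot m v = Ex (fun w => l2dot (Y w) v)].

Variable X : int -> Om -> L2 mu.

Definition stationary : Prop :=
  forall (s : int) (m : nat) (k : 'I_m -> int) (v : 'I_m -> L2 mu)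
    (B : 'I_m -> set (measurableTypeR R)), (forall i, measurable (B i)) ->
  P (\bigcap_(i in [set: 'I_m])
       ((fun w => l2dot (X (k i + s) w) (v i)) @^-1` B i)) =
  P (\bigcap_(i in [set: 'I_m])
       ((fun w => l2dot (X (k i) w) (v i)) @^-1` B i)).

Definition Xc (k : int) (w : Om) : L2 mu := X k w - l2mean (X 0).

Definition smean (n : nat) (w : Om) : L2 mu :=
  n%:R^-1 *: \sum_(1 <= k < n.+1) X k%:Z w.

Variable h : nat.

(* C_h and D = C_h^* C_h *)
Definition lagC (v : L2 mu) : L2 mu :=
  l2mean (fun w => l2dot (Xc 0 w) v *: Xc h%:Z w).

Definition lagD (v : L2 mu) : L2 mu := l2adjoint lagC (lagC v).

Definition lagD_hat (n : nat) (w : Om) (v : L2 mu) : L2 mu :=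
  let Xn k := X k%:Z w - smean n w in
  ((n - h)%:R ^+ 2)^-1 *:
    \sum_(1 <= k < (n - h).+1) \sum_(1 <= l < (n - h).+1)
      (l2dot (Xn (l + h)%N) (Xn (k + h)%N) * l2dot (Xn k) v) *: Xn l.

Variable e : nat -> L2 mu.

Definition lamt (j : nat) : R := Ex (fun w => l2dot (Xc 0 w) (e j) ^+ 2).

(* The normalised scores exist only in the directions e_j with lamt j > 0, that
   is, not orthogonal to the process.  Otherwise <Xc_k, e_j> = 0 almost surely
   and the division by 0 below makes eta vanish. *)
Definition eta (k : int) (j : nat) (w : Om) : R :=
  l2dot (Xc k w) (e j) / Num.sqrt (lamt j).

(* A_{l,h,r,i,j} and E[eta_{h,r} eta_{0,j}] *)
Definition crossA (l r i j : nat) (w : Om) : R :=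
  let Y m w := eta (l + h)%:Z r w * eta l%:Z m w in
  (Y i w - Ex (Y i)) * Ex (Y j).

Definition crossE (r j : nat) : R :=
  Ex (fun w => eta h%:Z r w * eta 0 j w).

Definition etaD (n i j : nat) (w : Om) : R :=
  (n - h)%:R^-1 * \sum_(1 <= l < (n - h).+1)
    limn (series (fun r => lamt r * (crossA l r i j w + crossA l r j i w)))
  + limn (series (fun r => lamt r * crossE r i * crossE r j)).

Definition etaR (n i j : nat) (w : Om) : R :=
  etaD n i j w
  - (Num.sqrt (lamt i * lamt j))^-1 * l2dot (lagD_hat n w (e i)) (e j).

(* I_{i,j} = <(\hat D - D)(e_i), e_j> *)
Definition pertI (n i j : nat) (w : Om) : R :=
  l2dot (lagD_hat n w (e i) - lagD (e i)) (e j).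

End process.

Section dependence.
Context dE (E : measurableType dE) (R : realType).
Context dO (Om : measurableType dO) (P : probability Om R).

(* the product sigma-algebra on the sequence space nat -> E *)
Definition cylinder_measurable : set (set (nat -> E)) :=
  <<s [set A | exists i (B : set E),
         measurable B /\ A = (fun x : nat -> E => x i) @^-1` B] >>.

(* independent and identically distributed random sequences *)
Definition iid_sequences (I : eqType) (xi : I -> Om -> nat -> E) : Prop :=
  [/\ forall i j, measurable_fun setT (fun w => xi i w j),
      forall i i' A, cylinder_measurable A ->
        P (xi i @^-1` A) = P (xi i' @^-1` A) &
      forall (s : seq I) (A : I -> set (nat -> E)), uniq s ->
        (forall i, cylinder_measurable (A i)) ->
        P (\bigcap_(i in [set` s]) (xi i @^-1` A i)) =
        (\prod_(i <- s) P (xi i @^-1` A i))%E].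

(* [eps] is an iid sequence indexed by int and [eps'] an independent copy *)
Definition iid_with_copy (eps eps' : int -> Om -> nat -> E) : Prop :=
  iid_sequences
    (fun bk : bool * int => if bk.1 then eps' bk.2 else eps bk.2).

Variables (g : nat -> (nat -> E) -> R) (eps eps' : int -> Om -> nat -> E).

(* The past (..., eps_{k-1,j}, eps_{k,j}) is listed backwards in time:
   coordinate i is eps_{k-i,j}. *)
Definition past (k : int) (j : nat) (w : Om) : nat -> E :=
  fun i => eps (k - i%:Z) w j.

Definition coupled_past (k : int) (j : nat) (w : Om) : nat -> E :=
  fun i => if k - i%:Z == 0 then eps' 0 w j else past k j w i.

Definition is_bernoulli_shift (y : int -> nat -> Om -> R) : Prop :=
  (forall j (B : set (measurableTypeR R)), measurable B ->
     cylinder_measurable (g j @^-1` B)) /\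
  (forall k j, {ae P, forall w, y k j w = g j (past k j w)}).

(* Omega_p(k) *)
Definition dep_coef (y : int -> nat -> Om -> R) (p : R) (k : nat) : \bar R :=
  ereal_sup (range (fun j =>
    pnorm P p (fun w => y k%:Z j w - g j (coupled_past k%:Z j w)))).

End dependence.

(* Main.v *)
From HB Require Import structures.
Require Import Defs.
From mathcomp Require Import all_boot all_order all_algebra.
From mathcomp Require Import all_classical all_reals all_analysis.
From mathcomp Require Import measurable_realfun ring lra.
From mathcomp Require finmap.
Set Implicit Arguments. Unset Strict Implicit. Unset Printing Implicit Defensive.
Import Order.TTheory GRing.Theory Num.Theory.
Import numFieldNormedType.Exports.
Local Open Scope classical_set_scope.
Local Open Scope ring_scope.

(** Write D for the lag operator C_h^* C_h and Dhat for its estimator.  In the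
    basis e the matrix of D is sqrt (lt_i lt_j) * m_ij, where lt_i is the variance
    of the i-th score and m_ij = sum_r lt_r E[eta_{h,r} eta_{0,i}]
    E[eta_{h,r} eta_{0,j}].  Since D is diagonal in e, its eigenvalues are
    lam_j = lt_j * m_jj; the lower bound assumed on the m_jj thus makes lt_j and
    lam_j comparable.  This is what makes the perturbation relative: the entries
    of Dhat - D are sqrt (lt_i lt_k) times averages of weakly dependent products
    of normalised scores, hence are bounded by sqrt (lam_i lam_k) times variables
    of order n^(-1/2), uniformly in i and k.

    The probabilistic half proves that order.  A functional of the noise is
    compared with itself after one innovation is redrawn.  The conditional means
    given the past up to time m telescope into martingale increments
    ([increment_orthogonal]), each controlled by the effect of redrawing the m-th
    innovation, and a pointwise expansion of |a + b|^s ([power_step]) makes their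
    squared L^s norms add up: this is [moment_bound], an Efron--Stein inequality
    in L^s.  With a discrete convolution inequality it shows that sums of n scores,
    or of n products of two scores, have L^s norm of order sqrt n
    ([block_bound]).  Expanding Dhat then separates a centred linear part, which is
    eta^D - E eta^D, from the terms that are quadratic in centred averages and
    of order 1/n, which make up - eta^R ([etaD_decomposition]).

    The deterministic half fixes j and compares a symmetric operator with matrix
    diag(lam) + E with the diagonal one, where E_ik^2 <= lam_i lam_k z_ik.  The
    weights lam_i / |lam_j - lam_i|, together with 1/x at i = j for a small number
    x, turn the entries z into two quantities: B, their doubly weighted sum, and
    t, their sum against one weight and the squared relative gaps.  When
    B <= 1/64 a min-max argument localises the j-th eigenvalue ([eig_close]), and
    the eigenvector equation read in coordinates gives first the size of the
    off-diagonal coordinates and then, inserting that bound into the same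
    equation, the error of the first-order expansions ([value_bound],
    [off_diagonal_bound], [second_order_bound]).  When B > 1/64 every error has a
    crude polynomial bound, and a power of 64 B may be put in front of it
    ([eigenvalue_expansion], [eigenfunction_expansion], [distance_expansion]).

    The halves meet as follows.  The gap condition says that the weights sum to
    at most G of order n^(1/2 - a); with x = 1 / (4 G) the variable B has norm of
    order n^(-2a), and t has norm of order Lambda_j / n.  The event B > 1/64 is
    paid for by the power m = 2^(ceil (hh / a) + 3) of 64 B, which outweighs the
    lower bound n^(-hh) for the eigenvalues; that power is the reason for moments
    of order 2 m p = q.  The maximum over J indices costs J^(1/p)
    ([pnorm_max]). *)

(** * Integrals of functions that may fail to be measurable *)

Section inner_integral.
Import HBNNSimple.
Context d (T : measurableType d) (R : realType) (mu : {measure set T -> \bar R}).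
Local Open Scope ereal_scope.

(** The integral of a nonnegative function is a supremum over the simple
    functions below it, so only the dominating function has to be measurable.
    Limits of series, and the eigenvalues and eigenfunctions of a random
    operator, come without a measurability proof. *)
Lemma le_integral_nomeas (f g : T -> \bar R) :
  (forall x, 0 <= f x) -> (forall x, 0 <= g x) -> measurable_fun setT g ->
  {ae mu, forall x, f x <= g x} -> \int[mu]_x f x <= \int[mu]_x g x.
Proof.
move=> f0 g0 mg [N [mN N0 fgN]].
pose g' := fun x => g x + (if x \in N then +oo else 0).
have mind : measurable_fun setT (fun x => if x \in N then +oo else 0 : \bar R).
  apply: measurable_fun_ifT => //=.
  by apply: (measurable_fun_bool true); rewrite setTI (_ : _ @^-1` _ = N) //;
    apply/seteqP; split=> x /=; [move/set_mem|move/mem_set ->].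
have g'0 x : 0 <= g' x by rewrite /g' adde_ge0 //; case: ifP.
have -> : \int[mu]_x g x = \int[mu]_x g' x.
  apply: ge0_ae_eq_integral => //.
  - exact: emeasurable_funD.
  - exists N; split=> // x /=; apply: contra_notP => xN _.
    by rewrite /g' (memNset xN) adde0.
rewrite !ge0_integralTE //.
apply: ereal_sup_le => _ [h hf <-]; exists h => //= x.
apply: (le_trans (hf x)); rewrite /g'.
have [xN|xN] := pselect (N x).
  by rewrite (mem_set xN) addey ?leey // gt_eqF // (lt_le_trans (ltNy0)).
rewrite (memNset xN) adde0; apply: contra_notT xN => xN; apply: fgN => /= xN'.
by rewrite xN' in xN.
Qed.

(** Multiplying the measurable function by the indicator of the complement of
    the null set puts it below the other one, which gives the second inequality. *)
Lemma integral_ae_nomeas (f g : T -> \bar R) :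
  (forall x, 0 <= f x) -> (forall x, 0 <= g x) -> measurable_fun setT g ->
  {ae mu, forall x, f x = g x} -> \int[mu]_x f x = \int[mu]_x g x.
Proof.
move=> f0 g0 mg fg; apply/eqP; rewrite eq_le le_integral_nomeas //=; last first.
  by apply: filterS fg => x ->.
have [N [mN N0 fgN]] := fg.
rewrite (_ : \int[mu]_x g x = \int[mu]_x (g x * (\1_(~` N) x)%:E)); last first.
  apply: ge0_ae_eq_integral => //.
  - by apply: emeasurable_funM => //; apply/measurable_EFinP; exact: measurable_indic (measurableC mN).
  - by move=> x _; rewrite mule_ge0 // lee_fin.
  - exists N; split=> // x /=; apply: contra_notP => xN _.
    by rewrite indicE mem_set // mule1.
rewrite !ge0_integralTE //; last by move=> x; rewrite mule_ge0 // lee_fin.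
apply: ereal_sup_le => _ [h hf <-]; exists h => //= x.
apply: (le_trans (hf x)).
have [xN|xN] := pselect (N x).
  by rewrite indicE memNset ?mule0 //= => /(_ xN).
rewrite indicE mem_set // mule1.
by apply: contra_notT xN => xN; apply: fgN => /= xN'; rewrite xN' lexx in xN.
Qed.

Lemma integral_ae_nomeasE (f g : T -> \bar R) : measurable_fun setT g ->
  {ae mu, forall x, f x = g x} -> \int[mu]_x f x = \int[mu]_x g x.
Proof.
move=> mg fg; rewrite integralE [RHS]integralE; congr (_ - _).
  apply: integral_ae_nomeas => //; first exact: measurable_funepos.
  by apply: filterS fg => x; rewrite !funeposE => ->.
apply: integral_ae_nomeas => //; first exact: measurable_funeneg.
by apply: filterS fg => x; rewrite !funenegE => ->.
Qed.

End inner_integral.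

(** * Bounds on L^s norms *)

Section norm_bounds.
Context d (T : measurableType d) (R : realType) (P : probability T R).
Implicit Types (f g : T -> R) (s A B : R).

(** The norm bound is stated through the integral of the s-th power, which needs
    no root and no finiteness side condition, and is bundled with measurability
    and with the sign of the bound. *)
Record Lb s f A : Prop := MkLb {
  Lb_measurable : measurable_fun setT f;
  Lb_bound_ge0 : 0 <= A;
  Lb_bound : (\int[P]_x (`|f x| `^ s)%:E <= (A `^ s)%:E)%E }.

Lemma measurable_absX s f : measurable_fun setT f ->
  measurable_fun setT (fun x => (`|f x| `^ s)%:E).
Proof.
move=> mf; apply/measurable_EFinP.
apply: (measurableT_comp (measurable_powR _)) => //.
exact: measurableT_comp.
Qed.

Lemma integral_absX s f :
  (\int[P]_x (`|(EFin \o f) x| `^ s)%E = \int[P]_x (`|f x| `^ s)%:E)%E.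
Proof. by apply: eq_integral => x _; rewrite -poweR_EFin. Qed.

Lemma Lb_norm s f A : 0 < s -> Lb s f A -> ('N[P]_(s%:E)[EFin \o f] <= A%:E)%E.
Proof.
move=> s0 [mf A0 fA]; rewrite unlock.
apply: (@le_trans _ _ ((A `^ s)%:E `^ s^-1)%E).
  apply: gt0_ler_poweR; rewrite ?invr_ge0 ?(ltW s0) //.
  - by rewrite in_itv /= leey andbT integral_ge0 // => x _; rewrite poweR_ge0.
  - by rewrite in_itv /= leey andbT lee_fin powR_ge0.
by rewrite poweR_EFin -powRrM divff ?gt_eqF // powRr1.
Qed.

Lemma norm_Lb s f A : 0 < s -> measurable_fun setT f -> 
  ('N[P]_(s%:E)[EFin \o f] <= A%:E)%E -> Lb s f A.
Proof.
move=> s0 mf fA.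
have A0 : 0 <= A by rewrite -lee_fin (le_trans _ fA) // Lnorm_ge0.
split=> //.
have := @powR_Lnorm _ _ _ P (EFin \o f) s (lt0r_neq0 s0).
rewrite integral_absX => <-.
rewrite -poweR_EFin; apply: gt0_ler_poweR => //; first exact: ltW.
  by rewrite in_itv /= leey andbT Lnorm_ge0.
by rewrite in_itv /= leey andbT lee_fin.
Qed.

Lemma Lb_dom s f g A : 0 < s -> measurable_fun setT g ->
  {ae P, forall x, `|g x| <= `|f x|} -> Lb s f A -> Lb s g A.
Proof.
move=> s0 mg gf [mf A0 fA]; split; [by []|by []|]; apply: le_trans fA.
apply: ae_ge0_le_integral; [by []|by []|exact: measurable_absX|by []|
  exact: measurable_absX|].
apply: filterS gf => x gfx _; rewrite lee_fin.
by rewrite ge0_ler_powR ?nnegrE ?(ltW s0).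
Qed.

(** An L^s norm is bounded by that of any measurable function dominating almost
    everywhere, whether or not the smaller function is measurable. *)
Lemma pnorm_le s (f g : T -> R) A : 0 < s ->
  {ae P, forall x, `|f x| <= g x} -> Lb s g A -> (pnorm P s f <= A%:E)%E.
Proof.
move=> s0 fg Lg; apply: le_trans (Lb_norm s0 Lg); case: Lg => mg _ _.
rewrite /pnorm unlock; apply: gt0_ler_poweR; rewrite ?invr_ge0 ?(ltW s0);
  [by []| | |].
- by rewrite in_itv /= leey andbT integral_ge0 // => x _; rewrite poweR_ge0.
- by rewrite in_itv /= leey andbT integral_ge0 // => x _; rewrite poweR_ge0.
apply: (le_integral_nomeas _ _ (measurable_absX s mg));
  [by move=> x; rewrite poweR_ge0|by move=> x; rewrite lee_fin powR_ge0|].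
apply: filterS fg => x fgx; rewrite /= lee_fin.
by rewrite ge0_ler_powR ?nnegrE ?(ltW s0) // (le_trans fgx) // ler_norm.
Qed.

Lemma Lb_le s f A B : 0 < s -> A <= B -> Lb s f A -> Lb s f B.
Proof.
move=> s0 AB [mf A0 fA]; split; [by []|exact: le_trans AB|].
apply: (le_trans fA); rewrite lee_fin ge0_ler_powR ?nnegrE ?(ltW s0) //.
exact: le_trans AB.
Qed.

Lemma Lb_cst s (a : R) : Lb s (cst a) `|a|.
Proof.
split; [exact: measurable_cst|exact: normr_ge0|].
rewrite (_ : (fun x => _) = cst (`|a| `^ s)%:E) //.
rewrite integral_cst //.
by rewrite [X in (_ * X)%E](_ : _ = 1%E) ?mule1 //; exact: probability_setT.
Qed.

Lemma Lb_add s f g A B : 1 <= s -> Lb s f A -> Lb s g B -> Lb s (fun x => f x + g x) (A + B).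
Proof.
move=> s1 Lf Lg.
have s0 : 0 < s by exact: lt_le_trans s1.
case: (Lf) (Lg) => mf A0 _ [mg B0 _].
apply: norm_Lb; [by []|exact: measurable_funD|].
apply: (le_trans (minkowski_EFin P mf mg s1)).
by rewrite EFinD leeD // Lb_norm.
Qed.

Lemma Lb_abs s f A : Lb s f A -> Lb s (fun x => `|f x|) A.
Proof.
move=> [mf A0 fA]; split; [exact: measurableT_comp|by []|].
by under eq_integral do rewrite normr_id.
Qed.

Lemma Lb_opp s f A : Lb s f A -> Lb s (fun x => - f x) A.
Proof.
move=> [mf A0 fA]; split; [exact: measurableT_comp|by []|].
by under eq_integral do rewrite normrN.
Qed.

Lemma Lb_sub s f g A B : 1 <= s -> Lb s f A -> Lb s g B -> Lb s (fun x => f x - g x) (A + B).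
Proof. by move=> s1 Lf Lg; exact: Lb_add s1 Lf (Lb_opp Lg). Qed.

(** The Cauchy--Schwarz inequality for the norms of order 2 s and s. *)
Lemma Lb_mul s f g A B : 0 < s -> Lb (2 * s) f A -> Lb (2 * s) g B ->
  Lb s (fun x => f x * g x) (A * B).
Proof.
move=> s0 [mf A0 fA] [mg B0 gB]; split; first exact: measurable_funM.
  exact: mulr_ge0.
pose F x := `|f x| `^ s; pose G x := `|g x| `^ s.
have mF : measurable_fun setT F by apply/measurable_EFinP; exact: measurable_absX.
have mG : measurable_fun setT G by apply/measurable_EFinP; exact: measurable_absX.
have two (h : T -> R) (C : R) : 0 <= C -> measurable_fun setT h ->
    (\int[P]_x (`|h x| `^ (2 * s))%:E <= (C `^ (2 * s))%:E)%E ->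
    ('N[P]_2%:E[EFin \o (fun x => (`|h x| `^ s)%R)] <= (C `^ s)%:E)%E.
  move=> C0 mh hC; apply: Lb_norm => //; split; [|exact: powR_ge0|].
    by apply/measurable_EFinP; exact: measurable_absX.
  rewrite -powRrM mulrC; apply: le_trans hC.
  rewrite le_eqVlt; apply/orP; left; apply/eqP; apply: eq_integral => x _.
  by rewrite ger0_norm ?powR_ge0 // -powRrM mulrC.
have := @hoelder _ _ _ P F G 2 2 mF mG.
rewrite -[X in X = 1]/(2^-1 + 2^-1) => /(_ ltac:(lra) ltac:(lra) ltac:(lra)).
rewrite Lnorm1 powRM // EFinM => h.
rewrite (_ : \int[P]_x _ = \int[P]_x `|(EFin \o (F \* G)%R) x|)%E; last first.
  apply: eq_integral => x _.
  transitivity (`|F x * G x|%:E) => //; congr EFin.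
  by rewrite [RHS]ger0_norm ?mulr_ge0 ?powR_ge0 // /F /G normrM powRM.
apply: (le_trans h).
by apply: lee_pmul; rewrite ?Lnorm_ge0 //; apply: two.
Qed.

Lemma Lb_scale s f A (a : R) : 0 < s -> Lb s f A -> Lb s (fun x => a * f x) (`|a| * A).
Proof.
move=> s0 [mf A0 fA]; split; first exact: measurable_funM.
  exact: mulr_ge0.
under eq_integral do rewrite normrM powRM // EFinM.
rewrite ge0_integralZl //.
  by rewrite powRM // EFinM lee_wpmul2l // lee_fin powR_ge0.
exact: measurable_absX.
Qed.

(** The norm of order s of an n-th power is the n-th power of the norm of order
    n s: large powers are affordable only with high moments. *)
Lemma Lb_pow s f A (n : nat) : (0 < n)%N -> 0 < s -> Lb (n%:R * s) f A ->
  Lb s (fun x => f x ^+ n) (A ^+ n).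
Proof.
move=> n0 s0 [mf A0 fA]; split; first exact: measurable_funX.
  exact: exprn_ge0.
rewrite -powR_mulrn // -powRrM.
under eq_integral do rewrite normrX -powR_mulrn // -powRrM.
exact: fA.
Qed.

Lemma Lb_sqrt s f A : 0 < s -> (forall x, 0 <= f x) -> Lb s f A ->
  Lb (2 * s) (fun x => Num.sqrt (f x)) (Num.sqrt A).
Proof.
move=> s0 f0 [mf A0 fA].
have e (y : R) : 0 <= y -> Num.sqrt y `^ (2 * s) = y `^ s.
  by move=> y0; rewrite powRrM powR_mulrn ?sqrtr_ge0 // sqr_sqrtr.
split; [|exact: sqrtr_ge0|].
  apply: measurableT_comp mf; apply: continuous_measurable_fun.
  exact: sqrt_continuous.
rewrite (e _ A0); apply: le_trans fA; rewrite le_eqVlt; apply/orP; left; apply/eqP.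
by apply: eq_integral => x _; rewrite ger0_norm ?sqrtr_ge0 // e // ger0_norm.
Qed.

Lemma Lb_incr s t f A : 1 <= s -> s <= t -> Lb t f A -> Lb s f A.
Proof.
move=> s1; rewrite le_eqVlt => /orP[/eqP -> //|st] [mf A0 fA].
have s0 : 0 < s by exact: lt_le_trans s1.
have t0 : 0 < t by exact: lt_trans st.
split; [by []|by []|].
pose F x := `|f x| `^ s.
have mF : measurable_fun setT F by apply/measurable_EFinP; exact: measurable_absX.
have := @hoelder _ _ _ P F (cst 1) (t / s) (t / (t - s)) mF (measurable_cst _).
have ts : 0 < t - s by rewrite subr_gt0.
rewrite !divr_gt0 // => /(_ isT isT).
rewrite !invf_div -mulrDl addrC subrK divff ?gt_eqF // => /(_ erefl).
rewrite Lnorm1 Lnorm_cst1 [X in (X `^ _)%E](_ : _ = 1%E); last first.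
  exact: probability_setT.
rewrite poweR_EFin powR1 mule1 => h.
rewrite (_ : \int[P]_x _ = \int[P]_x `|(EFin \o (F \* cst 1)%R) x|)%E; last first.
  apply: eq_integral => x _; transitivity (`|F x * 1|%:E) => //; congr EFin.
  by rewrite mulr1 [RHS]ger0_norm ?powR_ge0.
apply: (le_trans h); apply: Lb_norm; first exact: divr_gt0.
split; [by []|exact: powR_ge0|].
rewrite -powRrM mulrCA divff ?gt_eqF // mulr1; apply: le_trans fA.
rewrite le_eqVlt; apply/orP; left; apply/eqP; apply: eq_integral => x _.
by rewrite ger0_norm ?powR_ge0 // -powRrM mulrCA divff ?gt_eqF // mulr1.
Qed.

Lemma Lb_integrable s f A : 1 <= s -> Lb s f A -> P.-integrable setT (EFin \o f).
Proof.
move=> s1 /(Lb_incr (lexx 1) s1)[mf A0]; rewrite powRr1 // => fA.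
apply/integrableP; split; first exact/measurable_EFinP.
apply: le_lt_trans (ltry A); apply: le_trans fA.
rewrite le_eqVlt; apply/orP; left; apply/eqP; apply: eq_integral => x _ /=.
by rewrite powRr1.
Qed.

Lemma Lb_Ex s f A : 1 <= s -> Lb s f A -> `|Ex P f| <= A.
Proof.
move=> s1 Lf; have fi := Lb_integrable s1 Lf.
rewrite /Ex unlock -[fine _]/(\int[P]_x f x)%R.
apply: (le_trans (le_normr_Rintegral _ fi)) => //.
have [mf A0] := Lb_incr (lexx 1) s1 Lf; rewrite powRr1 // => fA.
rewrite -lee_fin /Rintegral fineK.
  by apply: le_trans fA; rewrite le_eqVlt; apply/orP; left; apply/eqP;
     apply: eq_integral => x _ /=; rewrite powRr1.
by apply: integrable_fin_num => //; exact: integrable_norm fi.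
Qed.

End norm_bounds.

(** * A pointwise expansion of the s-th power *)

Section power_step.
Context (R : realType).
Implicit Types (x y s a b : R).

Lemma expR_le_quad y (M : R) : `|y| <= M -> expR y <= 1 + y + y ^+ 2 * expR M.
Proof.
move=> yM.
have M0 : 0 <= M by exact: le_trans yM.
have [y0|y0] := leP 0 y.
  have h : expR y <= 1 + y * expR y.
    have := expR_ge1Dx (- y); rewrite expRN => h.
    have e0 := expR_gt0 y.
    have : (1 - y) * expR y <= 1.
      by rewrite -[leRHS](mulVf (lt0r_neq0 e0)) ler_pM2r //; lra.
    lra.
  have h2 : expR y <= expR M by rewrite ler_expR (le_trans _ yM) // ler_norm.
  have : y ^+ 2 * expR y <= y ^+ 2 * expR M by rewrite ler_wpM2l // sqr_ge0.
  have : y * expR y <= y * (1 + y * expR y) by rewrite ler_wpM2l.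
  rewrite expr2; nra.
have e1 : 1 <= expR M by rewrite -expR0 ler_expR.
have : y ^+ 2 <= y ^+ 2 * expR M by rewrite ler_peMr // sqr_ge0.
suff : expR y <= 1 + y + y ^+ 2 by lra.
have h := expR_ge1Dx (- y); rewrite expRN in h.
have e0 := expR_gt0 y.
have h2 : expR y * (1 - y) <= 1.
  by rewrite -[leRHS](mulfV (lt0r_neq0 e0)) ler_pM2l //; lra.
have z0 : 0 < 1 - y by lra.
rewrite -(ler_pM2r z0); apply: (le_trans h2).
have : 0 <= - (y ^+ 3) by rewrite oppr_ge0 exprn_odd_le0 // ltW.
rewrite !exprS expr0; lra.
Qed.

Definition step_cst s : R := s ^+ 2 * expR s + 3 `^ s + s * 2 `^ s.

Lemma step_cst_ge1 s : 2 < s -> 1 <= step_cst s.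
Proof.
move=> s2; rewrite /step_cst.
have : 1 <= (3 : R) `^ s by rewrite -[leLHS](_ : 1 `^ s = 1); [rewrite ge0_ler_powR ?nnegrE //; lra|rewrite powR1].
have : 0 <= s * 2 `^ s by rewrite mulr_ge0 ?powR_ge0 //; lra.
have : 0 <= s ^+ 2 * expR s by rewrite mulr_ge0 ?sqr_ge0 ?expR_ge0.
lra.
Qed.

(** Near 0 this is a second-order Taylor bound for the exponential of s ln (1 +
    x); for |x| > 1/2 the left-hand side and the linear term are dominated by
    multiples of |x|^s. *)
Lemma power_step1 s x : 2 < s ->
  `|1 + x| `^ s <= 1 + s * x + step_cst s * (x ^+ 2 + `|x| `^ s).
Proof.
move=> s2; rewrite /step_cst.
have A0 : 0 <= s ^+ 2 * expR s by rewrite mulr_ge0 ?sqr_ge0 ?expR_ge0.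
have B0 := powR_ge0 (3 : R) s; have C0 := powR_ge0 (2 : R) s.
have D0 : 0 <= s * 2 `^ s by rewrite mulr_ge0 //; lra.
have X0 := powR_ge0 `|x| s.
have Y0 := sqr_ge0 x.
(* 1/2 keeps 1 + x positive, so that its logarithm makes sense *)
have [xs|xb] := leP `|x| 2^-1.
  have x1 : 0 < 1 + x by move: xs; rewrite ler_norml => /andP[]; lra.
  have h : `|1 + x| `^ s <= 1 + s * x + x ^+ 2 * (s ^+ 2 * expR s).
    rewrite gtr0_norm // /powR gt_eqF //.
    apply: (@le_trans _ _ (expR (s * x))).
      rewrite ler_expR ler_pM2l; last lra.
      by have := le_ln1Dx (_ : -1 < x); apply; lra.
    apply: (le_trans (@expR_le_quad (s * x) s _)).
      rewrite normrM gtr0_norm; last lra.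
      rewrite -[leRHS]mulr1 ler_wpM2l //; lra.
    rewrite exprMn; lra.
  apply: (le_trans h).
  have : 0 <= s ^+ 2 * expR s * `|x| `^ s by rewrite mulr_ge0.
  have : 0 <= 3 `^ s * x ^+ 2 by rewrite mulr_ge0.
  have : 0 <= 3 `^ s * `|x| `^ s by rewrite mulr_ge0.
  have : 0 <= s * 2 `^ s * x ^+ 2 by rewrite mulr_ge0.
  have : 0 <= s * 2 `^ s * `|x| `^ s by rewrite mulr_ge0.
  nra.
have h1 : `|1 + x| `^ s <= 3 `^ s * `|x| `^ s.
  rewrite -powRM //; apply: ge0_ler_powR; rewrite ?nnegrE ?mulr_ge0 //; first lra.
  by apply: (le_trans (ler_normD _ _)); rewrite normr1; lra.
have h2 : s * `|x| <= s * 2 `^ s * `|x| `^ s.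
  rewrite -mulrA ler_wpM2l //; first lra.
  rewrite -powRM //.
  have e1 : 1 <= 2 * `|x| by lra.
  apply: (@le_trans _ _ (2 * `|x|)); first by lra.
  rewrite -[leLHS]powRr1; last lra.
  by rewrite ler_powR //; lra.
have h3 : - (s * x) <= s * `|x|.
  rewrite -mulrN ler_wpM2l //; first lra.
  by rewrite -normrN ler_norm.
have : 0 <= s ^+ 2 * expR s * `|x| `^ s by rewrite mulr_ge0.
have : 0 <= s ^+ 2 * expR s * x ^+ 2 by rewrite mulr_ge0.
have : 0 <= 3 `^ s * x ^+ 2 by rewrite mulr_ge0.
have : 0 <= s * 2 `^ s * x ^+ 2 by rewrite mulr_ge0.
nra.
Qed.

(** The term linear in b is kept with its sign, because its integral vanishes
    for a martingale increment b; only quadratic and higher terms in b remain. *)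
Lemma power_step s a b : 2 < s ->
  `|a + b| `^ s <= `|a| `^ s + s * (`|a| `^ (s - 2) * a * b)
    + step_cst s * (`|a| `^ (s - 2) * b ^+ 2 + `|b| `^ s).
Proof.
move=> s2; have [->|a0] := eqVneq a 0.
  rewrite add0r normr0 !powR0 ?gt_eqF ?subr_gt0 //; try lra.
  rewrite !mul0r mulr0 !add0r ler_peMl ?powR_ge0 //.
  exact: step_cst_ge1.
have an : 0 < `|a| by rewrite normr_gt0.
have P2 : `|a| `^ s = `|a| `^ (s - 2) * a ^+ 2.
  rewrite -[a ^+ 2]real_normK ?num_real // -powR_mulrn // -powRD; last by rewrite (gt_eqF an) implybT.
  by rewrite subrK.
have -> : a + b = a * (1 + b / a) by rewrite mulrDr mulr1 mulrC divfK.
rewrite normrM powRM //.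
apply: (@le_trans _ _ (`|a| `^ s * (1 + s * (b / a) + step_cst s * ((b / a) ^+ 2 + `|b / a| `^ s)))).
  by rewrite ler_wpM2l ?powR_ge0 // power_step1.
rewrite le_eqVlt; apply/orP; left; apply/eqP.
have -> : `|a| `^ s * (1 + s * (b / a) + step_cst s * ((b / a) ^+ 2 + `|b / a| `^ s))
  = `|a| `^ s + s * (`|a| `^ s * (b / a)) + step_cst s * (`|a| `^ s * (b / a) ^+ 2 + `|a| `^ s * `|b / a| `^ s) by ring.
have -> : `|a| `^ s * `|b / a| `^ s = `|b| `^ s.
  by rewrite -powRM // -normrM mulrC divfK.
rewrite P2; congr (_ + s * _ + _ * (_ + _)); field; exact: a0.
Qed.

(** This converts the expansion of s-th powers into additivity of squared norms:
    u and w stand for the squared L^s norms of a partial sum and of the next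
    increment. *)
Lemma sq_norm_step s u w (c : R) : 2 < s -> 0 <= u -> 0 <= w -> 1 <= c ->
  u `^ (s / 2) + c * (u `^ (s / 2 - 1) * w + w `^ (s / 2))
    <= (u + 2 * c * w) `^ (s / 2).
Proof.
move=> s2 u0 w0 c1; set r := s / 2.
have r1 : 0 < r - 1 by rewrite /r; lra.
have split_pow (z : R) : 0 <= z -> z `^ r = z * z `^ (r - 1).
  rewrite le_eqVlt => /orP[/eqP <-|z0].
    by rewrite powR0 ?mul0r // gt_eqF //; lra.
  rewrite -[in LHS](subrK 1 r) powRD; last by rewrite (gt_eqF z0) implybT.
  by rewrite powRr1 ?(ltW z0) // mulrC.
have W0 : 0 <= u + 2 * c * w by rewrite addr_ge0 // !mulr_ge0 //; lra.
have h1 : u `^ (r - 1) <= (u + 2 * c * w) `^ (r - 1).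
  apply: ge0_ler_powR; rewrite ?nnegrE //; [exact: ltW|].
  by rewrite lerDl !mulr_ge0 //; lra.
have h2 : w `^ (r - 1) <= (u + 2 * c * w) `^ (r - 1).
  apply: ge0_ler_powR; rewrite ?nnegrE //; [exact: ltW|].
  have : w <= 2 * c * w by rewrite ler_peMl //; lra.
  lra.
rewrite (split_pow _ W0) (split_pow _ u0) (split_pow _ w0).
set p1 := u `^ _ in h1 *; set p2 := w `^ _ in h2 *; set p3 := _ `^ _ in h1 h2 *.
have : u * p1 <= u * p3 by rewrite ler_wpM2l.
have : c * w * p1 <= c * w * p3 by rewrite ler_wpM2l // mulr_ge0 //; lra.
have : c * w * p2 <= c * w * p3 by rewrite ler_wpM2l // mulr_ge0 //; lra.
lra.
Qed.

End power_step.

(** * Closedness of L^s balls under convergence in L^1 *)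

Section L1_closed.
Context (R : realType).

(** The convex function t^s lies above its tangent at x. Only the case y <= x is
    not immediate, and there it is a form of the inequality of Young. *)
Lemma powR_tangent (s x y : R) : 1 < s -> 0 <= x -> 0 <= y ->
  x `^ s <= y `^ s + s * x `^ (s - 1) * `|y - x|.
Proof.
move=> s1 x0 y0; have s0 : 0 < s by lra.
have [xy|yx] := leP x y.
  apply: (@le_trans _ _ (y `^ s)); first by apply: ge0_ler_powR; rewrite ?nnegrE //; lra.
  by rewrite lerDl !mulr_ge0 ?powR_ge0 //; lra.
have x1 : 0 < x by lra.
have ss : 0 < s - 1 by lra.
have := @conjugate_powR R y (x `^ (s - 1)) s (s / (s - 1)) y0 (powR_ge0 _ _) s0.
rewrite divr_gt0 // => /(_ isT).
rewrite invf_div (_ : s^-1 + (s - 1) / s = 1); last by field; lra.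
move=> /(_ erefl).
rewrite -powRrM (_ : (s - 1) * (s / (s - 1)) = s); last by field; lra.
have e : x `^ s = x `^ (s - 1) * x.
  rewrite -[in LHS](subrK 1 s) [LHS]powRD; last by rewrite (gt_eqF x1) implybT.
  by rewrite powRr1.
rewrite ltr0_norm; last lra.
set p := x `^ (s - 1); rewrite e -/p; set Y := y `^ s.
move=> h.
have : s * (y * p) <= Y + p * x * (s - 1).
  have := ler_wpM2l (ltW s0) h.
  by rewrite (_ : s * (Y / s + _) = Y + p * x * (s - 1)) //; field; lra.
lra.
Qed.

Context d (Om : measurableType d) (P : probability Om R).

(** A limit in L^1 of functions in an L^s ball stays in the ball. Where |g| <= K
    the tangent inequality costs at most s K^(s-1) times the L^1 distance, which
    can be made arbitrarily small before K tends to infinity. *)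
Lemma Lb_L1_closed s (g : Om -> R) A : 1 < s -> 0 <= A -> measurable_fun setT g ->
  (forall e, 0 < e -> exists f, Lb P s f A /\ Lb P 1 (fun x => f x - g x) e) ->
  Lb P s g A.
Proof.
move=> s1 A0 mg close; split => //.
pose g_ (K : nat) x : \bar R := (if `|g x| <= K%:R then `|g x| `^ s else 0)%:E.
have mgK K : measurable_fun setT (g_ K).
  apply/measurable_EFinP; apply: measurable_fun_ifT => //.
    by apply: measurable_fun_ler => //; exact: measurableT_comp.
  by apply/measurable_EFinP; exact: measurable_absX.
have g0 K x : (0 <= g_ K x)%E by rewrite /g_ lee_fin; case: ifP; rewrite ?powR_ge0.
have nd x : {homo g_^~ x : m n / (m <= n)%N >-> (m <= n)%E}.
  move=> m n mn; rewrite /g_ lee_fin; case: ifPn => [h|_].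
    by rewrite (le_trans h) // ler_nat.
  by case: ifP; rewrite ?powR_ge0.
have := @monotone_convergence _ _ _ P setT measurableT g_ mgK (fun n x _ => g0 n x) (fun x _ => nd x).
have -> : (fun x => limn (g_^~ x)) = (fun x => (`|g x| `^ s)%:E).
  apply/funext => x; apply: lim_near_cst => //.
  have [N hN] : exists N : nat, `|g x| <= N%:R.
    by exists (Num.bound `|g x|); apply/ltW/archi_boundP.
  exists N => // n /= Nn; rewrite /g_ ifT // (le_trans hN) // ler_nat //.
move=> ->; apply: lime_le.
  apply: ereal_nondecreasing_is_cvgn => m n mn.
  apply: ge0_le_integral => // x _; exact: nd.
apply: nearW => K.
apply/lee_addgt0Pr => e e0.
have k0 : 0 < s * K%:R `^ (s - 1) + 1 by rewrite ltr_wpDl // mulr_ge0 ?powR_ge0 //; lra.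
(* the L^1 distance is chosen after K so as to beat the tangent slope at K *)
have [f [Lf Lfg]] := close _ (divr_gt0 e0 k0).
have [mf _ hf] := Lf; have [mfg e1 hfg] := Lfg; rewrite (powRr1 e1) in hfg.
have mabs (h : Om -> R) : measurable_fun setT h -> measurable_fun setT (fun x => (`|h x| `^ 1)%:E) by exact: measurable_absX.
apply: (@le_trans _ _ (\int[P]_x ((`|f x| `^ s)%:E + (s * K%:R `^ (s - 1))%:E * (`|f x - g x| `^ 1)%:E))%E).
  apply: ge0_le_integral => //.
  - apply: emeasurable_funD; first exact: measurable_absX.
    by apply: measurable_funeM; exact: mabs.
  - move=> x _; rewrite -EFinM -EFinD lee_fin powRr1 //; case: ifPn => h; last first.
      by rewrite addr_ge0 ?powR_ge0 // !mulr_ge0 ?powR_ge0 //; lra.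
    apply: (le_trans (powR_tangent s1 _ (normr_ge0 (f x)))) => //.
    rewrite lerD2l; apply: ler_pM; rewrite ?mulr_ge0 ?powR_ge0 //; first lra.
      by rewrite ler_wpM2l //; [lra|apply: ge0_ler_powR; rewrite ?nnegrE //; lra].
    exact: ler_dist_dist.
rewrite ge0_integralD //; last 3 first.
- exact: measurable_absX.
- move=> x _; rewrite mule_ge0 ?lee_fin ?powR_ge0 // mulr_ge0 ?powR_ge0 //; lra.
- by apply: measurable_funeM; exact: mabs.
rewrite ge0_integralZl //; last 2 first.
- exact: mabs.
- rewrite lee_fin mulr_ge0 ?powR_ge0 //; lra.
apply: leeD => //.
apply: (@le_trans _ _ ((s * K%:R `^ (s - 1))%:E * (e / (s * K%:R `^ (s - 1) + 1))%:E)%E).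
  by apply: lee_wpmul2l => //; rewrite lee_fin mulr_ge0 ?powR_ge0 //; lra.
rewrite -EFinM lee_fin mulrCA ger_pMr // ler_pdivrMr // mul1r; lra.
Qed.

End L1_closed.

(** * Laws of fields of independent variables *)

Definition coords (I : Type) d (F : measurableType d) : set (set (I -> F)) :=
  [set A | exists i (B : set F),
     measurable B /\ A = (fun x : I -> F => x i) @^-1` B].

Notation cylT I F := (g_sigma_algebraType (@coords I _ F)).

Section cylinder_spaces.
Context (I : Type) d (F : measurableType d) d' (T : measurableType d').

Lemma measurable_coord (i : I) :
  measurable_fun setT (fun x : cylT I F => x i).
Proof.
move=> _ B mB; rewrite setTI; apply: sub_sigma_algebra.
by exists i, B.
Qed.

Lemma measurable_into_cyl (f : T -> cylT I F) :
  (forall i, measurable_fun setT (fun t => f t i)) -> measurable_fun setT f.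
Proof.
move=> mf; have H := @measurability _ _ _ (cylT I F) setT f (@coords I _ F) erefl. apply: H.
move=> _ [_ [i [B [mB ->]]] <-].
exact: mf.
Qed.

End cylinder_spaces.

Section iid_fields.
Context dE (E : measurableType dE) (R : realType).
Context dO (Om : measurableType dO) (P : probability Om R).
Notation SE := (cylT nat E).

(** Finite rectangles form a pi-system that generates the product sigma-algebra. *)
Definition rects (I : eqType) : set (set (cylT I SE)) :=
  [set A | exists (s : seq I) (B : I -> set SE), uniq s /\
     (forall i, measurable (B i)) /\
     A = \bigcap_(i in [set` s]) ((fun x : I -> SE => x i) @^-1` B i)].

Lemma measurable_rects (I : eqType) A : @rects I A -> measurable A.
Proof.
move=> [s [B [us [mB ->]]]].
apply: fin_bigcap_measurable; first exact: finite_set_in_seq || exact: finite_seq.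
move=> i _; rewrite -[X in measurable X]setTI.
by apply: measurable_coord.
Qed.

Lemma setI_rects (I : eqType) : setI_closed (@rects I).
Proof.
move=> _ _ [s [B [us [mB ->]]]] [s' [B' [us' [mB' ->]]]].
exists (undup (s ++ s')),
  (fun i => (if i \in s then B i else setT) `&` (if i \in s' then B' i else setT)).
split; first exact: undup_uniq.
split; first by move=> i; apply: measurableI; case: ifP.
rewrite eqEsubset; split=> x /=.
  move=> [h h'] i /= _; split; first by case: ifPn => // /h.
  by case: ifPn => // /h'.
move=> h; split=> i /= iin.
  have := h i; rewrite /= mem_undup mem_cat iin /= => /(_ isT) [] //.
have := h i; rewrite /= mem_undup mem_cat iin orbT => /(_ isT) [] //.
Qed.

Lemma cylT_generated (I : eqType) : @measurable _ (cylT I SE) = <<s @rects I >>.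
Proof.
rewrite eqEsubset; split; apply: smallest_sub.
- exact: smallest_sigma_algebra.
- move=> _ [i [B [mB ->]]]; apply: sub_sigma_algebra.
  exists [:: i], (fun=> B); split=> //; split=> //.
  rewrite eqEsubset; split=> x /= h; last by apply: (h i); rewrite /= inE.
  by move=> j /=; rewrite inE => /eqP ->.
- exact: sigma_algebra_measurable.
- by move=> A; exact: measurable_rects.
Qed.

Lemma rects_setT (I : eqType) : @rects I setT.
Proof.
exists [::], (fun=> setT); split=> //; split=> //.
by rewrite eqEsubset; split=> x //= _ i /=; rewrite inE.
Qed.

(** Independence fixes the probability of every finite rectangle, and the
    rectangles are a generating pi-system, so the one-dimensional laws determine
    the law of the field. *)
Lemma iid_law_unique (I : eqType) d1 (O1 : measurableType d1)
    (P1 : probability O1 R) d2 (O2 : measurableType d2) (P2 : probability O2 R)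
    (x1 : I -> O1 -> nat -> E) (x2 : I -> O2 -> nat -> E) :
  iid_sequences P1 x1 -> iid_sequences P2 x2 ->
  (forall i A, cylinder_measurable A -> P1 (x1 i @^-1` A) = P2 (x2 i @^-1` A)) ->
  forall A : set (cylT I SE), measurable A ->
  P1 ((fun w i => x1 i w) @^-1` A) = P2 ((fun w i => x2 i w) @^-1` A).
Proof.
move=> [m1 _ i1] [m2 _ i2] e12 A mA.
have mf1 : measurable_fun setT (fun w => (fun i => x1 i w) : cylT I SE).
  by apply: measurable_into_cyl => i; apply: measurable_into_cyl => j; exact: m1.
have mf2 : measurable_fun setT (fun w => (fun i => x2 i w) : cylT I SE).
  by apply: measurable_into_cyl => i; apply: measurable_into_cyl => j; exact: m2.
pose M1 : {mfun O1 >-> cylT I SE} :=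
  HB.pack (fun w => (fun i => x1 i w) : cylT I SE)
    (isMeasurableFun.Build _ _ _ _ _ mf1).
pose M2 : {mfun O2 >-> cylT I SE} :=
  HB.pack (fun w => (fun i => x2 i w) : cylT I SE)
    (isMeasurableFun.Build _ _ _ _ _ mf2).
have := @measure_unique _ R (cylT I SE) (@rects I) (fun=> setT)
  (cylT_generated I) (@setI_rects I) (fun=> @rects_setT I) _
  (pushforward P1 M1) (pushforward P2 M2).
apply => //.
- by rewrite bigcup_const.
- move=> _ [s [B [us [mB ->]]]]; rewrite /pushforward.
  transitivity (P1 (\bigcap_(i in [set` s]) (x1 i @^-1` B i))).
    reflexivity.
  transitivity (P2 (\bigcap_(i in [set` s]) (x2 i @^-1` B i))); last first.
    reflexivity.
  rewrite i1 ?i2 //.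
  by apply: eq_bigr => i _; apply: e12; exact: mB.
- by move=> k; rewrite -[X in (X < _)%E]/(P1 setT) probability_setT ltry.
Qed.

Lemma iid_reindex (I J : eqType) d1 (O1 : measurableType d1)
    (P1 : probability O1 R) (x : I -> O1 -> nat -> E) (sg : J -> I) :
  injective sg -> iid_sequences P1 x -> iid_sequences P1 (fun j => x (sg j)).
Proof.
move=> isg [m1 id1 ind1]; split.
- by move=> i j; exact: m1.
- by move=> i i' A mA; exact: id1.
move=> s A us mA.
have [s0|[j0 _]] : s = [::] \/ exists j, j \in s.
  by case: s us => [|j s] us; [left|right; exists j; rewrite inE eqxx].
  rewrite s0 big_nil (_ : bigcap _ _ = setT) ?probability_setT //.
  by rewrite eqEsubset; split=> y //= _ i /=; rewrite inE.
pose pre (i : I) := nth j0 s (index i (map sg s)).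
have preK j : j \in s -> pre (sg j) = j.
  by move=> js; rewrite /pre index_map // nth_index.
have -> : \bigcap_(j in [set` s]) (x (sg j) @^-1` A j)
        = \bigcap_(i in [set` map sg s]) (x i @^-1` A (pre i)).
  rewrite eqEsubset; split=> w /= h.
    by move=> _ /= /mapP[j js ->]; rewrite preK //; exact: h.
  move=> j /= js; have := h (sg j); rewrite /= preK //; apply.
  by apply/mapP; exists j.
rewrite ind1 ?map_inj_uniq // big_map big_seq [RHS]big_seq.
by apply: eq_bigr => j js; rewrite preK.
Qed.

End iid_fields.

Section doubling.
Context dO (Om : measurableType dO) (R : realType) (P : probability Om R).

(** On the product of the probability space with itself the second coordinate
    supplies an independent copy of everything defined from the first;
    integrating over it is the way conditional expectations are realised below. *)
Definition PP : set (Om * Om) -> \bar R := (P \x P)%E.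
HB.instance Definition _ := Measure.on PP.
Let PP_setT : PP setT = 1%E.
Proof.
rewrite /PP -setXTT product_measure1E //.
by rewrite -[RHS]mule1; congr (_ * _)%E; exact: probability_setT.
Qed.
HB.instance Definition _ := Measure_isProbability.Build _ _ _ PP PP_setT.

Lemma PP_rect A B : measurable A -> measurable B ->
  (PP : probability (Om * Om)%type R) (A `*` B) = (P A * P B)%E.
Proof. by move=> mA mB; exact: product_measure1E. Qed.

Context dE (E : measurableType dE).
Notation SE := (cylT nat E).
Variables (eps eps' : int -> Om -> nat -> E).
Hypothesis epsiid : iid_with_copy P eps eps'.

(** The noise and its copy as one field on the given space. Its counterpart on
    the product space takes the copy from the second factor, so that the copy is
    a function of a separate variable that can be integrated out. *)
Definition srcP (b : bool * int) : Om -> nat -> E :=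
  if b.1 then eps' b.2 else eps b.2.
Definition srcPP (b : bool * int) (z : Om * Om) : nat -> E :=
  eps b.2 (if b.1 then z.2 else z.1).

Lemma iid_srcP : iid_sequences P srcP. Proof. exact: epsiid. Qed.

Lemma iid_eps : iid_sequences P eps.
Proof.
have := @iid_reindex _ E R _ _ _ _ P srcP (fun i : int => (false, i)).
apply; last exact: iid_srcP.
by move=> i j [].
Qed.

Lemma eps_measurable i (A : set SE) :
  measurable A -> measurable ((eps i : Om -> SE) @^-1` A).
Proof.
move=> mA; rewrite -[X in measurable X]setTI.
have [m _ _] := iid_eps.
by apply: (measurable_into_cyl (f := (eps i : Om -> SE))) => // j; exact: m.
Qed.

Lemma iid_srcPP : iid_sequences PP srcPP.
Proof.
have [m id1 ind] := iid_eps.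
have fact b A : cylinder_measurable A ->
    (PP : probability (Om * Om)%type R) (srcPP b @^-1` A) = P (eps b.2 @^-1` A).
  move=> mA; case: b => -[] i /=.
    rewrite (_ : _ @^-1` _ = setT `*` (eps i @^-1` A)).
      by rewrite PP_rect ?probability_setT ?mul1e //; exact: eps_measurable.
    by rewrite eqEsubset; split=> -[w w'] /=; [move=> ?; split|case].
  rewrite (_ : _ @^-1` _ = (eps i @^-1` A) `*` setT).
    by rewrite PP_rect ?probability_setT ?mule1 //; exact: eps_measurable.
  by rewrite eqEsubset; split=> -[w w'] /=; [move=> ?; split|case].
split.
- move=> [[] i] j; rewrite /srcPP /=.
    exact: (measurableT_comp (m i j) measurable_snd).
  exact: (measurableT_comp (m i j) measurable_fst).
- by move=> b b' A mA; rewrite !fact //; exact: id1.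
move=> s A us mA.
pose part c := [seq b.2 | b <- s & b.1 == c].
have upart c : uniq (part c).
  rewrite map_inj_in_uniq ?filter_uniq // => -[b1 i1] [b2 i2].
  by rewrite !mem_filter /= => /andP[/eqP -> _] /andP[/eqP -> _] ->.
have mpart c i : cylinder_measurable (A (c, i)) by exact: mA.
rewrite (_ : bigcap _ _ =
  (\bigcap_(i in [set` part false]) (eps i @^-1` A (false, i))) `*`
  (\bigcap_(i in [set` part true]) (eps i @^-1` A (true, i)))); last first.
  rewrite eqEsubset; split=> -[w w'] /= h.
    split=> i /= /mapP[[c k]]; rewrite mem_filter /= => /andP[/eqP -> ks] ->.
      exact: (h (false, k) ks).
    exact: (h (true, k) ks).
  case: h => h h' [[] i] /= bs; rewrite /srcPP /=.
    by apply: h' => /=; apply/mapP; exists (true, i); rewrite ?mem_filter //= bs.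
  by apply: h => /=; apply/mapP; exists (false, i); rewrite ?mem_filter //= bs.
have mcap c : measurable (\bigcap_(i in [set` part c]) (eps i @^-1` A (c, i))).
  apply: fin_bigcap_measurable; first exact: finite_seq.
  by move=> i _; apply: eps_measurable; exact: mpart.
rewrite PP_rect // !ind // /part !big_map !big_filter.
rewrite [RHS](bigID (fun b : bool * int => b.1 == false)) /=; congr (_ * _)%E.
  by apply: eq_bigr => -[c i] /= /eqP ->; rewrite fact.
rewrite [RHS](eq_bigl (fun b : bool * int => b.1 == true)); last by case=> [[] ?].
by apply: eq_bigr => -[c i] /= /eqP ->; rewrite fact.
Qed.

(** Both fields are independent and identically distributed, so any injective
    relabelling of either has the same law. All exchangeability arguments reduce
    to the choice of two relabellings. *)
Lemma relabelled_law (sg tau : bool * int -> bool * int) (A : set (cylT (bool * int) SE)) :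
  injective sg -> injective tau -> measurable A ->
  P ((fun w b => srcP (sg b) w) @^-1` A) =
  (PP : probability (Om * Om)%type R) ((fun z b => srcPP (tau b) z) @^-1` A).
Proof.
move=> isg itau mA.
apply: (@iid_law_unique _ E R _ _ _ P _ _ PP
  (fun b => srcP (sg b)) (fun b => srcPP (tau b))) => //.
- exact: iid_reindex iid_srcP.
- exact: iid_reindex iid_srcPP.
move=> b B mB.
have [_ id2 _] := iid_srcPP.
have [_ id1 _] := iid_srcP.
rewrite (id2 _ (false, 0)) // (id1 _ (false, 0)) // (_ : _ @^-1` _ = (eps 0 @^-1` B) `*` setT).
  by rewrite PP_rect ?probability_setT ?mule1 //; exact: eps_measurable.
by rewrite eqEsubset; split=> -[w w'] /=; [move=> ?; split|case].
Qed.

End doubling.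

(** * Averaging and one martingale step *)

Section averaging.
Context d1 d2 (T1 : measurableType d1) (T2 : measurableType d2) (R : realType).
Context (P : probability T2 R).

Definition avg (f : T1 * T2 -> R) (x : T1) : R := \int[P]_y f (x, y).

Lemma measurable_avg f : measurable_fun setT f -> measurable_fun setT (avg f).
Proof.
move=> mf; rewrite /avg /Rintegral.
apply: (measurableT_comp (fine_measurable measurableT)) => //.
have mE : measurable_fun setT (EFin \o f) by apply/measurable_EFinP.
rewrite (_ : (fun x => _) = (fun x => \int[P]_y ((EFin \o f)^\+ (x, y))
   - \int[P]_y ((EFin \o f)^\- (x, y)))%E); last first.
  apply/funext => x; rewrite integralE; congr (_ - _)%E.
  - by apply: eq_integral => y _; rewrite !funeposE.
  - by apply: eq_integral => y _; rewrite !funenegE.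
apply: emeasurable_funB.
  have h := @measurable_fun_fubini_tonelli_F _ _ _ _ _ P ((EFin \o f)^\+)%E
    (measurable_funepos mE) (funepos_ge0 _).
  exact: h.
have h := @measurable_fun_fubini_tonelli_F _ _ _ _ _ P ((EFin \o f)^\-)%E
  (measurable_funeneg mE) (funeneg_ge0 _).
exact: h.
Qed.

End averaging.

Section averaging_product.
Context d (Om : measurableType d) (R : realType) (P : probability Om R).
Notation PP := (PP P).

(** Averaging over the second variable is a contraction of L^s, by the power
    mean inequality under the integral. *)
Lemma avg_contract s f A : 1 <= s -> Lb PP s f A -> Lb P s (avg P f) A.
Proof.
move=> s1 [mf A0 fA]; have s0 : 0 < s by exact: lt_le_trans s1.
split; [exact: measurable_avg|by []|].
apply: le_trans fA.
have mabs := measurable_absX s mf.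
rewrite [leRHS](_ : _ = \int[P]_x \int[P]_y (`|f (x, y)| `^ s)%:E)%E; last first.
  have := @fubini_tonelli1 _ _ _ _ _ P P (fun z => (`|f z| `^ s)%:E) mabs.
  by apply=> z; rewrite lee_fin powR_ge0.
apply: ge0_le_integral; [by []|by move=> x _; rewrite lee_fin powR_ge0| | |].
- exact: (measurable_absX s (measurable_avg P mf)).
- apply: (@measurable_fun_fubini_tonelli_F _ _ _ _ _ P (fun z => (`|f z| `^ s)%:E)) => //.
- move=> x _.
  have mx : measurable_fun setT (fun y => f (x, y)).
    exact: measurableT_comp mf (measurable_pair1 _ _) || exact: measurableT_comp.
  set I := (\int[P]_y _)%E.
  have I0 : (0 <= I)%E by apply: integral_ge0 => y _; rewrite lee_fin powR_ge0.
  have [Ioo|Ioo] := eqVneq I +oo%E; first by rewrite Ioo leey.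
  have If : I \is a fin_num by rewrite ge0_fin_numE // lt_neqAle Ioo leey.
  have f0 : 0 <= fine I by exact: fine_ge0.
  have L : Lb P s (fun y => f (x, y)) (fine I `^ s^-1).
    split; [by []|exact: powR_ge0|].
    by rewrite -powRrM mulVf ?gt_eqF // powRr1 // fineK.
  have := Lb_Ex s1 L; rewrite /Ex unlock => h.
  rewrite -(fineK If) lee_fin -[leRHS]powRr1 // -[X in _ <= _ `^ X](mulVf (lt0r_neq0 s0)) powRrM.
  by apply: ge0_ler_powR; rewrite ?nnegrE ?powR_ge0 ?(ltW s0).
Qed.

Lemma avg_sub f g : PP.-integrable setT (EFin \o f) -> PP.-integrable setT (EFin \o g) ->
  {ae P, forall x, avg P (fun z => f z - g z) x = avg P f x - avg P g x}.
Proof.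
move=> fi gi.
have := ae_integrable1 fi; have := ae_integrable1 gi.
apply: filterS2 => x gx fx; rewrite /avg RintegralB //.
Qed.

Lemma avg_add f g : PP.-integrable setT (EFin \o f) -> PP.-integrable setT (EFin \o g) ->
  {ae P, forall x, avg P (fun z => f z + g z) x = avg P f x + avg P g x}.
Proof.
move=> fi gi.
have := ae_integrable1 fi; have := ae_integrable1 gi.
apply: filterS2 => x gx fx; rewrite /avg RintegralD //.
Qed.

End averaging_product.

Section moment_step.
Context d (Om : measurableType d) (R : realType) (P : probability Om R).

Lemma Lb_sq s (f : Om -> R) (u : R) : 0 < s -> 0 <= u -> measurable_fun setT f ->
  Lb P s f (Num.sqrt u) <-> (\int[P]_x (`|f x| `^ s)%:E <= (u `^ (s / 2))%:E)%E.
Proof.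
move=> s0 u0 mf.
have e : Num.sqrt u `^ s = u `^ (s / 2).
  by rewrite -powR12_sqrt // -powRrM mulrC.
split; first by case; rewrite e.
by move=> h; split; rewrite ?e // sqrtr_ge0.
Qed.

(** This makes the linear term of the expansion integrable. *)
Lemma powR_absM_le s (a b : R) : 2 < s ->
  `| `|a| `^ (s - 2) * a * b| <= `|a| `^ s + `|b| `^ s.
Proof.
move=> s2.
have e (x : R) : `|x| `^ s = `|x| `^ (s - 2) * `|x| * `|x|.
  have [->|x0] := eqVneq x 0; first by rewrite normr0 mulr0 powR0 // gt_eqF //; lra.
  rewrite -mulrA -expr2 -powR_mulrn // -powRD; last by rewrite normr_eq0 (negbTE x0) implybT.
  by rewrite subrK.
rewrite !normrM ger0_norm ?powR_ge0 //.
have [ab|ba] := leP `|a| `|b|.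
  apply: (@le_trans _ _ (`|b| `^ s)); last by rewrite lerDr powR_ge0.
  rewrite e ler_wpM2r //; apply: ler_pM => //.
  by apply: ge0_ler_powR; rewrite ?nnegrE //; lra.
apply: (@le_trans _ _ (`|a| `^ s)); last by rewrite lerDl powR_ge0.
by rewrite [leRHS]e ler_wpM2l ?mulr_ge0 ?powR_ge0 // ltW.
Qed.

(** Integrating the expansion of |X + Y|^s, the linear term vanishes by
    hypothesis and the mixed term is bounded by the inequality of Hoelder with
    exponents s/(s-2) and s/2. *)
Lemma Lb_martingale_step s (X Y : Om -> R) (u w : R) : 2 < s -> 0 <= u -> 0 <= w ->
  Lb P s X (Num.sqrt u) -> Lb P s Y (Num.sqrt w) ->
  (\int[P]_x (`|X x| `^ (s - 2) * X x * Y x)%:E = 0)%E ->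
  Lb P s (fun x => X x + Y x) (Num.sqrt (u + 2 * step_cst s * w)).
Proof.
move=> s2 u0 w0 LX LY orth.
have s0 : 0 < s by lra.
have c1 := step_cst_ge1 s2.
have [mX _ _] := LX; have [mY _ _] := LY.
have W0 : 0 <= u + 2 * step_cst s * w by rewrite addr_ge0 // !mulr_ge0 //; lra.
apply/(Lb_sq s0 W0); first exact: measurable_funD.
move/(Lb_sq s0 u0 mX): (LX) => hX; move/(Lb_sq s0 w0 mY): (LY) => hY.
have mpX (t : R) : measurable_fun setT (fun x => `|X x| `^ t).
  by apply/measurable_EFinP; exact: measurable_absX.
have mpY (t : R) : measurable_fun setT (fun x => `|Y x| `^ t).
  by apply/measurable_EFinP; exact: measurable_absX.
have iX : P.-integrable setT (EFin \o (fun x => `|X x| `^ s)).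
  apply/integrableP; split; first exact/measurable_EFinP.
  under eq_integral do rewrite /= ger0_norm ?powR_ge0 //.
  exact: le_lt_trans hX (ltry _).
have iY : P.-integrable setT (EFin \o (fun x => `|Y x| `^ s)).
  apply/integrableP; split; first exact/measurable_EFinP.
  under eq_integral do rewrite /= ger0_norm ?powR_ge0 //.
  exact: le_lt_trans hY (ltry _).
pose F2 x := `|X x| `^ (s - 2) * X x * Y x.
pose F3 x := `|X x| `^ (s - 2) * Y x ^+ 2.
have mF2 : measurable_fun setT F2 by do 2 apply: measurable_funM => //.
have mF3 : measurable_fun setT F3 by apply: measurable_funM => //; exact: measurable_funX.
have iF2 : P.-integrable setT (EFin \o F2).
  apply: le_integrable (integrableD measurableT iX iY); [by []|exact/measurable_EFinP|].
  move=> x _ /=; rewrite lee_fin [leRHS]ger0_norm ?addr_ge0 ?powR_ge0 //.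
  exact: powR_absM_le.
have F30 x : 0 <= F3 x by rewrite mulr_ge0 ?powR_ge0 ?sqr_ge0.
have hF3 : (\int[P]_x (F3 x)%:E <= (u `^ (s / 2 - 1) * w)%:E)%E.
  have s22 : 0 < s - 2 by lra.
  have mp := mpX (s - 2).
  have mY2 : measurable_fun setT (fun x => Y x ^+ 2) by exact: measurable_funX.
  have := @hoelder _ _ _ P (fun x => `|X x| `^ (s - 2)) (fun x => Y x ^+ 2)
     (s / (s - 2)) (s / 2) mp mY2.
  rewrite !divr_gt0 // => /(_ isT isT).
  rewrite !invf_div -mulrDl subrK divff ?gt_eqF // => /(_ erefl).
  rewrite Lnorm1 [((_ * w)%:E)%E]EFinM => h.
  rewrite (_ : \int[P]_x _ = \int[P]_x `|(EFin \o ((fun x => `|X x| `^ (s - 2)) \* (fun x => Y x ^+ 2))%R) x|)%E; last first.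
    apply: eq_integral => x _; transitivity (`|F3 x|%:E) => //.
    by rewrite ger0_norm.
  apply: (le_trans h); apply: lee_pmul; rewrite ?Lnorm_ge0 //.
    apply: Lb_norm; [exact: divr_gt0|split; [by []|exact: powR_ge0|]].
    rewrite -powRrM (_ : (s / 2 - 1) * _ = s / 2); last by field; lra.
    apply: le_trans hX; rewrite le_eqVlt; apply/orP; left; apply/eqP.
    apply: eq_integral => x _; rewrite ger0_norm ?powR_ge0 // -powRrM.
    by rewrite (_ : (s - 2) * _ = s) //; field; lra.
  apply: Lb_norm; [exact: divr_gt0|split; [by []|by []|]].
  apply: le_trans hY; rewrite le_eqVlt; apply/orP; left; apply/eqP.
  apply: eq_integral => x _; rewrite normrX -powR_mulrn // -powRrM.
  by rewrite (_ : 2%:R * _ = s) //; field.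
have iF3 : P.-integrable setT (EFin \o F3).
  apply/integrableP; split; first exact/measurable_EFinP.
  under eq_integral do rewrite /= ger0_norm //.
  exact: le_lt_trans hF3 (ltry _).
pose c := step_cst s.
have iZ (k : R) f : P.-integrable setT (EFin \o f) -> P.-integrable setT (EFin \o (fun x => k * f x)).
  by move=> i; have := integrableZl measurableT k i.
have iD f g : P.-integrable setT (EFin \o f) -> P.-integrable setT (EFin \o g) ->
    P.-integrable setT (EFin \o (fun x => f x + g x)).
  by move=> i j; have := integrableD measurableT i j.
have RZ (k : R) f : P.-integrable setT (EFin \o f) ->
   (\int[P]_x (k * f x) = k * \int[P]_x f x)%R.
  by move=> i; rewrite RintegralZl.
have RD f g : P.-integrable setT (EFin \o f) -> P.-integrable setT (EFin \o g) ->
   (\int[P]_x (f x + g x) = \int[P]_x f x + \int[P]_x g x)%R.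
  by move=> i j; rewrite RintegralD.
have RE f : P.-integrable setT (EFin \o f) -> (\int[P]_x (f x)%:E = (\int[P]_x f x)%:E)%E.
  by move=> i; rewrite /Rintegral fineK //; exact: integrable_fin_num.
pose H x := `|X x| `^ s + s * F2 x + c * (F3 x + `|Y x| `^ s).
have iH : P.-integrable setT (EFin \o H).
  by apply: (iD (fun x => _ + _)); [apply: iD => //; exact: iZ|apply: iZ; exact: iD].
apply: (@le_trans _ _ (\int[P]_x (H x)%:E)%E).
  apply: ge0_le_integral; [by []|by move=> x _; rewrite lee_fin powR_ge0| | |].
  - by apply: measurable_absX; exact: measurable_funD.
  - by have [] := integrableP _ _ _ iH.
  - by move=> x _; rewrite lee_fin; exact: power_step.
rewrite RE // /H.
rewrite (RD (fun x => _ + _)); [|by apply: iD => //; exact: iZ|by apply: iZ; exact: iD].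
rewrite RD //; last exact: iZ.
rewrite !RZ //; last exact: iD.
rewrite RD //.
have -> : (\int[P]_x F2 x = 0)%R by rewrite /Rintegral orth.
rewrite mulr0 addr0 lee_fin.
apply: le_trans (sq_norm_step s2 u0 w0 c1).
apply: lerD; first by rewrite -lee_fin -RE.
rewrite ler_wpM2l //; first by rewrite /c; lra.
by apply: lerD; rewrite -lee_fin -RE.
Qed.

End moment_step.

(** * The moment bound for functionals of the noise *)

Section innovations.
Context dE (E : measurableType dE) (R : realType).
Context dO (Om : measurableType dO) (P : probability Om R).
Notation SE := (cylT nat E).
Notation FF := (cylT (bool * int) SE).
Notation IS := (cylT int SE).
Variables (eps eps' : int -> Om -> nat -> E).
Hypothesis epsiid : iid_with_copy P eps eps'.
Notation PP := (PP P).
Notation srcP := (srcP eps eps').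
Notation srcPP := (srcPP eps).

Definition wfield (w : Om) : FF := fun b => srcP b w.
Definition wfield2 (z : Om * Om) : FF := fun b => srcPP b z.
Definition relabel (sg : bool * int -> bool * int) (z : FF) : FF := fun b => z (sg b).

Lemma measurable_wfield : measurable_fun setT wfield.
Proof.
have [m _ _] := iid_srcP epsiid.
by apply: measurable_into_cyl => b; apply: measurable_into_cyl => j; exact: m.
Qed.

Lemma measurable_wfield2 : measurable_fun setT wfield2.
Proof.
have [m _ _] := iid_srcPP epsiid.
by apply: measurable_into_cyl => b; apply: measurable_into_cyl => j; exact: m.
Qed.

Lemma measurable_relabel sg : measurable_fun setT (relabel sg).
Proof. by apply: measurable_into_cyl => b; exact: measurable_coord. Qed.

Lemma ge0_transfer (Psi : FF -> \bar R) sg tau : injective sg -> injective tau ->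
  measurable_fun setT Psi -> (forall z, 0 <= Psi z)%E ->
  (\int[P]_w Psi (relabel sg (wfield w)) = \int[PP]_z Psi (relabel tau (wfield2 z)))%E.
Proof.
move=> isg itau mPsi Psi0.
have m1 : measurable_fun setT (fun w => relabel sg (wfield w)).
  exact: measurableT_comp (measurable_relabel sg) measurable_wfield.
have m2 : measurable_fun setT (fun z => relabel tau (wfield2 z)).
  exact: measurableT_comp (measurable_relabel tau) measurable_wfield2.
have h1 := ge0_integral_pushforward m1 P measurableT mPsi (fun y _ => Psi0 y).
have h2 := ge0_integral_pushforward m2 PP measurableT mPsi (fun y _ => Psi0 y).
rewrite -[LHS]h1 -[RHS]h2.
apply: eq_measure_integral => A mA _.
exact: (relabelled_law epsiid isg itau mA).
Qed.

Lemma transfer (Psi : FF -> \bar R) sg tau : injective sg -> injective tau ->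
  measurable_fun setT Psi ->
  (\int[P]_w Psi (relabel sg (wfield w)) = \int[PP]_z Psi (relabel tau (wfield2 z)))%E.
Proof.
move=> isg itau mPsi; rewrite integralE [RHS]integralE; congr (_ - _)%E.
- transitivity (\int[P]_w (Psi^\+)%E (relabel sg (wfield w)))%E.
    by apply: eq_integral => w _; rewrite !funeposE.
  rewrite (@ge0_transfer (Psi^\+)%E sg tau isg itau) //; last exact: measurable_funepos.
  by apply: eq_integral => z _; rewrite !funeposE.
- transitivity (\int[P]_w (Psi^\-)%E (relabel sg (wfield w)))%E.
    by apply: eq_integral => w _; rewrite !funenegE.
  rewrite (@ge0_transfer (Psi^\-)%E sg tau isg itau) //; last exact: measurable_funeneg.
  by apply: eq_integral => z _; rewrite !funenegE.
Qed.

Definition noise_path (w : Om) : IS := fun i => eps i w.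
Definition redrawn_path (m : int) (w : Om) : IS := fun i => if i == m then eps' m w else eps i w.
(** Integrating out y conditions on the past of x up to time m. *)
Definition splice (m : int) (x y : IS) : IS := fun i => if i <= m then x i else y i.
Definition mainrow (z : FF) : IS := fun i => z (false, i).
Definition innovrow (m : int) (z : FF) : IS := fun i => if i == m then z (true, m) else z (false, i).

(** On the product space this relabelling produces the splice: up to time m it
    keeps the noise of the first factor, and after m it exchanges the two
    factors. *)
Definition mixsel (m : int) (b : bool * int) : bool * int :=
  if b.2 <= m then b else (~~ b.1, b.2).
Definition swapsel (m : int) (b : bool * int) : bool * int :=
  if b.2 == m then (~~ b.1, b.2) else b.

Lemma mixsel_inj m : injective (mixsel m).
Proof.
apply: (can_inj (g := mixsel m)) => -[b i]; rewrite /mixsel /=.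
by case im: (i <= m); rewrite /= im //= negbK.
Qed.

Lemma swapsel_inj m : injective (swapsel m).
Proof.
apply: (can_inj (g := swapsel m)) => -[b i]; rewrite /swapsel /=.
by case im: (i == m); rewrite /= im //= negbK.
Qed.

Lemma measurable_mainrow : measurable_fun setT mainrow.
Proof. by apply: measurable_into_cyl => i; exact: measurable_coord. Qed.

Lemma measurable_innovrow m : measurable_fun setT (innovrow m).
Proof.
apply: measurable_into_cyl => i; rewrite /innovrow; case: (i == m); exact: measurable_coord.
Qed.

Lemma innovrow_wfield m w : innovrow m (wfield w) = redrawn_path m w.
Proof. by apply/funext => i; rewrite /innovrow /redrawn_path /wfield; case: ifP. Qed.

Lemma mainrow_mix m z : mainrow (relabel (mixsel m) (wfield2 z)) = splice m (noise_path z.1) (noise_path z.2).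
Proof.
by apply/funext => i; rewrite /mainrow /relabel /mixsel /splice /wfield2 /=; case: ifP.
Qed.

Lemma innovrow_mix m z :
  innovrow m (relabel (mixsel m) (wfield2 z)) = splice (m - 1) (noise_path z.1) (noise_path z.2).
Proof.
apply/funext => i; rewrite /innovrow /relabel /mixsel /splice /wfield2 /=.
have -> : (i <= m - 1) = (i <= m) && (i != m).
  by rewrite lerBrDr lezD1 lt_neqAle andbC.
case: (eqVneq i m) => [->|im] /=; first by rewrite lexx.
by rewrite andbT; case: ifP.
Qed.

Lemma mainrow_swap m z : mainrow (relabel (swapsel m) z) = innovrow m z.
Proof.
apply/funext => i; rewrite /innovrow /mainrow /relabel /swapsel /=.
by case: eqP => [->|].
Qed.

Lemma innovrow_swap m z : innovrow m (relabel (swapsel m) z) = mainrow z.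
Proof.
apply/funext => i; rewrite /innovrow /mainrow /relabel /swapsel /= eqxx.
by case: eqP => [->|].
Qed.

Lemma measurable_noise_path : measurable_fun setT noise_path.
Proof.
by rewrite (_ : noise_path = mainrow \o wfield) //; exact: measurableT_comp measurable_mainrow measurable_wfield.
Qed.

Lemma measurable_redrawn_path m : measurable_fun setT (redrawn_path m).
Proof.
rewrite (_ : redrawn_path m = innovrow m \o wfield); last by apply/funext => w /=; rewrite innovrow_wfield.
exact: measurableT_comp (measurable_innovrow m) measurable_wfield.
Qed.

Lemma idfun_inj : injective (@idfun (bool * int)). Proof. by []. Qed.

Lemma measurable_splice m :
  measurable_fun setT (fun z : IS * Om => splice m z.1 (noise_path z.2)).
Proof.
apply: measurable_into_cyl => i; rewrite /splice; case: (i <= m).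
  exact: measurableT_comp (measurable_coord i) measurable_fst.
exact: measurableT_comp (measurableT_comp (measurable_coord i) measurable_noise_path) measurable_snd.
Qed.

(** Before and after time m the spliced path uses independent noises with the
    same law, so it is distributed as the noise itself. *)
Lemma splice_law (G : IS -> \bar R) m : measurable_fun setT G ->
  (\int[PP]_z G (splice m (noise_path z.1) (noise_path z.2)) = \int[P]_w G (noise_path w))%E.
Proof.
move=> mG.
have := @transfer (G \o mainrow) idfun (mixsel m) idfun_inj (@mixsel_inj m)
  (measurableT_comp mG measurable_mainrow).
by rewrite /comp => ->; apply: eq_integral => z _; rewrite mainrow_mix.
Qed.

(** Two splices at consecutive times differ in one innovation only. Jointly they
    are distributed as the noise and the noise with the m-th innovation redrawn. *)
Lemma splice_pair_law (H : IS -> IS -> \bar R) m :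
  measurable_fun setT (fun x : FF => H (mainrow x) (innovrow m x)) ->
  (\int[PP]_z H (splice m (noise_path z.1) (noise_path z.2)) (splice (m - 1) (noise_path z.1) (noise_path z.2))
   = \int[P]_w H (noise_path w) (redrawn_path m w))%E.
Proof.
move=> mH.
have := @transfer (fun x => H (mainrow x) (innovrow m x)) idfun (mixsel m) idfun_inj (@mixsel_inj m) mH.
rewrite (_ : (fun w => _) = (fun w => H (noise_path w) (redrawn_path m w))); last first.
  by apply/funext => w; rewrite -innovrow_wfield.
by move=> ->; apply: eq_integral => z _; rewrite mainrow_mix innovrow_mix.
Qed.

Section functional.
Variable G : IS -> R.
Hypothesis mG : measurable_fun setT G.

(** A version of the conditional expectation of G given the noise up to time m,
    defined at every path: the future is replaced by an independent copy and
    integrated out. *)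
Definition past_mean (m : int) (x : IS) : R := avg P (fun z : IS * Om => G (splice m z.1 (noise_path z.2))) x.
Definition spliceG (m : int) (z : Om * Om) : R := G (splice m (noise_path z.1) (noise_path z.2)).

Lemma measurable_past_mean m : measurable_fun setT (past_mean m).
Proof. apply: measurable_avg; exact: measurableT_comp mG (measurable_splice m). Qed.

Lemma past_mean_adapted m (x y : IS) : (forall i, i <= m -> x i = y i) ->
  past_mean m x = past_mean m y.
Proof.
move=> xy; rewrite /past_mean /avg; apply: eq_Rintegral => w _ /=.
by congr G; apply/funext => i; rewrite /splice; case: ifP => // /xy.
Qed.

Lemma measurable_spliceG m : measurable_fun setT (spliceG m).
Proof.
have h : measurable_fun setT (fun z : Om * Om => (noise_path z.1, z.2)).
  apply/measurable_fun_pairP; split; last exact: measurable_snd.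
  exact: measurableT_comp measurable_noise_path measurable_fst.
exact: measurableT_comp mG (measurableT_comp (measurable_splice m) h).
Qed.

Lemma Lb_spliceG s A m : Lb P s (G \o noise_path) A -> Lb PP s (spliceG m) A.
Proof.
move=> [_ A0 GA]; split; [exact: measurable_spliceG|by []|].
have h := @splice_law (fun x => (`|G x| `^ s)%:E) m.
by rewrite /spliceG h //; exact: measurable_absX.
Qed.

Lemma Lb_splice_diff s A m : Lb P s (fun w => G (noise_path w) - G (redrawn_path m w)) A ->
  Lb PP s (fun z => spliceG m z - spliceG (m - 1) z) A.
Proof.
move=> [_ A0 GA]; split; [|by []|].
  by apply: measurable_funB; exact: measurable_spliceG.
have h := @splice_pair_law (fun x y => (`|G x - G y| `^ s)%:E) m.
rewrite /spliceG h //.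
have mD : measurable_fun setT (fun x : FF => G (mainrow x) - G (innovrow m x)); last first.
  exact: (measurable_absX s mD).
apply: measurable_funB; first exact: measurableT_comp mG measurable_mainrow.
exact: measurableT_comp mG (measurable_innovrow m).
Qed.

Hypothesis iG : P.-integrable setT (EFin \o (G \o noise_path)).

Lemma Lb1_G : exists A, Lb P 1 (G \o noise_path) A.
Proof.
have [mf If] := integrableP _ _ _ iG.
exists (fine (\int[P]_x `|(EFin \o (G \o noise_path)) x|)%E); split.
- exact: measurableT_comp mG measurable_noise_path.
- exact/fine_ge0/integral_ge0.
rewrite powRr1 ?fine_ge0 ?integral_ge0 // fineK; last first.
  by rewrite ge0_fin_numE ?integral_ge0.
rewrite le_eqVlt; apply/orP; left; apply/eqP; apply: eq_integral => x _.
by rewrite powRr1.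
Qed.

Lemma integrable_spliceG m : PP.-integrable setT (EFin \o spliceG m).
Proof. have [A LA] := Lb1_G; exact: (Lb_integrable (lexx 1) (Lb_spliceG m LA)). Qed.

Definition increment m w : R := past_mean m (noise_path w) - past_mean (m - 1) (noise_path w).

(** Linearity of the average holds only where both averages converge, hence
    almost everywhere. *)
Lemma increment_ae m : {ae P, forall w,
  increment m w = avg P (fun z => spliceG m z - spliceG (m - 1) z) w}.
Proof.
have := avg_sub (integrable_spliceG m) (integrable_spliceG (m - 1)).
by apply: filterS => w ->.
Qed.

Lemma measurable_increment m : measurable_fun setT (increment m).
Proof.
by apply: measurable_funB; exact: measurableT_comp (measurable_past_mean _) measurable_noise_path.
Qed.

(** An increment is an average over the future of the difference of two splices
    at consecutive times, whose law is that of the effect of redrawing one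
    innovation. *)
Lemma Lb_increment s A m : 1 <= s ->
  Lb P s (fun w => G (noise_path w) - G (redrawn_path m w)) A -> Lb P s (increment m) A.
Proof.
move=> s1 LA; have s0 : 0 < s by exact: lt_le_trans s1.
apply: (Lb_dom s0 (measurable_increment m) _ (avg_contract s1 (Lb_splice_diff LA))).
by have := increment_ae m; apply: filterS => w ->.
Qed.

(** Up to time m - 1 the splices at m and at m - 1 agree, so a function H of
    that past does not see the exchange of the m-th innovation with its copy.
    The exchange reverses the sign of the difference of the two splices, so the
    integral is equal to its opposite. *)
Lemma increment_orthogonal s A B m (H : IS -> R) : 2 < s ->
  measurable_fun setT H ->
  (forall x y, (forall i, i <= m - 1 -> x i = y i) -> H x = H y) ->
  Lb P s (H \o noise_path) B ->
  Lb P s (fun w => G (noise_path w) - G (redrawn_path m w)) A ->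
  (\int[P]_w (`|H (noise_path w)| `^ (s - 2) * H (noise_path w) * increment m w)%:E = 0)%E.
Proof.
move=> s2 mH adH LH LA.
pose phi x := `|H x| `^ (s - 2) * H x.
have mphi : measurable_fun setT phi.
  apply: measurable_funM => //; apply/measurable_EFinP; exact: measurable_absX.
have mphiw : measurable_fun setT (phi \o noise_path) by exact: measurableT_comp mphi measurable_noise_path.
pose D z := spliceG m z - spliceG (m - 1) z.
have mD : measurable_fun setT D by apply: measurable_funB; exact: measurable_spliceG.
pose f (z : Om * Om) := phi (noise_path z.1) * D z.
have mf : measurable_fun setT f.
  by apply: measurable_funM => //; exact: measurableT_comp mphiw measurable_fst.
have LD := Lb_splice_diff LA.
have s1 : 1 <= s by lra.
have LHP : Lb PP s (fun z => H (noise_path z.1)) B.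
  have [_ B0 HB] := LH; split; [|by []|].
    exact: measurableT_comp (measurableT_comp mH measurable_noise_path) measurable_fst.
  apply: le_trans HB.
  rewrite -(@splice_law (fun x => (`|H x| `^ s)%:E) (m - 1)); last exact: measurable_absX.
  rewrite le_eqVlt; apply/orP; left; apply/eqP; apply: eq_integral => z _.
  congr (`|_| `^ _)%:E; apply: adH => i im.
  by rewrite /splice im.
have intp g C : Lb PP s g C -> PP.-integrable setT (EFin \o (fun z => `|g z| `^ s)).
  move=> [mg C0 gC]; apply/integrableP; split; first exact: measurable_absX.
  under eq_integral do rewrite /= ger0_norm ?powR_ge0 //.
  exact: le_lt_trans gC (ltry _).
have iF : PP.-integrable setT (EFin \o f).
  apply: le_integrable (integrableD measurableT (intp _ _ LHP) (intp _ _ LD)); [by []|exact/measurable_EFinP|].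
  move=> z _ /=; rewrite lee_fin [leRHS]ger0_norm ?addr_ge0 ?powR_ge0 //.
  exact: powR_absM_le.
have -> : (\int[P]_w (`|H (noise_path w)| `^ (s - 2) * H (noise_path w) * increment m w)%:E
   = \int[PP]_z (f z)%:E)%E.
  rewrite -(integral12_prod_meas1 iF).
  have iD : PP.-integrable setT (EFin \o D) by exact: Lb_integrable s1 LD.
  apply: ae_eq_integral => //.
  - apply/measurable_EFinP; apply: measurable_funM; last exact: measurable_increment.
    exact: mphiw.
  - exact: (measurable_fubini_F iF).
  have := ae_integrable1 iD; have := increment_ae m.
  apply: filterS2 => w hw iw _.
  rewrite /f /= hw -/(phi (noise_path w)) /avg.
  rewrite -RintegralZl // /Rintegral fineK //.
  apply: integrable_fin_num => //.
  by have := integrableZl measurableT (phi (noise_path w)) iw.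
pose Psi (z : FF) : \bar R := (phi (mainrow z) * (G (mainrow z) - G (innovrow m z)))%:E.
have mPsi : measurable_fun setT Psi.
  apply/measurable_EFinP; apply: measurable_funM; first exact: measurableT_comp mphi measurable_mainrow.
  apply: measurable_funB; first exact: measurableT_comp mG measurable_mainrow.
  exact: measurableT_comp mG (measurable_innovrow m).
have e1 : (\int[PP]_z (f z)%:E = \int[PP]_z Psi (relabel (mixsel m) (wfield2 z)))%E.
  apply: eq_integral => z _; rewrite /Psi mainrow_mix innovrow_mix.
  congr (_ * _)%:E; rewrite /phi; congr (`|_| `^ _ * _); apply: adH => i im;
  by rewrite /splice (le_trans im) // lerBlDr lerDl.
have e2 : (\int[PP]_z (f z)%:E = \int[P]_z Psi (wfield z))%E.
  by rewrite e1 -(@transfer Psi idfun (mixsel m) idfun_inj (@mixsel_inj m) mPsi).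
have e3 : (\int[PP]_z (f z)%:E = \int[P]_z Psi (relabel (swapsel m) (wfield z)))%E.
  by rewrite e1 -(@transfer Psi (swapsel m) (mixsel m) (@swapsel_inj m) (@mixsel_inj m) mPsi).
(* the exchange of the m-th innovations changes only the sign *)
have anti z : Psi (relabel (swapsel m) z) = (- Psi z)%E.
  rewrite /Psi mainrow_swap innovrow_swap -EFinN; congr EFin.
  have -> : phi (innovrow m z) = phi (mainrow z).
    have e : H (innovrow m z) = H (mainrow z).
      apply: adH => i im; rewrite /innovrow /mainrow; case: eqP => // e.
      by move: im; rewrite e lerBrDr gerDl.
    by rewrite /phi e.
  by rewrite -mulrN opprB.
have Ff : (\int[PP]_z (f z)%:E)%E \is a fin_num by exact: integrable_fin_num iF.
pose PF w := Psi (wfield w).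
have [fx fy] : (\int[P]_w PF^\+ w)%E \is a fin_num /\ (\int[P]_w PF^\- w)%E \is a fin_num.
  apply/andP; rewrite -fin_numB -integralE.
  by rewrite -e2.
have : (\int[PP]_z (f z)%:E = - \int[PP]_z (f z)%:E)%E.
  rewrite {1}e3 e2.
  under eq_integral do rewrite anti.
  rewrite integralN //.
  exact: fin_num_adde_defr.
move: Ff; case: (\int[PP]_z _)%E => // r _ [] h.
by congr EFin; lra.
Qed.

End functional.

(** Conditioning on the remote past is asymptotically the same, in L^1, as
    taking the mean. This is an approximate form of the zero-one law for the
    tail of the noise. *)
Definition past_trivial (G : IS -> R) : Prop := forall e : R, 0 < e ->
  exists m0 : int, forall m, m <= m0 ->
  Lb P 1 (fun w => past_mean G m (noise_path w) - \int[P]_w' G (noise_path w')) e.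

(** Passing to the limit is possible because the conditional mean and the mean
    are both contractions of L^1. *)
Lemma past_trivial_close G : measurable_fun setT G ->
  P.-integrable setT (EFin \o (G \o noise_path)) ->
  (forall e, 0 < e -> exists G', [/\ measurable_fun setT G',
     P.-integrable setT (EFin \o (G' \o noise_path)), past_trivial G' &
     Lb P 1 (fun w => G (noise_path w) - G' (noise_path w)) e]) -> past_trivial G.
Proof.
move=> mG iG close e e0.
have e3 : 0 < e / 3 by lra.
have [G' [mG' iG' tG' LG']] := close _ e3.
have [m0 hm0] := tG' _ e3; exists m0 => m mm0.
have L1 := hm0 _ mm0.
have LS : Lb PP 1 (fun z => spliceG G m z - spliceG G' m z) (e / 3).
  have := @Lb_spliceG (fun x => G x - G' x) _ 1 _ m LG'.
  by apply; apply: measurable_funB.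
have L2 : Lb P 1 (fun w => past_mean G m (noise_path w) - past_mean G' m (noise_path w)) (e / 3).
  apply: (Lb_dom _ _ _ (avg_contract (lexx 1) LS)) => //.
    by apply: measurable_funB; exact: measurableT_comp (measurable_past_mean _ _) measurable_noise_path.
  have := avg_sub (integrable_spliceG mG iG m) (integrable_spliceG mG' iG' m).
  by apply: filterS => w ->.
have L3 : Lb P 1 (cst (\int[P]_w' G' (noise_path w') - \int[P]_w' G (noise_path w'))) (e / 3).
  apply: (Lb_le _ _ (Lb_cst P 1 _)) => //.
  rewrite distrC -RintegralB //.
  by have := Lb_Ex (lexx 1) LG'; rewrite /Ex unlock.
have := Lb_add (lexx 1) (Lb_add (lexx 1) L1 L2) L3.
rewrite (_ : e / 3 + e / 3 + e / 3 = e); last by field.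
congr Lb; apply/funext => w; rewrite /cst; ring.
Qed.

Lemma past_trivialD G1 G2 : measurable_fun setT G1 -> measurable_fun setT G2 ->
  P.-integrable setT (EFin \o (G1 \o noise_path)) -> P.-integrable setT (EFin \o (G2 \o noise_path)) ->
  past_trivial G1 -> past_trivial G2 -> past_trivial (fun x => G1 x + G2 x).
Proof.
move=> m1 m2 i1 i2 t1 t2 e e0; have e2 : 0 < e / 2 by lra.
have [n1 h1] := t1 _ e2; have [n2 h2] := t2 _ e2.
exists (Num.min n1 n2) => m; rewrite le_min => /andP[/h1 L1 /h2 L2].
have := Lb_add (lexx 1) L1 L2; rewrite -splitr => L.
apply: (Lb_dom _ _ _ L) => //.
  apply: measurable_funB => //.
  apply: measurableT_comp (measurable_past_mean _ _) measurable_noise_path.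
  exact: measurable_funD.
have := avg_add (integrable_spliceG m1 i1 m) (integrable_spliceG m2 i2 m).
apply: filterS => w h.
rewrite RintegralD // (_ : past_mean _ m (noise_path w) = past_mean G1 m (noise_path w) + past_mean G2 m (noise_path w)) //.
rewrite le_eqVlt; apply/orP; left; apply/eqP; congr `|_|; ring.
Qed.

Lemma past_trivialZ k G : measurable_fun setT G ->
  P.-integrable setT (EFin \o (G \o noise_path)) ->
  past_trivial G -> past_trivial (fun x => k * G x).
Proof.
move=> mG iG tG e e0.
have k1 : 0 < `|k| + 1 by rewrite ltr_wpDl.
have [m0 h] := tG (e / (`|k| + 1)) (divr_gt0 e0 k1).
exists m0 => m /h L; have Lk := Lb_scale k ltr01 L.
have Le : Lb P 1 (fun w => k * (past_mean G m (noise_path w) - \int[P]_w' G (noise_path w'))) e.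
  apply: Lb_le Lk => //; rewrite mulrCA ger_pMr // ler_pdivrMr // mul1r; lra.
apply: (Lb_dom _ _ _ Le) => //.
  apply: measurable_funB => //.
  apply: measurableT_comp (measurable_past_mean _ _) measurable_noise_path.
  exact: measurable_funM.
have := ae_integrable1 (integrable_spliceG mG iG m).
apply: filterS => w iw.
rewrite RintegralZl // mulrBr /past_mean /avg RintegralZl //.
Qed.

Lemma integrable_indic_noise (A : set IS) : measurable A ->
  P.-integrable setT (EFin \o ((\1_A : IS -> R) \o noise_path)).
Proof.
move=> mA; apply: le_integrable (@finite_measure_integrable_cst _ _ R P setT 1 measurableT); [by []| |].
  by apply/measurable_EFinP; apply: measurableT_comp measurable_noise_path; exact: measurable_indic.
move=> w _ /=; rewrite lee_fin indicE; case: (_ \in _); rewrite ?normr1 ?normr0 //.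
Qed.

(** A rectangle depends on finitely many times, so that before the earliest of
    them the conditional mean is exactly the mean. *)
Lemma past_trivial_rect (A : set IS) : rects A -> past_trivial (\1_A).
Proof.
move=> [s [B [us [mB AE]]]] e e0.
(* earlier than every time that occurs in the rectangle *)
exists (- (\sum_(i <- s) `|i|) - 1) => m mm.
have ms i : i \in s -> (i <= m) = false.
  move=> is_; apply/negbTE; rewrite -ltNge.
  apply: (le_lt_trans mm); apply: (@lt_le_trans _ _ (- (\sum_(j <- s) `|j|))).
    by rewrite gtrDl oppr_lt0.
  rewrite lerNl; apply: (@le_trans _ _ `|i|); first by rewrite -normrN ler_norm.
  by rewrite (big_rem i) //= lerDl sumr_ge0.
have mA : measurable A by apply: measurable_rects; exists s, B.
have h w : past_mean (\1_A) m (noise_path w) = \int[P]_w' (\1_A : IS -> R) (noise_path w').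
  rewrite /past_mean /avg; apply: eq_Rintegral => w' _ /=.
  rewrite !indicE; congr (_%:R); congr nat_of_bool.
  apply/idP/idP => /set_mem; rewrite AE /= => hh; apply/mem_set => i /= is_;
  by have := hh i is_; rewrite /splice /= ms.
apply: (Lb_dom _ _ _ (Lb_le _ _ (Lb_cst P 1 0))) => //; last by rewrite normr0 ltW.
  apply: measurable_funB => //.
  apply: measurableT_comp (measurable_past_mean _ _) measurable_noise_path.
  exact: measurable_indic.
by apply: aeW => w; rewrite h subrr.
Qed.

Lemma past_trivial_cst k : past_trivial (cst k).
Proof.
move=> e e0; exists 0 => m _.
apply: (Lb_dom _ _ _ (Lb_le _ _ (Lb_cst P 1 0))) => //; last by rewrite normr0 ltW.
  apply: measurable_funB => //.
  by apply: measurableT_comp (measurable_past_mean _ _) measurable_noise_path.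
by apply: aeW => w; rewrite /past_mean /avg subrr.
Qed.

(** The sets whose indicator has the property form a Dynkin system containing
    the rectangles. *)
Lemma past_trivial_indic (A : set IS) : measurable A -> past_trivial (\1_A).
Proof.
move=> mA; move: (mA); rewrite cylT_generated => sA.
have mI B : measurable B -> measurable_fun setT (\1_B : IS -> R) by exact: measurable_indic.
apply: (@dynkin_induction _ IS (@rects _ E int) (fun A => past_trivial (\1_A)) _ _ _ _ _ _ A sA).
- exact: cylT_generated.
- exact: setI_rects.
- by apply: past_trivial_rect; exact: rects_setT.
- by move=> B; exact: past_trivial_rect.
- move=> B mB tB.
  rewrite (_ : \1_(~` B) = (fun x => cst 1 x + (- 1) * \1_B x)); last first.
    apply/funext => x; rewrite !indicE in_setC /=.
    by case: (_ \in _) => /=; rewrite ?mulr1 ?mulr0 ?subrr ?addr0.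
  apply: past_trivialD => //.
  + by apply: measurable_funM => //; exact: mI.
  + exact: finite_measure_integrable_cst.
  + by have := integrableZl measurableT (-1) (integrable_indic_noise mB).
  + exact: past_trivial_cst.
  + by apply: past_trivialZ => //; exact: integrable_indic_noise.
- move=> F mF tF hF.
  have mU : measurable (\bigcup_k F k) by exact: bigcup_measurable.
  apply: past_trivial_close; [exact: mI|exact: integrable_indic_noise|].
  move=> e e0.
  pose U n := \bigcup_(k in `I_n) F k.
  have mUn n : measurable (U n) by apply: bigcup_measurable.
  have tU n : past_trivial (\1_(U n)).
    elim: n => [|n IH].
      have -> : U 0%N = set0 by rewrite /U II0 bigcup_set0.
      rewrite indic0; exact: past_trivial_cst.
    rewrite (_ : \1_(U n.+1) = (fun x => \1_(U n) x + \1_(F n) x)); last first.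
      have dis : U n `&` F n = set0.
        rewrite -subset0 => x [[k /= kn Fkx] Fnx].
        have h : F k `&` F n = set0.
          by move/trivIsetP : tF => /(_ k n I I); apply; rewrite ltn_eqF.
        by have : (F k `&` F n) x by []; rewrite h.
      have -> : U n.+1 = U n `|` F n.
        by rewrite /U !bigcup_mkord big_ord_recr.
      apply/funext => x.
      have := congr1 (fun S : set IS => x \in S) dis.
      rewrite !indicE in_setI in_setU in_set0.
      by case: (_ \in _); case: (_ \in _) => //=; rewrite ?addr0 ?add0r.
    apply: past_trivialD => //; try exact: mI; try exact: integrable_indic_noise.
  have mpre B : measurable B -> measurable (noise_path @^-1` B).
    by move=> mB; rewrite -[X in measurable X]setTI; exact: measurable_noise_path.
  have cvgU : (fun n => P (noise_path @^-1` (U n))) @ \oo --> P (noise_path @^-1` (\bigcup_k F k)).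
    rewrite (_ : noise_path @^-1` (\bigcup_k F k) = \bigcup_n (noise_path @^-1` (U n))); last first.
      rewrite eqEsubset; split=> w /= [k _ h]; first by exists k.+1 => //; exists k => /=.
      by case: h => j _ h; exists j.
    apply: nondecreasing_cvg_mu => //.
    - by move=> n; exact: mpre.
    - by apply: bigcup_measurable => n _; exact: mpre.
    - move=> n n' nn'; apply/subsetPset => w /= [k /= kn h]; exists k => //=.
      exact: leq_trans nn'.
  have mpU := mpre _ mU.
  have [n hn] : exists n, fine (P (noise_path @^-1` (\bigcup_k F k))) - fine (P (noise_path @^-1` (U n))) <= e.
    have c : (fun n => fine (P (noise_path @^-1` (U n)))) @ \oo --> fine (P (noise_path @^-1` (\bigcup_k F k))).
      by apply: fine_cvg; rewrite fineK // fin_num_measure.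
    move/cvgrPdist_le : c => /(_ _ e0) [N _ hN]; exists N.
    by apply: le_trans (hN N (leqnn _)); exact: ler_norm.
  exists (\1_(U n)); split; [exact: mI|exact: integrable_indic_noise|exact: tU|].
  have sub : U n `<=` \bigcup_k F k by move=> x [k _ h]; exists k.
  split; [|exact: ltW|].
    apply: measurable_funB; exact: measurableT_comp (mI _ _) measurable_noise_path.
  have mD : measurable (noise_path @^-1` (\bigcup_k F k) `\` noise_path @^-1` (U n)).
    by apply: measurableD; exact: mpre.
  rewrite (_ : \int[P]_x _ = \int[P]_x (\1_(noise_path @^-1` (\bigcup_k F k) `\` noise_path @^-1` (U n)) x)%:E)%E; last first.
    apply: eq_integral => w _; rewrite powRr1 // !indicE in_setD.
    have -> : (w \in noise_path @^-1` (\bigcup_k F k)) = (noise_path w \in \bigcup_k F k) by [].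
    have -> : (w \in noise_path @^-1` (U n)) = (noise_path w \in U n) by [].
    have [/set_mem/sub/mem_set ->|_] := boolP (noise_path w \in U n).
      by rewrite /= subrr normr0.
    by rewrite /= subr0 andbT ger0_norm.
  rewrite integral_indic // setIT powRr1 ?(ltW e0) // measureD //; last 2 first.
  - exact: mpre.
  - by rewrite -ge0_fin_numE // fin_num_measure.
  rewrite setIidr; last by move=> w; exact: sub.
  apply: (@le_trans _ _ (fine (P (noise_path @^-1` (\bigcup_k F k))) - fine (P (noise_path @^-1` (U n))))%:E); last by rewrite lee_fin.
  rewrite EFinB !fineK ?fin_num_measure //; last exact: mpre.
Qed.

Import HBSimple.

(** Simple functions are dense in L^1 for the law of the noise. *)
Lemma past_trivial_integrable G : measurable_fun setT G ->
  P.-integrable setT (EFin \o (G \o noise_path)) -> past_trivial G.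
Proof.
move=> mG iG; apply: past_trivial_close => // e e0.
pose Q0 : {measure set IS -> \bar R} := pushforward P noise_path.
pose Q := Q0 measurable_noise_path.
have iQ : Q.-integrable setT (EFin \o G).
  apply/integrableP; split; first exact/measurable_EFinP.
  rewrite (ge0_integral_pushforward measurable_noise_path) //; last first.
    by apply: measurableT_comp => //; exact/measurable_EFinP.
  by have [_] := integrableP _ _ _ iG.
have [g [ig _ cg]] := approximation_sfun_integrable measurableT iQ.
have [n hn] : exists n, (\int[Q]_z `|(EFin \o G) z - (g n z)%:E| <= e%:E)%E.
  move/fine_cvgP : cg => [fN] /cvgrPdist_le /(_ _ e0) cN.
  near \oo => n; exists n.
  have fn : (\int[Q]_z `|(EFin \o G) z - (g n z)%:E|)%E \is a fin_num by near: n.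
  rewrite -(fineK fn) lee_fin.
  have : `|0 - fine (\int[Q]_z `|(EFin \o G) z - (g n z)%:E|)%E| <= e by near: n.
  by rewrite sub0r normrN; exact: le_trans (ler_norm _).
have mgn : measurable_fun setT (g n : IS -> R) by exact: measurable_funP.
have mI B : measurable B -> measurable_fun setT (\1_B : IS -> R) by exact: measurable_indic.
have mlev y : measurable (g n @^-1` [set y]).
  by rewrite -[X in measurable X]setTI; exact: mgn.
have ign : P.-integrable setT (EFin \o ((g n : IS -> R) \o noise_path)).
  have [_ h] := integrableP _ _ _ (ig n); apply/integrableP; split.
    by apply/measurable_EFinP; exact: measurableT_comp mgn measurable_noise_path.
  move: h; rewrite (ge0_integral_pushforward measurable_noise_path) //.
  by apply: measurableT_comp => //; exact/measurable_EFinP.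
exists (g n); split => //; last first.
  split; [|exact: ltW|].
    by apply: measurable_funB; exact: measurableT_comp measurable_noise_path.
  rewrite powRr1 ?(ltW e0) //; apply: le_trans hn.
  rewrite (ge0_integral_pushforward measurable_noise_path) //; last first.
    apply: measurableT_comp => //; apply: emeasurable_funB; exact/measurable_EFinP.
  rewrite le_eqVlt; apply/orP; left; apply/eqP; apply: eq_integral => w _.
  by rewrite powRr1.
pose S (l : seq R) (x : IS) := \sum_(y <- l) (y * \1_(g n @^-1` [set y]) x).
have -> : (g n : IS -> R) = S (finmap.enum_fset (fset_set (range (g n)))).
  by apply/funext => x; rewrite /S fimfunE fsbig_finite.
suff : forall l, [/\ measurable_fun setT (S l), P.-integrable setT (EFin \o (S l \o noise_path)) &
   past_trivial (S l)] by move=> /(_ (finmap.enum_fset (fset_set (range (g n))))) [].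
elim=> [|y l [mS iS tS]].
  have -> : S [::] = cst 0 by apply/funext => x; rewrite /S big_nil.
  split=> //; first exact: (@finite_measure_integrable_cst _ _ R P setT 0 measurableT).
  exact: past_trivial_cst.
have -> : S (y :: l) = (fun x => S l x + y * \1_(g n @^-1` [set y]) x).
  by apply/funext => x; rewrite /S big_cons addrC.
have mY : measurable_fun setT (fun x : IS => y * \1_(g n @^-1` [set y]) x).
  by apply: measurable_funM => //; exact: mI.
have iY : P.-integrable setT (EFin \o ((fun x : IS => y * \1_(g n @^-1` [set y]) x) \o noise_path)).
  by have := integrableZl measurableT y (integrable_indic_noise (mlev y)).
split.
- exact: measurable_funD.
- by have := integrableD measurableT iS iY.
apply: past_trivialD => //; apply: past_trivialZ; [exact: mI|exact: integrable_indic_noise|].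
exact: past_trivial_indic.
Unshelve. all: by end_near. Qed.

(** The functional is its own conditional mean at time M, and in L^1 its
    conditional mean at a remote time is close to the expectation. In between
    the conditional means telescope into increments whose squared norms add up,
    the norm of each being at most the effect D m of redrawing one innovation.
    As the remote past is only reached in L^1, the bound passes to the limit by
    the closedness of L^s balls. *)
Theorem moment_bound s G (M : int) (D : int -> R) (V : R) : 2 < s ->
  measurable_fun setT G -> P.-integrable setT (EFin \o (G \o noise_path)) ->
  (forall x y : IS, (forall i, i <= M -> x i = y i) -> G x = G y) ->
  (forall m, Lb P s (fun w => G (noise_path w) - G (redrawn_path m w)) (D m)) ->
  (forall K : nat, \sum_(k < K) D (M - k%:Z) ^+ 2 <= V) ->
  Lb P s (fun w => G (noise_path w) - \int[P]_w' G (noise_path w')) (Num.sqrt (2 * step_cst s * V)).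
Proof.
move=> s2 mG iG aG LD hV.
have s0 : 0 < s by lra.
have c1 := step_cst_ge1 s2.
have past_M w : past_mean G M (noise_path w) = G (noise_path w).
  rewrite /past_mean /avg (@eq_Rintegral _ _ _ P setT (cst (G (noise_path w)))); last first.
    by move=> w' _ /=; apply: aG => i iM; rewrite /splice iM.
  rewrite Rintegral_cst // [X in fine X](_ : _ = 1%E) ?mulr1 //.
  exact: probability_setT.
have mPM m : measurable_fun setT (fun w => past_mean G m (noise_path w)).
  exact: measurableT_comp (measurable_past_mean mG _) measurable_noise_path.
(* the sum of k increments, by induction on k: each step is orthogonal to the
   sum before it *)
have partial (m0 : int) (k : nat) : Lb P s
    (fun w => past_mean G (m0 + k%:Z) (noise_path w) - past_mean G m0 (noise_path w))
    (Num.sqrt (2 * step_cst s * \sum_(i < k) D (m0 + i%:Z + 1) ^+ 2)).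
  elim: k => [|k IH].
    rewrite big_ord0 mulr0 sqrtr0 addr0.
    apply: (Lb_dom s0 _ _ (Lb_le s0 _ (Lb_cst P s 0))); last by rewrite normr0.
      exact: measurable_funB.
    by apply: aeW => w; rewrite subrr.
  have e1 : m0 + k%:Z + 1 - 1 = m0 + k%:Z by rewrite addrK.
  have LI := Lb_increment mG iG (m := m0 + k%:Z + 1) (ltW (lt_trans (ltr1n R 2) s2)) (LD _).
  have D0 : 0 <= D (m0 + k%:Z + 1) by case: (LD (m0 + k%:Z + 1)).
  rewrite -[D _](ger0_norm D0) -sqrtr_sqr in LI.
  pose H x := past_mean G (m0 + k%:Z) x - past_mean G m0 x.
  have mH : measurable_fun setT H by apply: measurable_funB; exact: measurable_past_mean.
  have aH x y : (forall i, i <= m0 + k%:Z + 1 - 1 -> x i = y i) -> H x = H y.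
    rewrite e1 => xy; rewrite /H (past_mean_adapted G xy); congr (_ - _).
    by apply: past_mean_adapted => i im; apply: xy; rewrite (le_trans im) // lerDl.
  have orth := increment_orthogonal mG iG s2 mH aH IH (LD (m0 + k%:Z + 1)).
  have := Lb_martingale_step s2 _ (sqr_ge0 _) IH LI orth.
  rewrite -mulrDr big_ord_recr /= => /(_ _) L.
  have : Lb P s (fun w => past_mean G (m0 + k%:Z) (noise_path w) - past_mean G m0 (noise_path w)
     + increment G (m0 + k%:Z + 1) w)
    (Num.sqrt (2 * step_cst s * (\sum_(i < k) D (m0 + i%:Z + 1) ^+ 2 + D (m0 + k%:Z + 1) ^+ 2))).
    by apply: L; rewrite !mulr_ge0 ?sumr_ge0 // ?sqr_ge0 //; [lra|move=> *; exact: sqr_ge0].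
  congr Lb; apply/funext => w; rewrite /increment e1.
  have -> : m0 + k.+1%:Z = m0 + k%:Z + 1 by rewrite intS; ring.
  ring.
have tail := past_trivial_integrable mG iG.
have V0 : 0 <= V by have := hV 0%N; rewrite big_ord0.
apply: Lb_L1_closed; [lra|exact: sqrtr_ge0| |].
  by apply: measurable_funB => //; exact: measurableT_comp mG measurable_noise_path.
move=> e e0; have [m0 hm0] := tail _ e0.
pose m := Num.min m0 M.
have mM : m <= M by rewrite /m ge_min lexx orbT.
have Lt : Lb P 1 (fun w => past_mean G m (noise_path w) - \int[P]_w' G (noise_path w')) e.
  by apply: hm0; rewrite /m ge_min lexx.
exists (fun w => G (noise_path w) - past_mean G m (noise_path w)); split; last first.
  have := Lb_opp Lt; congr Lb; apply/funext => w; ring.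
have := partial m `|M - m|%N.
have eM : m + `|M - m|%N%:Z = M by rewrite gez0_abs ?subr_ge0 //; ring.
rewrite eM => L.
have : Lb P s (fun w => past_mean G M (noise_path w) - past_mean G m (noise_path w)) (Num.sqrt (2 * step_cst s * V)).
  apply: Lb_le L => //; rewrite ler_wsqrtr // ler_wpM2l //; first by rewrite mulr_ge0 //; lra.
  apply: le_trans (hV `|M - m|%N).
  rewrite (reindex_inj rev_ord_inj) /=; apply: ler_sum => i _.
  rewrite le_eqVlt; apply/orP; left; apply/eqP; congr (D _ ^+ 2).
  have aux (K j : nat) : (j < K)%N -> m + K%:Z = M -> m + (K - j.+1)%N%:Z + 1 = M - j%:Z.
    by move=> jK <-; rewrite -subzn // intS; ring.
  exact: aux.
by congr Lb; apply/funext => w; rewrite past_M.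
Qed.

End innovations.

(** * Stationarity and sums of weakly dependent terms *)

Section norm_sums.
Context d (T : measurableType d) (R : realType) (P : probability T R).

Lemma Lb_zero s : 0 < s -> Lb P s (cst 0) (0 : R).
Proof. by move=> s0; have := Lb_cst P s 0; rewrite normr0. Qed.

Lemma Lb_sum (I : Type) (r : seq I) s (F : I -> T -> R) (A : I -> R) : 1 <= s ->
  (forall i, Lb P s (F i) (A i)) -> Lb P s (fun x => \sum_(i <- r) F i x) (\sum_(i <- r) A i).
Proof.
move=> s1 LF; elim: r => [|i r IH].
  rewrite big_nil (_ : (fun x => _) = cst 0).
    by apply: Lb_zero; exact: lt_le_trans s1.
  by apply/funext => x; rewrite big_nil.
rewrite big_cons (_ : (fun x => _) = (fun x => F i x + \sum_(i <- r) F i x)); first exact: Lb_add.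
by apply/funext => x; rewrite big_cons.
Qed.

End norm_sums.

Section shift_and_blocks.
Context dE (E : measurableType dE) (R : realType).
Context dO (Om : measurableType dO) (P : probability Om R).
Notation SE := (cylT nat E).
Notation FF := (cylT (bool * int) SE).
Notation IS := (cylT int SE).
Variables (eps eps' : int -> Om -> nat -> E).
Hypothesis epsiid : iid_with_copy P eps eps'.
Notation epsw := (noise_path eps).
Notation epsm := (redrawn_path eps eps').

Definition time_shift (m : int) (x : IS) : IS := fun i => x (i + m).
Definition shiftsel (m : int) (b : bool * int) : bool * int := (b.1, b.2 + m).

Lemma shiftsel_inj m : injective (shiftsel m).
Proof. by move=> [b i] [b' i'] [-> /addIr ->]. Qed.

Lemma measurable_time_shift m : measurable_fun setT (time_shift m).
Proof. by apply: measurable_into_cyl => i; exact: measurable_coord. Qed.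

(** Translation in time is an injective relabelling, so it preserves the joint
    law of the noise and its copy. *)
Lemma shift_transfer (Psi : FF -> \bar R) m : measurable_fun setT Psi ->
  (\int[P]_w Psi (relabel (shiftsel m) (wfield eps eps' w)) = \int[P]_w Psi (wfield eps eps' w))%E.
Proof.
move=> mPsi.
rewrite (transfer epsiid (@shiftsel_inj m) (@idfun_inj) mPsi).
by rewrite -(transfer epsiid (@idfun_inj) (@idfun_inj) mPsi).
Qed.

Lemma shift_law (G : IS -> \bar R) m : measurable_fun setT G ->
  (\int[P]_w G (time_shift m (epsw w)) = \int[P]_w G (epsw w))%E.
Proof.
move=> mG.
exact: (shift_transfer m (measurableT_comp mG (measurable_mainrow (E := E)))).
Qed.

Lemma shift_pair_law (H : IS -> IS -> \bar R) m k :
  measurable_fun setT (fun x : FF => H (mainrow x) (innovrow k x)) ->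
  (\int[P]_w H (time_shift m (epsw w)) (time_shift m (epsm (k + m) w)) = \int[P]_w H (epsw w) (epsm k w))%E.
Proof.
move=> mH; have e1 := shift_transfer m mH.
transitivity (\int[P]_w (fun x : FF => H (mainrow x) (innovrow k x))
   (relabel (shiftsel m) (wfield eps eps' w)))%E.
  apply: eq_integral => w _; congr (H _ _); apply/funext => i.
  rewrite /innovrow /time_shift /redrawn_path /relabel /shiftsel /wfield /=.
  by rewrite (inj_eq (addIr m)); case: ifP.
by rewrite e1; apply: eq_integral => w _; rewrite innovrow_wfield.
Qed.

Lemma Lb_redrawn_path s (G : IS -> R) A m : measurable_fun setT G ->
  Lb P s (fun w => G (epsw w)) A -> Lb P s (fun w => G (epsm m w)) A.
Proof.
move=> mG [_ A0 GA]; split; [|by []|].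
  exact: measurableT_comp mG (measurable_redrawn_path epsiid m).
apply: le_trans GA; rewrite le_eqVlt; apply/orP; left; apply/eqP.
have mPsi : measurable_fun setT (fun x : FF => (`|G (mainrow x)| `^ s)%:E).
  exact: measurable_absX (measurableT_comp mG (measurable_mainrow (E := E))).
have h1 := transfer epsiid (@swapsel_inj m) (@idfun_inj) mPsi.
have h2 := transfer epsiid (@idfun_inj) (@idfun_inj) mPsi.
transitivity (\int[P]_w (fun x : FF => (`|G (mainrow x)| `^ s)%:E) (relabel (swapsel m) (wfield eps eps' w)))%E.
  by apply: eq_integral => w _; rewrite mainrow_swap innovrow_wfield.
by rewrite h1 -h2.
Qed.

Lemma Lb_shift_diff s (G : IS -> R) A m k : measurable_fun setT G ->
  Lb P s (fun w => G (epsw w) - G (epsm k w)) A ->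
  Lb P s (fun w => G (time_shift m (epsw w)) - G (time_shift m (epsm (k + m) w))) A.
Proof.
move=> mG [_ A0 GA]; split; [|by []|].
  apply: measurable_funB.
    exact: measurableT_comp mG (measurableT_comp (measurable_time_shift m) (measurable_noise_path epsiid)).
  exact: measurableT_comp mG (measurableT_comp (measurable_time_shift m) (measurable_redrawn_path epsiid _)).
have h := @shift_pair_law (fun x y => (`|G x - G y| `^ s)%:E) m k.
rewrite h //.
have mD : measurable_fun setT (fun x : FF => G (mainrow x) - G (innovrow k x)); last first.
  exact: (measurable_absX s mD).
apply: measurable_funB; first exact: measurableT_comp mG (measurable_mainrow (E := E)).
exact: measurableT_comp mG (measurable_innovrow k).
Qed.

(** A causal functional is unaffected by innovations later than its own time. *)
Definition zext (dl : nat -> R) (i : int) : R := if i is Posz n then dl n else 0.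

Section young_convolution.
Variables (dl : nat -> R) (Dl : R).
Hypothesis dl0 : forall i, 0 <= dl i.
Hypothesis dlD : forall N : nat, \sum_(i < N) dl i <= Dl.

Lemma zext_ge0 i : 0 <= zext dl i. Proof. by case: i => //=. Qed.

Lemma Dl_ge0 : 0 <= Dl. Proof. by apply: le_trans (dlD 0%N); rewrite big_ord0. Qed.

Lemma zext_sum_down (n k : nat) : \sum_(l < n) zext dl (k%:Z - l%:Z) <= Dl.
Proof.
have aux (k' : nat) : \sum_(l < k'.+1) zext dl (k'%:Z - l%:Z) <= Dl.
  rewrite (reindex_inj rev_ord_inj) /=; apply: le_trans (dlD k'.+1); apply: ler_sum => i _.
  by rewrite subSS subzn ?leq_subr // subKn // -ltnS.
have [nk|kn] := leqP n k.+1.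
  apply: le_trans (aux k).
  rewrite -(big_mkord xpredT (fun l => zext dl (k%:Z - l%:Z))) -(big_mkord xpredT (fun l => zext dl (k%:Z - l%:Z))).
  rewrite [leRHS](@big_cat_nat _ _ _ n) //= lerDl; apply: sumr_ge0 => i _; exact: zext_ge0.
apply: le_trans (aux k).
rewrite -(big_mkord xpredT (fun l => zext dl (k%:Z - l%:Z))) -(big_mkord xpredT (fun l => zext dl (k%:Z - l%:Z))).
rewrite (@big_cat_nat _ _ _ k.+1) //=; last exact: ltnW.
rewrite gerDl big_nat_cond big1 // => i /andP[/andP[ki _] _].
by have -> : k%:Z - i%:Z = Negz (i - k.+1) by rewrite NegzE -subSn // subSS -subzn ?opprB // ltnW.
Qed.

Lemma zext_sum_up (K l : nat) : \sum_(k < K) zext dl (k%:Z - l%:Z) <= Dl.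
Proof.
have [Kl|lK] := leqP K l.
  rewrite big1 ?Dl_ge0 // => i _.
  have il : (i < l)%N by exact: leq_trans (ltn_ord i) Kl.
  by have -> : (i : nat)%:Z - l%:Z = Negz (l - i.+1) by rewrite NegzE -subSn // subSS -subzn ?opprB // ltnW.
apply: le_trans (dlD (K - l)).
rewrite -(big_mkord xpredT (fun k => zext dl (k%:Z - l%:Z))) (@big_cat_nat _ _ _ l) //=; last exact: ltnW.
rewrite big_nat_cond big1 ?add0r; last first.
  move=> i /andP[/andP[_ il] _].
  by have -> : i%:Z - l%:Z = Negz (l - i.+1) by rewrite NegzE -subSn // subSS -subzn ?opprB // ltnW.
rewrite -{1}[l]add0n big_addn big_mkord; apply: ler_sum => i _.
by rewrite PoszD addrK.
Qed.

(** The discrete convolution inequality between l^1 and l^2, applied to the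
    indicator of n consecutive times. *)
Lemma young_convolution (K n : nat) :
  \sum_(k < K) (\sum_(l < n) zext dl (k%:Z - l%:Z)) ^+ 2 <= n%:R * Dl ^+ 2.
Proof.
(* one of the two factors of the square is bounded by Dl uniformly in k; the
   other is summed over k *)
apply: (@le_trans _ _ (\sum_(k < K) Dl * \sum_(l < n) zext dl (k%:Z - l%:Z))).
  apply: ler_sum => k _; rewrite expr2 ler_wpM2r ?zext_sum_down //.
  by apply: sumr_ge0 => l _; exact: zext_ge0.
rewrite -mulr_sumr exchange_big /=.
apply: (@le_trans _ _ (Dl * \sum_(l < n) Dl)).
  by rewrite ler_wpM2l ?Dl_ge0 //; apply: ler_sum => l _; exact: zext_sum_up.
rewrite sumr_const card_ord -mulr_natl le_eqVlt; apply/orP; left; apply/eqP; ring.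
Qed.

(** Redrawing the innovation at time m affects the sum by a convolution of the
    decay profile with the indicator of the n summation times, whose squared l^2
    norm is at most n times the squared l^1 norm of the profile. *)
Lemma block_bound s (F : nat -> IS -> R) (n : nat) (h : int) (A : R) : 2 < s ->
  (forall l, measurable_fun setT (F l)) ->
  (forall l, Lb P 1 (fun w => F l (epsw w)) A) ->
  (forall l x y, (forall i, i <= l%:Z + h -> x i = y i) -> F l x = F l y) ->
  (forall l m, Lb P s (fun w => F l (epsw w) - F l (epsm m w)) (zext dl (l%:Z + h - m))) ->
  Lb P s (fun w => \sum_(1 <= l < n.+1) (F l (epsw w) - \int[P]_w' F l (epsw w')))
     (Num.sqrt (2 * step_cst s * (n%:R * Dl ^+ 2))).
Proof.
move=> s2 mF iF aF LF.
pose G (x : IS) := \sum_(1 <= l < n.+1) F l x.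
have mG : measurable_fun setT G by apply: measurable_sum => l; exact: mF.
have iG l : P.-integrable setT (EFin \o (fun w => F l (epsw w))) by exact: Lb_integrable (lexx 1) (iF l).
have isum r : P.-integrable setT (EFin \o (fun w => \sum_(i <- r) F i (epsw w))).
  exact: Lb_integrable (lexx 1) (Lb_sum r (lexx 1) iF).
have GE r : (\int[P]_w (\sum_(l <- r) F l (epsw w)) = \sum_(l <- r) \int[P]_w F l (epsw w))%R.
  elim: r => [|l r IH].
    by rewrite big_nil /Rintegral; under eq_integral do rewrite big_nil; rewrite integral0.
  rewrite big_cons -IH -RintegralD //.
  by apply: eq_Rintegral => w _; rewrite big_cons.
have s1 : 1 <= s by lra.
pose D (m : int) : R := \sum_(1 <= l < n.+1) zext dl (l%:Z + h - m).
have LD m : Lb P s (fun w => G (epsw w) - G (epsm m w)) (D m).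
  rewrite (_ : (fun w => _) = (fun w => \sum_(1 <= l < n.+1) (F l (epsw w) - F l (epsm m w)))).
    by apply: Lb_sum => // l; exact: LF.
  by apply/funext => w; rewrite sumrB.
have aG x y : (forall i, i <= n%:Z + h -> x i = y i) -> G x = G y.
  move=> xy; apply: eq_big_nat => l /andP[_ ln]; apply: aF => i il; apply: xy.
  by rewrite (le_trans il) // lerD2r lez_nat -ltnS.
have := moment_bound epsiid s2 mG (isum _) aG LD.
move=> /(_ (n%:R * Dl ^+ 2)) mb.
rewrite (_ : (fun w => _) = (fun w => G (epsw w) - \int[P]_w' G (epsw w'))); last first.
  by apply/funext => w; rewrite sumrB GE.
apply: mb => K; apply: le_trans (young_convolution K n); apply: ler_sum => k _.
rewrite le_eqVlt; apply/orP; left; apply/eqP; congr (_ ^+ 2).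
rewrite /D big_add1 /= big_mkord (reindex_inj rev_ord_inj) /=.
apply: eq_bigr => l _; congr (zext dl _).
have -> : (n - l.+1).+1 = (n - l)%N by rewrite subnSK.
by rewrite -subzn ?(ltnW (ltn_ord l)) //; ring.
Qed.

End young_convolution.
End shift_and_blocks.

(** * The scalar product of L^2 *)

Section l2_space.
Context dS (S : measurableType dS) (R : realType).
Variable mu : {measure set S -> \bar R}.
Implicit Types (f g u v : L2 mu).

Lemma L2_mul_integrable f g : mu.-integrable setT (EFin \o (fun x => f x * g x)).
Proof.
apply/(Lfun1_integrable mu (fun x => f x * g x)).1.
by apply: Lfun2_mul_Lfun1; exact: LfunP.
Qed.

Lemma l2dotC f g : l2dot f g = l2dot g f.
Proof. by apply: eq_Rintegral => x _; rewrite mulrC. Qed.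

Lemma l2dotDl f g v : l2dot (f + g) v = l2dot f v + l2dot g v.
Proof.
rewrite /l2dot -RintegralD //; try exact: L2_mul_integrable.
by apply: eq_Rintegral => x _; rewrite -mulrDl.
Qed.

Lemma l2dotZl (a : R) f v : l2dot (a *: f) v = a * l2dot f v.
Proof.
rewrite /l2dot -RintegralZl //; last exact: L2_mul_integrable.
by apply: eq_Rintegral => x _; rewrite mulrA.
Qed.

Lemma l2dotNl f v : l2dot (- f) v = - l2dot f v.
Proof. by rewrite -scaleN1r l2dotZl mulN1r. Qed.

Lemma l2dotBl f g v : l2dot (f - g) v = l2dot f v - l2dot g v.
Proof. by rewrite l2dotDl l2dotNl. Qed.

Lemma l2dot0l v : l2dot 0 v = 0.
Proof. by rewrite -(scale0r v) l2dotZl mul0r. Qed.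

Lemma l2dotDr f g v : l2dot v (f + g) = l2dot v f + l2dot v g.
Proof. by rewrite !(l2dotC v) l2dotDl. Qed.

Lemma l2dotZr (a : R) f v : l2dot v (a *: f) = a * l2dot v f.
Proof. by rewrite !(l2dotC v) l2dotZl. Qed.

Lemma l2dotBr f g v : l2dot v (f - g) = l2dot v f - l2dot v g.
Proof. by rewrite !(l2dotC v) l2dotBl. Qed.

Lemma l2dot_suml (I : Type) (r : seq I) (P : pred I) (F : I -> L2 mu) v :
  l2dot (\sum_(i <- r | P i) F i) v = \sum_(i <- r | P i) l2dot (F i) v.
Proof.
elim: r => [|i r IH]; first by rewrite !big_nil l2dot0l.
by rewrite !big_cons; case: (P i); rewrite ?l2dotDl IH.
Qed.

Lemma l2dot_sumr (I : Type) (r : seq I) (P : pred I) (F : I -> L2 mu) v :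
  l2dot v (\sum_(i <- r | P i) F i) = \sum_(i <- r | P i) l2dot v (F i).
Proof. by rewrite l2dotC l2dot_suml; apply: eq_bigr => i _; rewrite l2dotC. Qed.

Lemma l2dot_ge0 f : 0 <= l2dot f f.
Proof. by apply: Rintegral_ge0 => x _; rewrite -expr2 sqr_ge0. Qed.

Lemma l2norm_ge0 f : 0 <= l2norm f. Proof. exact: sqrtr_ge0. Qed.

Lemma sqr_l2norm f : l2norm f ^+ 2 = l2dot f f.
Proof. by rewrite sqr_sqrtr // l2dot_ge0. Qed.

(** The discriminant of the nonnegative quadratic form. *)
Lemma l2_CS2 f g : l2dot f g ^+ 2 <= l2dot f f * l2dot g g.
Proof.
have h (t : R) : 0 <= l2dot f f - 2 * t * l2dot f g + t ^+ 2 * l2dot g g.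
  have := l2dot_ge0 (f - t *: g).
  by rewrite l2dotBl !l2dotBr !l2dotZl !l2dotZr (l2dotC g f); lra.
have [g0|g0] := eqVneq (l2dot g g) 0.
  rewrite g0 mulr0; have [->|fg] := eqVneq (l2dot f g) 0; first by rewrite expr0n.
  have := h ((l2dot f f + 1) / (2 * l2dot f g)); rewrite g0 mulr0 addr0.
  rewrite (_ : 2 * _ * _ = l2dot f f + 1); last by field.
  by lra.
have gp : 0 < l2dot g g by rewrite lt_def g0 l2dot_ge0.
have := h (l2dot f g / l2dot g g).
rewrite (_ : _ - _ + _ = (l2dot f f * l2dot g g - l2dot f g ^+ 2) / l2dot g g); last by field.
by rewrite pmulr_lge0 ?invr_gt0 // subr_ge0.
Qed.

Lemma l2_CS f g : `|l2dot f g| <= l2norm f * l2norm g.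
Proof.
rewrite -(ler_pXn2r (_ : (0 < 2)%N)) ?nnegrE ?mulr_ge0 ?l2norm_ge0 //.
by rewrite real_normK ?num_real // exprMn !sqr_l2norm l2_CS2.
Qed.

Lemma l2normD f g : l2norm (f + g) <= l2norm f + l2norm g.
Proof.
rewrite -(ler_pXn2r (_ : (0 < 2)%N)) ?nnegrE ?addr_ge0 ?l2norm_ge0 //.
rewrite sqrrD !sqr_l2norm l2dotDl !l2dotDr (l2dotC g f).
have := le_trans (ler_norm _) (l2_CS f g).
rewrite mulr2n; lra.
Qed.

Lemma l2normZ (a : R) f : l2norm (a *: f) = `|a| * l2norm f.
Proof.
by rewrite /l2norm l2dotZl l2dotZr mulrA -expr2 sqrtrM ?sqr_ge0 // sqrtr_sqr.
Qed.

Lemma l2normN f : l2norm (- f) = l2norm f.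
Proof. by rewrite -scaleN1r l2normZ normrN1 mul1r. Qed.

Lemma l2normB f g : l2norm (f - g) <= l2norm f + l2norm g.
Proof. by rewrite -(l2normN g); exact: l2normD. Qed.

Lemma l2norm_distC f g : l2norm (f - g) = l2norm (g - f).
Proof. by rewrite -l2normN opprB. Qed.

Lemma l2norm0 : l2norm (0 : L2 mu) = 0.
Proof. by rewrite /l2norm l2dot0l sqrtr0. Qed.

Lemma l2norm_eq0_dot f v : l2norm f = 0 -> l2dot f v = 0.
Proof.
move=> f0; apply/eqP; rewrite -normr_le0.
by apply: le_trans (l2_CS f v) _; rewrite f0 mul0r.
Qed.

Lemma l2norm0_dot_eq f g v : l2norm (f - g) = 0 -> l2dot f v = l2dot g v.
Proof. by move/l2norm_eq0_dot => /(_ v); rewrite l2dotBl => /subr0_eq. Qed.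

Lemma l2cvg_dot (u : nat -> L2 mu) f v : l2cvg u f ->
  (fun N => l2dot (u N) v) @ \oo --> l2dot f v.
Proof.
move=> uf; apply/cvgrPdist_le => e e0.
have k0 : 0 < l2norm v + 1 by rewrite ltr_wpDl // l2norm_ge0.
move/cvgrPdist_le : uf => /(_ _ (divr_gt0 e0 k0)); apply: filterS => N.
rewrite sub0r normrN ger0_norm ?l2norm_ge0 // => h.
rewrite -l2dotBl; apply: (le_trans (l2_CS _ _)); rewrite l2norm_distC.
apply: (@le_trans _ _ (e / (l2norm v + 1) * l2norm v)).
  by rewrite ler_wpM2r ?l2norm_ge0.
rewrite mulrAC -mulrA ger_pMr // ler_pdivrMr // mul1r; lra.
Qed.

Lemma l2cvg_eq (u u' : nat -> L2 mu) f f' :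
  (forall N, l2norm (u N - u' N) = 0) -> l2norm (f - f') = 0 -> l2cvg u f -> l2cvg u' f'.
Proof.
move=> uu ff uf; apply/cvgrPdist_le => e e0.
move/cvgrPdist_le : uf => /(_ _ e0); apply: filterS => N.
rewrite !sub0r !normrN !ger0_norm ?l2norm_ge0 // => h.
rewrite (_ : u' N - f' = (u' N - u N) + ((u N - f) + (f - f'))); last first.
  by rewrite !addrA !subrK.
apply: (le_trans (l2normD _ _)); rewrite (l2norm_distC (u' N)) uu add0r.
by apply: (le_trans (l2normD _ _)); rewrite ff addr0.
Qed.

(** The sum of a series is an arbitrarily chosen limit; as soon as some limit
    exists, the chosen one is a limit. *)
Lemma l2sum_cvg (u : nat -> L2 mu) f : l2cvg (fun N => \sum_(k < N) u k) f ->
  l2cvg (fun N => \sum_(k < N) u k) (l2sum u).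
Proof. by move=> uf; exact: (@xgetPex _ 0 [set f | l2cvg (fun N => \sum_(k < N) u k) f] (ex_intro _ f uf)). Qed.

End l2_space.

(** * Completeness of L^2 *)

Section l2_completeness.
Context dS (S : measurableType dS) (R : realType).
Variable mu : {measure set S -> \bar R}.
Implicit Types (f g u v : L2 mu).

Lemma l2dot_integral f : ((l2dot f f)%:E = \int[mu]_x (f x ^+ 2)%:E)%E.
Proof.
rewrite /l2dot /Rintegral fineK; last exact: integrable_fin_num (L2_mul_integrable f f).
by apply: eq_integral => x _; rewrite expr2.
Qed.

(** Completeness produces the limit as a plain measurable function, to be packed
    as an element of the space. *)
Lemma mem_L2 (h : S -> R) : measurable_fun setT h ->
  (\int[mu]_x (h x ^+ 2)%:E < +oo)%E -> h \in Lfun mu 2%:E.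
Proof.
move=> mh hoo; rewrite inE; apply/andP; split; rewrite inE //=.
rewrite /finite_norm unlock; apply: poweR_lty.
apply: le_lt_trans hoo; rewrite le_eqVlt; apply/orP; left; apply/eqP.
apply: eq_integral => x _; rewrite -[LHS]/((`|h x| `^ 2%:R)%:E).
by rewrite powR_mulrn // real_normK ?num_real.
Qed.

Lemma pointwise_geometric_cvg (w : nat -> R) (B : R) :
  (forall k, `|w k.+1 - w k| <= B * 2^-1 ^+ k) -> cvgn w.
Proof.
move=> h; have B0 : 0 <= B.
  by have := h 0%N; rewrite expr0 mulr1; exact: le_trans.
rewrite (_ : w = (fun k => w 0%N + series (fun k => w k.+1 - w k) k)); last first.
  apply/funext => k; rewrite /series /= telescope_sumr //; ring.
apply: is_cvgD; first exact: is_cvg_cst.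
apply: normed_cvg; apply: (@series_le_cvg _ _ (geometric B 2^-1)).
- by move=> k; exact: normr_ge0.
- by move=> k; rewrite /geometric /= mulr_ge0 // exprn_ge0 // invr_ge0.
- by move=> k; exact: h.
- by apply: is_cvg_geometric_series; rewrite ger0_norm ?invr_ge0 // invf_lt1 // ltr1n.
Qed.

(** Along a subsequence with increments of norm at most 4^-k the weighted square
    sum of the increments is integrable, hence finite almost everywhere; there
    the increments decay geometrically and the subsequence converges pointwise.
    Fatou's lemma turns pointwise limits into norm limits. *)
Lemma l2_complete (u : nat -> L2 mu) :
  (forall e, 0 < e -> exists N, forall m n, (N <= m)%N -> (N <= n)%N -> l2norm (u m - u n) <= e) ->
  exists f, l2cvg u f.
Proof.
move=> cau.
have q0 (k : nat) : 0 < (4^-1 : R) ^+ k by rewrite exprn_gt0 // invr_gt0.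
have /choice[Nk hNk] : forall k, exists N, forall m n, (N <= m)%N -> (N <= n)%N ->
    l2norm (u m - u n) <= (4^-1 : R) ^+ k by move=> k; exact: cau.
(* a nondecreasing choice of indices, so that later terms meet the earlier
   tolerances *)
pose nn k := (\max_(i < k.+1) Nk i)%N.
have nnN k i : (i <= k)%N -> (Nk i <= nn k)%N.
  by move=> ik; rewrite /nn (leq_bigmax_cond (Ordinal (_ : (i < k.+1)%N))) // ltnS.
pose w k := u (nn k).
have wd k : l2dot (w k.+1 - w k) (w k.+1 - w k) <= (16^-1 : R) ^+ k.
  rewrite -sqr_l2norm (_ : (16^-1 : R) ^+ k = ((4^-1) ^+ k) ^+ 2); last first.
    by rewrite -exprM mulnC exprM; congr (_ ^+ _); rewrite expr2 -invfM -natrM.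
  by rewrite ler_pXn2r ?nnegrE ?l2norm_ge0 ?(ltW (q0 _)) // hNk // nnN.
pose d k x : R := w k.+1 x - w k x.
have md k : measurable_fun setT (d k) by apply: measurable_funB.
(* the weight 4^k leaves the increments room to decay like 2^-k *)
pose H x : \bar R := (\sum_(0 <= k <oo) (4 ^+ k * d k x ^+ 2)%:E)%E.
have mterm k : measurable_fun setT (fun x => (4 ^+ k * d k x ^+ 2)%:E).
  by apply/measurable_EFinP; apply: measurable_funM => //; exact: measurable_funX.
have tge0 k x : (0 <= (4 ^+ k * d k x ^+ 2)%:E)%E by rewrite lee_fin mulr_ge0 ?sqr_ge0 // exprn_ge0.
have mH : measurable_fun setT H by apply: ge0_emeasurable_sum.
have H0 x : (0 <= H x)%E by apply: nneseries_ge0.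
have intH : (\int[mu]_x H x < +oo)%E.
  rewrite integral_nneseries //.
  apply: (@le_lt_trans _ _ (\sum_(0 <= k <oo) (geometric 1 (4^-1 : R) k)%:E)%E).
    apply: lee_nneseries => [k *|k *]; first by apply: integral_ge0.
    under eq_integral do rewrite EFinM.
    rewrite ge0_integralZl ?lee_fin ?exprn_ge0 //; last 2 first.
    - by apply/measurable_EFinP; exact: measurable_funX.
    - by move=> x _; rewrite lee_fin sqr_ge0.
    have -> : (\int[mu]_x (d k x ^+ 2)%:E = (l2dot (w k.+1 - w k) (w k.+1 - w k))%:E)%E.
      by rewrite l2dot_integral.
    rewrite -EFinM lee_fin /geometric /= mul1r.
    apply: (le_trans (ler_wpM2l _ (wd k))); first exact: exprn_ge0.
    by rewrite -exprMn (_ : 4 * 16^-1 = 4^-1 :> R) //; field.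
  have gc : `|4^-1 : R| < 1 by rewrite ger0_norm ?invr_ge0 // invf_lt1 // ltr1n.
  rewrite (_ : (fun n => _) = EFin \o series (geometric 1 (4^-1 : R))); last first.
    by apply/funext => n; rewrite /series /= sumEFin.
  by rewrite EFin_lim ?ltry //; apply: is_cvg_geometric_series.
have iH : mu.-integrable setT H.
  by apply/integrableP; split=> //; under eq_integral do rewrite gee0_abs //.
have aeH := integrable_ae measurableT iH.
pose A := [set x | H x \is a fin_num].
have mA : measurable A by rewrite -[A]setTI; exact: emeasurable_fin_num.
pose v k x : R := w k x * \1_A x.
have mv k : measurable_fun setT (v k) by apply: measurable_funM => //; exact: measurable_indic.
have cv x : cvgn (fun k => v k x).
  have [Ax|Ax] := pselect (A x); last first.
    rewrite (_ : (fun k => v k x) = cst 0); first exact: is_cvg_cst.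
    by apply/funext => k; rewrite /v indicE memNset // mulr0.
  apply: (@pointwise_geometric_cvg _ (Num.sqrt (fine (H x)))) => k.
  rewrite /v indicE mem_set // !mulr1 -/(d k x).
  have h : 4 ^+ k * d k x ^+ 2 <= fine (H x).
    rewrite -lee_fin fineK //.
    apply: (@le_trans _ _ (\sum_(0 <= i < k.+1) (4 ^+ i * d i x ^+ 2)%:E)%E).
      by rewrite big_nat_recr //= leeDr // sume_ge0.
    by apply: nneseries_lim_ge.
  have fH : 0 <= fine (H x) by exact: fine_ge0.
  rewrite -(ler_pXn2r (_ : (0 < 2)%N)) ?nnegrE ?mulr_ge0 ?sqrtr_ge0 ?exprn_ge0 ?invr_ge0 //.
  rewrite real_normK ?num_real // exprMn sqr_sqrtr //.
  rewrite -(ler_pM2l (_ : 0 < 4 ^+ k)) ?exprn_gt0 //; apply: (le_trans h).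
  rewrite mulrCA -exprM mulnC exprM -exprMn (_ : 4 * 2^-1 ^+ 2 = 1 :> R) ?expr1n ?mulr1 //.
  by field.
pose F x := limn (fun k => v k x).
have mF : measurable_fun setT F.
  by apply: (measurable_fun_cvg mv) => x _; exact: cv.
have bound k m : (nn k <= m)%N -> (\int[mu]_x ((F x - u m x) ^+ 2)%:E <= ((4^-1 ^+ k) ^+ 2)%:E)%E.
  move=> km.
  have mf i : measurable_fun setT (fun x => ((v i x - u m x) ^+ 2)%:E).
    by apply/measurable_EFinP; apply: measurable_funX; exact: measurable_funB.
  have fat := @fatou _ _ _ mu setT measurableT (fun i x => ((v i x - u m x) ^+ 2)%:E) mf
    (fun i x _ => _).
  rewrite (_ : \int[mu]_x _ = \int[mu]_x limn_einf (fun i => ((v i x - u m x) ^+ 2)%:E))%E; last first.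
    apply: eq_integral => x _; apply/esym.
    have c : (fun i => ((v i x - u m x) ^+ 2)%:E) @ \oo --> ((F x - u m x) ^+ 2)%:E.
      apply: cvg_EFin; first exact: nearW.
      rewrite expr2; under eq_fun do rewrite expr2.
      by apply: cvgM; (apply: cvgB; [exact: cv|exact: cvg_cst]).
    by have [+ _] := cvg_limn_einf_sup c.
  apply: (le_trans (fat _)); first by move=> i x; rewrite lee_fin sqr_ge0.
  rewrite limn_einf_lim; apply: lime_le; first exact: is_cvg_einfs.
  apply: nearW => j.
  apply: (@le_trans _ _ (\int[mu]_x ((v (maxn j k) x - u m x) ^+ 2)%:E)%E).
    by apply: ereal_inf_lbound; exists (maxn j k) => //=; exact: leq_maxl.
  rewrite (_ : \int[mu]_x _ = (l2dot (w (maxn j k) - u m) (w (maxn j k) - u m))%:E)%E; last first.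
    rewrite l2dot_integral; apply: ae_eq_integral => //.
      by apply/measurable_EFinP; apply: measurable_funX; exact: measurable_funB.
    by apply: filterS aeH => x /(_ I) Ax _; rewrite /v indicE mem_set // mulr1.
  rewrite lee_fin -sqr_l2norm ler_pXn2r ?nnegrE ?l2norm_ge0 ?(ltW (q0 _)) //.
  apply: hNk; first by apply: nnN; exact: leq_maxr.
  by apply: leq_trans km; exact: nnN.
have FL : F \in Lfun mu 2%:E.
  have dL : (fun x => F x - u (nn 0%N) x) \in Lfun mu 2%:E.
    apply: mem_L2; first exact: measurable_funB.
    exact: le_lt_trans (bound 0%N _ (leqnn _)) (ltry _).
  have [_ add] := @Lfun_addr_closed _ _ _ mu 2%:E (lee1n 2).
  have e : F = (fun x => F x - u (nn 0%N) x) \+ (u (nn 0%N) : S -> R).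
    by apply/funext => x /=; rewrite subrK.
  by rewrite e; exact: add _ _ dL (LfunP (u (nn 0%N))).
exists (Lfun_Sub (lee1n 2) FL).
apply/cvgrPdist_le => e e0.
have [k hk] : exists k, (4^-1 : R) ^+ k <= e.
  have gc : `|4^-1 : R| < 1 by rewrite ger0_norm ?invr_ge0 // invf_lt1 // ltr1n.
  have := cvg_expr gc => /cvgrPdist_le /(_ _ e0) [N _ hN]; exists N.
  by have := hN N (leqnn _); rewrite sub0r normrN; exact: le_trans (ler_norm _).
exists (nn k) => // m /= km.
rewrite sub0r normrN ger0_norm ?l2norm_ge0 // l2norm_distC; apply: le_trans hk.
rewrite -(ler_pXn2r (_ : (0 < 2)%N)) ?nnegrE ?l2norm_ge0 ?(ltW (q0 _)) //.
by rewrite sqr_l2norm -lee_fin l2dot_integral; exact: bound.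
Qed.

End l2_completeness.

(** * Orthonormal systems *)

Section orthonormal_systems.
Context dS (S : measurableType dS) (R : realType).
Variable mu : {measure set S -> \bar R}.
Implicit Types (f g u v : L2 mu) (e : nat -> L2 mu) (c d : nat -> R).

Lemma nonneg_series_cvg (c : nat -> R) (B : R) : (forall k, 0 <= c k) ->
  (forall N : nat, \sum_(k < N) c k <= B) -> cvgn (series c).
Proof.
move=> c0 cB; apply: nondecreasing_is_cvgn.
  by apply/nondecreasing_series => k _ _.
exists B => _ [N _ <-]; rewrite /series /= big_mkord; exact: cB.
Qed.

Lemma on_dot_sum e c (N j : nat) : Defs.orthonormal e ->
  l2dot (\sum_(k < N) c k *: e k) (e j) = if (j < N)%N then c j else 0.
Proof.
move=> on; rewrite l2dot_suml; under eq_bigr do rewrite l2dotZl on.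
case: ifP => jN.
  rewrite (bigD1 (Ordinal jN)) //= eqxx mulr1 big1 ?addr0 // => i ij.
  by rewrite (_ : (nat_of_ord i == j) = false) ?mulr0 //; apply: contraNF ij => /eqP ij; apply/eqP/val_inj.
rewrite big1 // => i _; rewrite (_ : (nat_of_ord i == j) = false) ?mulr0 //.
by apply/eqP => ij; move: jN; rewrite -ij ltn_ord.
Qed.

Lemma on_dot_sum2 e c d (N : nat) : Defs.orthonormal e ->
  l2dot (\sum_(k < N) c k *: e k) (\sum_(k < N) d k *: e k) = \sum_(k < N) c k * d k.
Proof.
move=> on; rewrite l2dot_sumr; apply: eq_bigr => k _.
by rewrite l2dotZr on_dot_sum // ltn_ord mulrC.
Qed.

Lemma bessel e v (N : nat) : Defs.orthonormal e ->
  \sum_(k < N) l2dot (e k) v ^+ 2 <= l2dot v v.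
Proof.
move=> on; pose p := \sum_(k < N) l2dot (e k) v *: e k.
have pp : l2dot p p = \sum_(k < N) l2dot (e k) v ^+ 2.
  rewrite /p (on_dot_sum2 (fun k => l2dot (e k) v) (fun k => l2dot (e k) v) N on).
  by apply: eq_bigr => k _; rewrite expr2.
have pv : l2dot p v = \sum_(k < N) l2dot (e k) v ^+ 2.
  by rewrite l2dot_suml; apply: eq_bigr => k _; rewrite l2dotZl.
have := l2dot_ge0 (v - p); rewrite l2dotBl !l2dotBr (l2dotC v p) pp pv; lra.
Qed.

(** Square-summable coefficients give a Cauchy sequence of partial sums. *)
Lemma riesz_fischer e c (B : R) : Defs.orthonormal e ->
  (forall N : nat, \sum_(k < N) c k ^+ 2 <= B) ->
  exists f, l2cvg (fun N => \sum_(k < N) c k *: e k) f.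
Proof.
move=> on cB; apply: l2_complete => eps eps0.
have cs := nonneg_series_cvg (fun k => sqr_ge0 (c k)) cB.
have e2 : 0 < eps ^+ 2 / 2 by rewrite divr_gt0 // exprn_gt0.
move/cvgrPdist_le : cs => /(_ _ e2) [N _ hN].
have key (m n : nat) : (N <= m)%N -> (m <= n)%N ->
    l2norm (\sum_(k < n) c k *: e k - \sum_(k < m) c k *: e k) <= eps.
  move=> Nm mn.
  rewrite -(ler_pXn2r (_ : (0 < 2)%N)) ?nnegrE ?l2norm_ge0 ?(ltW eps0) // sqr_l2norm.
  have sq (N' : nat) : \sum_(k < N') c k * c k = series (fun k => c k ^+ 2) N'.
    by rewrite /series /= big_mkord; apply: eq_bigr => k _; rewrite expr2.
  have cross : l2dot (\sum_(k < n) c k *: e k) (\sum_(k < m) c k *: e k)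
     = series (fun k => c k ^+ 2) m.
    rewrite -sq l2dot_sumr; apply: eq_bigr => k _.
    by rewrite l2dotZr (on_dot_sum c n k on) (leq_trans (ltn_ord k) mn).
  rewrite l2dotBl !l2dotBr (l2dotC (\sum_(k < m) _)) cross.
  rewrite (on_dot_sum2 c c n on) (on_dot_sum2 c c m on) !sq.
  have := hN _ Nm; have := hN _ (leq_trans Nm mn).
  set l := lim _; rewrite !ler_norml => /andP[h1 h2] /andP[h3 h4]; lra.
exists N => m n Nm Nn; have [mn|nm] := leqP m n; last exact: key (ltnW nm).
by rewrite l2norm_distC; exact: key.
Qed.

Lemma l2cvg_coef e c f j : Defs.orthonormal e ->
  l2cvg (fun N => \sum_(k < N) c k *: e k) f -> l2dot f (e j) = c j.
Proof.
move=> on cf; apply: (cvg_unique _ (l2cvg_dot (v := e j) cf)) => //.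
apply: cvg_near_cst.
by exists j.+1 => // N /= jN; rewrite on_dot_sum // jN.
Qed.

Section basis.
Variable e : nat -> L2 mu.
Hypothesis eb : orthonormal_basis e.
Let on : Defs.orthonormal e := eb.1.

Lemma parseval u v : (fun N => \sum_(k < N) l2dot (e k) u * l2dot (e k) v) @ \oo --> l2dot u v.
Proof.
have := l2cvg_dot (v := v) (eb.2 u); apply: cvg_trans; apply: near_eq_cvg; apply: nearW => N /=.
by rewrite l2dot_suml; apply: eq_bigr => k _; rewrite l2dotZl.
Qed.

Lemma parseval_le v (B : R) : (forall N : nat, \sum_(k < N) l2dot (e k) v ^+ 2 <= B) ->
  l2dot v v <= B.
Proof.
move=> h; rewrite -(cvg_lim _ (@parseval v v)) //; apply: limr_le.
  by apply/cvg_ex; exists (l2dot v v); exact: parseval.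
by apply: nearW => N; exact: h.
Qed.

Lemma basis_ext f g : (forall k, l2dot f (e k) = l2dot g (e k)) -> l2norm (f - g) = 0.
Proof.
move=> h; apply/eqP; rewrite sqrtr_eq0; apply: parseval_le => N.
by rewrite big1 // => k _; rewrite l2dotC l2dotBl h subrr expr0n.
Qed.

(** The values on the basis are square-summable with sum at most the squared
    norm of the functional, and the vector with these coordinates represents it. *)
Lemma riesz (phi : L2 mu -> R) (B : R) :
  (forall u v, phi (u + v) = phi u + phi v) -> (forall a u, phi (a *: u) = a * phi u) ->
  (forall v, `|phi v| <= B * l2norm v) ->
  exists m : L2 mu, forall v, l2dot m v = phi v.
Proof.
move=> phiD phiZ phiB.
have phi0 : phi 0 = 0 by rewrite -(scale0r (0 : L2 mu)) phiZ mul0r.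
have phi_sum N c : phi (\sum_(k < N) c k *: e k) = \sum_(k < N) c k * phi (e k).
  elim: N => [|N IH]; first by rewrite !big_ord0.
  by rewrite !big_ord_recr /= phiD phiZ IH.
have B0 : 0 <= B ^+ 2 by exact: sqr_ge0.
have cB N : \sum_(k < N) phi (e k) ^+ 2 <= B ^+ 2.
  set s := \sum_(k < N) _.
  have s0 : 0 <= s by apply: sumr_ge0 => k _; exact: sqr_ge0.
  have h : s <= B * Num.sqrt s.
    have := phiB (\sum_(k < N) phi (e k) *: e k).
    rewrite (phi_sum N (fun k => phi (e k))) (_ : \sum_(k < N) _ = s); last by apply: eq_bigr => k _; rewrite expr2.
    rewrite /l2norm (on_dot_sum2 (fun k => phi (e k)) (fun k => phi (e k)) N on) (_ : \sum_(k < N) _ = s); last by apply: eq_bigr => k _; rewrite expr2.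
    by rewrite ger0_norm.
  have [->//|sn] := eqVneq s 0.
  have sp : 0 < Num.sqrt s by rewrite sqrtr_gt0 lt_def sn.
  have : Num.sqrt s <= B.
    by rewrite -(ler_pM2r sp) -expr2 sqr_sqrtr.
  move=> sB; have : Num.sqrt s ^+ 2 <= B ^+ 2.
    by rewrite ler_pXn2r ?nnegrE ?sqrtr_ge0 // (le_trans (sqrtr_ge0 s) sB).
  by rewrite sqr_sqrtr.
have [m mc] := @riesz_fischer e (fun k => phi (e k)) _ on cB; exists m => v.
apply: (cvg_unique _ (l2cvg_dot (v := v) mc)) => //.
have phiL : (fun N => phi (\sum_(k < N) l2dot (e k) v *: e k)) @ \oo --> phi v.
  apply/cvgrPdist_le => eps eps0.
  have k0 : 0 < `|B| + 1 by rewrite ltr_wpDl.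
  have := eb.2 v => /cvgrPdist_le /(_ _ (divr_gt0 eps0 k0)); apply: filterS => N.
  rewrite sub0r normrN ger0_norm ?l2norm_ge0 // => h.
  have -> : phi v - phi (\sum_(k < N) l2dot (e k) v *: e k) = phi (v - \sum_(k < N) l2dot (e k) v *: e k).
    set w := \sum_(k < N) _; rewrite (_ : v - w = v + (-1) *: w); last by rewrite scaleN1r.
    by rewrite phiD phiZ mulN1r.
  apply: (le_trans (phiB _)); rewrite l2norm_distC.
  apply: (@le_trans _ _ (`|B| * (eps / (`|B| + 1)))).
    apply: (@le_trans _ _ (`|B| * l2norm (\sum_(k < N) l2dot (e k) v *: e k - v))).
      by rewrite ler_wpM2r ?l2norm_ge0 // ler_norm.
    by rewrite ler_wpM2l.
  rewrite mulrCA ger_pMr // ler_pdivrMr // mul1r; lra.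
apply: cvg_trans phiL; apply: near_eq_cvg; apply: nearW => N /=.
rewrite (phi_sum N (fun k => l2dot (e k) v)) l2dot_suml; apply: eq_bigr => k _.
by rewrite l2dotZl mulrC.
Qed.

End basis.
End orthonormal_systems.

(** * Relative perturbation of one eigenpair, in coordinates *)

Section finite_sums.
Context (R : realType).

(** Only an upper bound for the squares of the terms is needed, which is the
    form in which the entries of a perturbation are controlled. *)
Lemma sum_CS (I : Type) (r : seq I) (P : pred I) (c p q : I -> R) :
  (forall i, 0 <= p i) -> (forall i, 0 <= q i) -> (forall i, c i ^+ 2 <= p i * q i) ->
  (\sum_(i <- r | P i) c i) ^+ 2 <= (\sum_(i <- r | P i) p i) * (\sum_(i <- r | P i) q i).
Proof.
move=> p0 q0 cpq; elim: r => [|i r IH]; first by rewrite !big_nil expr0n mulr0.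
rewrite !big_cons; case: (P i) => //.
have s0 : 0 <= \sum_(i <- r | P i) p i by exact: sumr_ge0.
have t0 : 0 <= \sum_(i <- r | P i) q i by exact: sumr_ge0.
move: IH s0 t0; set s := \sum_(i <- r | P i) c i.
set t := \sum_(i <- r | P i) p i; set w := \sum_(i <- r | P i) q i => IH t0 w0.
have h := cpq i; have pi0 := p0 i; have qi0 := q0 i.
have cross : 2 * (c i * s) <= p i * w + t * q i.
  have A0 : 0 <= p i * w + t * q i by rewrite addr_ge0 // mulr_ge0.
  apply: le_trans (ler_norm _) _.
  rewrite -(ler_pXn2r (_ : (0 < 2)%N)) ?nnegrE // real_normK ?num_real //.
  have : (c i * s) ^+ 2 <= (p i * q i) * (t * w).
    by rewrite exprMn ler_pM ?sqr_ge0.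
  have : 0 <= (p i * w - t * q i) ^+ 2 by exact: sqr_ge0.
  by rewrite !expr2; nra.
have e : (c i + s) ^+ 2 = c i ^+ 2 + 2 * (c i * s) + s ^+ 2 by ring.
rewrite e; have -> : (p i + t) * (q i + w) = p i * q i + (p i * w + t * q i) + t * w by ring.
lra.
Qed.

Lemma cvg_finite_sum (M : nat) (P : pred 'I_M) (F : nat -> 'I_M -> R) (l : 'I_M -> R) :
  (forall k, (fun N => F N k) @ \oo --> l k) ->
  (fun N => \sum_(k < M | P k) F N k) @ \oo --> \sum_(k < M | P k) l k.
Proof.
move=> h; elim: (index_enum _) => [|i r IH].
  by rewrite big_nil; under eq_fun do rewrite big_nil; exact: cvg_cst.
rewrite big_cons; under eq_fun do rewrite big_cons.
by case: (P i) => //; apply: cvgD.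
Qed.

Lemma cvg_le_bound (u : nat -> R) (l B : R) (N0 : nat) : u @ \oo --> l ->
  (forall N, (N0 <= N)%N -> u N <= B) -> l <= B.
Proof.
move=> ul h; rewrite -(cvg_lim _ ul) //; apply: limr_le.
  by apply/cvg_ex; exists l.
by exists N0.
Qed.

End finite_sums.

Section relative_perturbation.
Context (R : realType).
Variables (lam : nat -> R) (j : nat) (x : R) (E z : nat -> nat -> R) (B t : R).
Hypotheses (lam0 : forall i, 0 <= lam i) (lam_ub : forall i, lam i <= lam 0%N).
Hypotheses (lamj : 0 < lam j) (x0 : 0 < x).
Hypothesis sep : forall k, k != j -> 2 * (x * lam j) <= `|lam j - lam k|.
Hypothesis Esym : forall i k, E i k = E k i.
Hypothesis z0 : forall i k, 0 <= z i k.
Hypothesis Ez : forall i k, E i k ^+ 2 <= lam i * lam k * z i k.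

(** For i <> j this is the ratio whose sum the gap condition bounds. The value
    at j is a free parameter: it should be of the order of the sum of the other
    weights, which happens when x is of the order of its inverse. *)
Definition wgt (i : nat) : R := if i == j then x^-1 else lam i / `|lam j - lam i|.
(** The terms of Lambda_j. *)
Definition ell (k : nat) : R := lam k * lam j / (lam j - lam k) ^+ 2.

Hypothesis BE : forall N : nat, \sum_(k < N) \sum_(i < N) wgt k * (wgt i * z i k) <= B.
Hypothesis tE : forall M N : nat,
  x * \sum_(k < M | (k : nat) != j) ell k * \sum_(i < N) wgt i * z i k <= t.

Let xl : 0 < x * lam j. Proof. exact: mulr_gt0. Qed.

Let gap0 k : k != j -> 0 < `|lam j - lam k|.
Proof. by move=> kj; apply: lt_le_trans (sep kj); rewrite mulr_gt0. Qed.

Lemma wgt_ge0 i : 0 <= wgt i.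
Proof.
rewrite /wgt; case: ifPn => [_|ij]; first by rewrite invr_ge0 ltW.
by rewrite divr_ge0 // ltW // gap0.
Qed.

Lemma ell_ge0 k : 0 <= ell k.
Proof. by rewrite /ell divr_ge0 ?sqr_ge0 // mulr_ge0 // ltW. Qed.

Let rowsum (N k : nat) : R := \sum_(i < N) wgt i * z i k.

Let row0 N k : 0 <= rowsum N k.
Proof. by apply: sumr_ge0 => i _; rewrite mulr_ge0 ?wgt_ge0. Qed.

Let B0 : 0 <= B.
Proof. by apply: le_trans (BE 0%N); rewrite big_ord0. Qed.

Let t0 : 0 <= t.
Proof. by apply: le_trans (tE 0%N 0%N); rewrite big_ord0 mulr0. Qed.

Lemma weighted_rows (M N : nat) : (M <= N)%N ->
  \sum_(k < M | (k : nat) != j) wgt k * rowsum N k <= B.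
Proof.
move=> MN; apply: le_trans (BE N).
rewrite -(big_mkord (fun k => k != j) (fun k => wgt k * rowsum N k)).
rewrite -(big_mkord xpredT (fun k => \sum_(i < N) wgt k * (wgt i * z i k))).
rewrite [leRHS](@big_cat_nat _ _ _ M) //= -[leLHS]addr0; apply: lerD.
  rewrite big_mkcond /=; apply: ler_sum => k _.
  rewrite -mulr_sumr; case: ifP => _; first exact: lexx.
  by rewrite mulr_ge0 ?wgt_ge0 ?row0.
by apply: sumr_ge0 => k _; apply: sumr_ge0 => i _; rewrite !mulr_ge0 ?wgt_ge0.
Qed.

(** The weight of row j is 1/x, so that its row sum is smaller than B by the
    factor x. *)
Lemma row_j (N : nat) : rowsum N j <= x * B.
Proof.
have h (M : nat) : (j < M)%N -> rowsum M j <= x * B.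
  move=> jM; rewrite -ler_pdivrMl //.
  apply: le_trans (BE M); rewrite (bigD1 (Ordinal jM)) //= -mulr_sumr {1}/wgt eqxx.
  rewrite lerDl; apply: sumr_ge0 => k _; apply: sumr_ge0 => i _.
  by rewrite !mulr_ge0 ?wgt_ge0.
have [jN|Nj] := ltnP j N; first exact: h.
apply: le_trans (h j.+1 (ltnSn j)); rewrite /rowsum.
rewrite -(big_mkord xpredT (fun i => wgt i * z i j)) -(big_mkord xpredT (fun i => wgt i * z i j)).
rewrite [leRHS](@big_cat_nat _ _ _ N) //=; last exact: leq_trans Nj (leqnSn _).
by rewrite lerDl; apply: sumr_ge0 => i _; rewrite mulr_ge0 ?wgt_ge0.
Qed.

Lemma diag_bound : `|E j j| <= lam j * (x * Num.sqrt B).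
Proof.
have zj : z j j <= x ^+ 2 * B.
  have := row_j j.+1; rewrite /rowsum (bigD1 (Ordinal (ltnSn j))) //= {1}/wgt eqxx.
  set s := \sum_(i < _ | _) _ => h.
  have s0 : 0 <= s by apply: sumr_ge0 => i _; rewrite mulr_ge0 ?wgt_ge0.
  have h2 : x^-1 * z j j <= x * B by lra.
  by move: h2; rewrite ler_pdivrMl // expr2 mulrA.
rewrite -(ler_pXn2r (_ : (0 < 2)%N)) ?nnegrE ?mulr_ge0 ?sqrtr_ge0 ?(ltW x0) ?(ltW lamj) //.
rewrite real_normK ?num_real // !exprMn sqr_sqrtr //.
apply: (le_trans (Ez j j)); rewrite -expr2 ler_wpM2l ?sqr_ge0 //.
Qed.

Variables (a : nat -> R) (lh : R).
Hypothesis a1 : (fun N => \sum_(k < N) a k ^+ 2) @ \oo --> (1 : R).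
Hypothesis eig : forall k, (fun N => \sum_(i < N) E i k * a i) @ \oo --> (lh - lam k) * a k.
Hypothesis aj0 : 0 <= a j.
Hypothesis lh_close : `|lh - lam j| <= x * lam j.
Hypothesis Bsmall : B <= 64^-1.

Let lh_gap k : k != j -> `|lam j - lam k| <= 2 * `|lh - lam k|.
Proof.
move=> kj; have := sep kj; have := lh_close.
have := ler_normD (lh - lam k) (lam j - lh).
rewrite (_ : lh - lam k + (lam j - lh) = lam j - lam k); last by ring.
rewrite (distrC (lam j) lh); lra.
Qed.

Let lh0 k : k != j -> 0 < `|lh - lam k|.
Proof. by move=> kj; have := lh_gap kj; have := gap0 kj; lra. Qed.

Let a_partial N : \sum_(k < N) a k ^+ 2 <= 1.
Proof.
rewrite -(cvg_lim _ a1) //; apply: nondecreasing_cvgn_le.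
  apply/nondecreasing_seqP => n; rewrite big_ord_recr /= lerDl; exact: sqr_ge0.
by apply/cvg_ex; exists 1.
Qed.

Let aj1 : a j ^+ 2 <= 1.
Proof.
apply: le_trans (a_partial j.+1); rewrite big_ord_recr /= lerDr.
by apply: sumr_ge0 => k _; exact: sqr_ge0.
Qed.

Let ta i : R := if i == j then 0 else `|lam j - lam i| * a i ^+ 2.
Let ta0 i : 0 <= ta i.
Proof. by rewrite /ta; case: ifP => // _; rewrite mulr_ge0 ?sqr_ge0. Qed.

Let tail (N : nat) : R := \sum_(i < N) ta i.

Let tail_nd : nondecreasing_seq tail.
Proof. by apply/nondecreasing_seqP => n; rewrite /tail big_ord_recr /= lerDl. Qed.

Let tail_cvg : cvgn tail.
Proof.
apply: nondecreasing_is_cvgn => //; exists (2 * lam 0%N) => _ [N _ <-].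
apply: (@le_trans _ _ (2 * lam 0%N * \sum_(i < N) a i ^+ 2)).
  rewrite mulr_sumr; apply: ler_sum => i _; rewrite /ta; case: ifP => _.
    by rewrite mulr_ge0 ?sqr_ge0 // mulr_ge0.
  rewrite ler_wpM2r ?sqr_ge0 //; apply: (le_trans (ler_normB _ _)).
  by rewrite !ger0_norm //; have := lam_ub j; have := lam_ub i; lra.
by rewrite ger_pMr ?a_partial // mulr_gt0 //; apply: lt_le_trans (lam_ub j).
Qed.

Let T : R := limn tail.
Let tailT N : tail N <= T. Proof. exact: nondecreasing_cvgn_le. Qed.
Let T0 : 0 <= T. Proof. by have := tailT 0%N; rewrite /tail big_ord0. Qed.

Let W : R := x * lam j * a j ^+ 2 + T.
Let W0 : 0 <= W.
Proof. by rewrite addr_ge0 // mulr_ge0 ?sqr_ge0 // ltW. Qed.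

Let bs i : R := if i == j then x * lam j * a j ^+ 2 else ta i.
Let bs0 i : 0 <= bs i.
Proof. by rewrite /bs; case: ifP => // _; rewrite mulr_ge0 ?sqr_ge0 // ltW. Qed.

Let bs_sum N : \sum_(i < N) bs i <= W.
Proof.
pose A := x * lam j * a j ^+ 2.
have A0 : 0 <= A by rewrite mulr_ge0 ?sqr_ge0 // ltW.
have e i : bs i = (if i == j then A else 0) + ta i.
  by rewrite /bs /ta; case: eqP => _; rewrite ?addr0 ?add0r.
under eq_bigr do rewrite e.
rewrite big_split /=; apply: lerD; last exact: tailT.
have [jN|Nj] := ltnP j N.
  rewrite (bigD1 (Ordinal jN)) //= eqxx big1 ?addr0 // => i.
  by rewrite -val_eqE /= => /negbTE ->.
by rewrite big1 // => i _; rewrite ltn_eqF // (leq_trans (ltn_ord i) Nj).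
Qed.

Let lam_split i : lam i * a i ^+ 2 = wgt i * bs i.
Proof.
rewrite /wgt /bs /ta; case: eqP => [->|/eqP ij].
  by field; rewrite gt_eqF.
by field; rewrite normr_eq0 -normr_eq0 gt_eqF // gap0.
Qed.

Let term_le i k : (E i k * a i) ^+ 2 <= (lam k * (wgt i * z i k)) * bs i.
Proof.
rewrite exprMn; apply: (@le_trans _ _ (lam i * lam k * z i k * a i ^+ 2)).
  by rewrite ler_wpM2r ?sqr_ge0.
have -> : lam i * lam k * z i k * a i ^+ 2 = lam k * z i k * (lam i * a i ^+ 2) by ring.
rewrite lam_split le_eqVlt; apply/orP; left; apply/eqP; ring.
Qed.

Let lz0 i k : 0 <= lam k * (wgt i * z i k).
Proof. by rewrite !mulr_ge0 ?wgt_ge0. Qed.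

Let S (N k : nat) : R := \sum_(i < N) E i k * a i.

Let S_le N k : S N k ^+ 2 <= lam k * rowsum N k * W.
Proof.
apply: (@le_trans _ _ ((\sum_(i < N) lam k * (wgt i * z i k)) * \sum_(i < N) bs i)).
  by apply: sum_CS => i; [exact: lz0|exact: bs0|exact: term_le].
rewrite -mulr_sumr; apply: ler_wpM2l (bs_sum N).
by rewrite mulr_ge0 ?row0.
Qed.

Let Sj (N k : nat) : R := \sum_(i < N | (i : nat) != j) E i k * a i.

Let Sj_le N k : Sj N k ^+ 2 <= lam k * rowsum N k * T.
Proof.
apply: (@le_trans _ _ ((\sum_(i < N | (i : nat) != j) lam k * (wgt i * z i k)) * \sum_(i < N | (i : nat) != j) bs i)).
  by apply: sum_CS => i; [exact: lz0|exact: bs0|exact: term_le].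
apply: ler_pM; try by apply: sumr_ge0 => i _; [exact: lz0 || exact: bs0].
  rewrite -mulr_sumr ler_wpM2l // [leRHS](bigID (fun i : 'I_N => (i : nat) != j)) /=.
  by rewrite lerDl; apply: sumr_ge0 => i _; rewrite mulr_ge0 ?wgt_ge0.
apply: le_trans (tailT N); rewrite big_mkcond /=; apply: ler_sum => i _.
by rewrite /bs; case: ifPn => [/negbTE ->|]; rewrite // negbK => /eqP ->; rewrite /ta eqxx.
Qed.

Let S_split N k : (j < N)%N -> S N k = E j k * a j + Sj N k.
Proof.
by move=> jN; rewrite /S (bigD1 (Ordinal jN)).
Qed.

(** Each coordinate of index k <> j is expressed through the eigenvector
    equation; summing their weighted squares bounds T by B times the full energy
    W. *)
Let T_le : T <= 4 * B * W.
Proof.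
apply: limr_le => //; apply: nearW => M.
have cS : (fun N => \sum_(k < M | (k : nat) != j) (`|lam j - lam k| / (lh - lam k) ^+ 2) * (S N k ^+ 2)) @ \oo -->
   \sum_(k < M | (k : nat) != j) (`|lam j - lam k| / (lh - lam k) ^+ 2) * (((lh - lam k) * a k) ^+ 2).
  apply: cvg_finite_sum => k; apply: cvgM; first exact: cvg_cst.
  by rewrite expr2; under eq_fun do rewrite expr2; apply: cvgM; exact: eig.
have -> : tail M = \sum_(k < M | (k : nat) != j) (`|lam j - lam k| / (lh - lam k) ^+ 2) * (((lh - lam k) * a k) ^+ 2).
  rewrite big_mkcond /=; apply: eq_bigr => k _; rewrite /ta; case: (eqVneq (k : nat) j) => [//|kj] /=.
  by field; rewrite -normr_eq0 gt_eqF // lh0.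
apply: (@cvg_le_bound _ _ _ _ M cS) => N MN.
apply: (@le_trans _ _ (\sum_(k < M | (k : nat) != j) 4 * W * (wgt k * rowsum N k))); last first.
  rewrite -mulr_sumr mulrAC ler_wpM2r //; last by rewrite ler_wpM2l // weighted_rows.
apply: ler_sum => k kj.
have g := gap0 kj; have l := lh0 kj; have lg := lh_gap kj.
have q : `|lam j - lam k| / (lh - lam k) ^+ 2 <= 4 / `|lam j - lam k|.
  rewrite -[(lh - lam k) ^+ 2]real_normK ?num_real //.
  rewrite ler_pdivrMr ?exprn_gt0 // mulrAC ler_pdivlMr // -expr2.
  by rewrite (_ : 4 * _ = (2 * `|lh - lam k|) ^+ 2); [rewrite ler_pXn2r ?nnegrE|ring].
apply: (@le_trans _ _ (4 / `|lam j - lam k| * (lam k * rowsum N k * W))).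
  by apply: ler_pM; rewrite ?divr_ge0 ?sqr_ge0.
rewrite /wgt (negbTE kj) le_eqVlt; apply/orP; left; apply/eqP; field.
by rewrite normr_eq0 -normr_eq0 gt_eqF.
Qed.

(** W contains T itself, but with the coefficient 4 B < 1, so that part is
    absorbed. *)
Let T_small : T <= 5 * B * (x * lam j * a j ^+ 2).
Proof.
have := T_le; rewrite /W; set A := x * lam j * a j ^+ 2 => h.
have A0 : 0 <= A by rewrite mulr_ge0 ?sqr_ge0 // ltW.
have BT : B * T <= 64^-1 * T by rewrite ler_wpM2r.
have T1 : T <= A by nra.
have : 15 * T <= A by nra.
nra.
Qed.

(** If the j-th coordinate vanished, so would all the others. *)
Let aj_gt0 : 0 < a j.
Proof.
rewrite lt_def aj0 andbT; apply/eqP => aj.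
have T00 : T = 0.
  by apply/eqP; rewrite eq_le T0 andbT; have := T_small; rewrite aj expr0n /= !mulr0.
have ak k : a k = 0.
  have [->//|kj] := eqVneq k j.
  have : ta k <= 0.
    by rewrite -T00; apply: le_trans (tailT k.+1); rewrite /tail big_ord_recr /= lerDr sumr_ge0.
  rewrite /ta (negbTE kj) pmulr_rle0 ?gap0 // => h.
  by apply/eqP; rewrite -sqrf_eq0 eq_le h sqr_ge0.
have : (fun N => \sum_(k < N) a k ^+ 2) @ \oo --> (0 : R).
  rewrite (_ : (fun N => _) = cst 0); first exact: cvg_cst.
  by apply/funext => N; rewrite big1 // => k _; rewrite ak expr0n.
by move/(cvg_unique (@Rhausdorff R) a1) => /eqP; rewrite oner_eq0.
Qed.

(** The j-th coordinate of the equation expresses the remainder as the sum of E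
    i j * a i over i <> j, which is of second order because T is already of
    order B. *)
Lemma value_bound : `|lh - lam j - E j j| <= 3 * x * B * lam j.
Proof.
have c : (fun N => (S N j - E j j * a j) ^+ 2) @ \oo --> (((lh - lam j) * a j - E j j * a j) ^+ 2).
  rewrite expr2; under eq_fun do rewrite expr2.
  by apply: cvgM; (apply: cvgB; [exact: eig|exact: cvg_cst]).
have h : ((lh - lam j) * a j - E j j * a j) ^+ 2 <= lam j * (x * B) * (5 * B * (x * lam j * a j ^+ 2)).
  apply: (@cvg_le_bound _ _ _ _ j.+1 c) => N jN.
  rewrite S_split // addrAC subrr add0r; apply: (le_trans (Sj_le _ _)).
  by apply: ler_pM; rewrite ?mulr_ge0 ?row0 // ler_wpM2l // row_j.
have a2 : 0 < a j ^+ 2 by rewrite exprn_gt0.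
rewrite -(ler_pXn2r (_ : (0 < 2)%N)) ?nnegrE ?mulr_ge0 ?(ltW x0) ?(ltW lamj) //.
rewrite real_normK ?num_real // -(ler_pM2r a2).
have -> : (lh - lam j - E j j) ^+ 2 * a j ^+ 2 = ((lh - lam j) * a j - E j j * a j) ^+ 2 by ring.
apply: (le_trans h).
have -> : (3 * x * B * lam j) ^+ 2 * a j ^+ 2 = 9 * (x * B * lam j * a j) ^+ 2 by ring.
have -> : lam j * (x * B) * (5 * B * (x * lam j * a j ^+ 2)) = 5 * (x * B * lam j * a j) ^+ 2 by ring.
by rewrite ler_wpM2r ?sqr_ge0 //; lra.
Qed.

(** A crude first-order consequence of the expansion, needed to replace the
    perturbed eigenvalue by the unperturbed one in denominators. *)
Lemma eigenvalue_shift : `|lh - lam j| <= 2 * (x * lam j) * Num.sqrt B.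
Proof.
have h1 := value_bound; have h2 := diag_bound.
have s0 := sqrtr_ge0 B; have sB := sqr_sqrtr B0.
have s8 : Num.sqrt B <= 8^-1.
  rewrite -(ler_pXn2r (_ : (0 < 2)%N)) ?nnegrE // sB; apply: (le_trans Bsmall).
  by rewrite expr2 -invfM -natrM.
have h3 : B <= Num.sqrt B * 8^-1 by rewrite -{1}sB expr2 ler_wpM2l.
have := ler_normD (lh - lam j - E j j) (E j j); rewrite subrK => h4.
have : x * lam j * B <= x * lam j * (Num.sqrt B * 8^-1) by rewrite ler_wpM2l // ltW.
have : 0 <= x * lam j * Num.sqrt B by rewrite mulr_ge0 // ltW.
lra.
Qed.

Let W_le : W <= 5 / 4 * (x * lam j * a j ^+ 2).
Proof.
have := T_small; rewrite /W; set A := x * lam j * a j ^+ 2 => h.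
have A0 : 0 <= A by rewrite mulr_ge0 ?sqr_ge0 // ltW.
have : B * A <= 64^-1 * A by rewrite ler_wpM2r.
lra.
Qed.

(** lam k / (lam j - lam k)^2 is ell k / lam j, so that t controls these sums up
    to the factor 1 / (x lam j). *)
Let scaled_rows (M N : nat) (c : nat -> R) (K : R) :
  (forall k, k != j -> 0 <= c k <= 4 / (lam j - lam k) ^+ 2) -> 0 <= K ->
  \sum_(k < M | (k : nat) != j) c k * (lam k * rowsum N k * K) <= 4 / (x * lam j) * K * t.
Proof.
move=> hc K0.
apply: (@le_trans _ _ (4 / (x * lam j) * K * (x * \sum_(k < M | (k : nat) != j) ell k * rowsum N k))); last first.
  by rewrite ler_wpM2l ?tE // mulr_ge0 // divr_ge0 // ltW.
rewrite !mulr_sumr; apply: ler_sum => k kj.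
have /andP[c0 c4] := hc _ kj.
apply: (@le_trans _ _ (4 / (lam j - lam k) ^+ 2 * (lam k * rowsum N k * K))).
  by rewrite ler_wpM2r // !mulr_ge0.
rewrite /ell le_eqVlt; apply/orP; left; apply/eqP; field.
by rewrite -normr_eq0 !gt_eqF ?gap0.
Qed.

Let lh_inv k : k != j -> ((lh - lam k) ^+ 2)^-1 <= 4 / (lam j - lam k) ^+ 2.
Proof.
move=> kj; have g := gap0 kj; have l := lh0 kj; have lg := lh_gap kj.
rewrite -[(lh - lam k) ^+ 2]real_normK ?num_real // -[(lam j - lam k) ^+ 2]real_normK ?num_real //.
rewrite -[leLHS]mul1r ler_pdivrMr ?exprn_gt0 // mulrAC ler_pdivlMr ?exprn_gt0 // mul1r.
by rewrite (_ : 4 * _ = (2 * `|lh - lam k|) ^+ 2); [rewrite ler_pXn2r ?nnegrE|ring].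
Qed.

(** Dividing the k-th equation by the gap, the row sums appear with the weights
    that define t. *)
Lemma off_diagonal_bound (M : nat) : \sum_(k < M | (k : nat) != j) a k ^+ 2 <= 5 * t.
Proof.
have c : (fun N => \sum_(k < M | (k : nat) != j) ((lh - lam k) ^+ 2)^-1 * S N k ^+ 2) @ \oo -->
   \sum_(k < M | (k : nat) != j) ((lh - lam k) ^+ 2)^-1 * ((lh - lam k) * a k) ^+ 2.
  apply: cvg_finite_sum => k; apply: cvgM; first exact: cvg_cst.
  by rewrite expr2; under eq_fun do rewrite expr2; apply: cvgM; exact: eig.
have -> : \sum_(k < M | (k : nat) != j) a k ^+ 2 =
   \sum_(k < M | (k : nat) != j) ((lh - lam k) ^+ 2)^-1 * ((lh - lam k) * a k) ^+ 2.
  by apply: eq_bigr => k kj; field; rewrite -normr_eq0 gt_eqF // lh0.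
apply: (@cvg_le_bound _ _ _ _ 0%N c) => N _.
apply: (@le_trans _ _ (\sum_(k < M | (k : nat) != j) ((lh - lam k) ^+ 2)^-1 * (lam k * rowsum N k * W))).
  by apply: ler_sum => k _; apply: ler_wpM2l (S_le _ _); rewrite invr_ge0 sqr_ge0.
apply: (le_trans (@scaled_rows M N (fun k => ((lh - lam k) ^+ 2)^-1) W _ W0)).
  by move=> k kj; rewrite invr_ge0 sqr_ge0 lh_inv.
have h : W <= 5 / 4 * (x * lam j).
  apply: (le_trans W_le); rewrite ler_wpM2l //.
  by rewrite ger_pMr.
rewrite ler_wpM2r //.
apply: (@le_trans _ _ (4 / (x * lam j) * (5 / 4 * (x * lam j)))).
  by rewrite ler_wpM2l // divr_ge0 // ltW.
by rewrite (_ : _ * _ = 5) //; field; rewrite !gt_eqF.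
Qed.

(** The coordinates of the eigenvector predicted by first-order perturbation
    theory. *)
Definition first_order k : R := E j k / (lam j - lam k).

(** The square of the k-th term is at most ell k * z j k, and z j k is at most x
    times the k-th row sum, because the weight of j is 1/x. *)
Lemma first_order_bound (M : nat) : \sum_(k < M | (k : nat) != j) first_order k ^+ 2 <= t.
Proof.
apply: le_trans (tE M j.+1); rewrite mulr_sumr; apply: ler_sum => k kj.
have g := gap0 kj.
apply: (@le_trans _ _ (ell k * z j k)).
  rewrite /first_order /ell expr_div_n [leRHS]mulrAC ler_wpM2r ?invr_ge0 ?sqr_ge0 //.
  by apply: (le_trans (Ez j k)); rewrite [lam j * _]mulrC.
rewrite mulrCA ler_wpM2l ?ell_ge0 // (bigD1 (Ordinal (ltnSn j))) //= {1}/wgt eqxx mulrDr.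
rewrite mulrA divff ?gt_eqF // mul1r lerDl mulr_ge0 ?(ltW x0) //.
by apply: sumr_ge0 => i _; rewrite mulr_ge0 ?wgt_ge0.
Qed.

(** As the vector has norm one, 1 - a j <= 1 - a j ^+ 2 is at most the sum of
    the squares of the other coordinates. *)
Lemma one_minus_aj : 0 <= 1 - a j <= 5 * t.
Proof.
have aj1' : a j <= 1 by rewrite -(ler_pXn2r (_ : (0 < 2)%N)) ?nnegrE // expr1n.
rewrite subr_ge0 aj1' /=.
apply: (@le_trans _ _ (1 - a j ^+ 2)).
  by rewrite lerD2l lerN2 expr2 ger_pMr.
rewrite lerBlDr.
apply: (@cvg_le_bound _ _ _ _ j.+1 a1) => N jN.
rewrite (bigD1 (Ordinal jN)) //= addrC lerD2r.
apply: le_trans (off_diagonal_bound N).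
by rewrite le_eqVlt; apply/orP; left; apply/eqP; apply: eq_bigl => i; rewrite -val_eqE.
Qed.

(** The k-th coordinate differs from its first-order prediction in two ways: the
    factor a j / (lh - lam k) is not 1 / (lam j - lam k), which costs the shift
    of the eigenvalue and 1 - a j, and the sum over i <> j in the equation is
    nonzero, which costs T. Both are small relative to t. *)
Lemma second_order_bound (M : nat) :
  \sum_(k < M | (k : nat) != j) (a k - first_order k) ^+ 2 <= t * (8 * Num.sqrt B + 8 * t) ^+ 2.
Proof.
pose Q := 2 * Num.sqrt B + (1 - a j).
have /andP[d0 d1] := one_minus_aj.
have s0 := sqrtr_ge0 B; have sB := sqr_sqrtr B0.
have Q0 : 0 <= Q by rewrite addr_ge0 // mulr_ge0.
pose br k := a j / (lh - lam k) - (lam j - lam k)^-1.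
have brQ k : k != j -> (E j k * br k) ^+ 2 <= first_order k ^+ 2 * Q ^+ 2.
  move=> kj; have g := gap0 kj; have l := lh0 kj; have lg := lh_gap kj.
  have l0 : lh - lam k != 0 by rewrite -normr_eq0 gt_eqF.
  have g0 : lam j - lam k != 0 by rewrite -normr_eq0 gt_eqF.
  have -> : E j k * br k = first_order k * (a j * (lam j - lh) / (lh - lam k) + (a j - 1)).
    by rewrite /br /first_order; field; rewrite l0 g0.
  rewrite exprMn ler_wpM2l ?sqr_ge0 // -[leLHS]real_normK ?num_real // ler_pXn2r ?nnegrE //.
  apply: (le_trans (ler_normD _ _)); rewrite /Q; apply: lerD; last first.
    by rewrite distrC ger0_norm.
  rewrite normrM normfV normrM ler_pdivrMr // ger0_norm //.
  have aj1' : a j <= 1 by lra.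
  apply: (@le_trans _ _ (`|lam j - lh|)); first by rewrite ler_piMl.
  rewrite distrC; apply: (le_trans eigenvalue_shift).
  have := sep kj; have xl' := ltW xl => sp.
  have h : x * lam j <= `|lh - lam k| by lra.
  rewrite -mulrA mulrC -!mulrA; nra.
have c : (fun N => \sum_(k < M | (k : nat) != j) (S N k / (lh - lam k) - first_order k) ^+ 2) @ \oo -->
   \sum_(k < M | (k : nat) != j) ((lh - lam k) * a k / (lh - lam k) - first_order k) ^+ 2.
  apply: cvg_finite_sum => k; rewrite expr2; under eq_fun do rewrite expr2.
  by apply: cvgM; (apply: cvgB; [apply: cvgM; [exact: eig|exact: cvg_cst]|exact: cvg_cst]).
have -> : \sum_(k < M | (k : nat) != j) (a k - first_order k) ^+ 2 =
   \sum_(k < M | (k : nat) != j) ((lh - lam k) * a k / (lh - lam k) - first_order k) ^+ 2.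
  apply: eq_bigr => k kj; congr ((_ - _) ^+ 2); field.
  by rewrite -normr_eq0 gt_eqF // lh0.
apply: (@cvg_le_bound _ _ _ _ j.+1 c) => N jN.
apply: (@le_trans _ _ (\sum_(k < M | (k : nat) != j)
   (2 * Q ^+ 2 * first_order k ^+ 2 + 2 * (((lh - lam k) ^+ 2)^-1 * (lam k * rowsum N k * T))))).
  apply: ler_sum => k kj; have l := lh0 kj.
  have l0 : lh - lam k != 0 by rewrite -normr_eq0 gt_eqF.
  have -> : S N k / (lh - lam k) - first_order k = E j k * br k + Sj N k / (lh - lam k).
    rewrite S_split // /br /first_order; field.
    by rewrite l0 -normr_eq0 gt_eqF // gap0.
  apply: (@le_trans _ _ (2 * (E j k * br k) ^+ 2 + 2 * (Sj N k / (lh - lam k)) ^+ 2)).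
    by have := sqr_ge0 (E j k * br k - Sj N k / (lh - lam k)); rewrite !expr2; lra.
  apply: lerD.
    by rewrite -mulrA ler_wpM2l // [leRHS]mulrC brQ.
  rewrite ler_wpM2l // expr_div_n mulrC ler_wpM2l ?invr_ge0 ?sqr_ge0 //.
rewrite big_split /= -!mulr_sumr.
have h1 : \sum_(k < M | (k : nat) != j) ((lh - lam k) ^+ 2)^-1 * (lam k * rowsum N k * T)
    <= 20 * B * t.
  apply: (le_trans (@scaled_rows M N (fun k => ((lh - lam k) ^+ 2)^-1) T _ T0)).
    by move=> k kj; rewrite invr_ge0 sqr_ge0 lh_inv.
  rewrite ler_wpM2r //.
  apply: (@le_trans _ _ (4 / (x * lam j) * (5 * B * (x * lam j)))).
    rewrite ler_wpM2l ?divr_ge0 ?(ltW xl) //; apply: (le_trans T_small).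
    by rewrite ler_wpM2l ?mulr_ge0 // ger_pMr.
  have -> : 4 / (x * lam j) * (5 * B * (x * lam j)) = 20 * B by field; rewrite !gt_eqF.
  exact: lexx.
have h2 := first_order_bound M.
have h3 : Q <= 2 * Num.sqrt B + 5 * t by rewrite /Q; lra.
have h4 : Q ^+ 2 <= (2 * Num.sqrt B + 5 * t) ^+ 2 by rewrite ler_pXn2r ?nnegrE //; exact: le_trans Q0 h3.
apply: (@le_trans _ _ (2 * (2 * Num.sqrt B + 5 * t) ^+ 2 * t + 2 * (20 * B * t))).
  apply: lerD; last by rewrite ler_wpM2l.
  by apply: ler_pM; rewrite ?mulr_ge0 ?sqr_ge0 ?sumr_ge0 // ?ler_wpM2l // => k _; exact: sqr_ge0.
have -> : 2 * (2 * Num.sqrt B + 5 * t) ^+ 2 * t + 2 * (20 * B * t) = t * (2 * (2 * Num.sqrt B + 5 * t) ^+ 2 + 40 * Num.sqrt B ^+ 2).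
  by rewrite sB; ring.
rewrite ler_wpM2l //.
have : 0 <= Num.sqrt B * t by rewrite mulr_ge0.
have : 0 <= t * t by rewrite mulr_ge0.
have : 0 <= Num.sqrt B * Num.sqrt B by rewrite mulr_ge0.
rewrite !expr2; lra.
Qed.

End relative_perturbation.

(** * Comparison of eigenvalues by the min-max principle *)

(** One more row than columns forces a linear relation between the rows. It will
    provide a nonzero vector in a span of dimension j + 1 that is orthogonal to
    j given vectors. *)
Lemma exists_left_kernel (F : fieldType) (n : nat) (A : 'M[F]_(n.+1, n)) :
  exists2 c : 'rV[F]_n.+1, c != 0 & c *m A = 0.
Proof.
exists (nz_row (kermx A)).
  rewrite nz_row_eq0 -mxrank_eq0 mxrank_ker subn_eq0 -ltnNge ltnS.
  exact: rank_leq_col.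
by apply/eqP; rewrite -sub_kermx nz_row_sub.
Qed.

Section eigensystem.
Context dS (S : measurableType dS) (R : realType).
Variable mu : {measure set S -> \bar R}.
Implicit Types (u v : L2 mu).
Variables (A : L2 mu -> L2 mu) (lh : nat -> R) (eh : nat -> L2 mu).
Hypothesis esys : is_eigensystem A lh eh.
Hypothesis Apos : forall v, 0 <= l2dot (A v) v.

Let on : Defs.orthonormal eh. Proof. by case: esys. Qed.
Let nd i j : (i <= j)%N -> lh j <= lh i. Proof. by case: esys => _ h _; exact: h. Qed.
Let expand v : l2cvg (fun N => \sum_(j < N) (lh j * l2dot (eh j) v) *: eh j) (A v).
Proof. by case: esys. Qed.

Lemma eig_form u v :
  (fun N => \sum_(m < N) lh m * l2dot (eh m) u * l2dot (eh m) v) @ \oo --> l2dot (A u) v.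
Proof.
have := l2cvg_dot (v := v) (expand u); apply: cvg_trans.
apply: near_eq_cvg; apply: nearW => N /=.
by rewrite l2dot_suml; apply: eq_bigr => k _; rewrite l2dotZl.
Qed.

Lemma eig_dot j v : l2dot (A (eh j)) v = lh j * l2dot (eh j) v.
Proof.
apply: (cvg_unique _ (@eig_form (eh j) v)) => //; apply: cvg_near_cst.
exists j.+1 => // N /= jN; rewrite (bigD1 (Ordinal jN)) //= on eqxx mulr1 big1 ?addr0 // => i.
by rewrite -val_eqE /= => ij; rewrite on (negbTE ij) mulr0 mul0r.
Qed.

Lemma eig_ge0 j : 0 <= lh j.
Proof. by have := Apos (eh j); rewrite eig_dot on eqxx mulr1. Qed.

Lemma eig_sym u v : l2dot (A u) v = l2dot (A v) u.
Proof.
apply: (cvg_unique _ (@eig_form u v)) => //; have := @eig_form v u.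
apply: cvg_trans; apply: near_eq_cvg; apply: nearW => N /=.
by apply: eq_bigr => m _; rewrite mulrAC.
Qed.

Lemma eig_bounded u v : `|l2dot (A u) v| <= lh 0%N * (l2norm u * l2norm v).
Proof.
have B0 : 0 <= lh 0%N * (l2norm u * l2norm v) by rewrite !mulr_ge0 ?eig_ge0 ?l2norm_ge0.
rewrite -(ler_pXn2r (_ : (0 < 2)%N)) ?nnegrE // real_normK ?num_real //.
have c : (fun N => (\sum_(m < N) lh m * l2dot (eh m) u * l2dot (eh m) v) ^+ 2) @ \oo --> l2dot (A u) v ^+ 2.
  by rewrite expr2; under eq_fun do rewrite expr2; apply: cvgM; exact: eig_form.
apply: (cvg_le_bound (N0 := 0) c) => N _.
apply: (@le_trans _ _ ((\sum_(m < N) (lh 0%N * l2dot (eh m) u) ^+ 2) * \sum_(m < N) l2dot (eh m) v ^+ 2)).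
  apply: sum_CS => m; rewrite ?sqr_ge0 // -exprMn.
  rewrite !exprMn !ler_wpM2r ?sqr_ge0 //.
  by rewrite ler_pXn2r ?nnegrE ?eig_ge0 // nd.
rewrite !exprMn !sqr_l2norm mulrA; apply: ler_pM; rewrite ?sumr_ge0 //; try by move=> *; exact: sqr_ge0.
  under eq_bigr do rewrite exprMn.
  by rewrite -mulr_sumr ler_wpM2l ?sqr_ge0 // bessel.
exact: bessel.
Qed.

Lemma eig_cvgl (w : nat -> L2 mu) u v : l2cvg w u ->
  (fun N => l2dot (A (w N)) v) @ \oo --> l2dot (A u) v.
Proof.
move=> wu; rewrite eig_sym; under eq_fun do rewrite eig_sym l2dotC.
by rewrite l2dotC; exact: l2cvg_dot.
Qed.

Lemma eig_suml (c : nat -> R) (e : nat -> L2 mu) (N : nat) v :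
  l2dot (A (\sum_(i < N) c i *: e i)) v = \sum_(i < N) c i * l2dot (A (e i)) v.
Proof.
rewrite eig_sym l2dot_sumr; apply: eq_bigr => i _.
by rewrite l2dotZr eig_sym.
Qed.

Section comparison.
Variables (e : nat -> L2 mu) (lam : nat -> R) (E z : nat -> nat -> R) (j : nat) (x B : R).
Hypothesis eb : orthonormal_basis e.
Hypotheses (lam0 : forall i, 0 <= lam i) (lam_nd : forall i k, (i <= k)%N -> lam k <= lam i).
Hypothesis entries : forall i k, l2dot (A (e i)) (e k) = (if i == k then lam i else 0) + E i k.

Lemma eig_equation m k :
  (fun N => \sum_(i < N) E i k * l2dot (e i) (eh m)) @ \oo --> (lh m - lam k) * l2dot (e k) (eh m).
Proof.
have c := @eig_cvgl _ _ (e k) (eb.2 (eh m)).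
rewrite eig_dot in c.
have -> : (lh m - lam k) * l2dot (e k) (eh m) = lh m * l2dot (eh m) (e k) - lam k * l2dot (e k) (eh m).
  by rewrite (l2dotC (eh m)) mulrBl.
have c2 : (fun N => l2dot (A (\sum_(i < N) l2dot (e i) (eh m) *: e i)) (e k) - lam k * l2dot (e k) (eh m))
    @ \oo --> lh m * l2dot (eh m) (e k) - lam k * l2dot (e k) (eh m).
  by apply: cvgB; [exact: c|exact: cvg_cst].
apply: cvg_trans c2; apply: near_eq_cvg; exists k.+1 => // N /= kN.
rewrite (eig_suml (fun i => l2dot (e i) (eh m))).
under [X in X - _ = _]eq_bigr do rewrite entries mulrDr.
rewrite big_split /= (bigD1 (Ordinal kN)) //= eqxx big1 ?addr0; last first.
  by move=> i; rewrite -val_eqE /= => /negbTE ->; rewrite mulr0.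
rewrite [l2dot (e k) (eh m) * _]mulrC addrAC subrr add0r; apply: eq_bigr => i _; exact: mulrC.
Qed.

Hypotheses (lamj : 0 < lam j) (x0 : 0 < x).
Hypothesis sep : forall k, k != j -> 2 * (x * lam j) <= `|lam j - lam k|.
Hypothesis z0 : forall i k, 0 <= z i k.
Hypothesis Ez : forall i k, E i k ^+ 2 <= lam i * lam k * z i k.
Hypothesis BE : forall N : nat,
  \sum_(k < N) \sum_(i < N) wgt lam j x k * (wgt lam j x i * z i k) <= B.
Hypothesis B1 : B <= 1.

Let wg0 i : 0 <= wgt lam j x i.
Proof. by apply: wgt_ge0; try exact: sep. Qed.

(** The quadratic form of the perturbation is absorbed by any diagonal form om
    for which lam i <= wgt i * om i, since the Cauchy--Schwarz inequality then
    leaves the double sum B <= 1 as a factor. *)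
Lemma form_perturbation (N : nat) (v om : nat -> R) :
  (forall i, 0 <= om i) -> (forall i, lam i * v i ^+ 2 <= wgt lam j x i * (om i * v i ^+ 2)) ->
  `|\sum_(k < N) \sum_(i < N) E i k * (v i * v k)| <= \sum_(i < N) om i * v i ^+ 2.
Proof.
move=> om0 h.
have O0 : 0 <= \sum_(i < N) om i * v i ^+ 2 by apply: sumr_ge0 => i _; rewrite mulr_ge0 ?sqr_ge0.
rewrite -(ler_pXn2r (_ : (0 < 2)%N)) ?nnegrE // real_normK ?num_real //.
rewrite !pair_bigA /=.
apply: (@le_trans _ _ ((\sum_(p : 'I_N * 'I_N) wgt lam j x p.1 * (wgt lam j x p.2 * z p.2 p.1)) *
   \sum_(p : 'I_N * 'I_N) (om p.1 * v p.1 ^+ 2) * (om p.2 * v p.2 ^+ 2))).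
  apply: sum_CS => -[k i] /=.
  - by rewrite !mulr_ge0.
  - by apply: mulr_ge0; apply: mulr_ge0; rewrite ?om0 ?sqr_ge0.
  apply: (@le_trans _ _ (lam i * lam k * z i k * (v i ^+ 2 * v k ^+ 2))).
    by rewrite !exprMn ler_wpM2r // mulr_ge0 ?sqr_ge0.
  have -> : lam i * lam k * z i k * (v i ^+ 2 * v k ^+ 2) = z i k * ((lam i * v i ^+ 2) * (lam k * v k ^+ 2)) by ring.
  have -> : wgt lam j x k * (wgt lam j x i * z i k) * (om k * v k ^+ 2 * (om i * v i ^+ 2))
     = z i k * ((wgt lam j x i * (om i * v i ^+ 2)) * (wgt lam j x k * (om k * v k ^+ 2))) by ring.
  by rewrite ler_wpM2l // ler_pM // mulr_ge0 ?sqr_ge0.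
rewrite -(pair_bigA _ (fun k i : 'I_N => wgt lam j x k * (wgt lam j x i * z i k))) /=.
rewrite -(pair_bigA _ (fun k i : 'I_N => (om k * v k ^+ 2) * (om i * v i ^+ 2))) /=.
have -> : \sum_(i < N) \sum_(j0 < N) om i * v i ^+ 2 * (om j0 * v j0 ^+ 2) = (\sum_(i < N) om i * v i ^+ 2) ^+ 2.
  by rewrite expr2 big_distrl /=; apply: eq_bigr => i _; rewrite big_distrr.
by rewrite ler_piMl ?sqr_ge0 // (le_trans (BE N)).
Qed.

Lemma form_coordinates (N : nat) (c : nat -> R) :
  l2dot (A (\sum_(i < N) c i *: e i)) (\sum_(i < N) c i *: e i) =
  \sum_(i < N) lam i * c i ^+ 2 + \sum_(k < N) \sum_(i < N) E i k * (c i * c k).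
Proof.
rewrite l2dot_sumr -big_split /=; apply: eq_bigr => k _.
rewrite l2dotZr eig_suml.
under [X in _ * X = _]eq_bigr do rewrite entries mulrDr.
rewrite big_split /= mulrDr; congr (_ + _); last first.
  by rewrite mulr_sumr; apply: eq_bigr => i _; ring.
rewrite (bigD1 k) //= eqxx big1 ?addr0; last first.
  by move=> i ik; rewrite val_eqE (negbTE ik) mulr0.
by rewrite expr2; ring.
Qed.

(** Some nonzero vector v in the span of the first j + 1 perturbed eigenvectors
    is orthogonal to the first j vectors of the basis. The form at v is at least
    lh j times the squared norm of v; it is also at most lam j (1 + x) times it,
    because the diagonal form lam j - lam i + x lam j, for i >= j, absorbs the
    perturbation and raises each lam i to exactly this value. *)
Lemma eig_upper : lh j <= lam j * (1 + x).
Proof.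
have [c c0 cA] := exists_left_kernel (\matrix_(m < j.+1, i < j) l2dot (eh m) (e i)).
pose cn (m : nat) : R := if insub m is Some o then c 0 o else 0.
have cnE (m : 'I_j.+1) : cn m = c 0 m by rewrite /cn valK.
pose v := \sum_(m < j.+1) cn m *: eh m.
have vv : l2dot v v = \sum_(m < j.+1) cn m ^+ 2.
  by rewrite /v (on_dot_sum2 cn cn _ on); apply: eq_bigr => k _; rewrite expr2.
have vpos : 0 < l2dot v v.
  rewrite lt_def l2dot_ge0 andbT vv; apply: contraNneq c0 => s0.
  apply/eqP/rowP => m; rewrite mxE -cnE; apply/eqP; rewrite -sqrf_eq0.
  move/eqP: s0; rewrite psumr_eq0; last by move=> *; exact: sqr_ge0.
  by move/allP => /(_ m); rewrite mem_index_enum => /(_ isT) /implyP; apply.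
have vperp i : (i < j)%N -> l2dot (e i) v = 0.
  move=> ij; have /rowP /(_ (Ordinal ij)) := cA; rewrite !mxE => <-.
  rewrite /v l2dot_sumr; apply: eq_bigr => m _; rewrite mxE l2dotZr cnE.
  by rewrite (l2dotC (e i)).
have q1 : lh j * l2dot v v <= l2dot (A v) v.
  rewrite {3}/v eig_suml vv mulr_sumr; apply: ler_sum => m _.
  rewrite eig_dot (_ : l2dot (eh m) v = cn m); last first.
    by rewrite l2dotC /v (on_dot_sum cn _ _ on) ltn_ord.
  by rewrite [leRHS]mulrCA -expr2 ler_wpM2r ?sqr_ge0 // nd // -ltnS.
have q2 : l2dot (A v) v <= lam j * (1 + x) * l2dot v v.
  pose a i := l2dot (e i) v.
  have lim1 : (fun N => l2dot (A (\sum_(i < N) a i *: e i)) (\sum_(i < N) a i *: e i)) @ \oo --> l2dot (A v) v.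
    have e2 := eb.2 v; rewrite -/a in e2.
    have h : (fun N => l2dot (A (\sum_(i < N) a i *: e i)) v) @ \oo --> l2dot (A v) v by exact: eig_cvgl.
    have h2 : (fun N => l2dot (A (\sum_(i < N) a i *: e i)) (\sum_(i < N) a i *: e i)
          - l2dot (A (\sum_(i < N) a i *: e i)) v) @ \oo --> 0.
      apply/cvgrPdist_le => eps eps0.
      have K0 : 0 < lh 0%N * l2norm v + 1 by rewrite ltr_wpDl // mulr_ge0 ?eig_ge0 ?l2norm_ge0.
      move/cvgrPdist_le : e2 => /(_ _ (divr_gt0 eps0 K0)); apply: filterS => N.
      rewrite !sub0r !normrN (ger0_norm (l2norm_ge0 _)) => hN.
      rewrite -l2dotBr; apply: (le_trans (eig_bounded _ _)).
      have pN : l2norm (\sum_(i < N) a i *: e i) <= l2norm v.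
        rewrite /l2norm ler_wsqrtr // (on_dot_sum2 a a _ eb.1).
        by apply: le_trans (bessel v N eb.1); apply: ler_sum => i _; rewrite expr2.
      apply: (@le_trans _ _ (lh 0%N * (l2norm v * (eps / (lh 0%N * l2norm v + 1))))).
        by rewrite ler_wpM2l ?eig_ge0 // ler_pM ?l2norm_ge0.
      rewrite (_ : lh 0%N * _ = eps * (lh 0%N * l2norm v / (lh 0%N * l2norm v + 1))); last by ring.
      rewrite ger_pMr // ler_pdivrMr // mul1r; lra.
    have h3 := cvgD h2 h; rewrite add0r in h3.
    set F := (fun N => l2dot (A _) (\sum_(i < N) _)).
    set F1 := (fun N => l2dot (A _) v) in h h2 h3.
    rewrite (_ : F = (fun N => (F N - F1 N) + F1 N)); first exact: h3.
    by apply/funext => N; rewrite subrK.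
  apply: (cvg_le_bound (N0 := 0) lim1) => N _; rewrite form_coordinates.
  (* the coordinates of v below j vanish, so nothing has to be absorbed there *)
  pose om i := if (i < j)%N then 0 else lam j - lam i + x * lam j.
  have om0 i : 0 <= om i.
    rewrite /om; case: ltnP => // ji; rewrite addr_ge0 ?subr_ge0 ?lam_nd //.
    by rewrite mulr_ge0 // ltW.
  have ha i : lam i * a i ^+ 2 <= wgt lam j x i * (om i * a i ^+ 2).
    rewrite /om; case: ltnP => ij; first by rewrite /a vperp // expr0n /= !mulr0.
    rewrite mulrA ler_wpM2r ?sqr_ge0 // /wgt; case: eqP => [->|/eqP ij'].
      by rewrite subrr add0r mulrA mulVf ?mul1r // gt_eqF.
    have g : 0 < `|lam j - lam i| by apply: lt_le_trans (sep ij'); rewrite !mulr_gt0.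
    rewrite -mulrA ler_peMr // mulrC ler_pdivlMr // mul1r ger0_norm ?subr_ge0 ?lam_nd //.
    by rewrite lerDl mulr_ge0 // ltW.
  have := le_trans (ler_norm _) (@form_perturbation N a om om0 ha) => h.
  apply: (@le_trans _ _ (\sum_(i < N) lam i * a i ^+ 2 + \sum_(i < N) om i * a i ^+ 2)).
    by rewrite lerD2l.
  rewrite -big_split /=.
  apply: (@le_trans _ _ (\sum_(i < N) lam j * (1 + x) * a i ^+ 2)).
    apply: ler_sum => i _; rewrite -mulrDl /om; case: ltnP => ij; last first.
      by rewrite le_eqVlt; apply/orP; left; apply/eqP; congr (_ * _); ring.
    by rewrite /a vperp // expr0n /= !mulr0.
  rewrite -mulr_sumr ler_wpM2l ?mulr_ge0 ?(ltW lamj) //; first by have := x0; lra.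
  exact: bessel eb.1.
by rewrite -(ler_pM2r vpos) (le_trans q1).
Qed.

(** The same argument with the roles of the two families exchanged, and with the
    form lam i - lam j + x lam j for i <= j. *)
Lemma eig_lower : lam j * (1 - x) <= lh j.
Proof.
have [c c0 cA] := exists_left_kernel (\matrix_(m < j.+1, i < j) l2dot (e m) (eh i)).
pose cn (m : nat) : R := if insub m is Some o then c 0 o else 0.
have cnE (m : 'I_j.+1) : cn m = c 0 m by rewrite /cn valK.
pose v := \sum_(m < j.+1) cn m *: e m.
have vv : l2dot v v = \sum_(m < j.+1) cn m ^+ 2.
  by rewrite /v (on_dot_sum2 cn cn _ eb.1); apply: eq_bigr => k _; rewrite expr2.
have vpos : 0 < l2dot v v.
  rewrite lt_def l2dot_ge0 andbT vv; apply: contraNneq c0 => s0.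
  apply/eqP/rowP => m; rewrite mxE -cnE; apply/eqP; rewrite -sqrf_eq0.
  move/eqP: s0; rewrite psumr_eq0; last by move=> *; exact: sqr_ge0.
  by move/allP => /(_ m); rewrite mem_index_enum => /(_ isT) /implyP; apply.
have vperp i : (i < j)%N -> l2dot (eh i) v = 0.
  move=> ij; have /rowP /(_ (Ordinal ij)) := cA; rewrite !mxE => <-.
  rewrite /v l2dot_sumr; apply: eq_bigr => m _; rewrite mxE l2dotZr cnE.
  by rewrite (l2dotC (eh i)).
have q1 : l2dot (A v) v <= lh j * l2dot v v.
  apply: (cvg_le_bound (N0 := 0) (@eig_form v v)) => N _.
  apply: (@le_trans _ _ (\sum_(m < N) lh j * l2dot (eh m) v ^+ 2)).
    apply: ler_sum => m _; rewrite -mulrA -expr2.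
    have [mj|jm] := ltnP m j; first by rewrite vperp // expr0n /= !mulr0.
    by rewrite ler_wpM2r ?sqr_ge0 // nd.
  by rewrite -mulr_sumr ler_wpM2l ?eig_ge0 // bessel.
have q2 : lam j * (1 - x) * l2dot v v <= l2dot (A v) v.
  rewrite form_coordinates vv.
  (* the coordinates of v above j vanish, so nothing has to be absorbed there *)
  pose om i := if (i <= j)%N then lam i - lam j + x * lam j else 0.
  have om0 i : 0 <= om i.
    rewrite /om; case: leqP => // ij; rewrite addr_ge0 ?subr_ge0 ?lam_nd //.
    by rewrite mulr_ge0 // ltW.
  have cn0 i : (j < i)%N -> cn i = 0.
    by move=> ji; rewrite /cn insubF // ltnS leqNgt ji.
  have ha i : lam i * cn i ^+ 2 <= wgt lam j x i * (om i * cn i ^+ 2).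
    rewrite /om; case: leqP => ij; last by rewrite cn0 // expr0n /= !mulr0.
    rewrite mulrA ler_wpM2r ?sqr_ge0 // /wgt; case: eqP => [->|/eqP ij'].
      by rewrite subrr add0r mulrA mulVf ?mul1r // gt_eqF.
    have g : 0 < `|lam j - lam i| by apply: lt_le_trans (sep ij'); rewrite !mulr_gt0.
    rewrite -mulrA ler_peMr // mulrC ler_pdivlMr // mul1r distrC ger0_norm ?subr_ge0 ?lam_nd //.
    by rewrite lerDl mulr_ge0 // ltW.
  have := @form_perturbation j.+1 cn om om0 ha.
  rewrite ler_norml => /andP[h _].
  apply: (@le_trans _ _ (\sum_(i < j.+1) lam i * cn i ^+ 2 - \sum_(i < j.+1) om i * cn i ^+ 2)); last first.
    by rewrite lerD2l.
  rewrite -sumrB mulr_sumr; apply: ler_sum => i _.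
  rewrite /om -ltnS ltn_ord le_eqVlt; apply/orP; left; apply/eqP; ring.
by rewrite -(ler_pM2r vpos) (le_trans q2).
Qed.

Lemma eig_close : `|lh j - lam j| <= x * lam j.
Proof. by rewrite ler_norml; have := eig_upper; have := eig_lower; lra. Qed.

End comparison.
End eigensystem.

(** * Moments of the scores *)

Section expectation.
Context dO (Om : measurableType dO) (R : realType) (P : probability Om R).

Lemma ExE f : Ex P f = (\int[P]_w f w)%R.
Proof. by rewrite /Ex unlock. Qed.

(** The left-hand function may be a limit of a series, with no measurability
    known. *)
Lemma Ex_ae (f g : Om -> R) : measurable_fun setT g ->
  {ae P, forall w, f w = g w} -> Ex P f = Ex P g.
Proof.
move=> mg fg; rewrite !ExE /Rintegral; congr fine.
apply: integral_ae_nomeasE; first exact/measurable_EFinP.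
by move: fg; apply: filterS => w ->.
Qed.

Lemma Ex_add s f g A B : 1 <= s -> Lb P s f A -> Lb P s g B ->
  Ex P (fun w => f w + g w) = Ex P f + Ex P g.
Proof.
move=> s1 Lf Lg; rewrite !ExE RintegralD //; [exact: Lb_integrable s1 Lf|exact: Lb_integrable s1 Lg].
Qed.

Lemma Ex_scale s f A (c : R) : 1 <= s -> Lb P s f A ->
  Ex P (fun w => c * f w) = c * Ex P f.
Proof. by move=> s1 Lf; rewrite !ExE RintegralZl //; exact: Lb_integrable s1 Lf. Qed.

Lemma Ex_cst (c : R) : Ex P (cst c) = c.
Proof.
rewrite ExE /Rintegral (_ : (fun w => _) = cst c%:E) // integral_cst //.
by rewrite [X in (_ * X)%E](_ : _ = 1%E) ?mule1 //; exact: probability_setT.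
Qed.

Lemma Lb_mul2 f g A B : Lb P 2 f A -> Lb P 2 g B -> Lb P 1 (fun w => f w * g w) (A * B).
Proof. by rewrite -{1 2}(mulr1 2); exact: (Lb_mul ltr01). Qed.

Lemma second_moment_Lb (f : Om -> R) : measurable_fun setT f ->
  P.-integrable setT (EFin \o (fun w => f w ^+ 2)) ->
  Lb P 2 f (Num.sqrt (Ex P (fun w => f w ^+ 2))).
Proof.
move=> mf fi; split; [by []|exact: sqrtr_ge0|].
rewrite -[2]/(2%:R) powR_mulrn ?sqrtr_ge0 // sqr_sqrtr; last first.
  by rewrite ExE; apply: Rintegral_ge0 => w _; exact: sqr_ge0.
rewrite ExE /Rintegral fineK; last exact: integrable_fin_num.
rewrite le_eqVlt; apply/orP; left; apply/eqP; apply: eq_integral => w _.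
by rewrite /= powR_mulrn // real_normK ?num_real.
Qed.

Lemma Lb_sq_integrable f A : Lb P 2 f A -> P.-integrable setT (EFin \o (fun w => f w ^+ 2)).
Proof.
move=> Lf; apply: (@Lb_integrable _ _ _ P 1) (lexx 1) (Lb_pow (n := 2) _ _ _) => //.
by rewrite mulr1; exact: Lf.
Qed.

Lemma Lb_zero_ae f : Lb P 2 f 0 -> {ae P, forall w, f w = 0}.
Proof.
move=> Lf; have [mf _ _] := Lf.
have h0 : (\int[P]_w `|((f w ^+ 2)%:E : \bar R)| = 0)%E.
  apply/eqP; rewrite eq_le integral_ge0 ?andbT; last by move=> w _; exact: abse_ge0.
  have [_ _] := Lf; rewrite powR0 // => h; apply: le_trans h.
  rewrite le_eqVlt; apply/orP; left; apply/eqP; apply: eq_integral => w _.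
  rewrite abse_EFin ger0_norm ?sqr_ge0 // -[X in `|_| `^ X]/(2%:R) powR_mulrn //.
  by rewrite real_normK ?num_real.
have mf2 : measurable_fun setT (fun w => (f w ^+ 2)%:E).
  by apply/measurable_EFinP; exact: measurable_funX.
have /(_ h0) := (ae_eq_integral_abs P measurableT mf2).1.
apply: filterS => w /(_ I) [] /eqP; rewrite sqrf_eq0 => /eqP //.
Qed.

End expectation.

Section covariance.
Context dS (S : measurableType dS) (R : realType).
Variable mu : {measure set S -> \bar R}.
Context dO (Om : measurableType dO) (P : probability Om R).
Variables (X : int -> Om -> L2 mu) (e : nat -> L2 mu) (C : R) (h : nat).
Hypothesis eb : orthonormal_basis e.
Hypothesis Xre : forall k, random_element (X k).
Hypothesis Xst : stationary P X.
Hypothesis C0 : 0 <= C.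
Hypothesis XC : forall k, ('E_P[fun w => (l2norm (X k w) ^+ 2)%R] <= C%:E)%E.

Lemma random_dot (Y Y' : Om -> L2 mu) : random_element Y -> random_element Y' ->
  measurable_fun setT (fun w => l2dot (Y w) (Y' w)).
Proof.
move=> mY mY'; apply: (measurable_fun_cvg (h := fun N w =>
  \sum_(k < N) l2dot (e k) (Y w) * l2dot (e k) (Y' w))) => [N|w _].
  apply: measurable_sum => k; apply: measurable_funM.
    by under eq_fun do rewrite l2dotC; exact: mY.
  by under eq_fun do rewrite l2dotC; exact: mY'.
exact: (parseval eb).
Qed.

Lemma Lb_dot_sq (Y : Om -> L2 mu) (D : R) v : random_element Y -> 0 <= D ->
  ('E_P[fun w => (l2norm (Y w) ^+ 2)%R] <= D%:E)%E ->
  Lb P 2 (fun w => l2dot (Y w) v) (Num.sqrt D * l2norm v).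
Proof.
move=> mY D0; rewrite unlock => YD; split; [exact: mY|by rewrite mulr_ge0 ?sqrtr_ge0|].
rewrite -[2]/(2%:R) powR_mulrn ?mulr_ge0 ?sqrtr_ge0 // exprMn sqr_sqrtr //.
have mn : measurable_fun setT (fun w => l2norm (Y w) ^+ 2).
  by under eq_fun do rewrite sqr_l2norm; exact: random_dot.
apply: (@le_trans _ _ (\int[P]_w ((l2norm v ^+ 2)%:E * (l2norm (Y w) ^+ 2)%:E))%E).
  apply: ge0_le_integral; [by []| |exact: (measurable_absX 2%:R (mY v))| |].
  - by move=> w _; rewrite lee_fin powR_ge0.
  - by apply/measurable_EFinP; exact: measurable_funM.
  move=> w _; rewrite -EFinM lee_fin powR_mulrn // real_normK ?num_real //.
  by rewrite !sqr_l2norm mulrC; exact: l2_CS2.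
rewrite ge0_integralZl; [|by []|exact/measurable_EFinP|by move=> w _; rewrite lee_fin sqr_ge0|
  by rewrite lee_fin sqr_ge0].
rewrite [D * _]mulrC [leRHS]EFinM; apply: lee_wpmul2l; [by rewrite lee_fin sqr_ge0|exact: YD].
Qed.

(** The mean is an arbitrarily chosen element with a prescribed pairing;
    boundedness of the pairing and the representation theorem show that such an
    element exists. *)
Lemma weak_mean (Y : Om -> L2 mu) (D : R) :
  (forall v, Lb P 1 (fun w => l2dot (Y w) v) (D * l2norm v)) ->
  forall v, l2dot (l2mean P Y) v = Ex P (fun w => l2dot (Y w) v).
Proof.
move=> L.
have [m mE] : exists m : L2 mu, forall v, l2dot m v = Ex P (fun w => l2dot (Y w) v); last first.
  by have := xgetPex (0 : L2 mu) (ex_intro (fun m : L2 mu => forall v, l2dot m v = Ex P (fun w => l2dot (Y w) v)) m mE).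
apply: (riesz eb (B := D)).
- move=> u v; rewrite -(Ex_add (lexx 1) (L u) (L v)); congr Ex.
  by apply/funext => w; rewrite l2dotDr.
- move=> a u; rewrite -(Ex_scale a (lexx 1) (L u)); congr Ex.
  by apply/funext => w; rewrite l2dotZr.
- move=> v; exact: Lb_Ex (lexx 1) (L v).
Qed.

Let ler12 : (1 : R) <= 2. Proof. by rewrite ler1n. Qed.

Lemma Lb_X k v : Lb P 2 (fun w => l2dot (X k w) v) (Num.sqrt C * l2norm v).
Proof. exact: Lb_dot_sq. Qed.

Let m0 := l2mean P (X 0).

Lemma mean_dot v : l2dot m0 v = Ex P (fun w => l2dot (X 0 w) v).
Proof.
apply: (weak_mean (D := Num.sqrt C)) => {}v.
exact: Lb_incr (lexx 1) ler12 (Lb_X 0 v).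
Qed.

Lemma mean_norm : l2norm m0 <= Num.sqrt C.
Proof.
have [->|n0] := eqVneq (l2norm m0) 0; first exact: sqrtr_ge0.
have np : 0 < l2norm m0 by rewrite lt_def n0 l2norm_ge0.
rewrite -(ler_pM2r np) -expr2 sqr_l2norm mean_dot.
by apply: le_trans (ler_norm _) (Lb_Ex ler12 (Lb_X 0 m0)).
Qed.

Lemma Xc_dot k w v : l2dot (Xc P X k w) v = l2dot (X k w) v - l2dot m0 v.
Proof. exact: l2dotBl. Qed.

Lemma Xc_random k : random_element (Xc P X k).
Proof.
move=> v; rewrite (_ : (fun w => _) = (fun w => l2dot (X k w) v - l2dot m0 v)).
  by apply: measurable_funB => //; exact: Xre.
by apply/funext => w; rewrite Xc_dot.
Qed.

Lemma Xc_energy k : ('E_P[fun w => (l2norm (Xc P X k w) ^+ 2)%R] <= (4 * C)%:E)%E.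
Proof.
have mn : measurable_fun setT (fun w => l2norm (X k w) ^+ 2).
  by under eq_fun do rewrite sqr_l2norm; exact: random_dot.
have mc : measurable_fun setT (fun w => l2norm (Xc P X k w) ^+ 2).
  by under eq_fun do rewrite sqr_l2norm; apply: random_dot; exact: Xc_random.
have := XC k; rewrite unlock => h1.
apply: (@le_trans _ _ (\int[P]_w (2%:E * (l2norm (X k w) ^+ 2)%:E + (2 * C)%:E))%E).
  apply: ge0_le_integral; [by []| | | |].
  - by move=> w _; rewrite lee_fin sqr_ge0.
  - exact/measurable_EFinP.
  - by apply/measurable_EFinP; apply: measurable_funD => //; exact: measurable_funM.
  move=> w _; rewrite -EFinM -EFinD lee_fin.
  have a0 := l2norm_ge0 (X k w); have b0 := l2norm_ge0 m0.
  have c0 := l2norm_ge0 (Xc P X k w).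
  have t : l2norm (Xc P X k w) <= l2norm (X k w) + l2norm m0 by exact: l2normB.
  have m2 : l2norm m0 ^+ 2 <= C.
    by rewrite -[leRHS]sqr_sqrtr // lerXn2r ?nnegrE ?sqrtr_ge0 ?mean_norm.
  apply: (@le_trans _ _ ((l2norm (X k w) + l2norm m0) ^+ 2)).
    by rewrite lerXn2r ?nnegrE ?addr_ge0.
  have := sqr_ge0 (l2norm (X k w) - l2norm m0); nra.
rewrite ge0_integralD; [|by []|
  by move=> w _; rewrite -EFinM lee_fin mulr_ge0 ?sqr_ge0|
  by apply/measurable_EFinP; exact: measurable_funM|
  by move=> w _; rewrite lee_fin mulr_ge0|by []].
rewrite integral_cst // [X in (_ + _ * X)%E](_ : _ = 1%E) ?mule1; last exact: probability_setT.
rewrite ge0_integralZl; [|by []|exact/measurable_EFinP|by move=> w _; rewrite lee_fin sqr_ge0|by []].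
rewrite (_ : 4 * C = 2 * C + 2 * C); last by ring.
rewrite [leRHS]EFinD; apply: leeD; last by [].
rewrite [leRHS]EFinM; apply: lee_wpmul2l; [by []|exact: h1].
Qed.

Let C4 : 0 <= 4 * C. Proof. by rewrite mulr_ge0. Qed.

Lemma Lb_Xc k v : Lb P 2 (fun w => l2dot (Xc P X k w) v) (Num.sqrt (4 * C) * l2norm v).
Proof. by apply: Lb_dot_sq => //; [exact: Xc_random|exact: Xc_energy]. Qed.

(** Stationarity is only assumed for finite-dimensional distributions, of which
    the law of one pairing is the simplest case. *)
Lemma stationary_law k v (G : R -> \bar R) : measurable_fun setT G ->
  (\int[P]_w G (l2dot (X k w) v) = \int[P]_w G (l2dot (X 0 w) v))%E.
Proof.
have ge0_case (G' : R -> \bar R) : measurable_fun setT G' -> (forall y, 0 <= G' y)%E ->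
    (\int[P]_w G' (l2dot (X k w) v) = \int[P]_w G' (l2dot (X 0 w) v))%E.
  move=> mG G0.
  have e1 := @ge0_integral_pushforward _ _ _ R _ _ (Xre k v) P setT G' measurableT mG (fun y _ => G0 y).
  have e2 := @ge0_integral_pushforward _ _ _ R _ _ (Xre 0 v) P setT G' measurableT mG (fun y _ => G0 y).
  rewrite !preimage_setT in e1 e2; rewrite -[LHS]e1 -[RHS]e2.
  pose Fk : {mfun Om >-> R} := HB.pack (fun w => l2dot (X k w) v : R)
    (isMeasurableFun.Build _ _ _ _ _ (Xre k v)).
  pose F0 : {mfun Om >-> R} := HB.pack (fun w => l2dot (X 0 w) v : R)
    (isMeasurableFun.Build _ _ _ _ _ (Xre 0 v)).
  apply: (@eq_measure_integral _ _ _ _ (pushforward P F0) (pushforward P Fk)) => A mA _.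
  rewrite /pushforward.
  have := @Xst k 1 (fun _ => 0) (fun _ => v) (fun _ => A) (fun _ => mA).
  have bc (k' : int) (Z : set Om) : \bigcap_(i in [set: 'I_1]) Z = Z.
    by rewrite eqEsubset; split=> w; [move/(_ ord0 I)|move=> ? ? ?].
  by rewrite !bc // add0r.
move=> mG; rewrite (integralE P _ (fun w => G (l2dot (X k w) v))) (integralE P _ (fun w => G (l2dot (X 0 w) v))).
have p1 := ge0_case (G^\+)%E (measurable_funepos mG) (fun y => funepos_ge0 G y).
have p2 := ge0_case (G^\-)%E (measurable_funeneg mG) (fun y => funeneg_ge0 G y).
have pE k' : ((fun w => G (l2dot (X k' w) v))^\+ = (fun w => G^\+ (l2dot (X k' w) v)))%E.
  by apply/funext => w; rewrite !funeposE.
have nE k' : ((fun w => G (l2dot (X k' w) v))^\- = (fun w => G^\- (l2dot (X k' w) v)))%E.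
  by apply/funext => w; rewrite !funenegE.
by rewrite !pE !nE p1 p2.
Qed.

Definition coef (k : int) (j : nat) (w : Om) : R := l2dot (Xc P X k w) (e j).

Local Notation lt := (lamt P X e).
Local Notation et := (eta P X e).

Lemma measurable_coef k j : measurable_fun setT (coef k j).
Proof. exact: Xc_random. Qed.

Lemma coef_law k j (G : R -> \bar R) : measurable_fun setT G ->
  (\int[P]_w G (coef k j w) = \int[P]_w G (coef 0 j w))%E.
Proof.
move=> mG; have mG' : measurable_fun setT (fun y : R => G (y - l2dot m0 (e j))).
  by apply: (measurableT_comp mG); exact: measurable_funB.
have := stationary_law k (e j) mG'.
by under eq_integral do rewrite -Xc_dot; under [X in _ = X]eq_integral do rewrite -Xc_dot.
Qed.

Lemma Lb_coef k j : Lb P 2 (coef k j) (Num.sqrt (lt j)).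
Proof.
have L := Lb_Xc k (e j).
have q : (\int[P]_w (coef k j w ^+ 2)%:E = \int[P]_w (coef 0 j w ^+ 2)%:E)%E.
  have mG : measurable_fun setT (fun y : R => (y ^+ 2)%:E).
    by apply/measurable_EFinP; exact: measurable_funX.
  exact: (coef_law k j mG).
have -> : lt j = Ex P (fun w => coef k j w ^+ 2).
  exact: (etrans (ExE P (fun w => coef 0 j w ^+ 2))
    (etrans (congr1 fine (esym q)) (esym (ExE P (fun w => coef k j w ^+ 2))))).
apply: second_moment_Lb; first exact: measurable_coef.
exact: Lb_sq_integrable L.
Qed.

Lemma lamt_ge0 j : 0 <= lt j.
Proof. by rewrite /lamt ExE; apply: Rintegral_ge0 => w _; exact: sqr_ge0. Qed.

(** When the variance of a score is 0 the score vanishes almost surely, and both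
    sides are 0. *)
Lemma coef_eta k j : {ae P, forall w, coef k j w = Num.sqrt (lt j) * et k j w}.
Proof.
have [l0|ln0] := eqVneq (lt j) 0.
  have := Lb_coef k j; rewrite l0 sqrtr0 => /Lb_zero_ae.
  by apply: filterS => w ->; rewrite mul0r.
apply: aeW => w; rewrite /eta mulrC divfK // gt_eqF // sqrtr_gt0.
by rewrite lt_def ln0 lamt_ge0.
Qed.

Lemma measurable_eta k j : measurable_fun setT (et k j).
Proof. by apply: measurable_funM => //; exact: measurable_coef. Qed.

Lemma Lb_eta2 k j : Lb P 2 (et k j) 1.
Proof.
have p2 : (0 : R) < 2 by [].
have := Lb_scale ((Num.sqrt (lt j))^-1) p2 (Lb_coef k j).
rewrite (_ : (fun w => _) = et k j); last by apply/funext => w; rewrite mulrC.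
apply: Lb_le => //; rewrite ger0_norm ?invr_ge0 ?sqrtr_ge0 //.
by have [->|n0] := eqVneq (Num.sqrt (lt j)) 0; rewrite ?mulr0 ?mulVf.
Qed.

Lemma coef_mean k j : Ex P (coef k j) = 0.
Proof.
transitivity (Ex P (coef 0 j)).
  have q : (\int[P]_w (coef k j w)%:E = \int[P]_w (coef 0 j w)%:E)%E.
    have mG : measurable_fun setT (fun y : R => y%:E) by exact/measurable_EFinP.
    exact: (coef_law k j mG).
  exact: (etrans (ExE P _) (etrans (congr1 fine q) (esym (ExE P _)))).
have -> : coef 0 j = (fun w => l2dot (X 0 w) (e j) + cst (- l2dot m0 (e j)) w).
  by apply/funext => w; rewrite /coef Xc_dot.
by rewrite (Ex_add ler12 (Lb_X 0 (e j)) (Lb_cst P 2 _)) Ex_cst mean_dot subrr.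
Qed.

Lemma eta_mean0 k j : Ex P (et k j) = 0.
Proof.
have -> : et k j = (fun w => (Num.sqrt (lt j))^-1 * coef k j w).
  by apply/funext => w; rewrite mulrC.
by rewrite (Ex_scale _ ler12 (Lb_coef k j)) coef_mean mulr0.
Qed.

(** Bessel's inequality under the expectation. *)
Lemma lamt_sum N : \sum_(j < N) lt j <= 4 * C.
Proof.
have -> : \sum_(j < N) lt j = Ex P (fun w => \sum_(j < N) coef 0 j w ^+ 2).
  rewrite ExE /Rintegral.
  under eq_integral do rewrite -sumEFin.
  rewrite integral_sum //; last first.
    by move=> j; exact: Lb_sq_integrable (Lb_coef 0 j).
  rewrite -sum_fine; last first.
    by move=> j _; apply: integrable_fin_num => //; exact: Lb_sq_integrable (Lb_coef 0 j).
  by apply: eq_bigr => j _; rewrite /lamt ExE.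
have := Xc_energy 0; rewrite unlock => hX.
rewrite ExE -lee_fin /Rintegral fineK; last first.
  apply: integrable_fin_num => //.
  under eq_fun do rewrite -sumEFin.
  by apply: integrable_sum => // j _; exact: Lb_sq_integrable (Lb_coef 0 j).
apply: le_trans hX; apply: ge0_le_integral; [by []| | | |].
- by move=> w _; rewrite lee_fin sumr_ge0 // => j _; exact: sqr_ge0.
- by apply/measurable_EFinP; apply: measurable_sum => j; apply: measurable_funX; exact: measurable_coef.
- apply/measurable_EFinP; under eq_fun do rewrite sqr_l2norm.
  by apply: random_dot; exact: Xc_random.
move=> w _; rewrite lee_fin sqr_l2norm.
apply: le_trans (bessel (Xc P X 0 w) N eb.1).
by apply: ler_sum => j _; rewrite /coef l2dotC.
Qed.

End covariance.

(** * The lag operator and its sample version *)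

Section lag_operators.
Context dS (S : measurableType dS) (R : realType).
Variable mu : {measure set S -> \bar R}.
Context dO (Om : measurableType dO) (P : probability Om R).
Variables (X : int -> Om -> L2 mu) (e : nat -> L2 mu) (C : R) (h : nat).
Hypothesis eb : orthonormal_basis e.
Hypothesis Xre : forall k, random_element (X k).
Hypothesis Xst : stationary P X.
Hypothesis C0 : 0 <= C.
Hypothesis XC : forall k, ('E_P[fun w => (l2norm (X k w) ^+ 2)%R] <= C%:E)%E.

Local Notation lt := (lamt P X e).
Local Notation et := (eta P X e).
Local Notation cE := (crossE P X h e).
Local Notation lC := (lagC P X h).
Local Notation lD := (lagD P X h).
Let K := 4 * C.

Let K0 : 0 <= K. Proof. by rewrite mulr_ge0. Qed.

Lemma Lb_Xc_mul v u : Lb P 1 (fun w => l2dot (Xc P X 0 w) v * l2dot (Xc P X h%:Z w) u)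
  (Num.sqrt K * l2norm v * (Num.sqrt K * l2norm u)).
Proof. exact: (Lb_mul2 (Lb_Xc eb Xre C0 XC 0 v) (Lb_Xc eb Xre C0 XC h%:Z u)). Qed.

(** The product of two pairings with bounded second moments is integrable, so
    the weak integral that defines the operator exists. *)
Lemma lagC_dot v u :
  l2dot (lC v) u = Ex P (fun w => l2dot (Xc P X 0 w) v * l2dot (Xc P X h%:Z w) u).
Proof.
have YE (u' : L2 mu) : (fun w => l2dot (l2dot (Xc P X 0 w) v *: Xc P X h%:Z w) u') =
    (fun w => l2dot (Xc P X 0 w) v * l2dot (Xc P X h%:Z w) u').
  by apply/funext => w; rewrite l2dotZl.
have L u' : Lb P 1 (fun w => l2dot (l2dot (Xc P X 0 w) v *: Xc P X h%:Z w) u')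
    (Num.sqrt K * l2norm v * Num.sqrt K * l2norm u').
  by rewrite YE -mulrA; exact: Lb_Xc_mul.
exact: (etrans (weak_mean eb L u) (congr1 (Ex P) (YE u))).
Qed.

Lemma lagC_bound v u : `|l2dot (lC v) u| <= K * (l2norm v * l2norm u).
Proof.
rewrite lagC_dot (_ : K * _ = Num.sqrt K * l2norm v * (Num.sqrt K * l2norm u)).
  exact: Lb_Ex (lexx 1) (Lb_Xc_mul v u).
by rewrite -{1}(sqr_sqrtr K0); ring.
Qed.

Lemma lagC_norm v : l2norm (lC v) <= K * l2norm v.
Proof.
have [->|n0] := eqVneq (l2norm (lC v)) 0; first by rewrite mulr_ge0 ?l2norm_ge0.
have np : 0 < l2norm (lC v) by rewrite lt_def n0 l2norm_ge0.
rewrite -(ler_pM2r np) -expr2 sqr_l2norm -mulrA.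
exact: le_trans (ler_norm _) (lagC_bound v (lC v)).
Qed.

Lemma lagC_dotD (u u' v : L2 mu) : l2dot (lC (u + u')) v = l2dot (lC u) v + l2dot (lC u') v.
Proof.
have F : (fun w => l2dot (Xc P X 0 w) (u + u') * l2dot (Xc P X h%:Z w) v) =
    (fun w => l2dot (Xc P X 0 w) u * l2dot (Xc P X h%:Z w) v +
       l2dot (Xc P X 0 w) u' * l2dot (Xc P X h%:Z w) v).
  by apply/funext => w; rewrite -mulrDl; congr (_ * _); exact: l2dotDr.
have E := Ex_add (lexx 1) (Lb_Xc_mul u v) (Lb_Xc_mul u' v).
exact: (etrans (lagC_dot _ _) (etrans (congr1 (Ex P) F) (etrans E
  (esym (congr2 +%R (lagC_dot u v) (lagC_dot u' v)))))).
Qed.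

Lemma lagC_dotZ a (u v : L2 mu) : l2dot (lC (a *: u)) v = a * l2dot (lC u) v.
Proof.
have F : (fun w => l2dot (Xc P X 0 w) (a *: u) * l2dot (Xc P X h%:Z w) v) =
    (fun w => a * (l2dot (Xc P X 0 w) u * l2dot (Xc P X h%:Z w) v)).
  by apply/funext => w; rewrite mulrA; congr (_ * _); exact: l2dotZr.
have E := Ex_scale a (lexx 1) (Lb_Xc_mul u v).
exact: (etrans (lagC_dot _ _) (etrans (congr1 (Ex P) F) (etrans E
  (esym (congr1 ( *%R a) (lagC_dot u v)))))).
Qed.

(** The adjoint exists because the lag operator is bounded. *)
Lemma lagD_dot u v : l2dot u (lD v) = l2dot (lC u) (lC v).
Proof.
have [m mE] : exists m : L2 mu, forall u, l2dot (lC u) (lC v) = l2dot u m; last first.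
  by have := xgetPex (0 : L2 mu) (ex_intro
    (fun m : L2 mu => forall u, l2dot (lC u) (lC v) = l2dot u m) m mE) => ->.
have bound u' : `|l2dot (lC u') (lC v)| <= K * (K * l2norm v) * l2norm u'.
  apply: (le_trans (lagC_bound _ _)); rewrite -mulrA ler_wpM2l // mulrC.
  by rewrite ler_wpM2r ?l2norm_ge0 //; exact: lagC_norm.
have [m mE] := riesz eb (fun u u' => lagC_dotD u u' (lC v)) (fun a u => lagC_dotZ a u (lC v)) bound.
by exists m => u'; rewrite -mE l2dotC.
Qed.

Lemma lagD_sym u v : l2dot (lD u) v = l2dot (lD v) u.
Proof.
exact: (etrans (l2dotC _ _) (etrans (lagD_dot v u) (etrans (l2dotC _ _)
  (etrans (esym (lagD_dot u v)) (l2dotC _ _))))).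
Qed.

(** The scores have second moment at most 1. *)
Lemma cross_bound r i : `|cE r i| <= 1.
Proof.
rewrite -[leRHS](mulr1 1); apply: (Lb_Ex (lexx 1)).
exact: (Lb_mul2 (Lb_eta2 eb Xre Xst C0 XC h%:Z r) (Lb_eta2 eb Xre Xst C0 XC 0 _)).
Qed.

Lemma lagC_coef j r : l2dot (lC (e j)) (e r) = Num.sqrt (lt j) * Num.sqrt (lt r) * cE r j.
Proof.
have me k i := measurable_eta P e Xre k i.
have Lm : Lb P 1 (fun w => et h%:Z r w * et 0 j w) (1 * 1).
  exact: (Lb_mul2 (Lb_eta2 eb Xre Xst C0 XC h%:Z r) (Lb_eta2 eb Xre Xst C0 XC 0 _)).
have ms : measurable_fun setT (fun w => Num.sqrt (lt j) * Num.sqrt (lt r) * (et h%:Z r w * et 0 j w)).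
  by apply: measurable_funM => //; exact: measurable_funM.
apply: (etrans (lagC_dot _ _)); apply: (etrans _ (Ex_scale _ (lexx 1) Lm)).
apply: Ex_ae ms _.
have h0 := coef_eta eb Xre Xst C0 XC 0 j.
have hh := coef_eta eb Xre Xst C0 XC h%:Z r.
apply: filterS2 h0 hh => w h0 hh.
rewrite -[l2dot (Xc P X 0 w) (e j)]/(coef P X e 0 j w) -[l2dot (Xc P X h%:Z w) (e r)]/(coef P X e h%:Z r w).
by rewrite h0 hh; ring.
Qed.

Lemma weighted_series_cvg (b : nat -> R) (B : R) : (forall r, `|b r| <= B) ->
  cvgn (series (fun r => lt r * b r)).
Proof.
move=> bB; apply: normed_cvg.
have B0 : 0 <= B by exact: le_trans (bB 0%N).
apply: (@nonneg_series_cvg _ (fun r => `|lt r * b r|) (K * B)) => [k|N]; first exact: normr_ge0.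
apply: (@le_trans _ _ (\sum_(k < N) lt k * B)).
  apply: ler_sum => k _; rewrite normrM ger0_norm ?lamt_ge0 //.
  by rewrite ler_wpM2l ?lamt_ge0.
by rewrite -mulr_suml ler_wpM2r //; exact: lamt_sum.
Qed.

(** The limit m_ij of a series that converges absolutely, since the variances
    are summable and the correlations bounded by 1. *)
Definition scaled_entry i j : R := limn (series (fun r => lt r * cE r i * cE r j)).
Local Notation m := scaled_entry.

Lemma scaled_entry_cvg i j :
  series (fun r => lt r * cE r i * cE r j) @ \oo --> m i j.
Proof.
have : cvgn (series (fun r => lt r * (cE r i * cE r j))).
  apply: (@weighted_series_cvg _ 1) => r; rewrite normrM -[leRHS]mulr1.
  by rewrite ler_pM ?cross_bound.
by under eq_fun do rewrite mulrA.
Qed.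

(** Parseval's identity for the images of two basis vectors under the lag
    operator. *)
Lemma lagD_entry i j : l2dot (lD (e i)) (e j) = Num.sqrt (lt i * lt j) * m i j.
Proof.
apply: (etrans (l2dotC _ _)); apply: (etrans (lagD_dot _ _)).
have p := parseval eb (u := lC (e j)) (v := lC (e i)).
have q : (fun N => Num.sqrt (lt i * lt j) * series (fun r => lt r * cE r i * cE r j) N) @ \oo
    --> Num.sqrt (lt i * lt j) * m i j.
  by apply: cvgM; [exact: cvg_cst|exact: scaled_entry_cvg].
apply: (cvg_unique _ p) => //.
have -> : (fun N => \sum_(k < N) l2dot (e k) (lC (e j)) * l2dot (e k) (lC (e i))) =
   (fun N => Num.sqrt (lt i * lt j) * series (fun r => lt r * cE r i * cE r j) N); last by [].
apply/funext => N; rewrite /series /= big_mkord mulr_sumr; apply: eq_bigr => r _.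
have a1 := etrans (l2dotC (e r) (lC (e j))) (lagC_coef j r).
have a2 := etrans (l2dotC (e r) (lC (e i))) (lagC_coef i r).
apply: (etrans (congr2 *%R a1 a2)); rewrite sqrtrM ?lamt_ge0 //.
have := sqr_sqrtr (lamt_ge0 P X e r).
move: (cE r j) (cE r i) (lt r) (Num.sqrt (lt r)) (Num.sqrt (lt j)) (Num.sqrt (lt i)).
by move=> v u l z y x <-; ring.
Qed.

Lemma scaled_entry_le i : m i i <= K.
Proof.
apply: (cvg_le_bound (N0 := 0) (@scaled_entry_cvg i i)) => N _.
rewrite /series /= big_mkord.
apply: le_trans (lamt_sum eb Xre Xst C0 XC N); apply: ler_sum => r _.
rewrite -mulrA -expr2 ler_piMr ?lamt_ge0 // -(@ler_pXn2r _ 1) ?nnegrE ?sqr_ge0 // expr1.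
by rewrite -real_normK ?num_real // expr_le1 // cross_bound.
Qed.

Lemma scaled_entry_partial i N : \sum_(r < N) lt r * cE r i ^+ 2 <= m i i.
Proof.
have -> : \sum_(r < N) lt r * cE r i ^+ 2 = series (fun r => lt r * cE r i * cE r i) N.
  by rewrite /series /= big_mkord; apply: eq_bigr => r _; rewrite -mulrA.
apply: nondecreasing_cvgn_le; last by apply/cvg_ex; exists (m i i); exact: scaled_entry_cvg.
apply/nondecreasing_seqP => k; rewrite /series /= big_nat_recr //= lerDl -mulrA.
by rewrite mulr_ge0 ?lamt_ge0 // -expr2 sqr_ge0.
Qed.

Lemma scaled_entry_ge0 i : 0 <= m i i.
Proof. by have := scaled_entry_partial i 0; rewrite big_ord0. Qed.

Lemma scaled_entry_ge i (c : R) :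
  (c%:E <= \sum_(0 <= r <oo) (lt r * cE r i ^+ 2)%:E)%E -> c <= m i i.
Proof.
move=> cl; rewrite -lee_fin; apply: (le_trans cl).
apply: lime_le.
  by apply: is_cvg_nneseries => r _ _; rewrite lee_fin mulr_ge0 ?sqr_ge0 ?lamt_ge0.
by apply: nearW => N; rewrite big_mkord sumEFin lee_fin scaled_entry_partial.
Qed.

Section eigenvalues.
Variable lam : nat -> R.
Hypothesis eig : forall j, l2norm (lD (e j) - lam j *: e j) = 0.

Lemma lagD_eig j v : l2dot (lD (e j)) v = lam j * l2dot (e j) v.
Proof. by rewrite (l2norm0_dot_eq _ (eig j)) l2dotZl. Qed.

Lemma entry_lam i j : Num.sqrt (lt i * lt j) * m i j = if i == j then lam i else 0.
Proof. by rewrite -lagD_entry lagD_eig eb.1; case: eqP; rewrite ?mulr1 ?mulr0. Qed.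

(** On the diagonal of the matrix of D this compares eigenvalues with variances
    of scores. *)
Lemma lam_lamt j : lam j = lt j * m j j.
Proof.
by have := entry_lam j j; rewrite eqxx -expr2 sqrtr_sqr ger0_norm ?lamt_ge0 // => ->.
Qed.

Lemma lam_ge0 j : 0 <= lam j.
Proof. by rewrite lam_lamt mulr_ge0 ?lamt_ge0 ?scaled_entry_ge0. Qed.

Lemma lam_sum N : \sum_(j < N) lam j <= K ^+ 2.
Proof.
apply: (@le_trans _ _ (\sum_(j < N) lt j * K)).
  by apply: ler_sum => j _; rewrite lam_lamt ler_wpM2l ?lamt_ge0 ?scaled_entry_le.
by rewrite -mulr_suml expr2 ler_wpM2r //; exact: lamt_sum.
Qed.

(** The eigenvalue relation holds on the basis; boundedness of the operator
    extends it to all vectors. *)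
Lemma lagD_expansion v :
  l2cvg (fun N => \sum_(j < N) (lam j * l2dot (e j) v) *: e j) (lD v).
Proof.
have lK j : lam j <= K ^+ 2.
  apply: le_trans (lam_sum j.+1); rewrite big_ord_recr /= lerDr.
  by apply: sumr_ge0 => i _; exact: lam_ge0.
have [f fE] : exists f, l2cvg (fun N => \sum_(j < N) (lam j * l2dot (e j) v) *: e j) f.
  suff bnd N : \sum_(j < N) (lam j * l2dot (e j) v) ^+ 2 <= (K ^+ 2) ^+ 2 * l2dot v v.
    exact: (riesz_fischer (c := fun j => lam j * l2dot (e j) v) eb.1 bnd).
  apply: (@le_trans _ _ ((K ^+ 2) ^+ 2 * \sum_(j < N) l2dot (e j) v ^+ 2)).
    rewrite mulr_sumr; apply: ler_sum => j _; rewrite exprMn ler_wpM2r ?sqr_ge0 //.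
    by rewrite lerXn2r ?nnegrE ?lam_ge0 ?sqr_ge0.
  by rewrite ler_wpM2l ?sqr_ge0 // bessel //; exact: eb.1.
have z (v0 : L2 mu) : l2norm (v0 - v0) = 0 by rewrite subrr l2norm0.
apply: (l2cvg_eq (fun N => z _) _ fE); apply: (basis_ext eb) => k.
exact: (etrans (l2cvg_coef (c := fun j => lam j * l2dot (e j) v) k eb.1 fE) (esym (etrans (lagD_sym v (e k)) (lagD_eig k v)))).
Qed.

End eigenvalues.
End lag_operators.

Section sample_operator.
Context dS (S : measurableType dS) (R : realType).
Variable mu : {measure set S -> \bar R}.
Context dO (Om : measurableType dO).
Variables (X : int -> Om -> L2 mu) (h n : nat).

Definition resid (k : nat) (w : Om) : L2 mu := X k%:Z w - smean X n w.

(** The sample lag operator. The estimator is its adjoint composed with it,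
    hence symmetric and nonnegative. *)
Definition lagC_hat (w : Om) (u : L2 mu) : L2 mu :=
  (n - h)%:R^-1 *: \sum_(1 <= k < (n - h).+1) l2dot (resid k w) u *: resid (k + h) w.

Lemma lagD_hat_dot w u v :
  l2dot (lagD_hat X h n w u) v = l2dot (lagC_hat w u) (lagC_hat w v).
Proof.
rewrite /lagD_hat /lagC_hat l2dotZl l2dotZl l2dotZr mulrA -invfM -expr2; congr (_ * _).
rewrite !l2dot_suml; apply: eq_bigr => k _.
rewrite l2dot_suml l2dotZl l2dot_sumr mulr_sumr; apply: eq_bigr => l _.
by rewrite l2dotZl l2dotZr -/(resid (l + h) w) -/(resid (k + h) w) -/(resid k w) -/(resid l w)
  [l2dot (resid (l + h) w) _]l2dotC; ring.
Qed.

Lemma lagD_hat_sym w u v : l2dot (lagD_hat X h n w u) v = l2dot (lagD_hat X h n w v) u.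
Proof. by rewrite !lagD_hat_dot l2dotC. Qed.

Lemma lagD_hat_ge0 w v : 0 <= l2dot (lagD_hat X h n w v) v.
Proof. by rewrite lagD_hat_dot l2dot_ge0. Qed.

Lemma lagC_hat_dot w u v : l2dot (lagC_hat w u) v =
  (n - h)%:R^-1 * \sum_(1 <= k < (n - h).+1) l2dot (resid (k + h) w) v * l2dot (resid k w) u.
Proof.
rewrite l2dotZl l2dot_suml; congr (_ * _); apply: eq_bigr => k _.
by rewrite l2dotZl mulrC.
Qed.

Lemma lagC_hat_norm w u : l2norm (lagC_hat w u) <=
  (n - h)%:R^-1 * (\sum_(1 <= k < (n - h).+1) l2norm (resid k w) * l2norm (resid (k + h) w)) * l2norm u.
Proof.
rewrite l2normZ ger0_norm ?invr_ge0 // -mulrA ler_wpM2l ?invr_ge0 //.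
rewrite mulr_suml; elim: (index_iota _ _) => [|k s IH]; first by rewrite !big_nil l2norm0.
rewrite !big_cons; apply: le_trans (l2normD _ _) _; apply: lerD => //.
by rewrite l2normZ mulrAC ler_wpM2r ?l2norm_ge0 // l2_CS.
Qed.

End sample_operator.

(** * Scores as causal functionals of the noise *)

Section power_series_bound.
Context (R : realType).

(** A telescoping majorant of the terms of the series of k^(-3/2). *)
Lemma inv_three_halves_le (k : nat) :
  (k.+2%:R : R) `^ (- (3 / 2)) <= 2 * ((Num.sqrt k.+1%:R)^-1 - (Num.sqrt k.+2%:R)^-1).
Proof.
set a := Num.sqrt (k.+1%:R : R); set b := Num.sqrt (k.+2%:R : R).
have a0 : 0 < a by rewrite sqrtr_gt0 ltr0n.
have b0 : 0 < b by rewrite sqrtr_gt0 ltr0n.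
have a2 : a ^+ 2 = k.+1%:R by rewrite sqr_sqrtr.
have b2 : b ^+ 2 = k.+2%:R by rewrite sqr_sqrtr.
have ab : a <= b by rewrite ler_wsqrtr // ler_nat.
have -> : (k.+2%:R : R) `^ (- (3 / 2)) = (b ^+ 3)^-1.
  rewrite powRN -b2 -powR_mulrn ?(ltW b0) // -powRrM -powR_mulrn ?(ltW b0) //.
  by congr ((_ `^ _)^-1); lra.
have d : b ^+ 2 - a ^+ 2 = 1 by rewrite a2 b2 -natrB // subSnn.
have dd : (b - a) * (b + a) = 1 by rewrite -d; ring.
(* from (b - a) (b + a) = 1 and a <= b *)
have h : 1 <= 2 * b * (b - a) by nra.
have -> : 2 * (a^-1 - b^-1) = (2 * b * (b - a)) * (a * b ^+ 2)^-1 by field; rewrite !gt_eqF.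
apply: (@le_trans _ _ ((a * b ^+ 2)^-1)).
  rewrite lef_pV2 ?posrE ?exprn_gt0 ?mulr_gt0 ?exprn_gt0 // (exprS b 2).
  by rewrite ler_wpM2r // exprn_ge0 // ltW.
by rewrite ler_peMl // invr_ge0 ltW // mulr_gt0 // exprn_gt0.
Qed.

(** The terms i = 0 and i = 1 contribute 1 each and the telescoping majorant of
    the others contributes at most 2. *)
Lemma decay_sum (b : R) (N : nat) : 3 / 2 < b ->
  \sum_(i < N) ((maxn i 1)%:R : R) `^ (- b) <= 4.
Proof.
move=> b32.
have mono (i : nat) : ((maxn i 1)%:R : R) `^ (- b) <= ((maxn i 1)%:R : R) `^ (- (3 / 2)).
  apply: ler_powR; last by lra.
  by rewrite ler1n leq_maxr.
suff h : forall M : nat, \sum_(i < M.+2) ((maxn i 1)%:R : R) `^ (- b) <= 4 - 2 * (Num.sqrt M.+1%:R)^-1.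
  have h' := h N.
  apply: (@le_trans _ _ (\sum_(i < N.+2) ((maxn i 1)%:R : R) `^ (- b))).
    by rewrite !big_ord_recr /= -addrA lerDl addr_ge0 ?powR_ge0.
  apply: (le_trans h'); rewrite gerDl oppr_le0 mulr_ge0 // invr_ge0 sqrtr_ge0 //.
elim=> [|M IH].
  rewrite !big_ord_recr big_ord0 /= add0r !maxnn max0n powR1 sqrtr1 invr1; lra.
rewrite big_ord_recr /=.
have -> : maxn M.+2 1 = M.+2 by [].
have := le_trans (mono M.+2) _ => /(_ _ (inv_three_halves_le M)).
have -> : maxn M.+2 1 = M.+2 by [].
move: IH; lra.
Qed.

End power_series_bound.

Section scores.
Context dE (E : measurableType dE) (R : realType).
Context dO (Om : measurableType dO) (P : probability Om R).
Notation SE := (cylT nat E).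
Notation IS := (cylT int SE).
Variables (g : nat -> (nat -> E) -> R) (eps eps' : int -> Om -> nat -> E).
Hypothesis epsiid : iid_with_copy P eps eps'.
Notation epsw := (noise_path eps).
Notation epsm := (redrawn_path eps eps').
Variable eta : int -> nat -> Om -> R.
Hypothesis meta : forall k j, measurable_fun setT (eta k j).
Hypothesis shiftE : is_bernoulli_shift P g eps eta.
Hypothesis eta2 : forall k j, Lb P 2 (eta k j) 1.
Hypothesis eta_mean : forall k j, (\int[P]_w eta k j w = 0)%R.
Variables (s K b : R).
Hypotheses (s4 : 4 < s) (b32 : 3 / 2 < b).
Hypothesis dep : forall k : nat,
  (dep_coef P g eps eps' eta s k <= (K * (maxn k 1)%:R `^ (- b))%:E)%E.

(** A representative of the normalised score as a function of the whole noise
    path; it agrees with the score almost surely. *)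
Definition score (k : int) (j : nat) (x : IS) : R := g j (fun i => x (k - i%:Z) j).

Lemma measurable_score k j : measurable_fun setT (score k j).
Proof.
have mg : measurable_fun setT (g j : SE -> R).
  by move=> _ B mB; rewrite setTI; exact: shiftE.1.
apply: (measurableT_comp mg); apply: measurable_into_cyl => i.
exact: measurableT_comp (measurable_coord j) (measurable_coord _).
Qed.

Lemma score_eta k j : {ae P, forall w, eta k j w = score k j (epsw w)}.
Proof. exact: shiftE.2. Qed.

Lemma score_shift k m j x : score (k + m) j x = score k j (time_shift m x).
Proof. by rewrite /score; congr g; apply/funext => i; rewrite /time_shift; congr (x _ _); ring. Qed.

Lemma score_adapted k j x y : (forall i, i <= k -> x i = y i) -> score k j x = score k j y.
Proof.
move=> xy; rewrite /score; congr g; apply/funext => i; rewrite xy //.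
by rewrite gerDl oppr_le0 lez_nat.
Qed.

Let s0 : 0 < s. Proof. by have := s4; lra. Qed.

Definition lag_bound (k : nat) : R := K * (maxn k 1)%:R `^ (- b).

(** The dependence coefficient is a supremum over the components, so it bounds
    each of them. *)
Lemma Lb_score_lag (k j : nat) :
  Lb P s (fun w => score k j (epsw w) - score k j (epsm 0 w)) (lag_bound k).
Proof.
have mc : measurable_fun setT (fun w => g j (coupled_past eps eps' k j w)).
  rewrite (_ : (fun w => _) = (fun w => score k j (epsm 0 w))).
    exact: measurableT_comp (measurable_score k j) (measurable_redrawn_path epsiid 0).
  apply/funext => w; rewrite /score /coupled_past /past /redrawn_path; congr g.
  by apply/funext => i; case: ifP.
have L : Lb P s (fun w => eta k j w - g j (coupled_past eps eps' k j w)) (lag_bound k).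
  apply: norm_Lb; [by []|exact: measurable_funB (meta _ _) mc|].
  apply: le_trans (dep k); apply: ereal_sup_ubound; exists j => //.
apply: (Lb_dom s0 _ _ L).
  apply: measurable_funB.
    exact: measurableT_comp (measurable_score k j) (measurable_noise_path epsiid).
  exact: measurableT_comp (measurable_score k j) (measurable_redrawn_path epsiid 0).
have := score_eta k j; apply: filterS => w ->.
rewrite le_eqVlt; apply/orP; left; apply/eqP; congr `|_ - _|.
rewrite /score /coupled_past /past /redrawn_path; congr g.
by apply/funext => i; case: ifP.
Qed.

Lemma lag_bound_ge0 k : 0 <= lag_bound k. Proof. by case: (Lb_score_lag k 0). Qed.

Lemma K_ge0 : 0 <= K.
Proof. by have := lag_bound_ge0 0; rewrite /lag_bound powR1 mulr1. Qed.

Lemma lag_bound_sum N : \sum_(i < N) lag_bound i <= 4 * K.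
Proof. by rewrite /lag_bound -mulr_sumr mulrC ler_wpM2r ?K_ge0 // decay_sum. Qed.

(** By stationarity the effect of redrawing time m on a score at time k depends
    on k - m only. *)
Lemma Lb_score_diff k j m :
  Lb P s (fun w => score k j (epsw w) - score k j (epsm m w)) (zext lag_bound (k - m)).
Proof.
case e : (k - m) => [n|n] /=.
  have L := Lb_shift_diff epsiid m (measurable_score n j) (Lb_score_lag n j).
  move: L; rewrite add0r; congr Lb; apply/funext => w; rewrite -!score_shift -e.
  by rewrite subrK.
apply: (Lb_dom s0 _ _ (Lb_zero P s0)).
  apply: measurable_funB.
    exact: measurableT_comp (measurable_score k j) (measurable_noise_path epsiid).
  exact: measurableT_comp (measurable_score k j) (measurable_redrawn_path epsiid m).
apply: aeW => w; rewrite (@score_adapted k j (epsw w) (epsm m w)) ?subrr // => i ik.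
rewrite /redrawn_path ifF //; apply/negbTE; apply: contraTneq ik => ->.
by rewrite -ltNge -subr_lt0 e.
Qed.

Lemma Lb_score_ae t k j A : 0 < t -> Lb P t (eta k j) A -> Lb P t (fun w => score k j (epsw w)) A.
Proof.
move=> t0; apply: Lb_dom => //.
  exact: measurableT_comp (measurable_score k j) (measurable_noise_path epsiid).
by have := score_eta k j; apply: filterS => w ->.
Qed.

Lemma score_mean k j : (\int[P]_w score k j (epsw w) = 0)%R.
Proof.
rewrite -(eta_mean k j) /Rintegral; congr fine; apply: ae_eq_integral => //.
- apply/measurable_EFinP.
  exact: measurableT_comp (measurable_score k j) (measurable_noise_path epsiid).
- exact/measurable_EFinP.
by have := score_eta k j; apply: filterS => w ->.
Qed.

Definition sum_cst : R := Num.sqrt (2 * step_cst s) * (4 * K).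

Lemma sqrt_block c (n : nat) (Dl : R) : 0 <= c -> 0 <= Dl ->
  Num.sqrt (c * (n%:R * Dl ^+ 2)) = Num.sqrt n%:R * (Num.sqrt c * Dl).
Proof.
move=> c0 D0; rewrite sqrtrM // sqrtrM ?ler0n // sqrtr_sqr ger0_norm //; ring.
Qed.

Lemma Lb_eta_sum (n : nat) (h : int) j :
  Lb P s (fun w => \sum_(1 <= l < n.+1) eta (l%:Z + h) j w) (Num.sqrt n%:R * sum_cst).
Proof.
have s2 : 2 < s by have := s4; lra.
have := @block_bound _ E R _ Om P eps eps' epsiid lag_bound (4 * K) lag_bound_ge0 lag_bound_sum s
   (fun l => score (l%:Z + h) j) n h 1 s2.
rewrite sqrt_block; last 2 first.
- by have := step_cst_ge1 s2; lra.
- by have := K_ge0; lra.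
move=> bb; apply: (Lb_dom s0 _ _ (bb _ _ _ _)).
- by apply: measurable_sum => l.
- have h1 : {ae P, forall w, forall l : nat, eta (l%:Z + h) j w = score (l%:Z + h) j (epsw w)}.
    by apply/ae_foralln => l; exact: score_eta.
  apply: filterS h1 => w hw; rewrite le_eqVlt; apply/orP; left; apply/eqP; congr `|_|.
  by apply: eq_bigr => l _; rewrite hw score_mean subr0.
- by move=> l; exact: measurable_score.
- by move=> l; apply: Lb_score_ae => //; apply: Lb_incr (eta2 _ _) => //; lra.
- by move=> l x y; exact: score_adapted.
- by move=> l m; exact: Lb_score_diff.
Qed.

(** A single score is the sum of one term. *)
Lemma Lb_eta k j : Lb P s (eta k j) sum_cst.
Proof.
have := Lb_eta_sum 1 (k - 1) j; rewrite sqrtr1 mul1r; congr Lb.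
by apply/funext => w; rewrite big_nat1; congr eta; ring.
Qed.

Section cross.
Variable h : nat.

Definition cross_fun (r i l : nat) (x : IS) : R := score (l%:Z + h%:Z) r x * score l%:Z i x.

Lemma measurable_cross_fun r i l : measurable_fun setT (cross_fun r i l).
Proof. by apply: measurable_funM; exact: measurable_score. Qed.

Definition cross_mean r i : R := Ex P (fun w => eta h%:Z r w * eta 0 i w).

(** Stationarity of the noise makes the mean of a lagged product independent of
    its time. *)
Lemma cross_fun_mean r i l : (\int[P]_w cross_fun r i l (epsw w) = cross_mean r i)%R.
Proof.
rewrite /cross_mean /Ex unlock -[fine _]/(\int[P]_w (eta h%:Z r w * eta 0 i w))%R.
transitivity (\int[P]_w cross_fun r i 0 (epsw w))%R.
  have := @shift_law _ E R _ Om P eps eps' epsiid (fun x => (cross_fun r i 0 x)%:E) l.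
  rewrite /Rintegral => <-; last by apply/measurable_EFinP; exact: measurable_cross_fun.
  congr fine; apply: eq_integral => w _; rewrite /cross_fun -!score_shift.
  by rewrite add0r [h%:Z + _]addrC.
rewrite /Rintegral; congr fine; apply: ae_eq_integral => //.
- apply/measurable_EFinP; exact: measurableT_comp (measurable_cross_fun r i 0) (measurable_noise_path epsiid).
- by apply/measurable_EFinP; exact: measurable_funM.
have := score_eta h%:Z r; have := score_eta 0 i.
by apply: filterS2 => w e1 e2 _; rewrite e1 e2 /cross_fun add0r.
Qed.

Lemma cross_mean_stationary r i (l : nat) : Ex P (fun w => eta (l + h)%N%:Z r w * eta l%:Z i w) = cross_mean r i.
Proof.
rewrite -(cross_fun_mean r i l) /Ex unlock /Rintegral; congr fine; apply: ae_eq_integral => //.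
- by apply/measurable_EFinP; exact: measurable_funM.
- apply/measurable_EFinP; exact: measurableT_comp (measurable_cross_fun r i l) (measurable_noise_path epsiid).
have := score_eta (l + h)%N%:Z r; have := score_eta l i.
by apply: filterS2 => w e1 e2 _; rewrite e1 e2 /cross_fun PoszD.
Qed.

Lemma cross_mean_le1 r i : `|cross_mean r i| <= 1.
Proof.
have := Lb_mul ltr01 (_ : Lb P (2 * 1) (eta h%:Z r) 1) (_ : Lb P (2 * 1) (eta 0 i) 1).
rewrite !mulr1 => /(_ (eta2 _ _) (eta2 _ _)); exact: Lb_Ex (lexx 1).
Qed.

Let sh := s / 2.
Let sh2 : 2 * sh = s. Proof. by rewrite /sh; field. Qed.
Let sh0 : 2 < sh. Proof. by rewrite /sh; have := s4; lra. Qed.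

(** A product at lag h feels an innovation through both its factors: through the
    later one at distance k, and through the earlier one, once k >= h, at
    distance k - h. *)
Definition cross_lag (k : nat) : R :=
  sum_cst * (lag_bound k + (if (h <= k)%N then lag_bound (k - h) else 0)).

Let sc0 : 0 <= sum_cst. Proof. by case: (Lb_eta 0 0). Qed.

Lemma cross_lag_ge0 k : 0 <= cross_lag k.
Proof.
rewrite mulr_ge0 // addr_ge0 ?lag_bound_ge0 //; case: ifP => // _; exact: lag_bound_ge0.
Qed.

Lemma cross_lag_sum N : \sum_(i < N) cross_lag i <= sum_cst * (8 * K).
Proof.
rewrite /cross_lag -mulr_sumr ler_wpM2l // big_split /=.
have h2 : \sum_(i < N) (if (h <= i)%N then lag_bound (i - h) else 0) <= 4 * K.
  have [Nh|hN] := leqP N h.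
    rewrite big1 ?mulr_ge0 ?K_ge0 // => i _; rewrite ifF //.
    by apply/negbTE; rewrite -ltnNge (leq_trans (ltn_ord i)).
  rewrite -(big_mkord xpredT (fun i => if (h <= i)%N then lag_bound (i - h) else 0)).
  rewrite (@big_cat_nat _ _ _ h) //=; last exact: ltnW.
  rewrite big_nat_cond big1 ?add0r; last by move=> i /andP[/andP[_ ih] _]; rewrite leqNgt ih.
  rewrite -{1}[h]add0n big_addn big_mkord; apply: le_trans (lag_bound_sum (N - h)).
  by apply: ler_sum => i _; rewrite leq_addl addnK.
by have := lag_bound_sum N; lra.
Qed.

(** Redrawing changes the two factors one at a time; each change is paired with
    the norm of the other factor. *)
Lemma Lb_cross_diff r i (l : nat) m :
  Lb P sh (fun w => cross_fun r i l (epsw w) - cross_fun r i l (epsm m w))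
     (zext cross_lag (l%:Z + h%:Z - m)).
Proof.
have L1 := Lb_score_diff (l%:Z + h%:Z) r m.
have L2 := Lb_score_diff l%:Z i m.
have Ly := Lb_score_ae s0 (Lb_eta l%:Z i).
have Lx := Lb_redrawn_path epsiid m (measurable_score _ _) (Lb_score_ae s0 (Lb_eta (l%:Z + h%:Z) r)).
rewrite -sh2 in L1 L2 Ly Lx.
have shp : 0 < sh by have := sh0; lra.
have sh1 : 1 <= sh by have := sh0; lra.
have L := Lb_add sh1 (Lb_mul shp L1 Ly) (Lb_mul shp Lx L2).
have -> : (fun w => cross_fun r i l (epsw w) - cross_fun r i l (epsm m w)) =
  (fun w => (score (l%:Z + h%:Z) r (epsw w) - score (l%:Z + h%:Z) r (epsm m w)) * score l%:Z i (epsw w)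
    + score (l%:Z + h%:Z) r (epsm m w) * (score l%:Z i (epsw w) - score l%:Z i (epsm m w))).
  by apply/funext => w; rewrite /cross_fun; ring.
apply: (Lb_le shp _ L).
rewrite /zext; case e : (l%:Z + h%:Z - m) => [n|n]; case e2 : (l%:Z - m) => [n2|n2] /=.
- have nE : n%:Z = n2%:Z + h%:Z by rewrite -e -e2; ring.
  have hn : (h <= n)%N by rewrite -lez_nat nE lerDr.
  have nh : (n - h)%N = n2.
    by move: nE; rewrite -PoszD => -[->]; rewrite addnK.
  by rewrite /cross_lag hn nh mulrDr mulrC.
- rewrite mulr0 addr0 mulrC /cross_lag ler_wpM2l // lerDl.
  by case: ifP => // _; exact: lag_bound_ge0.
- exfalso; have : n2%:Z + h%:Z = Negz n by rewrite -e -e2; ring.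
  by rewrite -PoszD.
- by rewrite mulr0 mul0r addr0.
Qed.

Definition cross_cst : R := Num.sqrt (2 * step_cst sh) * (sum_cst * (8 * K)).

Lemma Lb_cross_sum (n r i : nat) :
  Lb P sh (fun w => \sum_(1 <= l < n.+1) (eta (l + h)%N%:Z r w * eta l%:Z i w - cross_mean r i))
     (Num.sqrt n%:R * cross_cst).
Proof.
have shp : 0 < sh by have := sh0; lra.
have sh1 : 1 <= sh by have := sh0; lra.
have Lsc l j : Lb P 1 (fun w => cross_fun j i l (epsw w)) (sum_cst * sum_cst).
  have Ly := Lb_score_ae s0 (Lb_eta l%:Z i).
  have Lx := Lb_score_ae s0 (Lb_eta (l%:Z + h%:Z) j).
  rewrite -sh2 in Ly Lx.
  exact: Lb_incr (lexx 1) sh1 (Lb_mul shp Lx Ly).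
have := @block_bound _ E R _ Om P eps eps' epsiid cross_lag (sum_cst * (8 * K)) cross_lag_ge0 cross_lag_sum sh
   (fun l => cross_fun r i l) n h%:Z (sum_cst * sum_cst) sh0.
rewrite sqrt_block; last 2 first.
- by have := step_cst_ge1 sh0; lra.
- by rewrite mulr_ge0 // mulr_ge0 // K_ge0.
move=> bb; apply: (Lb_dom shp _ _ (bb _ _ _ _)).
- apply: measurable_sum => l; apply: measurable_funB => //; exact: measurable_funM.
- have h1 : {ae P, forall w, forall l : nat, eta (l + h)%N%:Z r w = score (l%:Z + h%:Z) r (epsw w)}.
    by apply/ae_foralln => l; rewrite -PoszD; exact: score_eta.
  have h2 : {ae P, forall w, forall l : nat, eta l%:Z i w = score l%:Z i (epsw w)}.
    by apply/ae_foralln => l; exact: score_eta.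
  apply: filterS2 h1 h2 => w hw1 hw2; rewrite le_eqVlt; apply/orP; left; apply/eqP; congr `|_|.
  by apply: eq_bigr => l _; rewrite hw1 hw2 cross_fun_mean.
- by move=> l; exact: measurable_cross_fun.
- by move=> l; exact: Lsc.
- move=> l x y xy; rewrite /cross_fun; congr (_ * _); apply: score_adapted => // k kl.
  by apply: xy; rewrite (le_trans kl) // lerDl.
- by move=> l m; exact: Lb_cross_diff.
Qed.

End cross.
End scores.

(** * Random weighted series *)

Section random_series.
Context d (T : measurableType d) (R : realType) (P : probability T R).
Variables (s A B : R) (c : nat -> R) (f : nat -> T -> R).
Hypotheses (s1 : 1 <= s) (c0 : forall k, 0 <= c k).
Hypothesis cA : forall N : nat, \sum_(k < N) c k <= A.
Hypothesis fB : forall k, Lb P s (f k) B.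

Let s0 : 0 < s. Proof. exact: lt_le_trans s1. Qed.
Let B0 : 0 <= B. Proof. by case: (fB 0%N). Qed.
Let A0 : 0 <= A. Proof. by apply: le_trans (cA 0%N); rewrite big_ord0. Qed.

Let G (N : nat) (w : T) : R := \sum_(k < N) c k * `|f k w|.

Let G0 N w : 0 <= G N w.
Proof. by apply: sumr_ge0 => k _; rewrite mulr_ge0. Qed.

Let LG N : Lb P s (G N) (A * B).
Proof.
apply: (@Lb_le _ _ _ P s _ (\sum_(k < N) `|c k| * B)) => //.
  rewrite -mulr_suml ler_wpM2r //; apply: le_trans (cA N).
  by apply: ler_sum => k _; rewrite ger0_norm.
by apply: Lb_sum => // k; apply: Lb_scale => //; exact: Lb_abs.
Qed.

Let Gs (N : nat) (w : T) : \bar R := (G N w `^ s)%:E.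

Let mGs N : measurable_fun setT (Gs N).
Proof.
have [mG _ _] := LG N; have := measurable_absX s mG.
by congr measurable_fun; apply/funext => w; rewrite /Gs ger0_norm.
Qed.

Let Gs0 N w : (0 <= Gs N w)%E. Proof. by rewrite lee_fin powR_ge0. Qed.

Let Gs_nd w : {homo (fun N => Gs N w) : n m / (n <= m)%N >-> (n <= m)%E}.
Proof.
move=> n m nm; rewrite lee_fin ge0_ler_powR ?nnegrE ?G0 ?(ltW s0) // /G.
rewrite -!(big_mkord xpredT (fun k => c k * `|f k w|)) (@big_cat_nat _ _ _ n 0 m) //=.
by rewrite lerDl sumr_ge0 // => k _; rewrite mulr_ge0.
Qed.

Let psi (w : T) : \bar R := limn (fun N => Gs N w).

Let psi_cvg w : (fun N => Gs N w) @ \oo --> psi w.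
Proof. apply: ereal_nondecreasing_is_cvgn; exact: Gs_nd. Qed.

Let mpsi : measurable_fun setT psi.
Proof. by apply: (emeasurable_fun_cvg Gs) => [m|w _]; [exact: mGs|exact: psi_cvg]. Qed.

Let psi_ge N w : (Gs N w <= psi w)%E.
Proof.
rewrite /psi (cvg_lim _ (ereal_nondecreasing_cvgn (@Gs_nd w))) //.
by apply: ereal_sup_ubound; exists N.
Qed.

Let psi0 w : (0 <= psi w)%E. Proof. exact: le_trans (Gs0 0 w) (psi_ge 0 w). Qed.

Let int_psi : (\int[P]_w psi w <= ((A * B) `^ s)%:E)%E.
Proof.
rewrite /psi monotone_convergence //.
apply: lime_le.
  apply: ereal_nondecreasing_is_cvgn => n m nm; apply: ge0_le_integral;
    [by []|by []|exact: mGs|exact: mGs|by move=> w _; exact: Gs_nd].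
apply: nearW => N; have [_ _ h] := LG N; apply: le_trans h.
rewrite le_eqVlt; apply/orP; left; apply/eqP; apply: eq_integral => w _.
by rewrite /Gs ger0_norm.
Qed.

Let good : set T := [set w | psi w \is a fin_num].

Let mgood : measurable good.
Proof.
rewrite (_ : good = setT `&` [set w | psi w \is a fin_num]); last by rewrite setTI.
exact: emeasurable_fin_num.
Qed.

Let good_ae : {ae P, forall w, good w}.
Proof.
have ip : P.-integrable setT psi.
  apply/integrableP; split; [exact: mpsi|].
  under eq_integral do rewrite gee0_abs //.
  exact: le_lt_trans int_psi (ltry _).
by have := integrable_ae measurableT ip; apply: filterS => w; apply.
Qed.

Let F (w : T) : R := fine (psi w) `^ s^-1.

Let F0 w : 0 <= F w. Proof. exact: powR_ge0. Qed.

Let mF : measurable_fun setT F.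
Proof.
apply: (measurableT_comp (measurable_powR _)).
exact: measurableT_comp (fine_measurable measurableT) mpsi.
Qed.

Let LF : Lb P s F (A * B).
Proof.
split; [exact: mF|exact: mulr_ge0|]; apply: le_trans int_psi.
apply: ge0_le_integral; [by []| |exact: measurable_absX mF|exact: mpsi|].
  by move=> w _; rewrite lee_fin powR_ge0.
move=> w _; rewrite ger0_norm // /F -powRrM mulVf ?gt_eqF // powRr1; last exact: fine_ge0.
by case: (psi w) (psi0 w) => //= r; rewrite leey.
Qed.

Let GF N w : good w -> G N w <= F w.
Proof.
move=> gw; have := psi_ge N w; rewrite -(fineK gw) lee_fin => h.
rewrite /F -[leLHS](_ : (G N w `^ s) `^ s^-1 = _).
  by rewrite ge0_ler_powR ?nnegrE ?powR_ge0 ?invr_ge0 ?(ltW s0) ?fine_ge0.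
by rewrite -powRrM mulfV ?gt_eqF // powRr1.
Qed.

(** By Minkowski's inequality the partial sums are bounded in L^s uniformly, and
    by monotone convergence so is their limit, which is finite almost
    everywhere. The bound is uniform in the number of terms outside one null
    set. *)
Lemma random_series_dominated : exists F : T -> R,
  [/\ Lb P s F (A * B), forall w, 0 <= F w &
      {ae P, forall w, forall N : nat, \sum_(k < N) c k * `|f k w| <= F w}].
Proof.
exists F; split; [exact: LF|exact: F0|].
by apply: filterS good_ae => w gw N; exact: GF.
Qed.

Let S (N : nat) (w : T) : R := \1_good w * series (fun k => c k * f k w) N.

Let mS N : measurable_fun setT (S N).
Proof.
apply: measurable_funM; first exact: measurable_indic.
rewrite (_ : (fun w => _) = (fun w => \sum_(k < N) c k * f k w)); last first.
  by apply/funext => w; rewrite /series /= big_mkord.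
apply: measurable_sum => k; apply: measurable_funM => //; by case: (fB k).
Qed.

Let S_le N w : `|S N w| <= F w.
Proof.
rewrite /S indicE; case: (boolP (w \in good)) => [|_]; last by rewrite mul0r normr0.
rewrite inE mul1r => gw; apply: le_trans (GF N gw); rewrite /series /= big_mkord.
apply: le_trans (ler_norm_sum _ _ _) _.
by apply: ler_sum => k _; rewrite normrM (ger0_norm (c0 k)).
Qed.

Let D (w : T) : R := limn (fun N => S N w).

Let S_cvg w : (fun N => S N w) @ \oo --> D w.
Proof.
suff : cvgn (fun N => S N w) by [].
rewrite /S indicE; case: (boolP (w \in good)) => [|_]; last first.
  by under eq_fun do rewrite mul0r; exact: is_cvg_cst.
rewrite inE => gw; under eq_fun do rewrite mul1r; apply: normed_cvg.
apply: (@nonneg_series_cvg _ (fun k => `|c k * f k w|) (F w)) => // N.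
by apply: le_trans (GF N gw); apply: ler_sum => k _; rewrite normrM (ger0_norm (c0 k)).
Qed.

(** Multiplying the partial sums by the indicator of the set where the
    dominating series is finite makes them converge everywhere, so that the
    limit is measurable. Dominated convergence then transports vanishing means. *)
Lemma random_series_limit : exists D : T -> R,
  [/\ Lb P s D (A * B),
      {ae P, forall w, series (fun k => c k * f k w) @ \oo --> D w} &
      (forall k, Ex P (f k) = 0) -> Ex P D = 0].
Proof.
have mD : measurable_fun setT D.
  by apply: (measurable_fun_cvg (h := S)) => [N|w _]; [exact: mS|exact: S_cvg].
have DF w : `|D w| <= F w.
  apply: (cvg_le_bound (u := fun N => `|S N w|) (N0 := 0)) => [|N _]; last exact: S_le.
  exact: cvg_norm (@S_cvg w).
exists D; split.
- by apply: (Lb_dom s0 mD _ LF); apply: aeW => w; rewrite (ger0_norm (F0 w)).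
- apply: filterS good_ae => w gw; have := @S_cvg w.
  by rewrite /S indicE mem_set //; under eq_fun do rewrite mul1r.
move=> f0.
have S0 N : Ex P (S N) = 0.
  have Lk k : Lb P s (fun w => c k * f k w) (`|c k| * B) by exact: Lb_scale.
  have -> : Ex P (S N) = Ex P (fun w => \sum_(k < N) c k * f k w).
    apply: Ex_ae; first by apply: measurable_sum => k; case: (Lk k).
    apply: filterS good_ae => w gw.
    by rewrite /S indicE mem_set // mul1r /series /= big_mkord.
  elim: N => [|N IH].
    by under eq_fun do rewrite big_ord0; exact: Ex_cst.
  under eq_fun do rewrite big_ord_recr /=.
  have LN : Lb P s (fun w => \sum_(k < N) c k * f k w) (\sum_(k < N) `|c k| * B).
    by apply: Lb_sum => // k; exact: Lk.
  by rewrite (Ex_add s1 LN (Lk N)) IH (Ex_scale _ s1 (fB N)) f0 mulr0 addr0.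
have mSE N : measurable_fun setT (fun w => (S N w)%:E) by apply/measurable_EFinP; exact: mS.
have mDE : measurable_fun setT (fun w => (D w)%:E) by exact/measurable_EFinP.
have cv : {ae P, forall w, setT w -> (fun N => (S N w)%:E) @ \oo --> (D w)%:E}.
  by apply: aeW => w _; apply: cvg_EFin; [exact: nearW|exact: S_cvg].
have dom : {ae P, forall w, forall N : nat, setT w -> (`|(S N w)%:E| <= (F w)%:E)%E}.
  by apply: aeW => w N _; rewrite abse_EFin lee_fin.
have iF := Lb_integrable s1 LF.
have [iD _ lim] := dominated_convergence measurableT mSE mDE cv iF dom.
have z N : (\int[P]_w (S N w)%:E = 0)%E.
  have := S0 N; rewrite ExE /Rintegral => hz.
  rewrite -[LHS]fineK ?hz //; apply: integrable_fin_num => //.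
  apply: le_integrable iF; [by []|exact: mSE|].
  by move=> w _; rewrite lee_fin (ger0_norm (F0 w)).
rewrite ExE /Rintegral (_ : (\int[P]_w (D w)%:E)%E = 0%E) //.
apply: (cvg_unique _ lim) => //.
by rewrite (_ : (fun n => _) = cst 0%E); [exact: cvg_cst|apply/funext => N; exact: z].
Qed.

End random_series.

(** * Decomposition of the entries of the sample operator *)

Section sample_cross_covariances.
Context dE (E : measurableType dE) (R : realType).
Context dO (Om : measurableType dO) (P : probability Om R).
Variables (g : nat -> (nat -> E) -> R) (eps eps' : int -> Om -> nat -> E).
Hypothesis epsiid : iid_with_copy P eps eps'.
Variable eta : int -> nat -> Om -> R.
Hypothesis meta : forall k j, measurable_fun setT (eta k j).
Hypothesis shiftE : is_bernoulli_shift P g eps eta.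
Hypothesis eta2 : forall k j, Lb P 2 (eta k j) 1.
Hypothesis eta_mean : forall k j, (\int[P]_w eta k j w = 0)%R.
Variables (s K b : R).
Hypotheses (s4 : 4 < s) (b32 : 3 / 2 < b).
Hypothesis dep : forall k : nat,
  (dep_coef P g eps eps' eta s k <= (K * (maxn k 1)%:R `^ (- b))%:E)%E.
Variables (lt : nat -> R) (Kw : R).
Hypothesis lt0 : forall r, 0 <= lt r.
Hypothesis ltK : forall N : nat, \sum_(r < N) lt r <= Kw.
Variables (h n : nat).
Hypothesis hn : (h < n)%N.

Local Notation N := (n - h)%N.
Local Notation cE := (cross_mean P eta h).

Let N0 : (0 < N)%N. Proof. by rewrite subn_gt0. Qed.
Let NR : (0 : R) < N%:R. Proof. by rewrite ltr0n. Qed.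
Let Nn : (N%:R : R) != 0. Proof. by rewrite gt_eqF. Qed.
Let sN : (0 : R) < Num.sqrt N%:R. Proof. by rewrite sqrtr_gt0. Qed.
Let sN2 : Num.sqrt (N%:R : R) ^+ 2 = N%:R. Proof. by rewrite sqr_sqrtr // ltW. Qed.

Let sc : R := sum_cst s K.
Let cc : R := cross_cst s K.
Let sh := s / 2.
Let qq := s / 4.
Let s0 : 0 < s. Proof. by have := s4; lra. Qed.
Let sh0 : 0 < sh. Proof. by have := s4; rewrite /sh; lra. Qed.
Let sh1 : 1 <= sh. Proof. by have := s4; rewrite /sh; lra. Qed.
Let qq0 : 0 < qq. Proof. by have := s4; rewrite /qq; lra. Qed.
Let qq1 : 1 <= qq. Proof. by have := s4; rewrite /qq; lra. Qed.
Let sh2 : 2 * sh = s. Proof. by rewrite /sh; field. Qed.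
Let qq2 : 2 * qq = sh. Proof. by rewrite /sh /qq; field. Qed.

Let Le k j : Lb P s (eta k j) sc.
Proof. exact: (Lb_eta epsiid meta shiftE eta2 eta_mean s4 b32 dep). Qed.

Let sc0 : 0 <= sc. Proof. by case: (Le 0 0). Qed.

Let LcS r i : Lb P sh (fun w => \sum_(1 <= l < N.+1)
  (eta (l + h)%N%:Z r w * eta l%:Z i w - cE r i)) (Num.sqrt N%:R * cc).
Proof. exact: (Lb_cross_sum epsiid meta shiftE eta2 eta_mean s4 b32 dep). Qed.

Let cE1 r i : `|cE r i| <= 1.
Proof. exact: cross_mean_le1 eta2 _ _ _. Qed.

Definition centred_product (l r i : nat) (w : Om) : R :=
  eta (l + h)%N%:Z r w * eta l%:Z i w - cE r i.
Local Notation Z := centred_product.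

Let LZ l r i : Lb P sh (Z l r i) (sc * sc + 1).
Proof.
apply: (Lb_le sh0 _ (Lb_sub sh1 (Lb_mul sh0 (_ : Lb P (2 * sh) (eta (l + h)%N r) sc)
  (_ : Lb P (2 * sh) (eta l i) sc)) (Lb_cst P sh (cE r i)))).
- by rewrite lerD2l.
- by rewrite sh2.
- by rewrite sh2.
Qed.

Let EZ l r i : Ex P (Z l r i) = 0.
Proof.
have Lp : Lb P sh (fun w => eta (l + h)%N%:Z r w * eta l%:Z i w) (sc * sc).
  by apply: Lb_mul; rewrite ?sh2.
rewrite (Ex_add sh1 Lp (Lb_cst P sh (- cE r i))) Ex_cst.
by rewrite (cross_mean_stationary epsiid meta shiftE h r i l) subrr.
Qed.

Let Ex_sum0 (I : Type) (rs : seq I) (F : I -> Om -> R) (A : R) : 0 <= A ->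
  (forall k, Lb P sh (F k) A) -> (forall k, Ex P (F k) = 0) ->
  Ex P (fun w => \sum_(k <- rs) F k w) = 0.
Proof.
move=> A0 LF EF; elim: rs => [|k rs IH].
  by under eq_fun do rewrite big_nil; exact: Ex_cst.
under eq_fun do rewrite big_cons.
by rewrite (Ex_add sh1 (LF k) (Lb_sum rs sh1 LF)) EF IH addr0.
Qed.

Definition mean_product (r i : nat) (w : Om) : R :=
  N%:R^-1 * \sum_(1 <= l < N.+1) Z l r i w.
Local Notation U := mean_product.

Let LU r i : Lb P sh (U r i) (cc / Num.sqrt N%:R).
Proof.
have := Lb_scale N%:R^-1 sh0 (LcS r i); apply: (Lb_le sh0).
rewrite ger0_norm ?invr_ge0 ?ler0n // -{1}sN2 le_eqVlt; apply/orP; left; apply/eqP.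
by field; rewrite gt_eqF.
Qed.

Let EU r i : Ex P (U r i) = 0.
Proof.
have A0 : 0 <= sc * sc + 1 := addr_ge0 (mulr_ge0 sc0 sc0) ler01.
rewrite (Ex_scale _ sh1 (LcS r i)).
have := @Ex_sum0 _ (index_iota 1 N.+1) (fun l => Z l r i) _ A0 (fun l => LZ l r i) (fun l => EZ l r i).
by move=> ->; rewrite mulr0.
Qed.

Definition smoothed i j r w : R := cE r j * U r i w + cE r i * U r j w.
Definition smoothed_at l i j r w : R := cE r j * Z l r i w + cE r i * Z l r j w.

Let Lpair (f f' : Om -> R) r i j t A : 1 <= t -> Lb P t f A -> Lb P t f' A ->
  Lb P t (fun w => cE r j * f w + cE r i * f' w) (2 * A).
Proof.
move=> t1 Lf Lf'; have t0 : 0 < t by exact: lt_le_trans t1.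
have A0 : 0 <= A by case: Lf.
have le1 (i' : nat) : `|cE r i'| * A <= A by rewrite ler_piMl.
rewrite mulr2n mulrDl mul1r; apply: Lb_add => //.
  exact: Lb_le (le1 j) (Lb_scale _ t0 Lf).
exact: Lb_le (le1 i) (Lb_scale _ t0 Lf').
Qed.

(** The definition of eta^D for an arbitrary array of scores and arbitrary
    summable weights. *)
Definition scaled_sample_D i j w : R :=
  N%:R^-1 * \sum_(1 <= l < N.+1)
    limn (series (fun r => lt r *
      ((eta (l + h)%N%:Z r w * eta l%:Z i w
        - Ex P (fun w => eta (l + h)%N%:Z r w * eta l%:Z i w))
         * Ex P (fun w => eta (l + h)%N%:Z r w * eta l%:Z j w)
     + (eta (l + h)%N%:Z r w * eta l%:Z j w
        - Ex P (fun w => eta (l + h)%N%:Z r w * eta l%:Z j w))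
         * Ex P (fun w => eta (l + h)%N%:Z r w * eta l%:Z i w))))
  + limn (series (fun r => lt r * cE r i * cE r j)).

Let mij i j := limn (series (fun r => lt r * cE r i * cE r j)).

(** The sum over time is inside the series in the linear part and outside it in
    eta^D. For each of the finitely many times the series converges almost
    surely, so the two orders of summation agree. *)
Lemma linear_part i j : exists D : Om -> R,
  [/\ Lb P sh D (Kw * (2 * (cc / Num.sqrt N%:R))), Ex P D = 0,
      {ae P, forall w, series (fun r => lt r * smoothed i j r w) @ \oo --> D w} &
      {ae P, forall w, scaled_sample_D i j w = D w + mij i j}].
Proof.
have [D [LD cD ED]] := random_series_limit sh1 lt0 ltK
  (fun r => @Lpair _ _ r i j _ _ sh1 (LU r i) (LU r j)).
have EDz : Ex P D = 0.
  apply: ED => r; have Ls k k' := Lb_scale (cE r k') sh0 (LU r k).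
  rewrite (Ex_add sh1 (Ls i j) (Ls j i)) (Ex_scale _ sh1 (LU r i)) (Ex_scale _ sh1 (LU r j)).
  by rewrite !EU !mulr0 addr0.
exists D; split=> //.
have cl : {ae P, forall w, forall l : nat, cvgn (series (fun r => lt r * smoothed_at l i j r w))}.
  apply/ae_foralln => l.
  have [D' [_ cD' _]] := random_series_limit sh1 lt0 ltK
    (fun r => @Lpair _ _ r i j _ _ sh1 (LZ l r i) (LZ l r j)).
  by apply: filterS cD' => w h1; apply/cvg_ex; exists (D' w).
apply: filterS2 cD cl => w hD hl; rewrite /scaled_sample_D; congr (_ + _).
have -> : \sum_(1 <= l < N.+1)
    limn (series (fun r => lt r *
      ((eta (l + h)%N%:Z r w * eta l%:Z i w
        - Ex P (fun w => eta (l + h)%N%:Z r w * eta l%:Z i w))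
         * Ex P (fun w => eta (l + h)%N%:Z r w * eta l%:Z j w)
     + (eta (l + h)%N%:Z r w * eta l%:Z j w
        - Ex P (fun w => eta (l + h)%N%:Z r w * eta l%:Z j w))
         * Ex P (fun w => eta (l + h)%N%:Z r w * eta l%:Z i w))))
  = \sum_(1 <= l < N.+1) limn (series (fun r => lt r * smoothed_at l i j r w)).
  apply: eq_bigr => l _; congr (limn (series _)); apply/funext => r.
  rewrite !(cross_mean_stationary epsiid meta shiftE h) /smoothed_at /centred_product; ring.
apply: (cvg_unique _ _ hD) => //.
rewrite (_ : series _ = (fun M => N%:R^-1 * \sum_(1 <= l < N.+1) series (fun r => lt r * smoothed_at l i j r w) M)).
  apply: cvgM; first exact: cvg_cst.
  rewrite big_add1 /= big_mkord.
  under eq_fun do rewrite big_add1 /= big_mkord.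
  by apply: (cvg_finite_sum (F := fun M (l : 'I_N) => series (fun r => lt r * smoothed_at l.+1 i j r w) M)
     (l := fun l : 'I_N => limn (series (fun r => lt r * smoothed_at l.+1 i j r w)))) => l; exact: hl.
apply/funext => M; rewrite /series /= exchange_big /= mulr_sumr; apply: eq_bigr => r _.
have -> : \sum_(1 <= l < N.+1) lt r * smoothed_at l i j r w =
    lt r * (cE r j * \sum_(1 <= l < N.+1) Z l r i w + cE r i * \sum_(1 <= l < N.+1) Z l r j w).
  by rewrite !mulr_sumr -big_split mulr_sumr.
by rewrite /smoothed /mean_product; ring.
Qed.

Definition mean_eta (r : nat) (w : Om) : R := n%:R^-1 * \sum_(1 <= k < n.+1) eta k%:Z r w.
Local Notation eb := mean_eta.

(** The sample cross moment at lag h, centred by empirical means, on the scale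
    of the normalised scores. *)
Definition sample_product (r i : nat) (w : Om) : R :=
  N%:R^-1 * \sum_(1 <= k < N.+1) (eta (k + h)%N%:Z r w - eb r w) * (eta k%:Z i w - eb i w).
Local Notation B := sample_product.

Let early i w : R := N%:R^-1 * \sum_(1 <= k < N.+1) eta k%:Z i w.
Let late r w : R := N%:R^-1 * \sum_(1 <= k < N.+1) eta (k + h)%N%:Z r w.
Let V r i w : R := eb r w * eb i w - eb r w * early i w - late r w * eb i w.

Let B_split r i w : B r i w = cE r i + U r i w + V r i w.
Proof.
have card1 (a : R) : \sum_(1 <= k < N.+1) a = N%:R * a.
  by rewrite big_const_nat subn1 /= iter_addr_0 mulr_natl.
have e1 : \sum_(1 <= k < N.+1) (eta (k + h)%N%:Z r w - eb r w) * (eta k%:Z i w - eb i w)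
  = \sum_(1 <= l < N.+1) Z l r i w + \sum_(1 <= l < N.+1) (cE r i + eb r w * eb i w)
    - eb r w * (\sum_(1 <= k < N.+1) eta k%:Z i w) - (\sum_(1 <= k < N.+1) eta (k + h)%N%:Z r w) * eb i w.
  rewrite mulr_sumr mulr_suml -big_split -!sumrB /=; apply: eq_bigr => k _.
  rewrite /centred_product; ring.
by rewrite /sample_product e1 card1 /mean_product /V /early /late; field.
Qed.

Let v := sc / Num.sqrt N%:R.

Let scaled_sum_le (f : Om -> R) (m : nat) : (N <= m)%N ->
  Lb P s f (Num.sqrt m%:R * sc) -> Lb P s (fun w => m%:R^-1 * f w) v.
Proof.
move=> Nm Lf; have m0 : (0 : R) < m%:R by rewrite ltr0n (leq_trans N0).
have sm : 0 < Num.sqrt (m%:R : R) by rewrite sqrtr_gt0.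
apply: (Lb_le s0 _ (Lb_scale _ s0 Lf)); rewrite ger0_norm ?invr_ge0 ?ler0n //.
have -> : m%:R^-1 * (Num.sqrt m%:R * sc) = sc / Num.sqrt m%:R.
  by rewrite -{1}(sqr_sqrtr (ltW m0)); field; rewrite gt_eqF.
by rewrite ler_wpM2l // lef_pV2 ?posrE // ler_wsqrtr // ler_nat.
Qed.

Let Leb r : Lb P s (eb r) v.
Proof.
apply: scaled_sum_le; first exact: leq_subr.
have := Lb_eta_sum epsiid meta shiftE eta2 eta_mean s4 b32 dep n 0 r.
by under eq_fun do under eq_bigr do rewrite addr0.
Qed.

Let Learly r : Lb P s (early r) v.
Proof.
apply: scaled_sum_le => //.
have := Lb_eta_sum epsiid meta shiftE eta2 eta_mean s4 b32 dep N 0 r.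
by under eq_fun do under eq_bigr do rewrite addr0.
Qed.

Let Llate r : Lb P s (late r) v.
Proof.
apply: scaled_sum_le => //.
exact: (Lb_eta_sum epsiid meta shiftE eta2 eta_mean s4 b32 dep N h%:Z r).
Qed.

Let LV r i : Lb P sh (V r i) (3 * v ^+ 2).
Proof.
have M f f' : Lb P s f v -> Lb P s f' v -> Lb P sh (fun w => f w * f' w) (v * v).
  by move=> Lf Lf'; apply: Lb_mul; rewrite ?sh2.
have := Lb_sub sh1 (Lb_sub sh1 (M _ _ (Leb r) (Leb i)) (M _ _ (Leb r) (Learly i)))
  (M _ _ (Llate r) (Leb i)).
by apply: (Lb_le sh0); rewrite le_eqVlt; apply/orP; left; apply/eqP; ring.
Qed.

Let W r i w := U r i w + V r i w.
Definition noise_cst : R := cc + 3 * sc ^+ 2.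

Let LW r i : Lb P sh (W r i) (noise_cst / Num.sqrt N%:R).
Proof.
apply: (Lb_le sh0 _ (Lb_add sh1 (LU r i) (LV r i))).
rewrite /noise_cst [leRHS]mulrDl lerD2l /v expr_div_n sN2 -mulrA ler_wpM2l // ler_wpM2l ?sqr_ge0 //.
rewrite lef_pV2 ?posrE // -{2}sN2 expr2 ler_peMl ?sqrtr_ge0 //.
by rewrite -[leLHS]sqrtr1 ler_wsqrtr // ler1n.
Qed.

Let rem i j r w : R := (cE r j * V r i w + cE r i * V r j w) + W r i w * W r j w.
Definition quadratic_cst : R := 6 * sc ^+ 2 + noise_cst ^+ 2.

Let Lrem i j r : Lb P qq (rem i j r) (quadratic_cst / N%:R).
Proof.
have LVq k l : Lb P qq (V k l) (3 * v ^+ 2).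
  by apply: Lb_incr (LV k l) => //; rewrite /sh /qq; have := s4; lra.
have LWW : Lb P qq (fun w => W r i w * W r j w) (noise_cst / Num.sqrt N%:R * (noise_cst / Num.sqrt N%:R)).
  by apply: Lb_mul; [exact: qq0|rewrite qq2; exact: LW|rewrite qq2; exact: LW].
apply: (Lb_le qq0 _ (Lb_add qq1 (@Lpair _ _ r i j _ _ qq1 (LVq r i) (LVq r j)) LWW)).
rewrite le_eqVlt; apply/orP; left; apply/eqP.
by rewrite /quadratic_cst /v -[in RHS]sN2; field; rewrite gt_eqF.
Qed.

(** Each sample cross moment is its mean plus U plus V, where U is the average
    of centred products and V collects the terms with an empirical mean. In the
    product of two cross moments the terms linear in U form the linear part; the
    others contain V, or two centred factors, and are of order 1/N. *)
Lemma sample_entry i j : exists D D' : Om -> R,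
  [/\ Lb P sh D (Kw * (2 * (cc / Num.sqrt N%:R))), Ex P D = 0,
      Lb P qq D' (Kw * (quadratic_cst / N%:R)),
      {ae P, forall w, scaled_sample_D i j w = D w + mij i j} &
      {ae P, forall w, series (fun r => lt r * (B r i w * B r j w)) @ \oo -->
        mij i j + D w + D' w}].
Proof.
have [D [LD ED cD eD]] := linear_part i j.
have [D' [LD' cD' _]] := random_series_limit qq1 lt0 ltK (Lrem i j).
exists D, D'; split=> //.
have cm : series (fun r => lt r * cE r i * cE r j) @ \oo --> mij i j.
  apply: normed_cvg; apply: (@nonneg_series_cvg _ (fun r => `|lt r * cE r i * cE r j|) Kw) => // M.
  apply: le_trans (ltK M); apply: ler_sum => r _; rewrite !normrM ger0_norm // -mulrA.
  by rewrite ler_piMr // mulr_ile1.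
apply: filterS2 cD cD' => w h1 h2.
rewrite (_ : series _ = (fun M => series (fun r => lt r * cE r i * cE r j) M
  + series (fun r => lt r * smoothed i j r w) M + series (fun r => lt r * rem i j r w) M)).
  by apply: cvgD h2; exact: cvgD cm h1.
apply/funext => M; rewrite /series /= -!big_split /=; apply: eq_bigr => r _.
rewrite !B_split /smoothed /rem /W; ring.
Qed.

End sample_cross_covariances.

(** * Entries of the sample operator in the basis of scores *)

Section sample_operator_entries.
Context dS (S : measurableType dS) (R : realType).
Variable mu : {measure set S -> \bar R}.
Context dO (Om : measurableType dO) (P : probability Om R).
Context dE (E : measurableType dE).
Variables (X : int -> Om -> L2 mu) (e : nat -> L2 mu) (C : R) (h n : nat).
Hypothesis eb : orthonormal_basis e.
Hypothesis Xre : forall k, random_element (X k).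
Hypothesis Xst : stationary P X.
Hypothesis C0 : 0 <= C.
Hypothesis XC : forall k, ('E_P[fun w => (l2norm (X k w) ^+ 2)%R] <= C%:E)%E.
Hypothesis hn : (h < n)%N.

Local Notation lt := (lamt P X e).
Local Notation et := (eta P X e).
Local Notation cE := (crossE P X h e).
Local Notation N := (n - h)%N.

Let n0 : (0 < n)%N. Proof. exact: leq_ltn_trans hn. Qed.
Let nR : (n%:R : R) != 0. Proof. by rewrite pnatr_eq0 -lt0n. Qed.

Lemma smean_dot w v :
  l2dot (smean X n w) v = n%:R^-1 * \sum_(1 <= l < n.+1) l2dot (X l%:Z w) v.
Proof. by rewrite l2dotZl l2dot_suml. Qed.

Lemma resid_coef k w i : l2dot (resid X n k w) (e i) =
  coef P X e k%:Z i w - n%:R^-1 * \sum_(1 <= l < n.+1) coef P X e l%:Z i w.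
Proof.
have cf (l : int) : coef P X e l i w = l2dot (X l w) (e i) - l2dot (l2mean P (X 0)) (e i).
  exact: Xc_dot.
apply: (etrans (l2dotBl _ _ _)); rewrite cf.
have -> : \sum_(1 <= l < n.+1) coef P X e l%:Z i w =
    \sum_(1 <= l < n.+1) (l2dot (X l%:Z w) (e i) - l2dot (l2mean P (X 0)) (e i)).
  by apply: eq_bigr => l _; exact: cf.
rewrite sumrB big_const_nat subn1 iter_addr_0.
apply: (etrans (congr1 (fun z => l2dot (X k%:Z w) (e i) - z) (smean_dot w (e i)))).
move: (l2dot (X k%:Z w) (e i)) (l2dot (l2mean P (X 0)) (e i)) (\sum_(1 <= i0 < n.+1) _) => x y z.
by rewrite -mulr_natl /=; field.
Qed.

(** One null set serves all times and all components. *)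
Lemma resid_eta : {ae P, forall w, forall (k i : nat), l2dot (resid X n k w) (e i) =
  Num.sqrt (lt i) * (et k%:Z i w - mean_eta et n i w)}.
Proof.
apply/ae_foralln => k; apply/ae_foralln => i.
have all_l : {ae P, forall w, forall l : nat, coef P X e l%:Z i w = Num.sqrt (lt i) * et l%:Z i w}.
  by apply/ae_foralln => l; exact: (coef_eta eb Xre Xst C0 XC).
apply: filterS all_l => w H; apply: (etrans (resid_coef k w i)).
rewrite H (eq_bigr _ (fun l _ => H l)) -mulr_sumr /mean_eta mulrBr; congr (_ - _).
by rewrite mulrCA.
Qed.

Lemma lagC_hat_coef : {ae P, forall w, forall (i r : nat),
  l2dot (e r) (lagC_hat X h n w (e i)) =
  Num.sqrt (lt r) * Num.sqrt (lt i) * sample_product et h n r i w}.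
Proof.
apply: filterS resid_eta => w H i r.
apply: (etrans (l2dotC _ _)); apply: (etrans (lagC_hat_dot _ _ _ _ _ _)).
have -> : \sum_(1 <= k < N.+1) l2dot (resid X n (k + h) w) (e r) * l2dot (resid X n k w) (e i) =
  \sum_(1 <= k < N.+1) (Num.sqrt (lt r) * (et (k + h)%N%:Z r w - mean_eta et n r w)) *
    (Num.sqrt (lt i) * (et k%:Z i w - mean_eta et n i w)).
  by apply: eq_bigr => k _; exact: (congr2 *%R (H (k + h)%N r) (H k i)).
rewrite /sample_product mulrCA; congr (_ * _); rewrite mulr_sumr; apply: eq_bigr => k _.
by rewrite mulrACA.
Qed.

(** Parseval's identity for the images of two basis vectors under the sample lag
    operator. *)
Lemma lagD_hat_entry : {ae P, forall w, forall (i j : nat) (L : R),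
  series (fun r => lt r * (sample_product et h n r i w * sample_product et h n r j w)) @ \oo --> L ->
  l2dot (lagD_hat X h n w (e i)) (e j) = Num.sqrt (lt i * lt j) * L}.
Proof.
apply: filterS lagC_hat_coef => w H i j L HL.
apply: (etrans (lagD_hat_dot _ _ _ _ _ _)).
have p := parseval eb (u := lagC_hat X h n w (e i)) (v := lagC_hat X h n w (e j)).
apply: (cvg_unique _ p) => //.
have -> : (fun M => \sum_(k < M) l2dot (e k) (lagC_hat X h n w (e i)) *
    l2dot (e k) (lagC_hat X h n w (e j))) =
  (fun M => Num.sqrt (lt i * lt j) *
    series (fun r => lt r * (sample_product et h n r i w * sample_product et h n r j w)) M).
  apply/funext => M; rewrite /series /= big_mkord mulr_sumr; apply: eq_bigr => r _.
  apply: (etrans (congr2 *%R (H i r) (H j r))); rewrite sqrtrM ?lamt_ge0 //.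
  have := sqr_sqrtr (lamt_ge0 P X e r).
  move: (sample_product et h n r i w) (sample_product et h n r j w) (lt r) (Num.sqrt (lt r))
    (Num.sqrt (lt i)) (Num.sqrt (lt j)).
  by move=> b1 b2 l x y z <-; ring.
by apply: cvgM; [exact: cvg_cst|exact: HL].
Qed.

Variables (g : nat -> (nat -> E) -> R) (eps eps' : int -> Om -> nat -> E) (s K b : R).
Hypothesis epsiid : iid_with_copy P eps eps'.
Hypothesis shiftE : is_bernoulli_shift P g eps et.
Hypotheses (s4 : 4 < s) (b32 : 3 / 2 < b).
Hypothesis dep : forall k : nat,
  (dep_coef P g eps eps' et s k <= (K * (maxn k 1)%:R `^ (- b))%:E)%E.

Let Kw := 4 * C.
Local Notation m := (scaled_entry P X e h).
Local Notation cc := (cross_cst s K).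
Local Notation kq := (quadratic_cst s K).

(** When the variance of one of the two scores is 0, its normalised score is 0
    by convention; the whole series vanishes, and so does the remainder. *)
Lemma etaD_decomposition i j : exists D D' : Om -> R,
  [/\ Lb P (s / 2) D (Kw * (2 * (cc / Num.sqrt N%:R))), Ex P D = 0,
      Lb P (s / 4) D' (Kw * (kq / N%:R)),
      {ae P, forall w, etaD P X h e n i j w = m i j + D w} &
      {ae P, forall w, [/\ etaR P X h e n i j w = - D' w,
        l2dot (lagD_hat X h n w (e i)) (e j) =
          Num.sqrt (lt i * lt j) * (etaD P X h e n i j w - etaR P X h e n i j w) &
        l2dot (lagD_hat X h n w (e i)) (e j) = Num.sqrt (lt i * lt j) * (m i j + D w + D' w)]}].
Proof.
have meta k r := measurable_eta P e Xre k r.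
have em k r : (\int[P]_w et k r w = 0)%R.
  by rewrite -ExE; exact: (eta_mean0 eb Xre Xst C0 XC).
have [D [D' [LD ED LD' eD cB]]] := sample_entry epsiid meta shiftE (Lb_eta2 eb Xre Xst C0 XC)
  em s4 b32 dep (lamt_ge0 P X e) (lamt_sum eb Xre Xst C0 XC) hn i j.
exists D, D'; split=> //.
  by apply: filterS eD => w; rewrite addrC.
apply: filterS3 eD cB lagD_hat_entry => w h1 h2 h3.
have h4 := h3 i j _ h2.
have eDw : etaD P X h e n i j w = D w + m i j by exact: h1.
have eR : etaR P X h e n i j w = - D' w.
  rewrite /etaR; apply: (etrans (congr2 (fun x y => x - (Num.sqrt (lt i * lt j))^-1 * y) eDw h4)).
  have [z|nz] := eqVneq (Num.sqrt (lt i * lt j)) 0; last first.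
    have rl (u v z : R) : v + u - (u + v + z) = - z by ring.
    by rewrite mulKf //; exact: rl.
  (* in the degenerate case every term of the series contains a vanishing score *)
  have L0 : m i j + D w + D' w = 0.
    have := h2; rewrite (_ : series _ = cst 0); last first.
      apply/funext => M; rewrite /series /= big1 // => r _.
      have d (i' : nat) : Num.sqrt (lt i') = 0 -> sample_product et h n r i' w = 0.
        move=> z'; rewrite /sample_product big1 ?mulr0 // => k _.
        have e0 (k' : int) : et k' i' w = 0 by rewrite /eta z' invr0 mulr0.
        have m0 : mean_eta et n i' w = 0.
          by rewrite /mean_eta big1 ?mulr0 // => l _; exact: e0.
        by rewrite e0 m0 subrr mulr0.
      move/eqP: z; rewrite sqrtrM ?lamt_ge0 // mulf_eq0 => /orP[] /eqP /d ->;
        by rewrite ?mul0r ?mulr0.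
    by move=> h5; apply/esym; apply: (cvg_unique _ (cvg_cst _) h5).
  rewrite z invr0 mul0r subr0; apply/eqP; rewrite -subr_eq0 opprK; apply/eqP.
  by rewrite -[RHS]L0; ring.
split; [exact: eR| |exact: h4].
apply: (etrans h4); congr (_ * _); apply: esym.
have rl (u v z : R) : v + u - - z = u + v + z by ring.
exact: (etrans (congr2 (fun x y => x - y) eDw eR) (rl _ _ _)).
Qed.

End sample_operator_entries.

(** * Error bounds valid without smallness of the perturbation *)

Section one_eigenpair.
Context dS (S : measurableType dS) (R : realType).
Variable mu : {measure set S -> \bar R}.
Variables (A : L2 mu -> L2 mu) (lh : nat -> R) (eh : nat -> L2 mu).
Hypothesis esys : is_eigensystem A lh eh.
Hypothesis Apos : forall v, 0 <= l2dot (A v) v.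
Variables (e : nat -> L2 mu) (lam : nat -> R) (E z : nat -> nat -> R) (j : nat) (x B t : R).
Hypothesis eb : orthonormal_basis e.
Hypotheses (lam0 : forall i, 0 <= lam i) (lam_nd : forall i k, (i <= k)%N -> lam k <= lam i).
Hypothesis entries : forall i k, l2dot (A (e i)) (e k) = (if i == k then lam i else 0) + E i k.
Hypotheses (lamj : 0 < lam j) (x0 : 0 < x) (x1 : x <= 1).
Hypothesis sep : forall k, k != j -> 2 * (x * lam j) <= `|lam j - lam k|.
Hypothesis z0 : forall i k, 0 <= z i k.
Hypothesis Ez : forall i k, E i k ^+ 2 <= lam i * lam k * z i k.
Hypothesis BE : forall N : nat,
  \sum_(k < N) \sum_(i < N) wgt lam j x k * (wgt lam j x i * z i k) <= B.
Hypothesis tE : forall M N : nat,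
  x * \sum_(k < M | (k : nat) != j) ell lam j k * \sum_(i < N) wgt lam j x i * z i k <= t.
Hypothesis sgn : 0 <= l2dot (eh j) (e j).

Let a k := l2dot (e k) (eh j).

Let B0 : 0 <= B. Proof. by apply: le_trans (BE 0); rewrite big_ord0. Qed.
Let t0 : 0 <= t. Proof. by apply: le_trans (tE 0 0); rewrite big_ord0 mulr0. Qed.
Let sB0 : 0 <= Num.sqrt B. Proof. exact: sqrtr_ge0. Qed.
Let sB2 : Num.sqrt B ^+ 2 = B. Proof. exact: sqr_sqrtr. Qed.
Let st0 : 0 <= Num.sqrt t. Proof. exact: sqrtr_ge0. Qed.
Let st2 : Num.sqrt t ^+ 2 = t. Proof. exact: sqr_sqrtr. Qed.
Let lam_ub i : lam i <= lam 0%N. Proof. exact: lam_nd. Qed.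

Let unit_eh : l2dot (eh j) (eh j) = 1.
Proof. by case: esys => on _ _; rewrite on eqxx. Qed.

Let unit_e k : l2dot (e k) (e k) = 1. Proof. by rewrite eb.1 eqxx. Qed.

Let a1 : (fun N => \sum_(k < N) a k ^+ 2) @ \oo --> (1 : R).
Proof.
rewrite -unit_eh (_ : (fun N => _) = (fun N => \sum_(k < N) l2dot (e k) (eh j) * l2dot (e k) (eh j))).
  exact: (parseval eb).
by apply/funext => N; apply: eq_bigr => k _; rewrite expr2.
Qed.

Let a_partial N : \sum_(k < N) a k ^+ 2 <= 1.
Proof. by rewrite -unit_eh; exact: bessel eb.1. Qed.

Let aj0 : 0 <= a j. Proof. by rewrite /a l2dotC. Qed.

Let eqn k : (fun N => \sum_(i < N) E i k * a i) @ \oo --> (lh j - lam k) * a k.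
Proof. exact: (eig_equation esys eb entries). Qed.

Let Esym i k : E i k = E k i.
Proof.
have := eig_sym esys (e i) (e k); rewrite !entries eq_sym.
by case: eqP => [->|_]; [move/addrI|rewrite !add0r].
Qed.

Let lh0 : 0 <= lh j. Proof. exact: eig_ge0 esys Apos j. Qed.

(** The form of the perturbation on unit vectors is at most lam 0 * sqrt B,
    since each lam i is at most lam 0 times its weight. *)
Lemma eigenvalue_crude : lh j <= lam 0%N * (1 + Num.sqrt B).
Proof.
have lw i : lam i <= lam 0%N * wgt lam j x i.
  rewrite /wgt; case: eqP => [->|/eqP ij].
    apply: (le_trans (lam_ub j)); rewrite ler_peMr ?lam0 //.
    by rewrite -(invr1 R) lef_pV2 ?posrE.
  have g0 : 0 < `|lam j - lam i|.
    by apply: lt_le_trans (sep ij); rewrite !mulr_gt0.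
  rewrite mulrCA ler_peMr ?lam0 // ler_pdivlMr // mul1r.
  by rewrite ler_norml; have := lam0 i; have := lam0 j; have := lam_ub i; have := lam_ub j; lra.
have form (M N : nat) : (M <= N)%N ->
    \sum_(k < M) a k * \sum_(i < N) E i k * a i <= lam 0%N * Num.sqrt B.
  move=> MN; apply: le_trans (ler_norm _) _.
  rewrite -(ler_pXn2r (_ : (0 < 2)%N)) ?nnegrE ?mulr_ge0 ?lam0 // exprMn sB2.
  rewrite real_normK ?num_real //.
  have -> : \sum_(k < M) a k * \sum_(i < N) E i k * a i =
      \sum_(p : 'I_M * 'I_N) a p.1 * (E p.2 p.1 * a p.2).
    by rewrite -(pair_bigA _ (fun (k : 'I_M) (i : 'I_N) => a k * (E i k * a i))) /=;
      apply: eq_bigr => k _; rewrite mulr_sumr.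
  apply: le_trans (@sum_CS _ _ _ _ _
    (fun p : 'I_M * 'I_N => lam 0%N ^+ 2 * (wgt lam j x p.1 * (wgt lam j x p.2 * z p.2 p.1)))
    (fun p => a p.1 ^+ 2 * a p.2 ^+ 2) _ _ _) _.
  - by move=> p; rewrite !mulr_ge0 ?sqr_ge0 ?wgt_ge0.
  - by move=> p; rewrite mulr_ge0 ?sqr_ge0.
  - move=> p; rewrite mulrCA exprMn exprMn; apply: ler_wpM2r; first by rewrite mulr_ge0 ?sqr_ge0.
    apply: (le_trans (Ez _ _)); rewrite expr2.
    have -> : lam 0%N * lam 0%N * (wgt lam j x p.1 * (wgt lam j x p.2 * z p.2 p.1)) =
      (lam 0%N * wgt lam j x p.2) * (lam 0%N * wgt lam j x p.1) * z p.2 p.1 by ring.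
    by apply: ler_wpM2r => //; apply: ler_pM.
  rewrite -[leRHS]mulr1; apply: ler_pM.
  - by apply: sumr_ge0 => p _; rewrite !mulr_ge0 ?sqr_ge0 ?wgt_ge0.
  - by apply: sumr_ge0 => p _; rewrite mulr_ge0 ?sqr_ge0.
  - rewrite -mulr_sumr ler_wpM2l ?sqr_ge0 //; apply: le_trans (BE N).
    rewrite -(pair_bigA _ (fun (k : 'I_M) (i : 'I_N) => wgt lam j x k * (wgt lam j x i * z i k))) /=.
    rewrite (big_ord_widen _ (fun k => \sum_(i < N) wgt lam j x k * (wgt lam j x i * z i k)) MN).
    rewrite [leRHS](bigID (fun k : 'I_N => (k < M)%N)) /= lerDl.
    by apply: sumr_ge0 => k _; apply: sumr_ge0 => i _; rewrite !mulr_ge0 ?wgt_ge0.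
  - rewrite -(pair_bigA _ (fun (k : 'I_M) (i : 'I_N) => a k ^+ 2 * a i ^+ 2)) /=.
    under eq_bigr do rewrite -mulr_sumr.
    by rewrite -mulr_suml mulr_ile1 ?a_partial // sumr_ge0 // => k _; rewrite sqr_ge0.
have part (M : nat) : lh j * \sum_(k < M) a k ^+ 2 <= lam 0%N * (1 + Num.sqrt B).
  have lim : (fun N => \sum_(k < M) a k * \sum_(i < N) E i k * a i) @ \oo -->
      \sum_(k < M) a k * ((lh j - lam k) * a k).
    apply: (cvg_finite_sum (F := fun N (k : 'I_M) => a k * \sum_(i < N) E i k * a i)) => k.
    by apply: cvgM; [exact: cvg_cst|exact: eqn].
  have := cvg_le_bound lim (form M).
  have -> : \sum_(k < M) a k * ((lh j - lam k) * a k) =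
      lh j * (\sum_(k < M) a k ^+ 2) - \sum_(k < M) lam k * a k ^+ 2.
    by rewrite mulr_sumr -sumrB; apply: eq_bigr => k _; ring.
  have : \sum_(k < M) lam k * a k ^+ 2 <= lam 0%N.
    apply: (@le_trans _ _ (lam 0%N * \sum_(k < M) a k ^+ 2)).
      by rewrite mulr_sumr; apply: ler_sum => k _; rewrite ler_wpM2r ?sqr_ge0.
    by rewrite ler_piMr // a_partial.
  lra.
have lim : (fun N => lh j * \sum_(k < N) a k ^+ 2) @ \oo --> lh j * 1.
  by apply: cvgM; [exact: cvg_cst|exact: a1].
by rewrite -[lh j]mulr1; apply: (cvg_le_bound (N0 := 0%N) lim) => N _; exact: part.
Qed.

Let close (B64 : B <= 64^-1) : `|lh j - lam j| <= x * lam j.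
Proof.
have B1 : B <= 1 by apply: le_trans B64 _; rewrite invf_le1 // ler1n.
exact: (eig_close esys Apos eb lam0 lam_nd entries lamj x0 sep z0 Ez BE B1).
Qed.

Section powers.
Variable m : nat.
Hypothesis m0 : (0 < m)%N.

Let big_pow (B64 : 64^-1 < B) : 1 <= 64 * B <= (64 * B) ^+ m.
Proof.
have h : 1 <= 64 * B by rewrite mulrC -ler_pdivrMr // ltW // mul1r.
by rewrite h /= -[leLHS]expr1 ler_weXn2l.
Qed.

Let big_root (B64 : 64^-1 < B) : 1 <= 8 * Num.sqrt B.
Proof.
by have /andP[h _] := big_pow B64; have := sB2; have := sB0; nra.
Qed.

Let pow0 : 0 <= (64 * B) ^+ m.
Proof. by rewrite exprn_ge0 // mulr_ge0. Qed.

(** For B <= 1/64 this is the bound in coordinates. Otherwise each of the three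
    terms on the left is at most a multiple of lam 0 * sqrt B or of lam 0, and
    any positive power of 64 B > 1 may be inserted. *)
Theorem eigenvalue_expansion :
  `|lh j - lam j - E j j| <= 3 * x * B * lam j + 3 * lam 0%N * (64 * B) ^+ m.
Proof.
have l0 := lam0 0.
have [B64|B64] := leP B 64^-1.
  apply: (le_trans (value_bound lam0 lam_ub lamj x0 sep z0 Ez BE a1 eqn aj0 (close B64) B64)).
  by rewrite lerDl mulr_ge0 ?mulr_ge0.
have /andP[h1 h2] := big_pow B64; have h3 := big_root B64.
have d := diag_bound lam0 lamj x0 z0 Ez BE.
have c := eigenvalue_crude; have u := lam_ub j; have l1 := lh0.
have sB8 : Num.sqrt B <= 8 * B by have := sB2; have := sB0; nra.
have xs : lam j * (x * Num.sqrt B) <= lam 0%N * Num.sqrt B.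
  by apply: ler_pM; rewrite ?mulr_ge0 ?(ltW lamj) ?(ltW x0) // ler_piMl.
have main : `|lh j - lam j - E j j| <= lam 0%N * (2 + 2 * Num.sqrt B).
  have lj := ltW lamj; have ls : 0 <= lam 0%N * Num.sqrt B by rewrite mulr_ge0.
  by move: d; rewrite !ler_norml => /andP[d1 d2]; apply/andP; split; lra.
apply: (le_trans main); apply: (@le_trans _ _ (3 * lam 0%N * (64 * B) ^+ m)).
  rewrite mulrC -mulrA [lam 0%N * _]mulrC mulrA ler_wpM2r //; nra.
by rewrite lerDr !mulr_ge0 // ltW.
Qed.

Let fo k := if k == j then 0 else E k j / (lam j - lam k).

Let fo_first k : k != j -> fo k = first_order lam j E k.
Proof. by move=> kj; rewrite /fo (negbTE kj) Esym. Qed.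

Let fo_sum N : \sum_(k < N) fo k ^+ 2 <= t.
Proof.
rewrite (bigID (fun k : 'I_N => (k : nat) == j)) /= big1 ?add0r; last first.
  by move=> k /eqP kj; rewrite /fo kj eqxx expr0n.
apply: le_trans (first_order_bound lam0 lamj x0 sep z0 Ez tE N).
by apply: ler_sum => k kj; rewrite fo_first.
Qed.

Let expansion_vec : L2 mu :=
  eh j - e j + (l2norm (eh j - e j) ^+ 2 / 2) *: e j
  - l2sum (fun k => if k == j then 0 else (E k j / (lam j - lam k)) *: e k).

Let dist2 : l2norm (eh j - e j) ^+ 2 = 2 - 2 * a j.
Proof.
rewrite sqr_l2norm l2dotBl !l2dotBr unit_eh unit_e.
by rewrite (l2dotC (eh j) (e j)) -/(a j); ring.
Qed.

Let expansion_coef k : l2dot (e k) expansion_vec = if k == j then 0 else a k - fo k.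
Proof.
have [f fE] := riesz_fischer (c := fo) eb.1 fo_sum.
have fsum : l2cvg (fun N => \sum_(k < N) (if (k : nat) == j then 0 else (E k j / (lam j - lam k)) *: e k))
   (l2sum (fun k => if k == j then 0 else (E k j / (lam j - lam k)) *: e k)).
  apply: (l2sum_cvg (f := f)).
  have -> : (fun N => \sum_(k < N) (if (k : nat) == j then 0 else (E k j / (lam j - lam k)) *: e k)) =
    (fun N => \sum_(k < N) fo k *: e k).
    by apply/funext => N; apply: eq_bigr => i _; rewrite /fo; case: ifP => // _; rewrite scale0r.
  exact: fE.
have fsum' : l2cvg (fun N => \sum_(k < N) fo k *: e k)
   (l2sum (fun k => if k == j then 0 else (E k j / (lam j - lam k)) *: e k)).
  have <- : (fun N => \sum_(k < N) (if (k : nat) == j then 0 else (E k j / (lam j - lam k)) *: e k)) =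
    (fun N => \sum_(k < N) fo k *: e k); last exact: fsum.
  by apply/funext => N; apply: eq_bigr => i _; rewrite /fo; case: ifP => // _; rewrite scale0r.
have fk := l2cvg_coef (c := fo) k eb.1 fsum'.
rewrite l2dotC in fk.
rewrite /expansion_vec l2dotBr l2dotDr l2dotBr l2dotZr fk !eb.1 dist2 -/(a k) /fo.
by case: eqVneq => [->|_] /=; rewrite ?mulr0; [field|ring].
Qed.

Let vec_bound D : 0 <= D ->
  (forall M : nat, \sum_(k < M | (k : nat) != j) (a k - first_order lam j E k) ^+ 2 <= D) ->
  l2norm expansion_vec <= Num.sqrt D.
Proof.
move=> D0 h; rewrite /l2norm ler_wsqrtr // (parseval_le eb) // => N.
rewrite (bigID (fun k : 'I_N => (k : nat) == j)) /= big1 ?add0r; last first.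
  by move=> k kj; rewrite expansion_coef kj expr0n.
apply: le_trans (h N); apply: ler_sum => k kj.
by rewrite expansion_coef (negbTE kj) fo_first.
Qed.

Let sum_off N : \sum_(k < N | (k : nat) != j) a k ^+ 2 <= 1.
Proof.
apply: le_trans (a_partial N); rewrite [leRHS](bigID (fun k : 'I_N => (k : nat) != j)) /= lerDl.
by apply: sumr_ge0 => k _; exact: sqr_ge0.
Qed.

(** The correction of length |ehat_j - e_j|^2 / 2 along e_j cancels the j-th
    coordinate exactly, because ehat_j has norm one. The remaining coordinates
    are the errors of the first-order prediction. *)
Theorem eigenfunction_expansion :
  l2norm expansion_vec <= Num.sqrt t * (16 * Num.sqrt B + 8 * t) + 2 * (64 * B) ^+ m.
Proof.
have [B64|B64] := leP B 64^-1.
  have D0 : 0 <= t * (8 * Num.sqrt B + 8 * t) ^+ 2 by rewrite mulr_ge0 // sqr_ge0.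
  apply: (le_trans (vec_bound D0
    (second_order_bound lam0 lam_ub lamj x0 sep z0 Ez BE tE a1 eqn aj0 (close B64) B64))).
  have p0 : 0 <= 8 * Num.sqrt B + 8 * t by rewrite addr_ge0 ?mulr_ge0.
  rewrite sqrtrM // sqrtr_sqr ger0_norm //.
  apply: (@le_trans _ _ (Num.sqrt t * (16 * Num.sqrt B + 8 * t))).
    by apply: ler_wpM2l => //; have := sB0; lra.
  by rewrite lerDl mulr_ge0.
have /andP[h1 h2] := big_pow B64; have h3 := big_root B64.
have D0 : 0 <= 2 + 2 * t by rewrite addr_ge0 ?mulr_ge0.
have L : l2norm expansion_vec <= Num.sqrt (2 + 2 * t).
  apply: (vec_bound D0) => M.
  apply: (@le_trans _ _ (\sum_(k < M | (k : nat) != j) (2 * a k ^+ 2 + 2 * first_order lam j E k ^+ 2))).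
    by apply: ler_sum => k _; have := sqr_ge0 (a k + first_order lam j E k); lra.
  rewrite big_split /= -!mulr_sumr; have := sum_off M.
  by have := first_order_bound lam0 lamj x0 sep z0 Ez tE M; lra.
apply: (le_trans L).
have L2 : Num.sqrt (2 + 2 * t) <= 2 + 2 * Num.sqrt t.
  rewrite -[leRHS]ger0_norm ?addr_ge0 ?mulr_ge0 // -sqrtr_sqr ler_wsqrtr //.
  by have := st2; have := st0; nra.
apply: (le_trans L2); rewrite addrC; apply: lerD; last by have := le_trans h1 h2; lra.
by rewrite mulrC ler_wpM2l //; have := t0; lra.
Qed.

Let fo_series := series (fun k : nat => if k == j then 0 else E k j ^+ 2 / (lam j - lam k) ^+ 2).

Let fo_seriesE N : fo_series N = \sum_(k < N) fo k ^+ 2.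
Proof.
rewrite /fo_series /series /= big_mkord; apply: eq_bigr => k _; rewrite /fo.
by case: ifP => _; rewrite ?expr0n // expr_div_n.
Qed.

Let fo_cvg : fo_series @ \oo --> limn fo_series.
Proof.
suff : cvgn fo_series by [].
apply: (@nonneg_series_cvg _ _ t) => [k|N].
  by case: ifP => // _; rewrite divr_ge0 ?sqr_ge0.
by move: (fo_sum N); rewrite -fo_seriesE /fo_series /series /= big_mkord.
Qed.

(** As both vectors have norm one, the squared distance is (1 - a j^2) + (1 - a
    j)^2. The first term is the sum of the squares of the other coordinates,
    compared with their predictions by factoring the difference of two squares;
    the second is of order t^2. *)
Theorem distance_expansion :
  `|l2norm (eh j - e j) ^+ 2 - limn fo_series| <= t * (32 * Num.sqrt B + 57 * t) + 2 * (64 * B) ^+ m.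
Proof.
have F0 : 0 <= limn fo_series.
  apply: limr_ge; first exact: fo_cvg.
  by apply: nearW => N; rewrite fo_seriesE sumr_ge0 // => k _; exact: sqr_ge0.
have Ft : limn fo_series <= t.
  by apply: (cvg_le_bound (N0 := 0%N) fo_cvg) => N _; rewrite fo_seriesE fo_sum.
have [B64|B64] := leP B 64^-1; last first.
  have /andP[h1 h2] := big_pow B64; have h3 := big_root B64.
  have aj1 : a j <= 1.
    rewrite -(@ler_pXn2r _ 2) ?nnegrE // expr1n; apply: le_trans (a_partial j.+1).
    by rewrite big_ord_recr /= lerDr sumr_ge0 // => k _; exact: sqr_ge0.
  rewrite dist2 ler_norml; apply/andP; split; have := t0; have := aj0; nra.
set G := limn fo_series in F0 Ft *.
have od := off_diagonal_bound lam0 lam_ub lamj x0 sep z0 Ez BE tE a1 eqn (close B64) B64.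
have fb := first_order_bound lam0 lamj x0 sep z0 Ez tE.
have sb := second_order_bound lam0 lam_ub lamj x0 sep z0 Ez BE tE a1 eqn aj0 (close B64) B64.
have /andP[ma0 ma1] := one_minus_aj lam0 lam_ub lamj x0 sep z0 Ez BE tE a1 eqn aj0 (close B64) B64.
pose dl := 8 * Num.sqrt B + 8 * t.
have dl0 : 0 <= dl by rewrite addr_ge0 ?mulr_ge0.
have diff N : `|\sum_(k < N | (k : nat) != j) (a k ^+ 2 - first_order lam j E k ^+ 2)| <= 4 * t * dl.
  rewrite -(ler_pXn2r (_ : (0 < 2)%N)) ?nnegrE ?mulr_ge0 //.
  rewrite real_normK ?num_real //.
  apply: le_trans (@sum_CS _ _ _ _ _
     (fun k : 'I_N => (a k - first_order lam j E k) ^+ 2)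
     (fun k : 'I_N => (a k + first_order lam j E k) ^+ 2) _ _ _) _.
  - by move=> k; exact: sqr_ge0.
  - by move=> k; exact: sqr_ge0.
  - by move=> k; rewrite subr_sqr exprMn.
  (* the sum of coordinate and prediction is of order sqrt t, the difference
     smaller by the factor dl *)
  have plus : \sum_(k < N | (k : nat) != j) (a k + first_order lam j E k) ^+ 2 <= 12 * t.
    apply: (@le_trans _ _ (\sum_(k < N | (k : nat) != j) (2 * a k ^+ 2 + 2 * first_order lam j E k ^+ 2))).
      by apply: ler_sum => k _; have := sqr_ge0 (a k - first_order lam j E k); lra.
    by rewrite big_split /= -!mulr_sumr; have := od N; have := fb N; lra.
  apply: (@le_trans _ _ (t * dl ^+ 2 * (12 * t))).
    by apply: ler_pM; [by apply: sumr_ge0 => k _; exact: sqr_ge0|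
      by apply: sumr_ge0 => k _; exact: sqr_ge0|exact: sb|exact: plus].
  have : 0 <= t * dl ^+ 2 * t by rewrite !mulr_ge0 // sqr_ge0.
  rewrite !exprMn; nra.
have lim : (fun N => \sum_(k < N) a k ^+ 2 - fo_series N) @ \oo --> 1 - G by exact: cvgB.
have split N : (j < N)%N -> \sum_(k < N) a k ^+ 2 - fo_series N =
   a j ^+ 2 + \sum_(k < N | (k : nat) != j) (a k ^+ 2 - first_order lam j E k ^+ 2).
  move=> jN; rewrite fo_seriesE (bigD1 (Ordinal jN)) //= [X in _ - X](bigD1 (Ordinal jN)) //=.
  rewrite {1}/fo eqxx expr0n /= add0r -addrA sumrB; congr (_ + (_ - _)).
  by apply: eq_bigr => k kj; rewrite fo_first.
have up : 1 - G <= a j ^+ 2 + 4 * t * dl.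
  apply: (cvg_le_bound (N0 := j.+1) lim) => N jN; rewrite split // lerD2l.
  by have := diff N; rewrite ler_norml => /andP[].
have lo : - (1 - G) <= - (a j ^+ 2 - 4 * t * dl).
  apply: (cvg_le_bound (N0 := j.+1) (cvgN lim)) => N jN.
  rewrite -[leLHS]/(- (\sum_(k < N) a k ^+ 2 - fo_series N)) split //.
  by have := diff N; rewrite ler_norml => /andP[+ _]; lra.
rewrite dist2; have p0 := pow0; have sB0' := sB0; have t0' := t0.
have ma2 : (1 - a j) ^+ 2 <= 25 * t ^+ 2 by nra.
have e1 : t * (32 * Num.sqrt B + 57 * t) = 4 * t * dl + 25 * t ^+ 2 by rewrite /dl; ring.
rewrite e1; have s0 := sqr_ge0 (1 - a j).
have e2 : 2 - 2 * a j - G = (1 - G - a j ^+ 2) + (1 - a j) ^+ 2 by ring.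
rewrite e2 ler_norml; apply/andP; split; lra.
Qed.

End powers.
End one_eigenpair.

(** * Consequences of the gap condition *)

Section gaps.
Context (R : realType).
Variables (C a hh L : R) (n Jn : nat) (lam : nat -> R).
Hypotheses (C0 : 0 < C) (n0 : (0 < n)%N).
Hypothesis lam0 : forall i, 0 <= lam i.
Hypothesis lam_nd : forall i k, (i <= k)%N -> lam k <= lam i.
Hypothesis lamL : forall N : nat, \sum_(i < N) lam i <= L.
Hypothesis gap : gap_condition C a hh n Jn lam.

(** The bound that the gap condition puts on the sum of the weights. *)
Definition gap_scale : R := C * n%:R `^ (2^-1 - a).
Local Notation G := gap_scale.

Let nR : (0 : R) < n%:R. Proof. by rewrite ltr0n. Qed.

(** Scaled by a positive constant, an extended-real series with a finite bound
    controls every partial sum. *)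
Lemma series_partial_le (u : nat -> R) (j N : nat) (c D : R) :
  (forall i, 0 <= u i) -> 0 < c ->
  (c%:E * \sum_(0 <= i <oo | i != j) (u i)%:E <= D%:E)%E ->
  \sum_(i < N | (i : nat) != j) u i <= D / c.
Proof.
move=> u0 c0 h; rewrite ler_pdivlMr // mulrC -lee_fin; apply: le_trans h.
rewrite EFinM; apply: lee_wpmul2l; first by rewrite lee_fin ltW.
rewrite -sumEFin -(big_mkord (fun i => i != j) (fun i => (u i)%:E)).
by apply: nneseries_lim_ge => i _; rewrite lee_fin.
Qed.

Let u1_ge0 j i : 0 <= lam i / `|lam j - lam i|. Proof. by rewrite divr_ge0. Qed.
Let u2_ge0 j i : 0 <= lam i * lam j / (lam j - lam i) ^+ 2.
Proof. by apply: divr_ge0; [exact: mulr_ge0|exact: sqr_ge0]. Qed.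

Lemma gap_sum j N : (j < Jn)%N ->
  \sum_(i < N | (i : nat) != j) lam i / `|lam j - lam i| <= G.
Proof.
move=> jJ; have [_ h _] := gap.1 j jJ.
have p0 : (0 : R) < n%:R `^ (- 2^-1 + a) by rewrite powR_gt0.
apply: (le_trans (@series_partial_le _ j N _ _ (u1_ge0 j) p0 h)).
by rewrite /gap_scale -powRN opprD opprK.
Qed.

Definition sq_gap j : R := fine (relgap2 lam j).

Let gap2_fin j : (j < Jn)%N -> relgap2 lam j \is a fin_num.
Proof.
move=> jJ; have [_ _ h] := gap.1 j jJ.
have r0 : (0 <= relgap2 lam j)%E by apply: nneseries_ge0 => i _ _; rewrite lee_fin; exact: u2_ge0.
rewrite ge0_fin_numE //; case: (relgap2 lam j) h r0 => [r| |] //; rewrite ?ltry //.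
by rewrite gt0_muley ?lte_fin ?powR_gt0 // leye_eq.
Qed.

Lemma sq_gap_sum j N : (j < Jn)%N ->
  \sum_(i < N | (i : nat) != j) ell lam j i <= sq_gap j.
Proof.
move=> jJ; rewrite -[leRHS]divr1; apply: (@series_partial_le _ j N 1 _ (u2_ge0 j) ltr01).
by rewrite mul1e fineK //; exact: gap2_fin.
Qed.

Lemma sq_gap_le j : (j < Jn)%N -> sq_gap j <= C * n%:R `^ (1 - 2 * a).
Proof.
move=> jJ; have [_ _ h] := gap.1 j jJ.
have p0 : (0 : R) < n%:R `^ (- 1 + 2 * a) by rewrite powR_gt0.
have e1 : n%:R `^ (1 - 2 * a) = (n%:R `^ (- 1 + 2 * a))^-1 :> R by rewrite -powRN opprD opprK.
rewrite e1 ler_pdivlMr // mulrC -lee_fin EFinM fineK //; exact: gap2_fin.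
Qed.

Lemma lam_lower j : (j < Jn)%N -> n%:R `^ (- hh) / C <= lam j.
Proof. by move=> jJ; apply: le_trans gap.2 _; apply: lam_nd; rewrite -ltnS prednK // (leq_ltn_trans _ jJ). Qed.

Lemma lam_gt0 j : (j < Jn)%N -> 0 < lam j.
Proof. by move/lam_lower; apply: lt_le_trans; rewrite divr_gt0 ?powR_gt0. Qed.

Lemma lam_le_total j : lam j <= L.
Proof.
apply: le_trans (lamL j.+1); rewrite big_ord_recr /= lerDr.
by apply: sumr_ge0 => i _.
Qed.

Hypothesis Jn2 : (1 < Jn)%N.

(** For the second eigenvalue the term of index 0 in the sum of the weights is
    lam 0 / (lam 0 - lam 1), which is at least 1. *)
Lemma gap_scale_ge1 : 1 <= G.
Proof.
have [ne _ _] := gap.1 1%N Jn2.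
apply: le_trans (gap_sum 1 Jn2); rewrite big_mkcond big_ord_recl big_ord0 /= addr0.
have l10 : lam 1%N < lam 0%N by rewrite lt_neqAle lam_nd // eq_sym ne.
rewrite ltr0_norm ?subr_lt0 // opprB ler_pdivlMr ?subr_gt0 // mul1r.
by rewrite lerBlDr lerDl.
Qed.

(** The choice of the parameter x: small enough for a separation of the
    eigenvalues by 2 x lam_j, and its inverse of the same order as the sum of
    the other weights. *)
Definition step_scale : R := (4 * G)^-1.
Local Notation x := step_scale.

Let G0 : 0 < G. Proof. exact: lt_le_trans gap_scale_ge1. Qed.

Lemma step_scale_gt0 : 0 < x. Proof. by rewrite invr_gt0 mulr_gt0. Qed.

Lemma step_scale_le1 : x <= 1.
Proof.
rewrite /step_scale invf_le1; last by rewrite mulr_gt0.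
by have := gap_scale_ge1; lra.
Qed.

(** One term of the sum bounds lam k by G times the gap, so lam j is at most G +
    1 times the gap, and G + 1 <= 2 G. *)
Lemma gap_separation j k : (j < Jn)%N -> k != j -> 2 * (x * lam j) <= `|lam j - lam k|.
Proof.
move=> jJ kj; have [ne _ _] := gap.1 j jJ.
set D := `|lam j - lam k|.
have D0 : 0 < D by rewrite normr_gt0 subr_eq0 eq_sym ne.
have t : lam k / D <= G.
  apply: le_trans (gap_sum k.+1 jJ); rewrite big_mkcond big_ord_recr /= kj lerDr.
  by apply: sumr_ge0 => i _; case: ifP.
have kG : lam k <= G * D by rewrite -ler_pdivrMr.
have jk : lam j <= lam k + D by have := ler_norm (lam j - lam k); rewrite -/D; lra.
have G1 := gap_scale_ge1.
have G4 : 0 < 4 * G by rewrite mulr_gt0.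
rewrite /step_scale -(ler_pM2l G4).
have -> : 4 * G * (2 * ((4 * G)^-1 * lam j)) = 2 * lam j by field; rewrite gt_eqF.
nra.
Qed.

Lemma wgt_sum j N : (j < Jn)%N -> \sum_(i < N) wgt lam j x i <= 5 * G.
Proof.
move=> jJ; rewrite (bigID (fun i : 'I_N => (i : nat) == j)) /=.
have -> : 5 * G = 4 * G + G by ring.
apply: lerD; last first.
  apply: le_trans (gap_sum N jJ); apply: ler_sum => i ij.
  by rewrite /wgt (negbTE ij).
have [jN|Nj] := ltnP j N.
  rewrite (big_pred1 (Ordinal jN)) /=; last by move=> i; apply/idP/idP => [/eqP h|/eqP -> //=]; apply/eqP/val_inj.
  by rewrite /wgt eqxx /step_scale invrK.
rewrite big1; first by apply: mulr_ge0 => //; exact: ltW.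
by move=> i /eqP ij; have := ltn_ord i; rewrite ij ltnNge Nj.
Qed.

(** The neighbour k = j + 1 alone contributes at least lam_(j+1) / lam_j. This
    is where the index j + 1 must be among the eigenvalues controlled by the gap
    condition. *)
Lemma sq_gap_lower j : (j.+1 < Jn)%N -> n%:R `^ (- hh) / C / L <= sq_gap j.
Proof.
move=> j1; have jJ : (j < Jn)%N by exact: ltnW.
have [ne _ _] := gap.1 j jJ.
have lj := lam_gt0 jJ; have lj1 := lam_gt0 j1; have lL := lam_le_total j.
have lo := lam_lower j1.
have d0 : 0 < lam j - lam j.+1.
  by rewrite subr_gt0 lt_neqAle lam_nd // andbT ne // neq_ltn ltnSn orbT.
have p : ell lam j j.+1 <= sq_gap j.
  apply: le_trans (sq_gap_sum j.+2 jJ); rewrite big_mkcond big_ord_recr /=.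
  rewrite ifT; last by rewrite neq_ltn ltnSn orbT.
  by rewrite lerDr sumr_ge0 // => i _; case: ifP => // _; exact: u2_ge0.
apply: le_trans p; rewrite /ell.
have L0 : 0 < L by exact: lt_le_trans lL.
apply: (@le_trans _ _ (lam j.+1 / lam j)).
  apply: ler_pM => //; first by rewrite divr_ge0 ?powR_ge0 ?ltW.
    by rewrite invr_ge0 ltW.
  by rewrite lef_pV2 ?posrE.
have d2 : (lam j - lam j.+1) ^+ 2 <= lam j ^+ 2.
  by rewrite lerXn2r ?nnegrE ?(ltW d0) ?(ltW lj) //; lra.
rewrite -mulrA ler_wpM2l ?(ltW lj1) // ler_pdivlMr ?exprn_gt0 //.
by rewrite mulrC ler_pdivrMr // -expr2.
Qed.

Lemma sq_gap_gt0 j : (j.+1 < Jn)%N -> 0 < sq_gap j.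
Proof.
move=> j1; apply: lt_le_trans (sq_gap_lower j1).
by rewrite !divr_gt0 ?powR_gt0 // (lt_le_trans (lam_gt0 j1)) // lam_le_total.
Qed.

End gaps.

Section maxima.
Context d (T : measurableType d) (R : realType) (P : probability T R).

(** The p-th power of a maximum is at most the sum of the p-th powers. *)
Lemma pnorm_max (p A : R) (J : nat) (f : nat -> T -> R) : 1 <= p -> 0 <= A ->
  (forall j, (j < J)%N -> exists2 F, Lb P p F A & {ae P, forall w, `|f j w| <= F w}) ->
  (pnorm P p (fun w => \big[Num.max/0%R]_(j < J) `|f j w|%R) <= (J%:R `^ p^-1 * A)%:E)%E.
Proof.
move=> p1 A0 h; have p0 : 0 < p by exact: lt_le_trans p1.
have hF (j : 'I_J) : exists F : T -> R, Lb P p F A /\ {ae P, forall w, `|f j w| <= F w}.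
  by have [F LF fF] := h j (ltn_ord j); exists F.
have /choice[F FP] := hF.
pose s w := \sum_(j < J) `|F j w| `^ p.
have s0 w : 0 <= s w by apply: sumr_ge0 => j _; exact: powR_ge0.
have ms : measurable_fun setT s.
  apply: measurable_sum => j; apply/measurable_EFinP; apply: measurable_absX.
  by case: (FP j).1.
have Ls : Lb P p (fun w => s w `^ p^-1) (J%:R `^ p^-1 * A).
  split; [exact: measurableT_comp (measurable_powR _) ms|by rewrite mulr_ge0 ?powR_ge0|].
  under eq_integral do rewrite ger0_norm ?powR_ge0 // -powRrM mulVf ?gt_eqF // powRr1 //.
  rewrite powRM ?powR_ge0 // -powRrM mulVf ?gt_eqF // powRr1 //.
  under eq_integral do rewrite /s -sumEFin.
  rewrite ge0_integral_sum; [|by []|by move=> j; apply: measurable_absX; case: (FP j).1|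
    by move=> j w _; rewrite lee_fin powR_ge0].
  apply: (@le_trans _ _ (\sum_(j < J) (A `^ p)%:E)%E).
    by apply: lee_sum => j _; have [[_ _]] := FP j.
  by rewrite sumEFin sumr_const card_ord mulr_natl.
apply: (pnorm_le p0 _ Ls).
have al : {ae P, forall w, forall j : 'I_J, `|f j w| <= F j w}.
  have al' : {ae P, forall w, forall k : nat, forall j : 'I_J, k = j -> `|f j w| <= F j w}.
    apply/ae_foralln => k; have [kJ|Jk] := ltnP k J.
      apply: filterS (FP (Ordinal kJ)).2 => w hw j kj.
      by rewrite (_ : j = Ordinal kJ) //; apply: val_inj.
    by apply: aeW => w j kj; have := ltn_ord j; rewrite -kj ltnNge Jk.
  by apply: filterS al' => w hw j; exact: (hw j).
apply: filterS al => w hw.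
have m0 : 0 <= \big[Num.max/0%R]_(j < J) `|f j w|.
  by elim/big_rec: _ => // j y _ y0; rewrite le_max y0 orbT.
rewrite ger0_norm //; apply: bigmax_le; first exact: powR_ge0.
move=> j _; apply: (@le_trans _ _ ((`|F j w| `^ p) `^ p^-1)).
  by rewrite -powRrM mulfV ?gt_eqF // powRr1 // (le_trans (hw j)) // ler_norm.
rewrite ge0_ler_powR ?nnegrE ?invr_ge0 ?powR_ge0 ?(ltW p0) // /s (bigD1 j) //= lerDl.
by apply: sumr_ge0 => i _; exact: powR_ge0.
Qed.

End maxima.

(** * L^p norms of the dominating variables *)

Section error_norms.
Context dO (Om : measurableType dO) (R : realType) (P : probability Om R).
Variables (C a hh L k0 p : R) (n Jn m : nat) (lam : nat -> R).
Hypotheses (C0 : 0 < C) (L0 : 0 <= L) (k00 : 0 <= k0) (p1 : 1 <= p) (n0 : (0 < n)%N) (a0 : 0 < a).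
Hypothesis hh0 : 0 <= hh.
Hypothesis m2 : (1 < m)%N.
Hypothesis hm : hh + 1 + a <= 2 * a * m%:R.
Hypothesis lam0 : forall i, 0 <= lam i.
Hypothesis lam_nd : forall i k, (i <= k)%N -> lam k <= lam i.
Hypothesis lamL : forall N : nat, \sum_(i < N) lam i <= L.
Hypothesis gap : gap_condition C a hh n Jn lam.
Variables (Z : nat -> nat -> Om -> R).
Hypothesis LZ : forall i k, Lb P (m%:R * p) (Z i k) (k0 / n%:R).
Hypothesis Z0 : forall i k w, 0 <= Z i k w.
Variable j : nat.
Hypothesis j1 : (j.+1 < Jn)%N.

Local Notation G := (gap_scale C a n).
Local Notation x := (step_scale C a n).
Local Notation Lam := (sq_gap lam j).
Local Notation kap := (k0 / n%:R).
Let s2 := m%:R * p.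
Let jJ : (j < Jn)%N. Proof. exact: ltnW. Qed.
Let Jn2 : (1 < Jn)%N. Proof. by apply: leq_ltn_trans j1. Qed.
Let p0 : 0 < p. Proof. exact: lt_le_trans p1. Qed.
Let mR : 2 <= (m%:R : R). Proof. by rewrite ler_nat. Qed.
Let s2p : 2 * p <= s2. Proof. by rewrite ler_wpM2r // ltW. Qed.
Let s21 : 1 <= s2. Proof. by have := s2p; have := p1; lra. Qed.
Let s20 : 0 < s2. Proof. exact: lt_le_trans s21. Qed.
Let nR : (0 : R) < n%:R. Proof. by rewrite ltr0n. Qed.
Let G1 : 1 <= G. Proof. exact: (gap_scale_ge1 n0 lam0 lam_nd gap Jn2). Qed.
Let G0 : 0 < G. Proof. exact: lt_le_trans G1. Qed.
Let x0 : 0 < x. Proof. exact: (step_scale_gt0 n0 lam0 lam_nd gap Jn2). Qed.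
Let kap0 : 0 <= kap. Proof. by rewrite divr_ge0 // ltW. Qed.
Let Lam0 : 0 < Lam. Proof. exact: (sq_gap_gt0 C0 n0 lam0 lam_nd lamL gap j1). Qed.
Let lj0 : 0 < lam j. Proof. exact: (lam_gt0 C0 n0 lam_nd gap jJ). Qed.

(** Both sums are iterated weighted series of the variables Z with summable
    weights, so they are dominated outside a null set by variables with the norm
    that the total weights dictate. *)
Lemma random_weights : exists B t : Om -> R,
  [/\ Lb P s2 B (25 * G ^+ 2 * kap) /\ Lb P s2 t (5 / 4 * Lam * kap),
      forall w, 0 <= B w /\ 0 <= t w &
      {ae P, forall w, (forall N : nat, \sum_(k < N) \sum_(i < N)
          wgt lam j x k * (wgt lam j x i * Z i k w) <= B w) /\
        (forall M N : nat, x * \sum_(k < M | (k : nat) != j) ell lam j k *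
           \sum_(i < N) wgt lam j x i * Z i k w <= t w)}].
Proof.
have w0 i : 0 <= wgt lam j x i by exact: wgt_ge0.
have l0 k : 0 <= ell lam j k by apply: divr_ge0; [exact: mulr_ge0|exact: sqr_ge0].
have wG N : \sum_(i < N) wgt lam j x i <= 5 * G by exact: (wgt_sum n0 lam0 lam_nd gap Jn2 N jJ).
have hrow k : exists F : Om -> R, [/\ Lb P s2 F (5 * G * kap), forall w, 0 <= F w &
    {ae P, forall w, forall N : nat, \sum_(i < N) wgt lam j x i * `|Z i k w| <= F w}].
  exact: random_series_dominated s21 w0 wG (fun i => LZ i k).
have /choice[F FP] := hrow.
have LF k : Lb P s2 (F k) (5 * G * kap) by case: (FP k).
have F0 k w : 0 <= F k w by case: (FP k).
have [B [LB B0 BF]] := random_series_dominated s21 w0 wG LF.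
pose el k := if k == j then 0 else ell lam j k.
have el0 k : 0 <= el k by rewrite /el; case: ifP.
have elL N : \sum_(k < N) el k <= Lam.
  apply: le_trans (sq_gap_sum n0 lam0 gap N jJ); rewrite [leRHS]big_mkcond.
  by apply: ler_sum => k _; rewrite /el if_neg.
have [t [Lt t0 tF]] := random_series_dominated s21 el0 elL LF.
have Fae : {ae P, forall w, forall k N : nat, \sum_(i < N) wgt lam j x i * `|Z i k w| <= F k w}.
  by apply/ae_foralln => k; case: (FP k).
have rowF w k N : (forall k N : nat, \sum_(i < N) wgt lam j x i * `|Z i k w| <= F k w) ->
    \sum_(i < N) wgt lam j x i * Z i k w <= F k w.
  by move=> h; apply: le_trans (h k N); apply: ler_sum => i _; rewrite ger0_norm.
exists B, (fun w => x * t w); split.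
- split.
    by apply: (Lb_le s20 _ LB); rewrite le_eqVlt; apply/orP; left; apply/eqP; ring.
  apply: (Lb_le s20 _ (Lb_scale x s20 Lt)).
  rewrite ger0_norm ?(ltW x0) // /step_scale le_eqVlt; apply/orP; left; apply/eqP.
  by field; rewrite gt_eqF //= gt_eqF.
- by move=> w; split=> //; rewrite mulr_ge0 // ltW.
apply: filterS3 Fae BF tF => w hF hB ht; split=> [N|M N].
  apply: le_trans (hB N); apply: ler_sum => k _; rewrite -mulr_sumr ler_wpM2l //.
  by rewrite ger0_norm // rowF.
rewrite ler_wpM2l ?(ltW x0) //; apply: le_trans (ht M); rewrite big_mkcond /=.
apply: ler_sum => k _; rewrite /el if_neg; case: ifP => _; first by rewrite mul0r.
by rewrite ler_wpM2l // ger0_norm // rowF.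
Qed.

Let r := (n%:R : R) `^ (- a).
Let sn := Num.sqrt (n%:R : R).
Let r0 : 0 < r. Proof. by rewrite powR_gt0. Qed.
Let n1 : (1 : R) <= n%:R. Proof. by rewrite ler1n. Qed.
Let r1 : r <= 1.
Proof. by rewrite /r -[leRHS](powRr0 n%:R) ler_powR // oppr_le0 ltW. Qed.

Let sn0 : 0 < sn. Proof. by rewrite sqrtr_gt0. Qed.
Let sn2 : sn ^+ 2 = n%:R. Proof. by rewrite sqr_sqrtr // ltW. Qed.
Let sn1 : 1 <= sn. Proof. by rewrite -[leLHS]sqrtr1 ler_wsqrtr. Qed.

Let GE : G = C * (sn * r).
Proof.
rewrite /gap_scale powRD; last by rewrite (gt_eqF nR) implybT.
by rewrite powR12_sqrt // ltW.
Qed.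

Let r2E : r ^+ 2 = n%:R `^ (- (2 * a)).
Proof. by rewrite /r -powR_mulrn ?powR_ge0 // -powRrM; congr (_ `^ _); ring. Qed.

Let LamE : Lam <= C * (n%:R * r ^+ 2).
Proof.
apply: (le_trans (sq_gap_le n0 lam0 gap jJ)); rewrite r2E.
rewrite powRD; last by rewrite (gt_eqF nR) implybT.
by rewrite powRr1 // ltW.
Qed.

Let hhn := (n%:R : R) `^ hh.
Let hhn1 : 1 <= hhn.
Proof. by rewrite /hhn -[leLHS](powRr0 n%:R) ler_powR. Qed.

(** On the exceptional event the power m of a variable of order n^(-2a)
    compensates the factor n^hh lost to the smallest eigenvalue, with n^(-1-a)
    to spare. *)
Let decay : hhn * (r ^+ 2) ^+ m <= r / n%:R.
Proof.
rewrite r2E -powR_mulrn ?powR_ge0 // -powRrM /hhn -powRD; last by rewrite (gt_eqF nR) implybT.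
have -> : r / n%:R = n%:R `^ (- a - 1).
  rewrite powRD; last by rewrite (gt_eqF nR) implybT.
  by rewrite -[X in _ = _ * X]/(n%:R `^ (- 1)) powR_inv1 // ltW.
by apply: ler_powR => //; have := hm; lra.
Qed.

Let rn_le : r / n%:R <= r / sn.
Proof.
by rewrite ler_wpM2l ?(ltW r0) // lef_pV2 ?posrE // -sn2 expr2 ler_peMl // ltW.
Qed.

Let GkE : 25 * G ^+ 2 * kap = 25 * (C ^+ 2 * k0 * r ^+ 2).
Proof. by rewrite GE -sn2; field; rewrite gt_eqF. Qed.

Let sqGkE : Num.sqrt (25 * G ^+ 2 * kap) = 5 * (C * Num.sqrt k0 * r).
Proof.
rewrite GkE (_ : 25 * _ = (5 * (C * r)) ^+ 2 * k0); last by ring.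
rewrite sqrtrM ?sqr_ge0 // sqrtr_sqr ger0_norm; last by rewrite !mulr_ge0 // ltW.
by ring.
Qed.

Let LkE : 5 / 4 * Lam * kap <= 5 / 4 * (C * k0 * r).
Proof.
have h1 : Lam * kap <= C * k0 * r ^+ 2.
  apply: (@le_trans _ _ (C * (n%:R * r ^+ 2) * kap)); first by apply: ler_wpM2r; [exact: kap0|exact: LamE].
  by rewrite le_eqVlt; apply/orP; left; apply/eqP; field; rewrite gt_eqF.
have h2 : C * k0 * r ^+ 2 <= C * k0 * r.
  by apply: ler_wpM2l; [rewrite mulr_ge0 // ltW|rewrite expr2 ler_piMr // ltW].
by rewrite -mulrA ler_wpM2l ?divr_ge0 //; exact: le_trans h1 h2.
Qed.

(** The constant that the m-th power of 64 B leaves after the rate is taken out. *)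
Definition bad_cst : R := (64 * 25 * (C ^+ 2 * k0)) ^+ m.
Let bad0 : 0 <= bad_cst.
Proof.
apply: exprn_ge0; apply: mulr_ge0; first by apply: mulr_ge0; exact: ler0n.
by apply: mulr_ge0 => //; exact: sqr_ge0.
Qed.

Variables B t : Om -> R.
Hypotheses (B0 : forall w, 0 <= B w) (t0 : forall w, 0 <= t w).
Hypothesis LB : Lb P s2 B (25 * G ^+ 2 * kap).
Hypothesis Lt : Lb P s2 t (5 / 4 * Lam * kap).

(** The contribution of the event B > 1/64, with a prefactor of size at most
    n^hh. *)
Let Lbad (c A : R) : 0 <= c -> c <= A * hhn -> 0 <= A ->
  Lb P p (fun w => c * (64 * B w) ^+ m) (A * bad_cst * (r / n%:R)).
Proof.
move=> c0 cA A0.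
have L1 : Lb P s2 (fun w => 64 * B w) (64 * 25 * (C ^+ 2 * k0 * r ^+ 2)).
  apply: (Lb_le s20 _ (Lb_scale 64 s20 LB)); rewrite GkE ger0_norm //.
  by rewrite le_eqVlt; apply/orP; left; apply/eqP; ring.
have L2 := Lb_pow (ltnW m2) p0 L1.
apply: (Lb_le p0 _ (Lb_scale c p0 L2)); rewrite ger0_norm //.
apply: (@le_trans _ _ (A * hhn * (64 * 25 * (C ^+ 2 * k0 * r ^+ 2)) ^+ m)).
  apply: ler_wpM2r => //; apply: exprn_ge0.
  apply: mulr_ge0; first by apply: mulr_ge0; exact: ler0n.
  by apply: mulr_ge0; [apply: mulr_ge0 => //; exact: sqr_ge0|exact: sqr_ge0].
rewrite mulrA [X in _ * X <= _](_ : _ = bad_cst * (r ^+ 2) ^+ m); last by rewrite /bad_cst -exprMn !mulrA.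
rewrite (_ : A * hhn * _ = A * bad_cst * (hhn * (r ^+ 2) ^+ m)); last by ring.
by rewrite ler_wpM2l // mulr_ge0.
Qed.

Let lam_ratio : lam 0%N / lam j <= L * C * hhn.
Proof.
have lo := lam_lower lam_nd gap jJ.
have p' : 0 < n%:R `^ (- hh) / C by rewrite divr_gt0 ?powR_gt0.
have i : (lam j)^-1 <= C * hhn.
  by rewrite -[leRHS]invrK lef_pV2 ?posrE ?invr_gt0 ?mulr_gt0 ?powR_gt0 // invfM mulrC /hhn -powRN.
rewrite -mulrA; apply: ler_pM => //; first by rewrite invr_ge0 ltW.
exact: lam_le_total lam0 lamL 0%N.
Qed.

Definition value_cst : R := 75 / 4 * C * k0 + 3 * (L * C) * bad_cst.

(** x is of order 1 / G and B of order G^2 / n, so the regular part is of order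
    G / n, that is, n^(-1/2 - a). *)
Lemma Lb_value_error :
  Lb P p (fun w => 3 * x * B w + 3 * (lam 0%N / lam j) * (64 * B w) ^+ m) (value_cst * (r / sn)).
Proof.
have Lg : Lb P p (fun w => 3 * x * B w) (75 / 4 * C * k0 * (r / sn)).
  have := Lb_scale (3 * x) p0 (Lb_incr p1 (_ : p <= s2) LB); move=> h.
  have ps : p <= s2 by have := s2p; have := p1; lra.
  apply: (Lb_le p0 _ (h ps)); rewrite ger0_norm; last by rewrite mulr_ge0 // ltW.
  rewrite le_eqVlt; apply/orP; left; apply/eqP.
  rewrite /step_scale; have g := GE.
  have -> : 3 * (4 * G)^-1 * (25 * G ^+ 2 * kap) = 75 / 4 * G * kap by field; rewrite gt_eqF //= gt_eqF.
  by rewrite g -sn2; field; rewrite gt_eqF.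
have A0 : 0 <= 3 * (L * C) by rewrite mulr_ge0 // mulr_ge0 // ltW.
have c0 : 0 <= 3 * (lam 0%N / lam j) by rewrite mulr_ge0 // divr_ge0.
have cA : 3 * (lam 0%N / lam j) <= 3 * (L * C) * hhn by have := lam_ratio; lra.
apply: (Lb_le p0 _ (Lb_add p1 Lg (Lbad c0 cA A0))).
rewrite /value_cst [leRHS]mulrDl lerD2l; apply: ler_wpM2l => //; exact: mulr_ge0.
Qed.

Let Lam_inv : Lam^-1 <= C * L * hhn.
Proof.
have lo := sq_gap_lower C0 n0 lam0 lam_nd lamL gap j1.
have L0' : 0 < L by apply: lt_le_trans lj0 _; exact: lam_le_total lam0 lamL j.
rewrite -[leRHS]invrK lef_pV2 ?posrE ?invr_gt0 ?mulr_gt0 ?powR_gt0 //.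
by rewrite !invfM mulrC /hhn -powRN mulrA.
Qed.

Let sqLam_inv : (Num.sqrt Lam)^-1 <= (1 + C * L) * hhn.
Proof.
have y0 : 0 <= Lam^-1 by rewrite invr_ge0 ltW.
have e : (Num.sqrt Lam)^-1 ^+ 2 = Lam^-1 by rewrite exprVn sqr_sqrtr // ltW.
have h : (Num.sqrt Lam)^-1 <= 1 + Lam^-1.
  by have := sqr_ge0 ((Num.sqrt Lam)^-1 - 1); rewrite sqrrB1 e; lra.
by apply: (le_trans h); rewrite mulrDl mul1r lerD.
Qed.

Let Ltau : Lb P s2 (fun w => Lam^-1 * t w) (5 / 4 * kap).
Proof.
apply: (Lb_le s20 _ (Lb_scale Lam^-1 s20 Lt)); rewrite ger0_norm; last by rewrite invr_ge0 ltW.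
by rewrite le_eqVlt; apply/orP; left; apply/eqP; field; rewrite !gt_eqF.
Qed.

Let p21 : 1 <= 2 * p. Proof. by have := p1; lra. Qed.
Let p20 : 0 < 2 * p. Proof. exact: lt_le_trans p21. Qed.
Let s22 : 2 * p <= 2 * s2. Proof. by have := s2p; have := s20; lra. Qed.

Let Lmix (b c : R) : 0 <= b -> 0 <= c ->
  Lb P (2 * p) (fun w => b * Num.sqrt (B w) + c * t w)
    ((5 * b * (C * Num.sqrt k0) + 5 / 4 * c * (C * k0)) * r).
Proof.
move=> b0 c0.
have LsB : Lb P (2 * p) (fun w => Num.sqrt (B w)) (5 * (C * Num.sqrt k0 * r)).
  by rewrite -sqGkE; apply: Lb_incr p21 s22 (Lb_sqrt s20 B0 LB).
have Lt2 : Lb P (2 * p) t (5 / 4 * (C * k0 * r)).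
  exact: Lb_le p20 LkE (Lb_incr p21 s2p Lt).
apply: (Lb_le p20 _ (Lb_add p21 (Lb_scale b p20 LsB) (Lb_scale c p20 Lt2))).
rewrite !ger0_norm // le_eqVlt; apply/orP; left; apply/eqP; ring.
Qed.

Definition function_cst : R :=
  Num.sqrt (5 / 4 * k0) * (80 * (C * Num.sqrt k0) + 10 * (C * k0)) + 2 * (1 + C * L) * bad_cst.

(** After division by sqrt Lambda_j the factor sqrt t is of order n^(-1/2),
    while sqrt B and t are of order n^(-a). *)
Lemma Lb_function_error :
  Lb P p (fun w => (Num.sqrt Lam)^-1 *
     (Num.sqrt (t w) * (16 * Num.sqrt (B w) + 8 * t w) + 2 * (64 * B w) ^+ m)) (function_cst * (r / sn)).
Proof.
have -> : (fun w => (Num.sqrt Lam)^-1 *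
     (Num.sqrt (t w) * (16 * Num.sqrt (B w) + 8 * t w) + 2 * (64 * B w) ^+ m)) =
  (fun w => Num.sqrt (Lam^-1 * t w) * (16 * Num.sqrt (B w) + 8 * t w)
     + 2 * (Num.sqrt Lam)^-1 * (64 * B w) ^+ m).
  apply/funext => w; rewrite sqrtrM ?invr_ge0 ?(ltW Lam0) // sqrtrV ?(ltW Lam0) //; ring.
have L1 : Lb P (2 * p) (fun w => Num.sqrt (Lam^-1 * t w)) (Num.sqrt (5 / 4 * kap)).
  apply: Lb_incr p21 s22 (Lb_sqrt s20 _ Ltau) => w.
  by rewrite mulr_ge0 // invr_ge0 ltW.
have c0 : 0 <= 2 * (Num.sqrt Lam)^-1 by rewrite mulr_ge0 // invr_ge0 ltW.
have cA : 2 * (Num.sqrt Lam)^-1 <= 2 * (1 + C * L) * hhn by have := sqLam_inv; lra.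
have A0 : 0 <= 2 * (1 + C * L) by rewrite mulr_ge0 // addr_ge0 // mulr_ge0 // ltW.
apply: (Lb_le p0 _ (Lb_add p1 (Lb_mul p0 L1 (@Lmix 16 8 _ _)) (Lbad c0 cA A0))) => //.
rewrite /function_cst [leRHS]mulrDl; apply: lerD; last by apply: ler_wpM2l => //; exact: mulr_ge0.
have -> : Num.sqrt (5 / 4 * kap) = Num.sqrt (5 / 4 * k0) / sn.
  by rewrite mulrA sqrtrM ?mulr_ge0 ?divr_ge0 // sqrtrV // ltW.
rewrite le_eqVlt; apply/orP; left; apply/eqP; field; rewrite gt_eqF //.
Qed.

Definition distance_cst : R :=
  5 / 4 * k0 * (160 * (C * Num.sqrt k0) + 285 / 4 * (C * k0)) + 2 * (C * L) * bad_cst.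

(** After division by Lambda_j the factor t is of order 1/n. *)
Lemma Lb_distance_error :
  Lb P p (fun w => Lam^-1 *
     (t w * (32 * Num.sqrt (B w) + 57 * t w) + 2 * (64 * B w) ^+ m)) (distance_cst * (r / n%:R)).
Proof.
have -> : (fun w => Lam^-1 * (t w * (32 * Num.sqrt (B w) + 57 * t w) + 2 * (64 * B w) ^+ m)) =
  (fun w => Lam^-1 * t w * (32 * Num.sqrt (B w) + 57 * t w) + 2 * Lam^-1 * (64 * B w) ^+ m).
  by apply/funext => w; ring.
have c0 : 0 <= 2 * Lam^-1 by rewrite mulr_ge0 // invr_ge0 ltW.
have cA : 2 * Lam^-1 <= 2 * (C * L) * hhn by have := Lam_inv; lra.
have A0 : 0 <= 2 * (C * L) by rewrite mulr_ge0 // mulr_ge0 // ltW.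
apply: (Lb_le p0 _ (Lb_add p1 (Lb_mul p0 (Lb_incr p21 s2p Ltau) (@Lmix 32 57 _ _)) (Lbad c0 cA A0))) => //.
rewrite /distance_cst [leRHS]mulrDl lerD2r.
by rewrite le_eqVlt; apply/orP; left; apply/eqP; field; rewrite gt_eqF.
Qed.

End error_norms.

(** * Double expansion of a symmetric bounded operator *)

Section matrix_of_operator.
Context dS (S : measurableType dS) (R : realType).
Variable mu : {measure set S -> \bar R}.
Variables (A : L2 mu -> L2 mu) (e : nat -> L2 mu) (t : nat -> nat -> R) (c : R).
Hypothesis eb : orthonormal_basis e.
Hypothesis Asym : forall u v, l2dot (A u) v = l2dot (A v) u.
Hypothesis Abounded : forall u v, `|l2dot (A u) v| <= c * (l2norm u * l2norm v).
Hypothesis entries : forall i j, l2dot (A (e i)) (e j) = t i j.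
Hypothesis c0 : 0 <= c.

Lemma projection_contracts (y : L2 mu) (N : nat) :
  l2norm (\sum_(j < N) l2dot (e j) y *: e j) <= l2norm y.
Proof.
rewrite /l2norm ler_wsqrtr //.
rewrite (on_dot_sum2 (fun j => l2dot (e j) y) (fun j => l2dot (e j) y) N eb.1).
by apply: le_trans (bessel y N eb.1); apply: ler_sum => j _; rewrite -expr2.
Qed.

(** Linearity of A is only known through its pairings; a bounded symmetric form
    is enough for a Lipschitz bound. *)
Lemma symmetric_bounded_norm (u v : L2 mu) : l2norm (A u - A v) <= c * l2norm (u - v).
Proof.
set y := A u - A v; have [->|n0] := eqVneq (l2norm y) 0.
  by rewrite mulr_ge0 ?l2norm_ge0.
have np : 0 < l2norm y by rewrite lt_def n0 l2norm_ge0.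
rewrite -(ler_pM2r np) -expr2 sqr_l2norm.
have -> : l2dot y y = l2dot (A y) (u - v).
  exact: (etrans (l2dotBl _ _ _) (etrans (congr2 (fun a b => a - b) (Asym u y) (Asym v y))
    (esym (l2dotBr _ _ _)))).
apply: le_trans (ler_norm _) _; apply: (le_trans (Abounded _ _)).
by rewrite -mulrA [l2norm y * _]mulrC.
Qed.

(** The double partial sum is A applied to the projection of v, then projected.
    Both projections are contractions and A is Lipschitz, so the two indices may
    grow independently. *)
Theorem matrix_expansion v : l2cvg2
  (fun M N => \sum_(i < M) \sum_(j < N) (t i j * l2dot (e i) v) *: e j) (A v).
Proof.
pose PM M : L2 mu := \sum_(i < M) l2dot (e i) v *: e i.
have SE M N : \sum_(i < M) \sum_(j < N) (t i j * l2dot (e i) v) *: e j =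
    \sum_(j < N) l2dot (e j) (A (PM M)) *: e j.
  rewrite exchange_big /=; apply: eq_bigr => j _; rewrite -scaler_suml; congr (_ *: _).
  have h1 : l2dot (e j) (A (PM M)) = l2dot (A (e j)) (PM M) := etrans (l2dotC _ _) (Asym _ _).
  rewrite h1 l2dot_sumr; apply: eq_bigr => i _; rewrite l2dotZr mulrC.
  by rewrite -(entries i j) (Asym (e i) (e j)).
pose al M := l2norm (PM M - v).
pose be N := l2norm (\sum_(j < N) l2dot (e j) (A v) *: e j - A v).
have al0 : al @ \oo --> (0 : R) by exact: (eb.2 v).
have be0 : be @ \oo --> (0 : R) by exact: (eb.2 (A v)).
have bound M N : l2norm (\sum_(i < M) \sum_(j < N) (t i j * l2dot (e i) v) *: e j - A v) <=
    c * al M + be N.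
  rewrite SE.
  have -> : \sum_(j < N) l2dot (e j) (A (PM M)) *: e j - A v =
     \sum_(j < N) l2dot (e j) (A (PM M) - A v) *: e j +
     (\sum_(j < N) l2dot (e j) (A v) *: e j - A v).
    rewrite addrA -big_split /=; congr (_ - _); apply: eq_bigr => j _.
    by rewrite -scalerDl; congr (_ *: _); rewrite l2dotBr subrK.
  apply: (le_trans (l2normD _ _)); apply: lerD => //.
  exact: (le_trans (projection_contracts _ _) (symmetric_bounded_norm _ _)).
have lim : (fun MN : nat * nat => c * al MN.1 + be MN.2) @ filter_prod \oo \oo --> (0 : R).
  have -> : (0 : R) = c * 0 + 0 by rewrite mulr0 addr0.
  apply: cvgD; first apply: cvgM; first exact: cvg_cst.
    exact: (cvg_comp (fun MN : nat * nat => MN.1) al cvg_fst al0).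
  exact: (cvg_comp (fun MN : nat * nat => MN.2) be cvg_snd be0).
rewrite /l2cvg2; apply: (squeeze_cvgr _ (cvg_cst 0) lim).
by apply: nearW => -[M N] /=; rewrite l2norm_ge0 bound.
Qed.

End matrix_of_operator.

(** * Estimation of the lag operator *)

Section lagged_covariance_estimation.
Context dS (S : measurableType dS) (R : realType).
Variable mu : {measure set S -> \bar R}.
Context dO (Om : measurableType dO) (P : probability Om R).
Context dE (E : measurableType dE).
Variables (h : nat) (C a hh p b K c : R).
Hypotheses (C0 : 0 < C) (a0 : 0 < a) (hh1 : 1 <= hh) (p1 : 1 <= p)
  (b32 : 3 / 2 < b) (c0 : 0 < c).

(** The power m of 64 B used on the exceptional event; it is chosen so that q =
    2 m p. *)
Definition half_exp : nat := (2 ^ (`|Num.ceil (hh / a)| + 3))%N.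
Local Notation hm := half_exp.
Local Notation q := (p * 2 ^+ (`|Num.ceil (hh / a)|%N + 4)).

Let qE : q = 2 * (hm%:R * p).
Proof. by rewrite /half_exp natrX [(_ + 4)%N]addnS exprS; ring. Qed.

Let hm8 : 8 <= (hm%:R : R).
Proof.
by rewrite ler_nat /half_exp expnD -[X in (X <= _)%N]mul1n leq_mul // expn_gt0.
Qed.

Let s := 4 * q.
Let s4 : 4 < s.
Proof. by rewrite /s qE; have := hm8; have := p1; nra. Qed.

Let hm_large : hh + 1 + a <= 2 * a * hm%:R.
Proof.
have ceil_le : hh / a <= (`|Num.ceil (hh / a)|%N)%:R.
  apply: (le_trans (Num.Theory.ceil_ge _)).
  by rewrite natr_absz ler_int ler_norm.
move: ceil_le; rewrite ler_pdivrMr // => hk.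
have hk2 : (`|Num.ceil (hh / a)|%N + 1)%:R <= (hm%:R : R).
  rewrite ler_nat /half_exp addn1; apply: leq_trans (ltn_expl _ (_ : 1 < 2)%N) _ => //.
  by rewrite leq_pexp2l // leq_addr.
move: hk2; rewrite natrD => hk2.
have := ler_wpM2l (ltW a0) hk2; have := hh1; have := a0.
by rewrite mulrDr mulr1; lra.
Qed.

Let Kw := 4 * C.
Let L := Kw ^+ 2.
Let cc := cross_cst s K.
Let kq := quadratic_cst s K.
Let hf : R := h.+1%:R.
Let k0 : R := (Kw * (2 * cc + kq)) ^+ 2 * hf / c ^+ 2.

(** One constant dominating every bound of the conclusion. It depends only on
    the quantities fixed before the process is chosen. *)
Definition final_cst : R :=
  C + L + Kw + `|Kw * (2 * cc) * hf| + `|Kw * kq * hf| + c^-1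
  + `|value_cst C L k0 hm| + `|function_cst C L k0 hm| + `|distance_cst C L k0 hm|.
Local Notation C' := final_cst.

Let Kw0 : 0 <= Kw. Proof. by rewrite mulr_ge0 // ltW. Qed.
Let L0 : 0 <= L. Proof. exact: sqr_ge0. Qed.
Let hf0 : 0 < hf. Proof. by rewrite ltr0n. Qed.
Let k00 : 0 <= k0. Proof.
apply: mulr_ge0; last by rewrite invr_ge0 sqr_ge0.
by apply: mulr_ge0; [exact: sqr_ge0|exact: ltW].
Qed.

Lemma final_cst_bounds : [/\ C <= C', L <= C', Kw <= C', Kw * (2 * cc) * hf <= C' &
  Kw * kq * hf <= C'] /\ [/\ c^-1 <= C', value_cst C L k0 hm <= C',
  function_cst C L k0 hm <= C' & distance_cst C L k0 hm <= C'].
Proof.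
have ci : 0 <= c^-1 by rewrite invr_ge0 ltW.
have n1 := normr_ge0 (Kw * (2 * cc) * hf); have n2 := normr_ge0 (Kw * kq * hf).
have n3 := normr_ge0 (value_cst C L k0 hm); have n4 := normr_ge0 (function_cst C L k0 hm).
have n5 := normr_ge0 (distance_cst C L k0 hm).
have m1 := ler_norm (Kw * (2 * cc) * hf); have m2 := ler_norm (Kw * kq * hf).
have m3 := ler_norm (value_cst C L k0 hm); have m4 := ler_norm (function_cst C L k0 hm).
have m5 := ler_norm (distance_cst C L k0 hm).
have Cp := C0; have K1 := Kw0; have L1 := L0; rewrite /final_cst; split; split; lra.
Qed.

Variables (X : int -> Om -> L2 mu) (lam : nat -> R) (e f : nat -> L2 mu)
  (eps eps' : int -> Om -> nat -> E) (g : nat -> (nat -> E) -> R).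
Hypothesis Xre : forall k, random_element (X k).
Hypothesis Xst : stationary P X.
Hypothesis XC : forall k, ('E_P[fun w => (l2norm (X k w) ^+ 2)%R] <= C%:E)%E.
Hypothesis svd : is_svd (lagC P X h) lam e f.
Hypothesis eig : forall j, l2norm (lagD P X h (e j) - lam j *: e j) = 0.
Hypothesis epsiid : iid_with_copy P eps eps'.
Hypothesis shiftE : is_bernoulli_shift P g eps (eta P X e).
Hypothesis dep : forall k : nat, (dep_coef P g eps eps' (eta P X e) s k
     <= (K * (maxn k 1)%:R `^ (- b))%:E)%E.
Hypothesis low : (c%:E <= ereal_inf
     [set \sum_(0 <= r <oo) (lamt P X e r * crossE P X h e r j ^+ 2)%:E
        | j in [set j : nat | (0 < lamt P X e j)%R]])%E.
Variables n Jn : nat.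
Hypotheses (hn : (h < n)%N).

Local Notation lt := (lamt P X e).
Local Notation m := (scaled_entry P X e h).
Local Notation N := (n - h)%N.

Let eb : orthonormal_basis e. Proof. by case: svd. Qed.
Let lam_nd i k : (i <= k)%N -> lam k <= lam i. Proof. by case: svd => _ _ nd _; exact: nd. Qed.
Let C0' : 0 <= C. Proof. exact: ltW. Qed.
Let lam0 i : 0 <= lam i. Proof. exact: (lam_ge0 eb Xre Xst C0' XC eig i). Qed.
Let lamL M : \sum_(i < M) lam i <= L. Proof. exact: (lam_sum eb Xre Xst C0' XC eig). Qed.
Let n0 : (0 < n)%N. Proof. exact: leq_ltn_trans hn. Qed.
Let nR : (0 : R) < n%:R. Proof. by rewrite ltr0n. Qed.
Let NR : (0 : R) < N%:R. Proof. by rewrite ltr0n subn_gt0. Qed.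
Let sn0 : 0 < Num.sqrt (n%:R : R). Proof. by rewrite sqrtr_gt0. Qed.
Let sN0 : 0 < Num.sqrt (N%:R : R). Proof. by rewrite sqrtr_gt0. Qed.
Let sn2 : Num.sqrt (n%:R : R) ^+ 2 = n%:R. Proof. by rewrite sqr_sqrtr // ltW. Qed.
Let sN2 : Num.sqrt (N%:R : R) ^+ 2 = N%:R. Proof. by rewrite sqr_sqrtr // ltW. Qed.

Let nN : (n%:R : R) <= hf * N%:R.
Proof.
rewrite -natrM ler_nat mulSn -{1}(subnK (ltnW hn)) leq_add2l.
by rewrite leq_pmulr // subn_gt0.
Qed.

Let invN : (N%:R : R)^-1 <= hf / n%:R.
Proof. by rewrite ler_pdivlMr // mulrC ler_pdivrMr. Qed.

Let snN : Num.sqrt (n%:R : R) / Num.sqrt N%:R <= hf.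
Proof.
have hf1 : 1 <= hf by rewrite ler1n.
rewrite ler_pdivrMr // -(ler_pXn2r (_ : (0 < 2)%N)) ?nnegrE ?mulr_ge0 ?(ltW sN0) ?(ltW hf0) ?(ltW sn0) //.
rewrite exprMn sn2 sN2; apply: (le_trans nN); rewrite ler_wpM2r ?(ltW NR) //.
by rewrite expr2 ler_peMr // ltW.
Qed.

Let q0 : 0 < q. Proof. by have := s4; rewrite /s; lra. Qed.
Let q1 : 1 <= q. Proof. by have := s4; rewrite /s; lra. Qed.
Let s_half : s / 2 = 2 * q. Proof. by rewrite /s; field. Qed.
Let s_quarter : s / 4 = q. Proof. by rewrite /s; field. Qed.

Lemma m_lower j : 0 < lt j -> c <= m j j.
Proof.
move=> lj; apply: (scaled_entry_ge eb Xre Xst C0' XC); apply: (le_trans low).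
by apply: ereal_inf_lbound; exists j.
Qed.

(** The variances of the scores are dominated by the eigenvalues: the source of
    relative error bounds. *)
Lemma lamt_le_lam j : c * lt j <= lam j.
Proof.
rewrite (lam_lamt eb Xre Xst C0' XC eig) mulrC.
have l0 := lamt_ge0 P X e j; rewrite le_eqVlt in l0.
case/orP: l0 => [/eqP <-|lj]; first by rewrite !mul0r.
by rewrite ler_wpM2l ?(ltW lj) // m_lower.
Qed.

Let decomp i j := etaD_decomposition eb Xre Xst C0' XC hn epsiid shiftE s4 b32 dep i j.

Lemma etaD_mean i j : Ex P (etaD P X h e n i j) = m i j /\
  ('E_P[etaD P X h e n i j] = (m i j)%:E)%E.
Proof.
have [D [D' [LD ED _ eD _]]] := decomp i j.
have sh1 : 1 <= s / 2 by rewrite s_half; have := q1; lra.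
have Lm : Lb P (s / 2) (fun w => cst (m i j) w + D w) (`|m i j| + Kw * (2 * (cc / Num.sqrt N%:R))).
  by apply: Lb_add => //; exact: Lb_cst.
have EE : Ex P (fun w => cst (m i j) w + D w) = m i j.
  by rewrite (Ex_add sh1 (Lb_cst P _ (m i j)) LD) ED Ex_cst addr0.
have EEt : ('E_P[etaD P X h e n i j] = (m i j)%:E)%E.
  rewrite -EE ExE /Rintegral fineK; last exact: (integrable_fin_num measurableT (Lb_integrable sh1 Lm)).
  rewrite unlock; apply: integral_ae_nomeasE; first by apply/measurable_EFinP; case: Lm.
  by apply: filterS eD => w ->.
by split; [rewrite /Ex EEt|].
Qed.

Lemma score_norm_bounds i j :
  ((Num.sqrt n%:R)%:E * pnorm P q (fun w => (etaD P X h e n i j w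
             - Ex P (etaD P X h e n i j))%R) <= C'%:E)%E /\
  ((Num.sqrt n%:R)%:E * pnorm P q (etaR P X h e n i j)
            <= (C' * (Num.sqrt n%:R)^-1)%:E)%E.
Proof.
have [[_ _ _ b1 b2] _] := final_cst_bounds.
have [D [D' [LD ED LD' eD eR]]] := decomp i j; split.
  have Lq : Lb P q (fun w => `|D w|) (Kw * (2 * (cc / Num.sqrt N%:R))).
    by apply: Lb_abs; apply: Lb_incr q1 _ LD; rewrite s_half; have := q0; lra.
  apply: (@le_trans _ _ ((Num.sqrt n%:R)%:E * (Kw * (2 * (cc / Num.sqrt N%:R)))%:E)%E).
    apply: lee_wpmul2l; first by rewrite lee_fin ltW.
    apply: (pnorm_le q0 _ Lq); apply: filterS eD => w ->.
    by rewrite (etaD_mean i j).1 addrC addKr.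
  rewrite -EFinM lee_fin; apply: le_trans b1.
  have A0 : 0 <= Kw * (2 * cc).
    have [_ l0 _] := LD; have : 0 <= Kw * (2 * cc) / Num.sqrt N%:R by move: l0; rewrite !mulrA.
    by rewrite pmulr_lge0 // invr_gt0.
  rewrite (_ : Num.sqrt n%:R * (Kw * (2 * (cc / Num.sqrt N%:R))) =
    Kw * (2 * cc) * (Num.sqrt n%:R / Num.sqrt N%:R)); last by ring.
  exact: ler_wpM2l.
have Lq : Lb P q (fun w => `|D' w|) (Kw * (kq / N%:R)) by rewrite -s_quarter; exact: Lb_abs.
apply: (@le_trans _ _ ((Num.sqrt n%:R)%:E * (Kw * (kq / N%:R))%:E)%E).
  apply: lee_wpmul2l; first by rewrite lee_fin ltW.
  by apply: (pnorm_le q0 _ Lq); apply: filterS eR => w [-> _ _]; rewrite normrN.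
rewrite -EFinM lee_fin.
have A0 : 0 <= Kw * kq.
  have [_ + _] := LD'; rewrite mulrA.
  by rewrite pmulr_lge0 // invr_gt0.
apply: (@le_trans _ _ (Kw * kq * hf * (Num.sqrt n%:R)^-1)); last first.
  by rewrite ler_wpM2r // invr_ge0 ltW.
rewrite (_ : Num.sqrt n%:R * (Kw * (kq / N%:R)) = Kw * kq * (Num.sqrt n%:R / N%:R)); last by ring.
rewrite -[leRHS]mulrA; apply: ler_wpM2l; first exact: A0.
by rewrite ler_pdivlMr // mulrAC -expr2 sn2 ler_pdivrMr.
Qed.

Lemma diagonal_mean_bounds j : 0 < lt j ->
  (C'^-1%:E <= 'E_P[etaD P X h e n j j])%E /\ ('E_P[etaD P X h e n j j] <= C'%:E)%E.
Proof.
move=> lj; rewrite (etaD_mean j j).2 !lee_fin.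
have [[_ _ b1 _ _] [b2 _ _ _]] := final_cst_bounds; split.
  apply: le_trans (m_lower lj); rewrite -[leRHS]invrK lef_pV2 ?posrE ?invr_gt0 //.
  by apply: lt_le_trans b2; rewrite invr_gt0.
by apply: le_trans b1; exact: (scaled_entry_le h eb Xre Xst C0' XC).
Qed.

Lemma eigenvalue_sum : (\sum_(0 <= j <oo) (lam j)%:E <= C'%:E)%E.
Proof.
have [[_ b1 _ _ _] _] := final_cst_bounds.
apply: lime_le; first by apply: is_cvg_nneseries => j _ _; rewrite lee_fin; exact: lam0.
by apply: nearW => M; rewrite big_mkord sumEFin lee_fin (le_trans (lamL M)).
Qed.

Lemma lagD_bounded u v : `|l2dot (lagD P X h u) v| <= Kw ^+ 2 * (l2norm u * l2norm v).
Proof.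
have -> : l2dot (lagD P X h u) v = l2dot (lagC P X h v) (lagC P X h u).
  exact: (etrans (l2dotC _ _) (lagD_dot h eb Xre C0' XC v u)).
apply: (le_trans (l2_CS _ _)).
have h1 := lagC_norm h eb Xre C0' XC v; have h2 := lagC_norm h eb Xre C0' XC u.
apply: (le_trans (ler_pM (l2norm_ge0 _) (l2norm_ge0 _) h1 h2)).
by rewrite -[4 * C]/Kw le_eqVlt; apply/orP; left; apply/eqP; ring.
Qed.

Lemma lagD_matrix v : l2cvg2 (fun M N' => \sum_(i < M) \sum_(j < N')
              (Num.sqrt (lamt P X e i * lamt P X e j)
               * Ex P (etaD P X h e n i j) * l2dot (e i) v) *: e j)
            (lagD P X h v).
Proof.
apply: (matrix_expansion (t := fun i j => Num.sqrt (lt i * lt j) * Ex P (etaD P X h e n i j)) eb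
  (lagD_sym h eb Xre C0' XC) lagD_bounded _ (sqr_ge0 Kw)).
move=> i j; rewrite (etaD_mean i j).1; exact: (lagD_entry h eb Xre Xst C0' XC).
Qed.

Lemma sample_matrix : {ae P, forall w, forall v, l2cvg2 (fun M N' => \sum_(i < M) \sum_(j < N')
              (Num.sqrt (lamt P X e i * lamt P X e j)
               * (etaD P X h e n i j w - etaR P X h e n i j w)
               * l2dot (e i) v) *: e j)
            (lagD_hat X h n w v)}.
Proof.
have ent : {ae P, forall w, forall i j : nat, l2dot (lagD_hat X h n w (e i)) (e j) =
   Num.sqrt (lt i * lt j) * (etaD P X h e n i j w - etaR P X h e n i j w)}.
  apply/ae_foralln => i; apply/ae_foralln => j; have [D [D' [_ _ _ _ eR]]] := decomp i j.
  by apply: filterS eR => w [_ -> _].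
apply: filterS ent => w ent v.
pose B := N%:R^-1 * (\sum_(1 <= k < N.+1) l2norm (resid X n k w) * l2norm (resid X n (k + h) w)).
have B0 : 0 <= B.
  rewrite mulr_ge0 ?invr_ge0 ?(ltW NR) //; apply: sumr_ge0 => k _.
  by rewrite mulr_ge0 ?l2norm_ge0.
apply: (matrix_expansion (c := B ^+ 2)
  (t := fun i j => Num.sqrt (lt i * lt j) * (etaD P X h e n i j w - etaR P X h e n i j w)) eb
  (@lagD_hat_sym _ _ _ _ _ _ X h n w) _ ent (sqr_ge0 B)).
move=> u u'; rewrite lagD_hat_dot; apply: (le_trans (l2_CS _ _)).
apply: (le_trans (ler_pM (l2norm_ge0 _) (l2norm_ge0 _)
  (lagC_hat_norm X h n w u) (lagC_hat_norm X h n w u'))).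
by rewrite -/B le_eqVlt; apply/orP; left; apply/eqP; ring.
Qed.

Local Notation I := (pertI P X h e n).

Lemma sample_entries w i k : l2dot (lagD_hat X h n w (e i)) (e k) =
  (if i == k then lam i else 0) + I i k w.
Proof.
have h1 : I i k w = l2dot (lagD_hat X h n w (e i)) (e k) - l2dot (lagD P X h (e i)) (e k).
  exact: l2dotBl.
have h2 : l2dot (lagD P X h (e i)) (e k) = if i == k then lam i else 0.
  apply: (etrans (lagD_eig eig i (e k))); rewrite eb.1.
  by case: (i == k); rewrite ?mulr1 ?mulr0.
by rewrite h1 h2 addrCA subrr addr0.
Qed.

Lemma lagC_hat_random u : random_element (fun w => lagC_hat X h n w u).
Proof.
move=> v; have mr k v' : measurable_fun setT (fun w => l2dot (resid X n k w) v').
  have -> : (fun w => l2dot (resid X n k w) v') =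
      (fun w => l2dot (X k%:Z w) v' - n%:R^-1 * \sum_(1 <= l < n.+1) l2dot (X l%:Z w) v').
    by apply/funext => w; apply: (etrans (l2dotBl _ _ _)); rewrite smean_dot.
  apply: measurable_funB; first exact: Xre.
  by apply: measurable_funM => //; apply: measurable_sum => l; exact: Xre.
have -> : (fun w => l2dot (lagC_hat X h n w u) v) =
    (fun w => N%:R^-1 * \sum_(1 <= k < N.+1) l2dot (resid X n (k + h) w) v * l2dot (resid X n k w) u).
  by apply/funext => w; exact: lagC_hat_dot.
by apply: measurable_funM => //; apply: measurable_sum => k; exact: measurable_funM.
Qed.

(** Each entry is a pairing of two random elements, by the factorisation of the
    estimator through the sample lag operator. *)
Lemma measurable_pertI i k : measurable_fun setT (I i k).
Proof.
have -> : I i k = (fun w => l2dot (lagC_hat X h n w (e i)) (lagC_hat X h n w (e k))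
    - (if i == k then lam i else 0)).
  apply/funext => w.
  by rewrite -(lagD_hat_dot X h n w (e i) (e k)) sample_entries addrC addKr.
apply: measurable_funB => //.
by apply: (random_dot eb) => //; exact: lagC_hat_random.
Qed.

(** If one of the two eigenvalues is 0 the perturbation vanishes almost surely
    in that entry, so that the value 0 given by division by 0 is the right one. *)
Definition relative_error i k w : R := I i k w ^+ 2 / (lam i * lam k).
Local Notation Z := relative_error.

Lemma relative_error_ge0 i k w : 0 <= Z i k w.
Proof. by apply: divr_ge0; [exact: sqr_ge0|exact: mulr_ge0]. Qed.

(** The factor D is the sum of the linear part and of the remainder; the latter
    is of smaller order, so a single rate serves both. *)
Lemma pertI_factor i k : exists2 D : Om -> R,
  Lb P q D (Kw * (2 * cc + kq) / Num.sqrt N%:R) &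
  {ae P, forall w, I i k w = Num.sqrt (lt i * lt k) * D w}.
Proof.
have [D [D' [LD _ LD' _ eR]]] := decomp i k.
exists (fun w => D w + D' w).
  have L1 : Lb P q D (Kw * (2 * (cc / Num.sqrt N%:R))).
    by apply: Lb_incr q1 _ LD; rewrite s_half; have := q0; lra.
  have L2 : Lb P q D' (Kw * (kq / N%:R)) by rewrite -s_quarter.
  apply: (Lb_le q0 _ (Lb_add q1 L1 L2)).
  have A0 : 0 <= Kw * kq.
    have [_ + _] := LD'; rewrite mulrA.
    by rewrite pmulr_lge0 // invr_gt0.
  have sN1 : 1 <= Num.sqrt (N%:R : R).
    by rewrite -[leLHS]sqrtr1 ler_wsqrtr // ler1n subn_gt0.
  have i1 : (N%:R : R)^-1 <= (Num.sqrt N%:R)^-1.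
    by rewrite lef_pV2 ?posrE // -{2}sN2 expr2 ler_peMl // ltW.
  have -> : Kw * (2 * cc + kq) / Num.sqrt N%:R =
      Kw * (2 * (cc / Num.sqrt N%:R)) + Kw * kq * (Num.sqrt N%:R)^-1 by ring.
  by rewrite lerD2l mulrA ler_wpM2l.
apply: filterS eR => w [_ _ h1].
have h2 := lagD_entry h eb Xre Xst C0' XC i k.
apply: (etrans (l2dotBl _ _ _)); apply: (etrans (congr2 (fun x y => x - y) h1 h2)).
have rl (u v z : R) : u + v + z - u = v + z by ring.
by rewrite -mulrBr; congr (_ * _); exact: rl.
Qed.

Lemma pertI_relative : {ae P, forall w, forall i k : nat, I i k w ^+ 2 <= lam i * lam k * Z i k w}.
Proof.
apply/ae_foralln => i; apply/ae_foralln => k; have [D _ hD] := pertI_factor i k.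
apply: filterS hD => w hw; rewrite /relative_error.
have [z|nz] := eqVneq (lam i * lam k) 0; last by rewrite mulrC divfK.
have z' (j : nat) : lam j = 0 -> lt j = 0.
  move=> lj; have := lamt_le_lam j; rewrite lj => lt0.
  apply/eqP; rewrite eq_le lamt_ge0 andbT.
  by rewrite -(pmulr_rle0 _ c0).
have -> : I i k w = 0.
  rewrite hw; move/eqP: z; rewrite mulf_eq0 => /orP[] /eqP /z' ->;
    by rewrite ?mul0r ?mulr0 sqrtr0 mul0r.
by rewrite expr0n z mul0r.
Qed.

(** Squaring halves the order of the moments, from q = 2 m p to m p. *)
Lemma Lb_relative_error i k : Lb P (hm%:R * p) (Z i k) (k0 / n%:R).
Proof.
have [D LD hD] := pertI_factor i k.
have s20 : 0 < hm%:R * p by have := q0; rewrite qE; lra.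
have LD2 : Lb P (hm%:R * p) (fun w => D w ^+ 2) ((Kw * (2 * cc + kq) / Num.sqrt N%:R) ^+ 2).
  by apply: Lb_pow => //; rewrite -qE.
have mZ : measurable_fun setT (Z i k).
  by apply: measurable_funM => //; apply: measurable_funX; exact: measurable_pertI.
have ci0 : 0 <= (c ^+ 2)^-1 by rewrite invr_ge0 sqr_ge0.
apply: (Lb_le s20 _ (Lb_dom s20 mZ _ (Lb_scale (c ^+ 2)^-1 s20 LD2))).
  rewrite ger0_norm // expr_div_n sN2 /k0.
  rewrite (_ : (c ^+ 2)^-1 * _ = (Kw * (2 * cc + kq)) ^+ 2 / c ^+ 2 * N%:R^-1); last by ring.
  rewrite (_ : (Kw * (2 * cc + kq)) ^+ 2 * hf / c ^+ 2 / n%:R =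
     (Kw * (2 * cc + kq)) ^+ 2 / c ^+ 2 * (hf / n%:R)); last by ring.
  by rewrite ler_wpM2l // divr_ge0 ?sqr_ge0.
apply: filterS hD => w hw; rewrite ger0_norm ?relative_error_ge0 //.
have d0 : 0 <= (c ^+ 2)^-1 * D w ^+ 2 by rewrite mulr_ge0 ?sqr_ge0.
rewrite ger0_norm // /relative_error.
have [->|nz] := eqVneq (lam i * lam k) 0; first by rewrite invr0 mulr0.
have lp : 0 < lam i * lam k by rewrite lt_def nz mulr_ge0.
rewrite ler_pdivrMr // hw exprMn sqr_sqrtr; last by rewrite mulr_ge0 ?lamt_ge0.
rewrite (_ : (c ^+ 2)^-1 * D w ^+ 2 * (lam i * lam k) =
  ((c ^+ 2)^-1 * (lam i * lam k)) * D w ^+ 2); last by ring.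
apply: ler_wpM2r; first exact: sqr_ge0.
rewrite ler_pdivlMl ?exprn_gt0 //.
have -> : c ^+ 2 * (lt i * lt k) = (c * lt i) * (c * lt k) by ring.
by apply: ler_pM; rewrite ?lamt_le_lam // mulr_ge0 ?lamt_ge0 // ltW.
Qed.

Hypothesis gap : gap_condition C a hh n Jn lam.
Variables (lamh : nat -> Om -> R) (eh : nat -> Om -> L2 mu).
Hypothesis esys : forall w, is_eigensystem (lagD_hat X h n w) (fun j => lamh j w) (fun j => eh j w).
Hypothesis sgn : forall w j, 0 <= l2dot (eh j w) (e j).

Let Lam (j : nat) := fine (relgap2 lam j).
Let value_error w (j : nat) := (lam j)^-1 * (lamh j w - lam j - I j j w).
Let function_error w (j : nat) :=
        (Num.sqrt (Lam j))^-1 *: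
          (eh j w - e j + (l2norm (eh j w - e j) ^+ 2 / 2) *: e j
           - l2sum (fun k : nat => if k == j then 0
                             else (I k j w / (lam j - lam k)) *: e k)).
Let norm_error w (j : nat) :=
        (Lam j)^-1 * (l2norm (eh j w - e j) ^+ 2
           - limn (series (fun k : nat => if k == j then 0
                                    else I k j w ^+ 2 / (lam j - lam k) ^+ 2))).

Local Notation r := (n%:R `^ (- a)).
Let hmgt1 : (1 < hm)%N.
Proof. by rewrite -(ltr_nat R); have := hm8; lra. Qed.

(** Outside a null set the entries of the perturbation satisfy the relative
    bound and the weighted sums are dominated by B and t; the deterministic
    expansions then hold there. Domination by measurable variables avoids any
    appeal to the measurability of the perturbed eigenpairs. *)
Lemma errors_dominated j : (j.+1 < Jn)%N ->
  [/\ exists2 F, Lb P p F (C' * (r / Num.sqrt n%:R)) & {ae P, forall w, `|value_error w j| <= F w},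
      exists2 F, Lb P p F (C' * (r / Num.sqrt n%:R)) & {ae P, forall w, `|l2norm (function_error w j)| <= F w} &
      exists2 F, Lb P p F (C' * (r / n%:R)) & {ae P, forall w, `|norm_error w j| <= F w}].
Proof.
move=> j1; have jJ : (j < Jn)%N by exact: ltnW.
have Jn2 : (1 < Jn)%N by exact: leq_ltn_trans j1.
have hh0 : 0 <= hh by have := hh1; lra.
have p0 : 0 < p by have := p1; lra.
have [B [t [[LB Lt] Bt0 ae]]] := random_weights p1 n0 hmgt1 lam0 lam_nd gap Lb_relative_error
  relative_error_ge0 j1.
have B0 w : 0 <= B w by case: (Bt0 w).
have t0 w : 0 <= t w by case: (Bt0 w).
have [_ [_ v1 v2 v3]] := final_cst_bounds.
have lj0 : 0 < lam j := lam_gt0 C0 n0 lam_nd gap jJ.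
have x0 := step_scale_gt0 n0 lam0 lam_nd gap Jn2.
have x1 := step_scale_le1 n0 lam0 lam_nd gap Jn2.
have sep k := @gap_separation R C a hh n Jn lam n0 lam0 lam_nd gap Jn2 j k jJ.
have L1 : 0 < Lam j := sq_gap_gt0 C0 n0 lam0 lam_nd lamL gap j1.
have rn0 : 0 <= r / n%:R by rewrite divr_ge0 // ltW.
have rs0 : 0 <= r / Num.sqrt n%:R by rewrite divr_ge0 // ltW.
have hm0 : (0 < hm)%N by exact: ltnW.
split.
- exists (fun w => 3 * step_scale C a n * B w + 3 * (lam 0%N / lam j) * (64 * B w) ^+ hm).
    apply: (Lb_le p0 _ (Lb_value_error C0 L0 k00 p1 n0 hmgt1 hm_large lam0 lam_nd lamL gap j1 LB)).
    exact: ler_wpM2r.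
  apply: filterS2 ae pertI_relative => w [hB ht] hz.
  have := eigenvalue_expansion (esys w) (lagD_hat_ge0 X h n w) eb lam0 lam_nd (sample_entries w)
    lj0 x0 x1 sep (fun i k => relative_error_ge0 i k w) hz hB (sgn w j) hm0.
  rewrite /value_error normrM ger0_norm ?invr_ge0 ?(ltW lj0) // => hv.
  apply: (le_trans (ler_wpM2l _ hv)); first by rewrite invr_ge0 ltW.
  by rewrite le_eqVlt; apply/orP; left; apply/eqP; field; rewrite gt_eqF.
- exists (fun w => (Num.sqrt (sq_gap lam j))^-1 *
     (Num.sqrt (t w) * (16 * Num.sqrt (B w) + 8 * t w) + 2 * (64 * B w) ^+ hm)).
    apply: (Lb_le p0 _ (Lb_function_error C0 L0 k00 p1 n0 a0 hh0 hmgt1 hm_large lam0 lam_nd lamL gap j1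
      B0 t0 LB Lt)).
    exact: ler_wpM2r.
  apply: filterS2 ae pertI_relative => w [hB ht] hz.
  have := eigenfunction_expansion (esys w) (lagD_hat_ge0 X h n w) eb lam0 lam_nd (sample_entries w)
    lj0 x0 sep (fun i k => relative_error_ge0 i k w) hz hB ht (sgn w j) hm0.
  move=> hv; rewrite ger0_norm ?l2norm_ge0 // /function_error l2normZ.
  by rewrite ger0_norm ?invr_ge0 ?sqrtr_ge0 // ler_wpM2l ?invr_ge0 ?sqrtr_ge0.
exists (fun w => (sq_gap lam j)^-1 *
     (t w * (32 * Num.sqrt (B w) + 57 * t w) + 2 * (64 * B w) ^+ hm)).
  apply: (Lb_le p0 _ (Lb_distance_error C0 L0 k00 p1 n0 a0 hmgt1 hm_large lam0 lam_nd lamL gap j1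
    B0 LB Lt)).
  exact: ler_wpM2r.
apply: filterS2 ae pertI_relative => w [hB ht] hz.
have := distance_expansion (esys w) (lagD_hat_ge0 X h n w) eb lam0 lam_nd (sample_entries w)
  lj0 x0 sep (fun i k => relative_error_ge0 i k w) hz hB ht (sgn w j) hm0.
move=> hv; rewrite /norm_error normrM ger0_norm ?invr_ge0 ?(ltW L1) //.
by rewrite ler_wpM2l // invr_ge0 ltW.
Qed.

Variable J : nat.
Hypothesis JJn : (1 <= J < Jn)%N.

Let C'0 : 0 <= C'.
Proof. by have [[b0 _ _ _ _] _] := final_cst_bounds; exact: le_trans (ltW C0) b0. Qed.

Let jJn j : (j < J)%N -> (j.+1 < Jn)%N.
Proof. by move=> jJ; case/andP: JJn => _; exact: leq_ltn_trans. Qed.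

Let rateE (y : R) : C' * J%:R `^ p^-1 * r / y = J%:R `^ p^-1 * (C' * (r / y)).
Proof. by ring. Qed.

Lemma maximal_errors :
      [/\ (pnorm P p (fun w => \big[Num.max/0%R]_(j < J) `|value_error w j|%R)
             <= (C' * J%:R `^ p^-1 * r / Num.sqrt n%:R)%:E)%E,
          (pnorm P p (fun w => \big[Num.max/0%R]_(j < J) l2norm (function_error w j))
             <= (C' * J%:R `^ p^-1 * r / Num.sqrt n%:R)%:E)%E &
          (pnorm P p (fun w => \big[Num.max/0%R]_(j < J) `|norm_error w j|%R)
             <= (C' * J%:R `^ p^-1 * r / n%:R)%:E)%E].
Proof.
have A1 : 0 <= C' * (r / Num.sqrt n%:R) by rewrite mulr_ge0 // divr_ge0 // ltW.
have A2 : 0 <= C' * (r / n%:R) by rewrite mulr_ge0 // divr_ge0 // ltW.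
rewrite !rateE; split.
- by apply: (pnorm_max (f := fun j w => value_error w j) p1 A1) => j jJ; case: (errors_dominated (jJn jJ)).
- have -> : (fun w => \big[Num.max/0%R]_(j < J) l2norm (function_error w j)) =
    (fun w => \big[Num.max/0%R]_(j < J) `|l2norm (function_error w j)|).
    by apply/funext => w; apply: eq_bigr => j _; rewrite ger0_norm ?l2norm_ge0.
  by apply: (pnorm_max (f := fun j w => l2norm (function_error w j)) p1 A1) => j jJ; case: (errors_dominated (jJn jJ)).
by apply: (pnorm_max (f := fun j w => norm_error w j) p1 A2) => j jJ; case: (errors_dominated (jJn jJ)).
Qed.

End lagged_covariance_estimation.

Theorem theorem3p2 (R : realType)
    (d : nat) (T : set (Rspace R d)) (cT : compact_Rd T) (mT : measurable T)
    (dO : measure_display) (Om : measurableType dO) (P : probability Om R)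
    (dE : measure_display) (E : measurableType dE)
    (h : nat) (C a hh p b K c : R)
    (C0 : 0 < C) (a0 : 0 < a) (hh1 : 1 <= hh) (p1 : 1 <= p)
    (b32 : 3 / 2 < b) (c0 : 0 < c) :
  let mu : {measure set (Rspace R d) -> \bar R} := mrestr (lebesgue_Rd d) mT in
  let q := p * 2 ^+ (`|Num.ceil (hh / a)|%N + 4) in
  exists2 C' : R, C <= C' &
  forall (X : int -> Om -> L2 mu) (lam : nat -> R) (e f : nat -> L2 mu)
    (eps eps' : int -> Om -> nat -> E) (g : nat -> (nat -> E) -> R),
  (forall k, random_element (X k)) ->
  stationary P X ->
  (forall k, ('E_P[fun w => (l2norm (X k w) ^+ 2)%R] <= C%:E)%E) ->
  is_svd (lagC P X h) lam e f ->
  (forall j, l2norm (lagD P X h (e j) - lam j *: e j) = 0) ->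
  iid_with_copy P eps eps' ->
  is_bernoulli_shift P g eps (eta P X e) ->
  (forall k : nat, (dep_coef P g eps eps' (eta P X e) (4 * q) k
     <= (K * (maxn k 1)%:R `^ (- b))%:E)%E) ->
  (c%:E <= ereal_inf
     [set \sum_(0 <= r <oo) (lamt P X e r * crossE P X h e r j ^+ 2)%:E
        | j in [set j : nat | (0 < lamt P X e j)%R]])%E ->
  forall n Jn : nat, (h < n)%N -> (0 < Jn)%N ->
  gap_condition C a hh n Jn lam ->
  [/\ [/\ forall j, 0 <= lam j,
          (\sum_(0 <= j <oo) (lam j)%:E <= C'%:E)%E,
          forall v, l2cvg (fun N => \sum_(j < N) (lam j * l2dot (e j) v) *: e j)
            (lagD P X h v),
          {ae P, forall w, forall v, l2cvg2 (fun M N => \sum_(i < M) \sum_(j < N)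
              (Num.sqrt (lamt P X e i * lamt P X e j)
               * (etaD P X h e n i j w - etaR P X h e n i j w)
               * l2dot (e i) v) *: e j)
            (lagD_hat X h n w v)} &
          forall v, l2cvg2 (fun M N => \sum_(i < M) \sum_(j < N)
              (Num.sqrt (lamt P X e i * lamt P X e j)
               * Ex P (etaD P X h e n i j) * l2dot (e i) v) *: e j)
            (lagD P X h v)],
      (forall i j,
         ((Num.sqrt n%:R)%:E * pnorm P q (fun w => (etaD P X h e n i j w
             - Ex P (etaD P X h e n i j))%R) <= C'%:E)%E /\
         ((Num.sqrt n%:R)%:E * pnorm P q (etaR P X h e n i j)
            <= (C' * (Num.sqrt n%:R)^-1)%:E)%E),
      (forall j, 0 < lamt P X e j ->
         (C'^-1%:E <= 'E_P[etaD P X h e n j j])%E /\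
         ('E_P[etaD P X h e n j j] <= C'%:E)%E) &
      forall (lamh : nat -> Om -> R) (eh : nat -> Om -> L2 mu),
      (forall j, random_element (eh j)) ->
      (forall w, is_eigensystem (lagD_hat X h n w)
         (fun j => lamh j w) (fun j => eh j w)) ->
      (forall w j, 0 <= l2dot (eh j w) (e j)) ->
      forall J : nat, (1 <= J < Jn)%N ->
      let I := pertI P X h e n in
      let Lam (j : nat) := fine (relgap2 lam j) in
      let value_error w (j : nat) :=
        (lam j)^-1 * (lamh j w - lam j - I j j w) in
      let function_error w (j : nat) :=
        (Num.sqrt (Lam j))^-1 *:
          (eh j w - e j + (l2norm (eh j w - e j) ^+ 2 / 2) *: e j
           - l2sum (fun k : nat => if k == j then 0
                             else (I k j w / (lam j - lam k)) *: e k)) in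
      let norm_error w (j : nat) :=
        (Lam j)^-1 * (l2norm (eh j w - e j) ^+ 2
           - limn (series (fun k : nat => if k == j then 0
                                    else I k j w ^+ 2 / (lam j - lam k) ^+ 2))) in
      let rate := C' * J%:R `^ p^-1 * n%:R `^ (- a) in
      [/\ (pnorm P p (fun w => \big[Num.max/0%R]_(j < J) `|value_error w j|%R)
             <= (rate / Num.sqrt n%:R)%:E)%E,
          (pnorm P p (fun w => \big[Num.max/0%R]_(j < J) l2norm (function_error w j))
             <= (rate / Num.sqrt n%:R)%:E)%E &
          (pnorm P p (fun w => \big[Num.max/0%R]_(j < J) `|norm_error w j|%R)
             <= (rate / n%:R)%:E)%E]].
Proof.
move=> mu q; exists (final_cst h C a hh p K c).
  by have [[]] := final_cst_bounds h a hh p K C0 c0.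
move=> X lam e f eps eps' g Xre Xst XC svd eig epsiid shiftE dep low n Jn hn Jn0 gap.
have eb : orthonormal_basis e by case: svd.
have lam0 j : 0 <= lam j := lam_ge0 eb Xre Xst (ltW C0) XC eig j.
split.
- split.
  + exact: lam0.
  + exact: (eigenvalue_sum a hh p K C0 c0 Xre Xst XC svd eig).
  + exact: (lagD_expansion eb Xre Xst (ltW C0) XC eig).
  + exact: (sample_matrix C0 p1 b32 Xre Xst XC svd epsiid shiftE dep hn).
  + exact: (lagD_matrix C0 p1 b32 Xre Xst XC svd epsiid shiftE dep hn).
- exact: (score_norm_bounds C0 p1 b32 c0 Xre Xst XC svd epsiid shiftE dep hn).
- move=> j.
  exact: (diagonal_mean_bounds C0 p1 b32 c0 Xre Xst XC svd epsiid shiftE dep low hn (j := j)).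
move=> lamh eh _ esys sgn J JJn.
exact: (maximal_errors C0 a0 hh1 p1 b32 c0 Xre Xst XC svd eig epsiid shiftE dep low hn gap esys sgn JJn).
Qed.
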